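(* Let $\Omega\subset\mathbb{R}^n$ be a bounded domain with $C^2$ boundary, let $F,G:\mathcal{P}(\Xi)\to C^0_b(\Xi;\mathbb{R})$ be bounded and continuous, and let $\ell:\Xi\times[0,T]\to\mathbb{R}$ be continuous and bounded from below. Let $\Theta$ be a closed subset of $\Xi^{\rm ad}$ satisfying condition (A) of the context, let $r>0$, $\Theta_r=\Theta\cap K_r$, and let $m_0$ be a probability measure on $\Xi$ supported in $\Theta_r$. Let $C=C(r,M)$ be the positive constant described in the context (so that $\Gamma^{\mu,\rm opt}[x,v]\subset\Gamma_C$ for all $(x,v)\in\Theta_r$, uniformly in $\mu$). Then there exists a constrained mean field game equilibrium $\mu\in\mathcal{P}_{m_0}(\Gamma_C)$ associated with $m_0$, i.e. $\mu\in\mathcal{P}_{m_0}(\Gamma_C)$ with $$\mathrm{supp}(\mu)\subset\bigcup_{(x,v)\in\mathrm{supp}(m_0)}\Gamma^{\mu,\rm opt}[x,v].$$ Moreover, $t\mapsto e_t\sharp\mu$ belongs to $C^{1/2}([0,T];\mathcal{P}(K_C))$, where $\mathcal{P}(K_C)$ is endowed with the Kantorovitch-Rubinstein distance.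
   Context: Fix $T>0$. $n(x)$ is the outward unit normal at $x\in\partial\Omega$; $d$ is the signed distance to $\partial\Omega$, negative in $\Omega$ and positive outside $\overline\Omega$ ($d$ is $C^2$ near $\partial\Omega$ and $\nabla d=n$ on $\partial\Omega$). $\Xi=\overline\Omega\times\mathbb{R}^n$ and $\Xi^{\rm ad}=\{(x,v): x\in\overline\Omega,\ v\cdot n(x)\le 0\text{ if }x\in\partial\Omega\}$. Condition (A) on a closed set $\Theta\subset\Xi^{\rm ad}$: for every sequence $(x^i,v^i)\in\Theta$ converging to some $(x,v)\in\Theta$ with $x\in\partial\Omega$, one has $((v^i\cdot\nabla d(x^i))_+)^3=o(|d(x^i)|)$ as $i\to\infty$ (where $a_i=o(b_i)$ means: for every $\epsilon>0$, $|a_i|\le\epsilon |b_i|$ for $i$ large). $\Gamma$ is the set of pairs $(\xi,\eta)\in C^1([0,T];\mathbb{R}^n)\times AC([0,T];\mathbb{R}^n)$ ($AC$ = absolutely continuous) with $\xi'(s)=\eta(s)$ and $(\xi(s),\eta(s))\in\Xi$ for all $s\in[0,T]$, with the metric $\|\xi-\tilde\xi\|_{C^1([0,T];\mathbb{R}^n)}$. $\Gamma[x,v]=\{(\xi,\eta)\in\Gamma:\xi(0)=x,\eta(0)=v\}$. For $C>0$: $K_C=\{(x,v)\in\Xi:|v|\le C\}$ and $\Gamma_C=\{(\xi,\eta)\in\Gamma:(\xi(t),\eta(t))\in K_C\ \forall t\in[0,T],\ \|\eta'\|_{L^2(0,T;\mathbb{R}^n)}\le C\}$. $\mathcal{P}(X)$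 denotes the Borel probability measures on a metric space $X$. $C_b^0(\Xi;\mathbb{R})$ is the space of bounded continuous functions (sup norm); continuity of $F,G$ is with respect to narrow convergence on $\mathcal{P}(\Xi)$; $F[m],G[m]$ denote the images of $m$. Set $M=\max\big(\sup_{\Xi\times[0,T]}\ell_-+\sup_{m}\|F[m]\|_{L^\infty(\Xi)},\ \sup_m\|G[m]\|_{L^\infty(\Xi)}\big)$. $e_t(\xi,\eta)=(\xi(t),\eta(t))$; for $\mu\in\mathcal{P}(\Gamma)$, $m^\mu(t)=e_t\sharp\mu$. $\mathcal{P}_{m_0}(\Gamma)$ (resp. $\mathcal{P}_{m_0}(\Gamma_C)$) is the set of $\mu\in\mathcal{P}(\Gamma)$ (resp. $\mathcal{P}(\Gamma_C)$) with $e_0\sharp\mu=m_0$; measures on $\Gamma_C$ are identified with measures on $\Gamma$ by extension by $0$. Cost: for $\mu\in\mathcal{P}(\Gamma)$ and $(\xi,\eta)\in\Gamma$, $$J^\mu(\xi,\eta)=\int_0^T\Big(F[m^\mu(s)](\xi(s),\eta(s))+\ell(\xi(s),\eta(s),s)+\tfrac12|\eta'(s)|^2\Big)ds+G[m^\mu(T)](\xi(T),\eta(T))$$ (equal to $+\infty$ if $\eta'\notin L^2$), and $\Gamma^{\mu,\rm opt}[x,v]=\{(\xi,\eta)\in\Gamma[x,v]:J^\mu(\xi,\eta)=\min_{\Gamma[x,v]}J^\mu\}$. The constant $C=C(r,M)$: for $\Theta_r=\Theta\cap K_r$, where $\Theta$ is a closed subset of $\Xi^{\rm ad}$ satisfying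 condition (A), $r>0$ and $K_r=\{(x,v)\in\Xi:|v|\le r\}$, there exists a positive constant $C$, uniform with respect to $\mu\in\mathcal{P}(\Gamma)$, such that $\Gamma^{\mu,\rm opt}[x,v]\subset\Gamma_C$ for all $(x,v)\in\Theta_r$ and all $\mu\in\mathcal{P}(\Gamma)$; $C$ denotes such a constant. *)

(* Defs.v *)
From HB Require Import structures.
From mathcomp Require Import all_boot all_order all_algebra.
From mathcomp Require Import all_classical all_reals all_analysis.

Set Implicit Arguments.
Unset Strict Implicit.
Unset Printing Implicit Defensive.

Import Order.TTheory GRing.Theory Num.Theory.
Import numFieldNormedType.Exports.

Local Open Scope classical_set_scope.
Local Open Scope ring_scope.

(** ** Euclidean geometry of R^n *)

Section euclidean.
Context {R : realType} {n : nat}.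
Implicit Types (x y v w : 'rV[R]_n) (A : set 'rV[R]_n) (f : 'rV[R]_n -> R).

Definition dotv v w : R := \sum_(i < n) v ord0 i * w ord0 i.

(* The library norm of ['rV[R]_n] is the sup norm; it induces the same
   topology, but the estimates below involve the Euclidean one. *)
Definition enorm v : R := Num.sqrt (dotv v v).

Definition frontier A : set 'rV[R]_n := closure A `\` interior A.

Definition basis_vec (i : 'I_n) : 'rV[R]_n := delta_mx ord0 i.

Definition partial (i : 'I_n) f : 'rV[R]_n -> R :=
  fun x => 'D_(basis_vec i) f x.

Definition grad f x : 'rV[R]_n := \row_i partial i f x.

Definition C1_on A f : Prop :=
  forall i x, A x -> derivable f x (basis_vec i) /\
                     {for x, continuous (partial i f)}.

Definition C2_on A f : Prop :=
  C1_on A f /\ forall i, C1_on A (partial i f).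

(* [phi] is a C^2 defining function of [A] in the neighbourhood [U] of [x]. *)
Definition defining_function A x (U : set 'rV[R]_n) (phi : 'rV[R]_n -> R) :=
  [/\ open U, U x, C2_on U phi, (forall y, U y -> grad phi y != 0) &
      forall y, U y -> (A y <-> phi y < 0) /\ (frontier A y <-> phi y = 0)].

Definition C2_boundary A : Prop :=
  forall x, frontier A x -> exists U phi, defining_function A x U phi.

Definition is_outward_normal A x nu : Prop :=
  exists U phi, defining_function A x U phi /\
    nu = (enorm (grad phi x))^-1 *: grad phi x.

(* Meaningful for [x] on a C^2 boundary, where the outward normal exists and
   does not depend on the defining function. *)
Definition outward_normal A x : 'rV[R]_n :=
  xget 0 [set nu | is_outward_normal A x nu].

Definition dist_to A x : R := inf [set enorm (x - y) | y in A].

Definition signed_dist A x : R :=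
  if x \in A then - dist_to (frontier A) x else dist_to (frontier A) x.

End euclidean.

(** ** Borel probability measures on a topological space *)

Section borel_probability.
Context {R : realType}.

Definition borel (X : ptopologicalType) := g_sigma_algebraType (@open X).

Definition prob (X : ptopologicalType) := probability (borel X) R.

Definition supp (X : ptopologicalType) (m : prob X) : set X :=
  [set x | forall U : set X, open U -> U x -> (0 < m U)%E].

Definition bounded_real (X : Type) (phi : X -> R) : Prop :=
  exists B : R, forall x, `|phi x| <= B.

Definition narrow_cvg (X : ptopologicalType) (m : nat -> prob X) (m' : prob X) :=
  forall phi : X -> R, continuous phi -> bounded_real phi ->
    (fun k => \int[m k]_x (phi x)%:E)%E @ \oo --> (\int[m']_x (phi x)%:E)%E.

(* [Phi : P(X) -> C_b^0(X;R)], with [Phi m] written as a function on [X],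
   bounded and continuous from narrow convergence to the sup norm. *)
Definition bounded_continuous_coupling (X : ptopologicalType)
    (Phi : prob X -> X -> R) : Prop :=
  [/\ forall m, continuous (Phi m),
      exists B : R, forall m x, `|Phi m x| <= B &
      forall (m : nat -> prob X) (m' : prob X), narrow_cvg m m' ->
        forall eps : R, 0 < eps ->
          \forall k \near \oo, forall x, `|Phi (m k) x - Phi m' x| <= eps].

End borel_probability.

Arguments prob : clear implicits.

Lemma continuous_borel_measurable (X Y : ptopologicalType) (f : X -> Y) :
  continuous f -> measurable_fun setT (f : borel X -> borel Y).
Proof.
move=> /continuousP cf.
apply: (@measurability _ _ (borel X) (borel Y) setT f (@open Y)) => //.
move=> _ [B oB <-]; rewrite setTI; apply: sub_sigma_algebra; exact: cf.
Qed.

(** ** Phase space *)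

Record domain (R : realType) (n : nat) := Domain {
  domain_set :> set 'rV[R]_n ;
  domain_open : open domain_set ;
  domain_connected : connected domain_set ;
  domain_nonempty : domain_set !=set0
}.

Section phase_space.
Context {R : realType} {n : nat}.
Implicit Type Omega : domain R n.

(* The type [phase Omega] is the space \Xi of the pairs (x, v) with x in the
   closure of Omega, with the topology induced by R^n x R^n. *)
Definition phase_set Omega : set ('rV[R]_n * 'rV[R]_n) :=
  [set z | closure Omega z.1].

Definition phase Omega : Type := set_type (phase_set Omega).

HB.instance Definition _ Omega := PseudoMetric.on (phase Omega).

Lemma phase_inhabited Omega : exists z, z \in phase_set Omega.
Proof.
have [x Ox] := domain_nonempty Omega.
by exists (x, 0); apply/mem_set; exact: subset_closure.
Qed.

Definition phase_point Omega : phase Omega :=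
  let H := cid (phase_inhabited Omega) in exist _ (projT1 H) (projT2 H).

HB.instance Definition _ Omega := isPointed.Build (phase Omega) (phase_point Omega).

Variable Omega : domain R n.
Implicit Types (z w : phase Omega).

Definition pos z : 'rV[R]_n := (set_val z).1.
Definition vel z : 'rV[R]_n := (set_val z).2.

Definition phase_dist z w : R :=
  Num.sqrt (enorm (pos z - pos w) ^+ 2 + enorm (vel z - vel w) ^+ 2).

Definition admissible : set (phase Omega) :=
  [set z | frontier Omega (pos z) ->
           dotv (vel z) (outward_normal Omega (pos z)) <= 0].

Definition K (C : R) : set (phase Omega) := [set z | enorm (vel z) <= C].

Definition condition_A (Theta : set (phase Omega)) : Prop :=
  forall (u : nat -> phase Omega) z,
    (forall i, Theta (u i)) -> Theta z -> u @ \oo --> z ->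
    frontier Omega (pos z) ->
    forall eps : R, 0 < eps -> \forall i \near \oo,
      `| Num.max (dotv (vel (u i)) (grad (signed_dist Omega) (pos (u i)))) 0 ^+ 3 |
        <= eps * `| signed_dist Omega (pos (u i)) |.

(* Kantorovich-Rubinstein distance between measures concentrated on [A]. *)
Definition KR_dist (A : set (phase Omega)) (m m' : prob R (phase Omega)) : \bar R :=
  ereal_sup [set (\int[m]_(z in A) (phi z)%:E - \int[m']_(z in A) (phi z)%:E)%E |
    phi in [set phi : phase Omega -> R |
      forall z w, A z -> A w -> `|phi z - phi w| <= phase_dist z w]].

End phase_space.

(** ** Constrained trajectories *)

Section trajectories.
Context {R : realType} {n : nat} (T : {posnum R}).

Definition time : Type := set_type `[0, T%:num]%classic.

HB.instance Definition _ := PseudoMetric.on time.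

Lemma clamp_subproof (s : R) :
  Num.max 0 (Num.min s T%:num) \in `[0, T%:num]%classic.
Proof.
apply/mem_set; rewrite /= in_itv /= le_max lexx /= ge_max.
by rewrite ge_min lexx orbT andbT.
Qed.

Definition clamp (s : R) : time :=
  exist (fun x => x \in _) _ (clamp_subproof s).

Definition time0 : time := clamp 0.
Definition timeT : time := clamp T%:num.

(* Derivative on the closed interval, one-sided at its endpoints. *)
Definition is_derivative_of (xi eta : time -> 'rV[R]_n) : Prop :=
  forall t : time,
    (fun s : time => (set_val s - set_val t)^-1 *: (xi s - xi t)) @ t^' --> eta t.

(* The elements of the sequence stand for the intervals (a, b), which are
   required to be pairwise disjoint. *)
Definition abs_continuous (eta : time -> 'rV[R]_n) : Prop :=
  forall eps : R, 0 < eps -> exists2 delta : R, 0 < delta &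
  forall s : seq (time * time),
    all (fun p => set_val p.1 <= set_val p.2) s ->
    pairwise (fun p q => (set_val p.2 <= set_val q.1) ||
                         (set_val q.2 <= set_val p.1)) s ->
    \sum_(p <- s) (set_val p.2 - set_val p.1) < delta ->
    \sum_(p <- s) enorm (eta p.2 - eta p.1) < eps.

Variable Omega : domain R n.

Definition path_space : Type := arrow_uniform_type time 'rV[R]_n.
HB.instance Definition _ := PseudoMetric.on path_space.

Definition curve_set : set (path_space * path_space) :=
  [set c | [/\ is_derivative_of c.1 c.2, abs_continuous c.2 &
               forall t, phase_set Omega (c.1 t, c.2 t)]].

(* The metric is the maximum of the sup distances of [xi] and of [eta]; as
   [eta] is the derivative of [xi], this is the C^1 distance of [xi]. *)
Definition curve : Type := set_type curve_set.

HB.instance Definition _ := PseudoMetric.on curve.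

Definition xi_of (g : curve) : time -> 'rV[R]_n := (set_val g).1.
Definition eta_of (g : curve) : time -> 'rV[R]_n := (set_val g).2.

Lemma ev_subproof (t : time) (g : curve) :
  (xi_of g t, eta_of g t) \in phase_set Omega.
Proof. by apply/mem_set; have /set_mem [_ _] := valP g; exact. Qed.

(* The evaluation map e_t. *)
Definition ev (t : time) (g : curve) : phase Omega :=
  exist (fun z => z \in _) _ (ev_subproof t g).

Lemma curve_inhabited : exists g, g \in curve_set.
Proof.
have [x Ox] := domain_nonempty Omega.
exists ((fun=> x), (fun=> 0)); apply/mem_set; split => /=.
- move=> t; under eq_fun do rewrite subrr scaler0; exact: cvg_cst.
- move=> e e0; exists 1 => // s _ _ _.
  rewrite big1// => p _; rewrite subrr /enorm /dotv big1 ?sqrtr0// => i _.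
  by rewrite mxE mul0r.
- by move=> t; exact: subset_closure.
Qed.

Definition curve_point : curve :=
  let H := cid curve_inhabited in exist _ (projT1 H) (projT2 H).

HB.instance Definition _ := isPointed.Build curve curve_point.

Lemma continuous_ev (t : time) : continuous (ev t).
Proof.
apply: continuous_comp_initial => g.
have cval : {for g, continuous (set_val : curve -> path_space * path_space)}.
  exact: initial_continuous.
have cev (f : path_space) : {for f, continuous (fun f : path_space => f t)}.
  move=> U /nbhs_ballP[e /= e0 eU].
  by apply/(@nbhs_ballP R path_space); exists e => // f' ff'; apply/eU/ff'.
have c1 : (fun g : curve => xi_of g t) @ g --> xi_of g t.
  exact: (cvg_comp _ _ (cvg_comp _ _ cval cvg_fst) (cev _)).
have c2 : (fun g : curve => eta_of g t) @ g --> eta_of g t.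
  exact: (cvg_comp _ _ (cvg_comp _ _ cval cvg_snd) (cev _)).
exact: (cvg_pair c1 c2).
Qed.

Definition ev_mfun (t : time) : {mfun borel curve >-> borel (phase Omega)} :=
  HB.pack (ev t : borel curve -> borel (phase Omega))
    (isMeasurableFun.Build _ _ _ _ (ev t : borel curve -> borel (phase Omega))
      (continuous_borel_measurable (@continuous_ev t))).

(* The measure m^mu(t), image of mu under e_t. *)
Definition marginal (mu : prob R curve) (t : time) : prob R (phase Omega) :=
  distribution mu (ev_mfun t).

(* The derivative eta', which exists almost everywhere on [0, T]. *)
Definition acceleration (g : curve) : R -> 'rV[R]_n :=
  (fun s : R => eta_of g (clamp s))^`()%classic.

Definition acceleration_L2norm (g : curve) : \bar R :=
  ((\int[lebesgue_measure]_(s in `[0%R, T%:num]) (enorm (acceleration g s) ^+ 2)%:E)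
    `^ 2^-1)%E.

Definition curves_from (z : phase Omega) : set curve := [set g | ev time0 g = z].

Definition curves_bounded (C : R) : set curve :=
  [set g | (forall t, K C (ev t g)) /\ (acceleration_L2norm g <= C%:E)%E].

Section mean_field_game.
Variables (F G : prob R (phase Omega) -> phase Omega -> R)
          (l : phase Omega * time -> R).

Definition cost (mu : prob R curve) (g : curve) : \bar R :=
  if `[< (acceleration_L2norm g < +oo)%E >] then
    (\int[lebesgue_measure]_(s in `[0%R, T%:num])
        (F (marginal mu (clamp s)) (ev (clamp s) g) + l (ev (clamp s) g, clamp s)
         + 2^-1 * enorm (acceleration g s) ^+ 2)%:E
     + (G (marginal mu timeT) (ev timeT g))%:E)%E
  else +oo%E.

Definition optimal_curves (mu : prob R curve) (z : phase Omega) : set curve :=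
  [set g | curves_from z g /\
           forall g', curves_from z g' -> (cost mu g <= cost mu g')%E].

Definition prob_from (m0 : prob R (phase Omega)) : set (prob R curve) :=
  [set mu : prob R curve | forall B : set (borel (phase Omega)),
     measurable B -> marginal mu time0 B = m0 B].

(* P_{m0}(Gamma_C), as measures on Gamma concentrated on Gamma_C. *)
Definition prob_from_bounded (m0 : prob R (phase Omega)) (C : R) :
    set (prob R curve) :=
  prob_from m0 `&` [set mu : prob R curve | mu (curves_bounded C) = 1%E].

Definition is_equilibrium (m0 : prob R (phase Omega)) (mu : prob R curve) : Prop :=
  prob_from m0 mu /\
  supp mu `<=` \bigcup_(z in supp m0) optimal_curves mu z.

End mean_field_game.

(* The curve of measures [m] belongs to C^{1/2}([0, T]; P(A)). *)
Definition half_holder (A : set (phase Omega)) (m : time -> prob R (phase Omega)) :=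
  (forall t, m t A = 1%E) /\
  exists L : R, forall s t,
    (KR_dist A (m s) (m t) <= (L * Num.sqrt `|set_val s - set_val t|)%:E)%E.

End trajectories.

(* Main.v *)
Require Import Defs.
From HB Require Import structures.
From mathcomp Require Import all_boot all_order all_algebra.
From mathcomp Require Import ring lra.

(* The equilibrium is a limit of Nash equilibria of finite games. At stage [k]
   the players are finitely many trajectories, an approximate net (for the C^1
   distance and for the energy) of those of energy at most [k] starting in
   [Theta /\ K r]; trajectories starting in the same cell of a finite
   partition of the phase space share the mass that [m0] gives to this cell.
   A Nash equilibrium exists by Brouwer's theorem, itself obtained from Scarf's
   lemma. Trajectories charged by it have uniformly bounded energy, because each
   of them competes with a trajectory of bounded energy starting nearby.

   Bounds on the energy and on the initial velocity make the trajectories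
   precompact in C^1, so the words that record the bits
   "coordinate at a rational time < rational threshold" determine them up to
   any precision. A subsequence of the equilibria converges on words; slicing
   [0, 1[ accordingly represents the limit [mu] as the law of a random
   trajectory.

   Let [g] in the support of [mu] start at [z], and let [h] be a competitor from
   [z] of finite energy. Charged trajectories of the finite games converge to
   [g]; from their starting points, condition (A) provides trajectories tending
   to [h] in C^1 with no energy gained in the limit. Near the boundary these
   add to [h] a displacement towards the interior, whose part compensating an
   outgoing velocity [b] at distance [a] costs an energy of order [b^3 / a].
   The energy is lower semicontinuous and the other terms of the cost are
   continuous, so [g] is optimal. *)

Set Implicit Arguments.
Unset Strict Implicit.
Unset Printing Implicit Defensive.

(** * Scarf's lemma *)

(** The obstacle is the stability of optimality: a competitor that starts at [z] must be turned into
    competitors that start at nearby points and still respect the constraint, at almost no cost.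
    Braking an outgoing slope [b] before the distance [a] is used up leaves a time of order [a / b],
    hence an energy of order [b^2 / (a / b)]; this is where the cube of condition (A) comes from.
    Finite games are chosen because Nash's map is single-valued and continuous in finitely many
    weights; the laws of trajectories then enter the costs only through integrals of bounded
    continuous functions of one phase. The acceleration is a pointwise derivative whose
    measurability is not given. Energy is therefore handled through finite sums of squared
    increments of the velocity divided by the lengths of the intervals: these involve finitely many
    values, so bounds on them survive pointwise limits, and Riesz's theorem returns to the integral.
    The energy bound found for charged trajectories comes from the construction; concentration on
    the trajectories bounded by [C] is deduced at the end from optimality on the support. *)

Section scarf.
Context {T I : finType} (rk : I -> T -> nat).
Hypothesis rk_inj : forall i, injective (rk i).
Implicit Types (s : {set T}) (D : {set I}).

(** Combinatorial substitute for the cells of a triangulation: no point of [T] lies strictly above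
    the minimum of [s] in all the orders of [D] at once. In the language of path-following
    arguments, pairs with as many elements in [s] as in [D] are rooms, and pairs with one more
    element in [D] are the doors between them. *)
Definition dominant s D :=
  [forall y, [exists i in D, [forall x in s, rk i y <= rk i x]]].

Lemma dominantP s D : reflect
  (forall y, exists2 i, i \in D & forall x, x \in s -> rk i y <= rk i x)
  (dominant s D).
Proof.
apply: (iffP forallP) => H y.
  by have /exists_inP[i iD /forall_inP ?] := H y; exists i.
by have [i iD Hi] := H y; apply/exists_inP; exists i => //; apply/forall_inP.
Qed.

Lemma dominantS s s' D D' : s' \subset s -> D \subset D' ->
  dominant s D -> dominant s' D'.
Proof.
move=> ss DD /dominantP H; apply/dominantP => y.
have [i iD Hi] := H y; exists i; first exact: (subsetP DD).
by move=> x xs; apply: Hi; exact: (subsetP ss).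
Qed.

Section door.
Variables (s : {set T}) (D : {set I}) (x0 : T).
Hypotheses (x0s : x0 \in s) (dsD : dominant s D) (cD : #|D| = #|s|.+1).

Let m i := [arg min_(x < x0 in s) rk i x].

Let mP i : m i \in s /\ forall x, x \in s -> rk i (m i) <= rk i x.
Proof. by rewrite /m; case: arg_minnP => // x xs H; split. Qed.

Let min_m i y : y \in s -> (forall x, x \in s -> rk i y <= rk i x) -> y = m i.
Proof.
move=> ys H; apply: (@rk_inj i); apply/eqP; rewrite eqn_leq.
by rewrite H ?(mP i).1// (mP i).2.
Qed.

Let low (D' : {set I}) : dominant s D' -> s \subset m @: D'.
Proof.
move=> /dominantP H; apply/subsetP => y ys.
have [i iD Hi] := H y; apply/imsetP; exists i => //; exact: min_m.
Qed.

Let imm : m @: D = s.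
Proof.
apply/eqP; rewrite eqEsubset low// andbT.
by apply/subsetP => _ /imsetP[i _ ->]; exact: (mP i).1.
Qed.

Let lt_m i x : x \notin s -> rk i x <= rk i (m i) -> rk i x < rk i (m i).
Proof.
move=> xs; rewrite leq_eqVlt => /orP[/eqP /rk_inj E|//].
by move: xs; rewrite E (mP i).1.
Qed.

Variables (i1 i2 : I).
Hypotheses (i1D : i1 \in D) (i2D : i2 \in D) (i12 : i1 != i2) (m12 : m i1 = m i2).

Let inj1 : {in D :\ i1 &, injective m}.
Proof.
apply/imset_injP/eqP; have -> : m @: (D :\ i1) = s.
  apply/eqP; rewrite eqEsubset; apply/andP; split.
    by apply/subsetP => _ /imsetP[j _ ->]; exact: (mP j).1.
  rewrite -{1}imm; apply/subsetP => _ /imsetP[j jD ->].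
  have [->|ji1] := eqVneq j i1.
    by rewrite m12; apply/imset_f; rewrite !inE eq_sym i12.
  by apply/imset_f; rewrite !inE ji1.
by have := cardsD1 i1 D; rewrite i1D cD add1n => -[].
Qed.

Let same i j : i \in D -> j \in D -> m i = m j -> i != j ->
  (i == i1) && (j == i2) || (i == i2) && (j == i1).
Proof.
move=> iD jD mij ij.
have [ii|ii] := eqVneq i i1; have [ji|ji] := eqVneq j i1.
- by move: ij; rewrite ii ji eqxx.
- rewrite /=; apply/orP; left; apply/eqP; apply: inj1; rewrite ?inE ?ji ?iD ?jD//.
    by rewrite eq_sym i12 i2D.
  by rewrite -mij ii.
- rewrite andbT /=; apply/eqP; apply: inj1; rewrite ?inE ?ii ?iD ?jD//.
    by rewrite eq_sym i12 i2D.
  by rewrite mij ji.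
- by case/eqP: ij; apply: inj1; rewrite ?inE ?ii ?ji ?iD ?jD.
Qed.

(* if [x] can be added, it undercuts [s] in exactly one order *)
Let two_low i j x : x \notin s -> dominant (x |: s) D -> i \in D -> j \in D ->
  i != j -> rk i x < rk i (m i) -> rk j x < rk j (m j) -> False.
Proof.
move=> xs /dominantP dx iD jD ij xi xj.
have : s \subset m @: (D :\ i :\ j).
  apply/subsetP => y ys; have [k kD Hk] := dx y.
  have ym : y = m k by apply: min_m => // z zs; apply: Hk; exact: setU1r.
  have := Hk x (setU11 _ _); rewrite ym => kx.
  apply/imsetP; exists k => //; rewrite !inE kD andbT.
  by apply/andP; split; apply: contraTneq kx => ->; rewrite -ltnNge.
move/subset_leq_card/leq_trans => /(_ _ (leq_imset_card _ _)).
have := cardsD1 j (D :\ i); have := cardsD1 i D.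
rewrite iD cD !inE eq_sym ij jD /= !add1n => -[->] ->.
by rewrite ltnn.
Qed.

Let above j := [set y | [forall i in D :\ j, rk i (m i) < rk i y]].

Let aboveP j y : reflect (forall i, i \in D -> i != j -> rk i (m i) < rk i y)
  (y \in above j).
Proof.
rewrite inE; apply: (iffP forall_inP) => H i; last by rewrite !inE => /andP[? ?]; exact: H.
by move=> iD ij; apply: H; rewrite !inE ij.
Qed.

Let dom_above j : dominant s (D :\ j) = (above j == set0).
Proof.
apply/dominantP/eqP => [H|H y].
  apply/setP => y; rewrite in_set0; apply/negP => /aboveP yj.
  have [i] := H y; rewrite !inE => /andP[ij iD] /(_ _ (mP i).1).
  by rewrite leqNgt yj.
have : y \notin above j by rewrite H inE.
rewrite inE negb_forall_in => /exists_inP[i iD]; rewrite -leqNgt => yi.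
by exists i => // x xs; apply: leq_trans yi _; exact: (mP i).2.
Qed.

Let A := [set x | x \notin s & dominant (x |: s) D].
Let Aj j := [set x in A | rk j x < rk j (m j)].

Let Aj_above j x : j \in D -> x \in Aj j ->
  x \in above j /\ forall y, y \in above j -> rk j y <= rk j x.
Proof.
move=> jD; rewrite !inE => /andP[/andP[xs dx] xj]; split.
  apply/forall_inP => i; rewrite !inE => /andP[ij iD].
  rewrite ltnNge; apply/negP => /(lt_m xs) xi; exact: (two_low xs dx iD jD ij).
move=> y /aboveP yj; have /dominantP/(_ y)[i iD Hi] := dx.
have [ij|ij] := eqVneq i j.
  by rewrite -ij; apply: Hi; exact: setU11.
have := Hi (m i) (setU1r _ (mP i).1).
by rewrite leqNgt yj.
Qed.

Let card_Aj j : (j == i1) || (j == i2) -> #|Aj j| = ~~ dominant s (D :\ j).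
Proof.
move=> j12; have jD : j \in D by case/orP: j12 => /eqP->.
rewrite dom_above; have [E|/set0Pn[y0 y0j]] := boolP (above j == set0).
  apply/eqP; rewrite cards_eq0; apply/eqP/setP => x; rewrite in_set0.
  by apply/negP => /(Aj_above jD)[]; rewrite (eqP E) inE.
case: (arg_maxnP (rk j) y0j) => x xj xmax.
suff -> : Aj j = [set x] by rewrite cards1.
have dj (y : T) : y \in above j -> rk j y <= rk j (m j).
  move=> /aboveP yj; have /dominantP/(_ y)[i iD Hi] := dsD.
  have [ij|ij] := eqVneq i j; first by rewrite -ij; apply: Hi; exact: (mP i).1.
  by have := Hi _ (mP i).1; rewrite leqNgt yj.
have xs : x \notin s.
  apply/negP; rewrite -imm => /imsetP[i iD xi].
  have [k [kD kj mk]] : exists k, [/\ k \in D, k != j & x = m k].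
    have [ij|ij] := eqVneq i j; last by exists i.
    case/orP: j12 => /eqP jE.
      by exists i2; split; rewrite ?i2D// ?xi ?ij jE // eq_sym.
    by exists i1; split; rewrite ?i1D// ?xi ?ij jE // m12.
  by have /aboveP/(_ _ kD kj) := xj; rewrite mk ltnn.
apply/setP => y; rewrite in_set1; apply/idP/eqP => [yA|->].
  have [yj yM] := Aj_above jD yA.
  apply: (@rk_inj j); apply/eqP; rewrite eqn_leq yM// andbT; exact: xmax.
rewrite !inE xs (lt_m xs) ?dj//= andbT; apply/dominantP => z.
have [zj|] := boolP (z \in above j).
  exists j => // w; rewrite !inE => /orP[/eqP->|ws]; first exact: xmax.
  by apply: leq_trans (dj _ zj) _; exact: (mP j).2.
rewrite inE negb_forall_in => /exists_inP[i].
rewrite !inE -leqNgt => /andP[ij iD] zi; exists i => // w; rewrite !inE => /orP[/eqP->|ws].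
  by apply: leq_trans zi _; apply: ltnW; have /aboveP := xj; exact.
by apply: leq_trans zi _; exact: (mP i).2.
Qed.

(** [m] maps [D] onto [s], which has one element less, so [i1] and [i2] are the only indices sharing
    a minimum. Each of them counts once: either it can be removed from [D], or [above] is non-empty
    and its greatest element in that order is the one point that can be added to [s]. Removing any
    other index would leave an element of [s] that is nobody's minimum. *)
Lemma door_count_aux :
  #|A| + #|[set j in D | dominant s (D :\ j)]| = 2.
Proof.
have -> : #|A| = #|Aj i1| + #|Aj i2|.
  have -> : A = Aj i1 :|: Aj i2.
    apply/setP => x; rewrite in_setU.
    have [xA|xA] := boolP (x \in A); last by move: xA; rewrite /Aj !inE => /negbTE->.
    have -> : (x \in Aj i1) = (rk i1 x < rk i1 (m i1)) by rewrite [LHS]inE xA.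
    have -> : (x \in Aj i2) = (rk i2 x < rk i2 (m i2)) by rewrite [LHS]inE xA.
    move: xA; rewrite inE => /andP[xs dx]; apply/esym.
    have /dominantP dx' := dx.
    have [i iD Hi] := dx' x.
    have xi : rk i x < rk i (m i).
      by apply: lt_m => //; apply: Hi; exact: setU1r (mP i).1.
    have [k kD Hk] := dx' (m i).
    have mik : m i = m k.
      by apply: min_m; [exact: (mP i).1|move=> z zs; apply: Hk; exact: setU1r].
    have ik : i != k.
      by apply: contraTneq xi => ->; rewrite -leqNgt -mik; apply: Hk; exact: setU11.
    have /orP[/andP[/eqP<- _]|/andP[/eqP<- _]] := same iD kD mik ik; by rewrite xi ?orbT.
  rewrite cardsU (_ : _ :&: _ = set0) ?cards0 ?subn0//.
  apply/setP => x; rewrite in_set0; apply/negP => /setIP[].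
  rewrite !inE => /andP[/andP[xs dx] x1] /andP[_ x2].
  exact: (two_low xs dx i1D i2D i12).
rewrite !card_Aj ?eqxx ?orbT//.
have -> : [set j in D | dominant s (D :\ j)] =
  [set j in [set i1; i2] | dominant s (D :\ j)].
  apply/setP => j; rewrite !inE; have [dj|] := boolP (dominant _ _); last by rewrite !andbF.
  rewrite !andbT; apply/idP/idP => [jD|/orP[]/eqP-> //].
  apply/negPn; rewrite negb_or; apply/negP => /andP[j1 j2].
  have /subsetP/(_ (m j) (mP j).1)/imsetP[k] := low dj.
  rewrite !inE => /andP[kj kD] mjk; rewrite eq_sym in kj.
  have := same jD kD mjk kj.
  by rewrite (negbTE j1) (negbTE j2).
have -> : #|[set j in [set i1; i2] | dominant s (D :\ j)]| =
   dominant s (D :\ i1) + dominant s (D :\ i2).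
  rewrite -sum1dep_card big_mkcondr/= big_setU1 ?inE//= big_set1.
  by do 2 case: dominant.
by do 2 case: dominant.
Qed.

End door.

Lemma door_count s D : s != set0 -> dominant s D -> #|D| = #|s|.+1 ->
  #|[set x | x \notin s & dominant (x |: s) D]| +
  #|[set j in D | dominant s (D :\ j)]| = 2.
Proof.
move=> /set0Pn[x0 x0s] dsD cD.
pose m i := [arg min_(x < x0 in s) rk i x].
have : ~~ dinjectiveb m (mem D).
  apply/negP => /dinjectiveP inj.
  have : #|m @: D| <= #|s|.
    apply/subset_leq_card/subsetP => _ /imsetP[i _ ->].
    by rewrite /m; case: arg_minnP.
  by rewrite card_in_imset// cD ltnn.
move=> /dinjectivePn[i iD [j]].
rewrite inE /= => /andP[ji jD] mij.
by apply: (door_count_aux x0s dsD cD iD jD _ mij); rewrite eq_sym.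
Qed.

Lemma outer_door_count (t0 : T) i :
  #|[set x | dominant [set x] [set i]]| = 1.
Proof.
case: (@arg_maxnP _ t0 predT (rk i) isT) => x _ xmax.
suff -> : [set x | dominant [set x] [set i]] = [set x] by rewrite cards1.
apply/setP => y; rewrite !inE; apply/dominantP/eqP => [H|-> z].
  have [j /set1P-> /(_ _ (set11 _)) xy] := H x.
  by apply: (@rk_inj i); apply/eqP; rewrite eqn_leq xy andbT; exact: xmax.
by exists i; rewrite ?set11// => w /set1P->; exact: xmax.
Qed.

Variables (c : T -> I) (t0 : T) (i0 : I).

Definition room s D := dominant s D && (#|D| == #|s|).
Definition colorful s D := room s D && (c @: s == D).
(** A door that misses the colour [i0] only: the cardinals force [c] to be injective on [s], so
    every other colour of [D] is worn exactly once. *)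
Definition typed s D := [&& dominant s D, #|D| == #|s|.+1, i0 \notin c @: s &
  D == i0 |: c @: s].

Let ndoors s D := #|[set x in s | typed (s :\ x) D]| +
  #|[set j | j \notin D & typed s (j |: D)]|.

Lemma colorful_inj s D : #|D| = #|s| -> c @: s = D -> {in s &, injective c}.
Proof. by move=> cD E; apply/imset_injP; rewrite E cD eqxx. Qed.

Lemma imset_D1 s x : {in s &, injective c} -> x \in s ->
  c @: (s :\ x) = (c @: s) :\ c x.
Proof.
move=> inj xs; apply/setP => i; rewrite !inE; apply/imsetP/andP => [[y]|[ix /imsetP[y ys iy]]].
  rewrite !inE => /andP[yx ys] ->; split; last exact: imset_f.
  by apply: contra_neq yx => /inj; exact.
by exists y => //; rewrite !inE ys andbT; apply: contra_neq ix => <-.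
Qed.

(** The only exit from a colourful room is to give up the element coloured [i0] if there is one, and
    otherwise to add [i0] to [D]. *)
Lemma ndoors_colorful s D : colorful s D -> ndoors s D = 1.
Proof.
move=> /andP[/andP[dom /eqP cD] /eqP E].
have inj := colorful_inj cD E.
have [iD|iD] := boolP (i0 \in D).
  have [x xs i0x] : exists2 x, x \in s & i0 = c x by move: iD; rewrite -E => /imsetP.
  rewrite /ndoors (_ : [set x in s | _] = [set x]); last first.
    apply/setP => y; rewrite !inE /typed; apply/idP/eqP => [/andP[ys /and4P[_ _ n _]]|->].
      move: n; rewrite imset_D1// in_setD1 E iD andbT negbK i0x => /eqP.
      by move/inj => /(_ xs ys).
    rewrite xs /=; apply/and4P; split.
    - by apply: dominantS dom => //; exact: subD1set.
    - by rewrite cD (cardsD1 x s) xs.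
    - by rewrite imset_D1// -i0x !inE eqxx.
    - by rewrite imset_D1// -i0x setD1K ?E.
  rewrite cards1 (_ : [set j | _ & _] = set0) ?cards0//.
  apply/setP => j; rewrite !inE; apply/negP => /andP[jD /and4P[_ _]].
  by rewrite E iD.
rewrite /ndoors (_ : [set x in s | _] = set0); last first.
  apply/setP => x; rewrite !inE; apply/negP => /andP[_ /and4P[_ _ _ /eqP DE]].
  by move: iD; rewrite DE !inE eqxx.
rewrite cards0 (_ : [set j | _ & _] = [set i0]) ?cards1//.
apply/setP => j; rewrite !inE; apply/idP/eqP => [/andP[jD /and4P[_ _ _ /eqP DE]]|->].
  have : j \in i0 |: c @: s by rewrite -DE !inE eqxx.
  by rewrite !inE E (negbTE jD) orbF => /eqP.
rewrite iD /=; apply/and4P; split.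
- by apply: dominantS dom => //; exact: subsetUr.
- by rewrite cardsU1 iD cD.
- by rewrite E.
- by rewrite E.
Qed.

(** [s :\ x] wears each colour of [D] other than [i0] once, and [x] is not coloured [i0]. If the
    colour of [x] is already worn by some [y], the second door is [s :\ y]; if it is new, the second
    door is obtained by adding it to [D]. *)
Lemma ndoors_typed1 s D x : room s D -> ~~ colorful s D -> x \in s ->
  typed (s :\ x) D -> ndoors s D = 2.
Proof.
move=> rm; rewrite /colorful rm /= => ncol xs /and4P[_ _ i0n /eqP DE].
have /andP[dom /eqP cD] := rm.
have inj : {in s :\ x &, injective c}.
  apply/imset_injP; rewrite -(eqn_add2l 1); apply/eqP.
  have := cardsU1 i0 (c @: (s :\ x)); rewrite i0n -DE cD => <-.
  by rewrite (cardsD1 x s) xs.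
have csE : c @: s = c x |: c @: (s :\ x) by rewrite -{1}(setD1K xs) imsetU1.
have cxi0 : c x != i0.
  by apply: contra ncol => /eqP cx; rewrite DE csE cx.
have i0D : i0 \in D by rewrite DE !inE eqxx.
have i0s : i0 \notin c @: s by rewrite csE !inE negb_or eq_sym cxi0.
have [cxD|cxD] := boolP (c x \in D).
  have csD : c @: s = D :\ i0.
    rewrite csE DE setU1K//; apply/setP => i; rewrite !inE.
    case: eqVneq => //= ->; apply/esym; move: cxD; rewrite DE !inE (negbTE cxi0) => //.
  have : c x \in c @: (s :\ x) by move: cxD; rewrite DE !inE (negbTE cxi0).
  move=> /imsetP[y]; rewrite !inE => /andP[yx ys] cxy.
  have swap : c @: (s :\ y) = c @: (s :\ x).
    apply/setP => i; apply/imsetP/imsetP => -[z]; rewrite !inE => /andP[zx zs] ->.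
      have [->|zx'] := eqVneq z x; last by exists z; rewrite ?inE ?zx'.
      by exists y; rewrite ?inE ?yx.
    have [->|zx'] := eqVneq z y; last by exists z; rewrite ?inE ?zx'.
    by exists x; rewrite ?inE ?(eq_sym x) ?yx.
  rewrite /ndoors (_ : [set x in s | _] = [set x; y]); last first.
    apply/setP => z; rewrite !inE; apply/idP/idP => [/andP[zs /and4P[_ _ zn /eqP zE]]|].
      apply/negPn; rewrite negb_or; apply/negP => /andP[zx zy].
      have cz : c z \in D.
        by rewrite DE !inE imset_f ?orbT// !inE zx.
      rewrite zE !inE in cz; case/orP: cz => [/eqP ci0|/imsetP[w]].
        by move: i0s; rewrite -ci0 imset_f.
      rewrite !inE => /andP[wz ws] cwz.
      have [wx|wx] := eqVneq w x.
        by case/eqP: zy; apply: inj; rewrite ?inE ?zx ?yx ?zs ?ys// cwz wx.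
      by case/eqP: wz; apply: inj; rewrite ?inE ?zx ?wx ?zs ?ws.
    move=> zxy; have zs : z \in s by case/orP: zxy => /eqP->.
    have zE : c @: (s :\ z) = c @: (s :\ x) by case/orP: zxy => /eqP->.
    rewrite /typed zE i0n -DE eqxx cD (cardsD1 z s) zs !andbT eqxx andbT.
    by apply: dominantS dom => //; exact: subD1set.
  rewrite cards2 (eq_sym x) yx (_ : [set j | _ & _] = set0) ?cards0//.
  apply/setP => j; rewrite !inE; apply/negP => /andP[jD /and4P[_ _ _ /eqP jE]].
  have : j \in i0 |: c @: s by rewrite -jE !inE eqxx.
  rewrite csD !inE (negbTE jD) andbF orbF => /eqP ji0.
  by move: jD; rewrite ji0 i0D.
rewrite /ndoors (_ : [set x in s | _] = [set x]); last first.
  apply/setP => z; rewrite !inE; apply/idP/eqP => [/andP[zs /and4P[_ _ zn /eqP zE]]|->].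
    apply: contraNeq cxD => zx; rewrite zE !inE imset_f ?orbT// !inE eq_sym zx.
    by rewrite xs.
  rewrite /typed xs i0n -DE eqxx cD (cardsD1 x s) xs !andbT eqxx andbT.
  by apply: dominantS dom => //; exact: subD1set.
rewrite cards1 (_ : [set j | _ & _] = [set c x]) ?cards1//.
have iE : i0 |: c @: s = c x |: D by rewrite csE DE setUCA.
apply/setP => j; rewrite !inE; apply/idP/eqP => [/andP[jD /and4P[_ _ _ /eqP jE]]|->].
  have : j \in i0 |: c @: s by rewrite -jE !inE eqxx.
  by rewrite iE !inE (negbTE jD) orbF => /eqP.
rewrite cxD /typed i0s iE eqxx cardsU1 cxD cD !andbT.
rewrite eqxx andbT; by apply: dominantS dom => //; exact: subsetUr.
Qed.

Lemma odd_ndoors s D : room s D -> odd (ndoors s D) = colorful s D.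
Proof.
move=> rm; have [col|ncol] := boolP (colorful s D); first by rewrite ndoors_colorful.
have [/existsP[x /andP[xs tx]]|/existsPn nx] := boolP [exists x, (x \in s) && typed (s :\ x) D].
  by rewrite (ndoors_typed1 rm ncol xs tx).
have [/existsP[j /andP[jD tj]]|/existsPn nj] := boolP [exists j, (j \notin D) && typed s (j |: D)].
  have /and4P[_ _ i0s /eqP jE] := tj.
  have /andP[dom /eqP cD] := rm.
  have : j \in i0 |: c @: s by rewrite -jE !inE eqxx.
  (* A door that adds [j] to [D] comes with the door that drops the element coloured [j], which
     leads back to [ndoors_typed1]. *)
  rewrite !inE => /orP[/eqP ji0|/imsetP[x xs jx]].
    case/negP: ncol; rewrite /colorful rm /=; apply/eqP/setP => i.
    move/setP/(_ i): jE; rewrite ji0 !inE; case: eqVneq => //= -> _.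
    by rewrite (negbTE i0s) -ji0 (negbTE jD).
  have inj : {in s &, injective c}.
    apply/imset_injP; rewrite -(eqn_add2l 1); apply/eqP.
    have := cardsU1 i0 (c @: s); rewrite i0s -jE => <-.
    by rewrite cardsU1 jD cD.
  have i0D : i0 \in D.
    have : i0 \in j |: D by rewrite jE !inE eqxx.
    rewrite !inE => /orP[/eqP i0j|//]; move: i0s; rewrite i0j jx imset_f//.
  have i0n : i0 \notin c @: (s :\ x).
    by apply: contra i0s => /imsetP[y]; rewrite !inE => /andP[_ ys] ->; rewrite imset_f.
  rewrite (@ndoors_typed1 _ _ x)// /typed i0n cD (cardsD1 x s) xs eqxx /=.
  apply/andP; split; first by apply: dominantS dom => //; exact: subD1set.
  apply/eqP; rewrite imset_D1// -jx; apply/setP => i.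
  move/setP/(_ i): jE; rewrite !inE.
  have [->|] := eqVneq i j => /=; last by [].
  by rewrite (negbTE jD) orbF; case: eqVneq => // ji0 _; move: jD; rewrite ji0 i0D.
rewrite /ndoors (_ : [set x in s | _] = set0).
  rewrite (_ : [set j | _ & _] = set0) ?cards0//.
  by apply/setP => j; rewrite !inE; apply/negbTE/(nj j).
by apply/setP => x; rewrite !inE; apply/negbTE/(nx x).
Qed.

Let nrooms s D := #|[set x | x \notin s & dominant (x |: s) D]| +
  #|[set j in D | dominant s (D :\ j)]|.

(** A typed door lies between two rooms, except the outer door, whose [s] is empty and which opens
    into a single room. *)
Lemma odd_nrooms s D : typed s D -> odd (nrooms s D) = (s == set0).
Proof.
move=> /and4P[dom /eqP cD i0s /eqP DE].
have [s0|s0] := eqVneq s set0; last by rewrite /nrooms door_count.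
rewrite /nrooms; have -> : D = [set i0] by rewrite DE s0 imset0 setU0.
rewrite s0 (_ : [set x | _ & _] = [set x | dominant [set x] [set i0]]).
  rewrite (outer_door_count t0) (_ : [set j in _ | _] = set0) ?cards0//.
  apply/setP => j; rewrite in_set0 inE; apply/negP => /andP[/set1P-> /dominantP /(_ t0)[i]].
  by rewrite !inE => /andP[/negbTE->].
by apply/setP => x; rewrite !inE /= setU0.
Qed.

Lemma double_count :
  \sum_(p : {set T} * {set I} | typed p.1 p.2) nrooms p.1 p.2 =
  \sum_(p : {set T} * {set I} | room p.1 p.2) ndoors p.1 p.2.
Proof.
rewrite /nrooms /ndoors !big_split /=; congr (_ + _).
  under eq_bigr do rewrite -sum1dep_card.
  under [RHS]eq_bigr do rewrite -sum1dep_card.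
  rewrite !pair_big_dep /=.
  rewrite (reindex_onto (fun p : {set T} * {set I} * T => ((p.1.1 :\ p.2, p.1.2), p.2))
    (fun p => ((p.2 |: p.1.1, p.1.2), p.2))) /=; last first.
    by move=> [[s D] x] /= /and3P[_ xs _]; rewrite setU1K.
  apply: eq_bigl => -[[s D] x] /=.
  apply/idP/idP => [/and3P[/andP[t /andP[xs dm]] /eqP [E]]|/and3P[rm xs t]].
    have xin : x \in s by rewrite -E !inE eqxx.
    rewrite xin t /= /room -E dm /=; have /and4P[_ /eqP-> _ _] := t.
    by move=> _; rewrite cardsU1 xs eqxx.
  rewrite t !inE eqxx /= setD1K// eqxx andbT; by case/andP: rm.
under eq_bigr do rewrite -sum1dep_card.
under [RHS]eq_bigr do rewrite -sum1dep_card.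
rewrite !pair_big_dep /=.
rewrite (reindex_onto (fun p : {set T} * {set I} * I => ((p.1.1, p.2 |: p.1.2), p.2))
    (fun p => ((p.1.1, p.1.2 :\ p.2), p.2))) /=; last first.
  by move=> [[s D] j] /= /and3P[_ jD _]; rewrite setD1K.
apply: eq_bigl => -[[s D] j] /=.
apply/idP/idP => [/andP[/and3P[t jD dm] /eqP [E]]|/and3P[rm jD t]].
  have jn : j \notin D by rewrite -E !inE eqxx.
  rewrite jn t /= /room -E dm /= andbT; have /and4P[_ /eqP cD _ _] := t.
  by rewrite E; move: cD; rewrite cardsU1 jn add1n => -[->].
rewrite t !inE eqxx /= setU1K// eqxx !andbT; by case/andP: rm.
Qed.

(** The incidences between typed doors and rooms are counted in two ways modulo 2: among doors only
    the outer one contributes, among rooms only the colourful ones, so the number of colourful rooms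
    is odd. *)
Theorem scarf : exists s D, [/\ dominant s D, #|D| = #|s| & c @: s = D].
Proof.
have oddS (J : finType) (P : pred J) (f : J -> nat) :
    odd (\sum_(p | P p) f p) = odd #|[set p | P p & odd (f p)]|.
  rewrite -sum1dep_card [in RHS]big_mkcondr /=.
  by elim/big_ind2 : _ => // [a b a' b' + + |p _]; rewrite ?oddD; [move=> -> ->|case: (odd (f p))].
have E := congr1 odd double_count; rewrite !oddS in E.
have : [set p : {set T} * {set I} | typed p.1 p.2 & odd (nrooms p.1 p.2)] = [set (set0, [set i0])].
  apply/setP => -[s D]; rewrite !inE /=; apply/andP/eqP => [[t]|[-> ->]].
    rewrite odd_nrooms// => /eqP s0; move: t => /and4P[_ _ _ /eqP ->].
    by rewrite s0 imset0 setU0.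
  have t : typed set0 [set i0].
    rewrite /typed imset0 setU0 cards0 cards1 inE !eqxx /= andbT.
    by apply/dominantP => y; exists i0; rewrite ?inE// => x; rewrite inE.
  by rewrite odd_nrooms// eqxx.
move=> H; rewrite H cards1 /= in E.
have [p] : exists p, p \in [set p : {set T} * {set I} | room p.1 p.2 & odd (ndoors p.1 p.2)].
  by apply/set0Pn; apply: contra_eq_neq E => ->; rewrite cards0.
rewrite inE => /andP[rm]; rewrite odd_ndoors// => /andP[_ /eqP cE].
by exists p.1, p.2; split=> //; case/andP: rm => // _ /eqP.
Qed.

End scarf.

From mathcomp Require Import all_classical all_reals all_analysis.
From mathcomp Require Import measurable_realfun.

Import Order.TTheory GRing.Theory Num.Theory.
Import numFieldNormedType.Exports.

Local Open Scope classical_set_scope.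
Local Open Scope ring_scope.

(** * Brouwer's theorem and Nash equilibria *)

Section extraction.
Context {R : realType}.

Lemma increasing_geS (phi : nat -> nat) : (forall k, (phi k < phi k.+1)%N) ->
  forall k, (k <= phi k)%N.
Proof. by move=> H; elim=> // k IH; exact: leq_ltn_trans IH (H k). Qed.

Lemma increasing_cvgn (phi : nat -> nat) : (forall k, (phi k < phi k.+1)%N) ->
  phi @ \oo --> \oo.
Proof.
move=> H A [N _ NA]; exists N => // k /= Nk; apply: NA => /=.
exact: leq_trans Nk (increasing_geS H k).
Qed.

(* An ultrafilter on the indices gives all the limits at once. *)
Lemma diagonal_extraction (a : nat -> nat -> R) (M : nat -> R) :
  (forall k j, `|a k j| <= M j) ->
  exists2 phi : nat -> nat, (forall k, (phi k < phi k.+1)%N) &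
  exists p : nat -> R, forall j, a (phi k) j @[k --> \oo] --> p j.
Proof.
move=> aM.
have [G [UG oG]] := @ultraFilterLemma nat \oo _.
have PG : ProperFilter G by exact: ultra_proper.
have /choice[p pP] : forall j, exists l : R, forall e, 0 < e -> G [set k | `|a k j - l| < e].
  move=> j; have cM : compact `[- M j, M j] := @segment_compact R _ _.
  have [] := cM (a^~ j @ G) _ _.
    have : G [set k | a k j \in `[- M j, M j]] by apply: filterE => k /=; have := aM k j; rewrite in_itv /= ler_norml.
    exact.
  move=> l [_ cl]; exists l => e e0.
  have [//|nG] := in_ultra_setVsetC [set k | `|a k j - l| < e] UG.
  have [|x [H1 H2]] := cl [set x | ~ `|x - l| < e] (ball l e) _ (nbhsx_ballx _ _ e0).
    exact: nG.
  by move: H2; rewrite /ball /= distrC => /H1.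
have pick (k m : nat) : exists i, (m < i)%N /\ forall j, (j < k)%N -> `|a i j - p j| < k.+1%:R^-1.
  have : G ([set i | (m < i)%N] `&` [set i | forall j, (j < k)%N -> `|a i j - p j| < k.+1%:R^-1]).
    apply: filterI; first by apply: oG; exists m.+1.
    elim: {1}k => [|n IH]; first by apply: filterE => i j.
    have : G [set i | `|a i n - p n| < k.+1%:R^-1] by apply: pP; rewrite invr_gt0.
    apply: filterS2 IH => i H1 H2 j; rewrite ltnS leq_eqVlt => /orP[/eqP->//|]; exact: H1.
  by move=> /filter_ex[i [mi Hi]]; exists i.
pose nx k m := projT1 (cid (pick k m)).
have nxP k m : (m < nx k m)%N /\ forall j, (j < k)%N -> `|a (nx k m) j - p j| < k.+1%:R^-1.
  by rewrite /nx; case: cid.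
pose phi := fix phi k := if k is k'.+1 then nx k (phi k') else nx 0 0.
exists phi; first by move=> k; exact: (nxP k.+1 (phi k)).1.
exists p => j; apply/cvgrPdist_lt => e e0.
have H := @cvg_harmonic R; move/cvgrPdist_lt : H => /(_ e e0) H.
near=> k.
have jk : (j < k)%N by near: k; exact: nbhs_infty_gt.
have -> : phi k = nx k (if k is k'.+1 then phi k' else 0) by case: (k).
rewrite distrC; apply: lt_trans ((nxP _ _).2 _ jk) _.
suff : `|0 - harmonic k| < e :> R by rewrite sub0r normrN ger0_norm// invr_ge0.
by near: k.
Unshelve. all: by end_near. Qed.

Lemma cvgn_subseq (T : topologicalType) (u : nat -> T) (l : T) (phi : nat -> nat) :
  (forall k, (phi k < phi k.+1)%N) -> u @ \oo --> l -> u (phi k) @[k --> \oo] --> l.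
Proof. by move=> /increasing_cvgn c ul; exact: cvg_comp c ul. Qed.

Lemma cvgr_max0 (u : nat -> R) l : u @ \oo --> l ->
  Num.max 0 (u k) @[k --> \oo] --> Num.max 0 l.
Proof.
move=> ul; under eq_fun do rewrite maxr_absE; rewrite maxr_absE.
apply: cvgM; last exact: cvg_cst.
apply: cvgD; first by apply: cvgD => //; exact: cvg_cst.
by apply: cvg_norm; apply: cvgB => //; exact: cvg_cst.
Qed.

Lemma cvgr_sum (I : finType) (P : pred I) (u : I -> nat -> R) (l : I -> R) :
  (forall i, u i @ \oo --> l i) ->
  \sum_(i | P i) u i k @[k --> \oo] --> \sum_(i | P i) l i.
Proof. by move=> ul; apply: cvg_big => //; exact: add_continuous. Qed.

End extraction.

(** * Brouwer's theorem, from a grid coloured by the coordinates that [f] does not decrease *)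

Section brouwer.
Context {R : realType} {I : finType}.
Implicit Types x y : I -> R.

Definition simplex x := (forall i, 0 <= x i) /\ \sum_i x i = 1.

Variable i0 : I.

Section grid.
Variables (f : (I -> R) -> I -> R) (N : nat).
Hypothesis fs : forall x, simplex x -> simplex (f x).

Let G : finType := {x : {ffun I -> 'I_N.+2} | (\sum_i x i == N.+1)%N}.
Let pt (x : G) i : R := (val x i)%:R / N.+1%:R.

Let pt_simplex (x : G) : simplex (pt x).
Proof.
split=> [i|]; first by rewrite divr_ge0.
rewrite -mulr_suml -natr_sum (eqP (valP x)) divff//.
Qed.

Let G0 : G.
Proof.
exists [ffun i => if i == i0 then ord_max else ord0].
rewrite (bigD1 i0)//= ffunE eqxx big1 ?addn0// => i /negbTE ni.
by rewrite ffunE ni.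
Qed.

Let colorable (x : G) : exists i, pt x i <= f (pt x) i.
Proof.
apply: contrapT => /forallNP H.
have [_ s1] := pt_simplex x; have [_ f1] := fs (pt_simplex x).
suff : \sum_i f (pt x) i < \sum_i pt x i by rewrite s1 f1 ltxx.
rewrite (bigD1 i0)//= [ltRHS](bigD1 i0)//=; apply: ltr_leD.
  by rewrite ltNge; apply/negP/H.
by apply: ler_sum => i _; rewrite ltW// ltNge; apply/negP/H.
Qed.

Let c (x : G) := projT1 (cid (colorable x)).
Let cP (x : G) : pt x (c x) <= f (pt x) (c x). Proof. by rewrite /c; case: cid. Qed.

(** Order by the [i]-th coordinate; the rank in the enumeration breaks ties, as Scarf's lemma asks
    for injective orders. *)
Let rk i (x : G) := (val x i * #|G| + enum_rank x)%N.

Let rk_inj i : injective (rk i).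
Proof.
move=> x y; rewrite /rk => E; apply: enum_rank_inj; apply: val_inj => /=.
have := congr1 (modn^~ #|G|) E; by rewrite !modnMDl !modn_small.
Qed.

Let rk_lt i (x y : G) : (val x i < val y i)%N -> (rk i x < rk i y)%N.
Proof.
move=> xy; rewrite /rk.
have H := ltn_ord (enum_rank x).
apply: (@leq_trans ((val x i).+1 * #|G|)); first by rewrite mulSn addnC ltn_add2r.
by apply: leq_trans (leq_addr _ _); rewrite leq_mul2r xy orbT.
Qed.

(** Dominance makes [s] small: the minima [m i] over [D] nearly add up to [N.+1], so no coordinate
    of a point of [s] exceeds its minimum by [#|I|], and the coordinates outside [D] stay below
    [#|I|]. For [i] in [D], [y i] is a point of [s] coloured [i]. *)
Lemma brouwer_approx : exists (x : I -> R) (y : I -> I -> R),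
  [/\ simplex x, (forall i, simplex (y i)),
      (forall i j, `|y i j - x j| <= #|I|%:R / N.+1%:R) &
      (forall i, x i <= #|I|%:R / N.+1%:R \/ y i i <= f (y i) i)].
Proof.
have [s [D [/dominantP dom cD sD]]] := scarf rk_inj c G0 i0.
have Dn0 : (0 < #|D|)%N.
  by have [i iD _] := dom G0; apply/card_gt0P; exists i.
have /card_gt0P[x0 x0s] : (0 < #|s|)%N by rewrite -cD.
pose m i := val [arg min_(x < x0 in s) val x i] i : nat.
have mP i (x : G) : x \in s -> (m i <= val x i)%N.
  by rewrite /m; case: arg_minnP => // y ys H /H.
have mS i : exists2 x, x \in s & m i = val x i.
  by rewrite /m; case: arg_minnP => // y ys H; exists y.
(* Otherwise there is room for a grid point whose coordinates in [D] all exceed the minima, the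
   surplus being put on the coordinate [d]; such a point contradicts dominance. *)
have msum : (N.+1 < \sum_(i in D) (m i).+1)%N.
  rewrite ltnNge; apply/negP => le.
  have /card_gt0P[d dD] := Dn0.
  pose z i := (if i \in D then (m i).+1 + (i == d) * (N.+1 - \sum_(i in D) (m i).+1) else 0)%N.
  have zs : (\sum_i z i = N.+1)%N.
    rewrite (bigID (mem D))/= [X in (_ + X)%N]big1 ?addn0; last first.
      by move=> i /negbTE iD; rewrite /z iD.
    rewrite (eq_bigr (fun i => (m i).+1 + (i == d) * (N.+1 - \sum_(i in D) (m i).+1))%N); last first.
      by move=> i iD; rewrite /z iD.
    rewrite big_split/= [X in (_ + X)%N](_ : _ = N.+1 - \sum_(i in D) (m i).+1)%N ?subnKC//.
    move: (N.+1 - \sum_(i in D) (m i).+1)%N => K.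
    by rewrite (bigD1 d)//= eqxx mul1n big1 ?addn0// => i /andP[_ /negbTE->].
  have zlt i : (z i < N.+2)%N.
    by rewrite ltnS -zs (bigD1 i)//= leq_addr.
  have zG : (\sum_i [ffun i => Ordinal (zlt i)] i == N.+1)%N.
    by under eq_bigr do rewrite ffunE; rewrite /= zs.
  pose g : G := exist _ [ffun i => Ordinal (zlt i)] zG.
  have [i iD Hi] := dom g.
  have [x xs mx] := mS i.
  have := Hi x xs; rewrite leqNgt => /negP; apply; apply: rk_lt.
  by rewrite /= ffunE /= -mx /z iD ltnS leq_addr.
have mI : (N.+1 < \sum_(i in D) m i + #|I|)%N.
  apply: leq_trans msum _.
  under eq_bigr do rewrite -addn1.
  by rewrite big_split/= sum1_card leq_add2l max_card.
have Dlt (x : G) i : x \in s -> i \in D -> (val x i < m i + #|I|)%N.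
  move=> xs iD; rewrite -(ltn_add2r (\sum_(j in D | j != i) m j)).
  apply: (@leq_ltn_trans N.+1); last first.
    apply: leq_trans mI _.
    by rewrite (bigD1 i)//= addnAC.
  have sx : (val x i + \sum_(j | j != i) val x j = N.+1)%N by have /eqP := valP x; rewrite (bigD1 i).
  rewrite -[leqRHS]sx leq_add2l.
  rewrite big_mkcond/= [leqRHS]big_mkcond/=; apply: leq_sum => j _.
  by case: (j \in D) => //=; case: ifP => // _; exact: mP.
have nDlt (x : G) i : x \in s -> i \notin D -> (val x i < #|I|)%N.
  move=> xs iD; rewrite -(ltn_add2l (\sum_(j in D) m j)).
  apply: (@leq_ltn_trans N.+1) => //.
  have sx : (val x i + \sum_(j | j != i) val x j = N.+1)%N by have /eqP := valP x; rewrite (bigD1 i).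
  rewrite -[leqRHS]sx addnC leq_add2l.
  rewrite big_mkcond/= [leqRHS]big_mkcond/=; apply: leq_sum => j _.
  have [jD|//] := boolP (j \in D).
  by rewrite (_ : j != i) ?mP//; apply: contraNneq iD => <-.
have N0 : 0 < N.+1%:R :> R by [].
have close (x x' : G) j : x \in s -> x' \in s -> (val x j < val x' j + #|I|)%N.
  move=> xs xs'; have [jD|jD] := boolP (j \in D).
    by apply: leq_trans (Dlt _ _ xs jD) _; rewrite leq_add2r mP.
  by apply: leq_trans (nDlt _ _ xs jD) _; rewrite leq_addl.
pose y i := if [pick x in s | c x == i] is Some x then x else x0.
have ys i : y i \in s.
  by rewrite /y; case: pickP => // x /andP[].
exists (pt x0), (fun i => pt (y i)); split => //.
  move=> i j; rewrite /pt -mulrBl normrM (ger0_norm (_ : 0 <= N.+1%:R^-1))//.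
  rewrite ler_pM2r ?invr_gt0// ler_norml lerBlDr lerBrDr.
  rewrite addrC lerBlDr -!natrD !ler_nat addnC.
  by apply/andP; split; rewrite addnC; apply: ltnW; exact: close.
move=> i; have [iD|iD] := boolP (i \in D); last first.
  by left; rewrite /pt ler_pM2r ?invr_gt0// ler_nat ltnW// nDlt.
right; move: iD; rewrite -sD => /imsetP[x xs ix].
rewrite /y; case: pickP => [z /andP[zs /eqP <-]|/(_ x)]; first exact: cP.
by rewrite xs ix eqxx.
Qed.

End grid.

Lemma simplex_cvg (u : nat -> I -> R) x :
  (forall k, simplex (u k)) -> (forall i, u k i @[k --> \oo] --> x i) -> simplex x.
Proof.
move=> us ux; split => [i|].
  by apply: (ler_cvg_to (cvg_cst 0) (ux i)); apply: nearW => k; exact: (us k).1.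
have := @cvgr_sum R I predT (fun i k => u k i) x ux.
under eq_fun do rewrite (us _).2.
by move=> /(cvg_lim (@Rhausdorff R)) <-; rewrite lim_cst.
Qed.

Theorem brouwer (f : (I -> R) -> I -> R) :
  (forall x, simplex x -> simplex (f x)) ->
  (forall (u : nat -> I -> R) x, (forall k, simplex (u k)) ->
    (forall i, u k i @[k --> \oo] --> x i) ->
    forall i, f (u k) i @[k --> \oo] --> f x i) ->
  exists2 x, simplex x & forall i, f x i = x i.
Proof.
move=> fs fc.
have /choice[x0 /choice[y0 H]] := fun N => @brouwer_approx f N fs.
pose a k j := if unpickle j is Some i then x0 k i else 0.
have le1 x i : simplex x -> `|x i| <= 1.
  move=> [x_ge0 <-]; rewrite ger0_norm// (bigD1 i)//= lerDl.
  by apply: sumr_ge0.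
have [k j|phi phi_mono [p pP]] := @diagonal_extraction R a (fun=> 1).
  rewrite /a; case: unpickle => [i|]; last by rewrite normr0.
  by apply: le1; have [] := H k.
pose x (i : I) := p (pickle i).
have xc i : x0 (phi k) i @[k --> \oo] --> x i.
  have := pP (pickle i); rewrite /a; under eq_fun do rewrite pickleK//.
  by [].
have xs : simplex x.
  by apply: simplex_cvg xc => k; have [] := H (phi k).
have hc : #|I|%:R / (phi k).+1%:R @[k --> \oo] --> (0 : R).
  have h : (fun k => #|I|%:R / k.+1%:R) @ \oo --> (0 : R).
    by rewrite -[X in _ --> X](mulr0 (#|I|%:R : R)); apply: cvgM; [exact: cvg_cst|exact: cvg_harmonic].
  exact: (cvgn_subseq phi_mono h).
have yc i j : y0 (phi k) i j @[k --> \oo] --> x j.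
  apply: (@squeeze_cvgr _ _ _ _ (fun k => x0 (phi k) j - #|I|%:R / (phi k).+1%:R)
    (fun k => x0 (phi k) j + #|I|%:R / (phi k).+1%:R)).
  - apply: nearW => k; have [_ _ /(_ i j)] := H (phi k).
    by rewrite ler_norml lerBrDr lerBlDr addrC => /andP[-> /=]; rewrite addrC.
  - by rewrite -[X in _ --> X]subr0; exact: cvgB.
  - by rewrite -[X in _ --> X]addr0; exact: cvgD.
(* If [f x i < x i], then [x i] is positive, hence eventually above the mesh, and only the second
   alternative of [brouwer_approx] remains. The inequalities are then equalities because both
   vectors have sum 1. *)
have fx i : x i <= f x i.
  rewrite leNgt; apply/negP => lt.
  have x_gt0 : 0 < x i by apply: le_lt_trans lt; exact: (fs _ xs).1.
  suff : x i <= f x i by rewrite leNgt lt.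
  apply: (ler_cvg_to (yc i i) (fc (fun k => y0 (phi k) i) x _ (yc i) i)).
    by move=> k; have [] := H (phi k).
  near=> k; have [_ _ _ /(_ i)[|//]] := H (phi k).
  rewrite leNgt => /negP[]; apply: (@lt_trans _ _ (x i / 2)).
    near: k; apply: (cvgr_lt 0) => //; lra.
  near: k; apply: (cvgr_gt (x i)) => //; lra.
exists x => // i; apply/eqP; rewrite eq_le fx andbT leNgt; apply/negP => lt.
suff : \sum_j x j < \sum_j f x j by rewrite (fs _ xs).2 xs.2 ltxx.
rewrite (bigD1 i)//= [ltRHS](bigD1 i)//=; apply: ltr_leD => //.
by apply: ler_sum.
Unshelve. all: by end_near. Qed.

End brouwer.

(* Mixed strategies: one probability vector on each fibre of [q]. The fixed
   point is that of Nash's map, transported to a single simplex by the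
   retraction [strat]. *)
Section nash.
Context {R : realType} {I : finType} {K : eqType} (q : I -> K).
Implicit Types w x y : I -> R.

Let cs w i := \sum_(j | q j == q i) w j.

Definition strategy w := (forall i, 0 <= w i) /\ forall i, \sum_(j | q j == q i) w j = 1.

Let n i : R := cs (fun=> 1) i.

Let n_gt0 i : 0 < n i.
Proof.
by rewrite /n /cs (bigD1 i)//=; apply: ltr_pwDl => //; apply: sumr_ge0.
Qed.

Let cs_cell w i j : q i = q j -> cs w i = cs w j.
Proof. by rewrite /cs => ->. Qed.

Let csZ w i c : cs (fun j => c * w j) i = c * cs w i.
Proof. by rewrite /cs mulr_sumr. Qed.

Let csD w x i : cs (fun j => w j + x j) i = cs w i + cs x i.
Proof. by rewrite /cs big_split. Qed.

Let cs_mul w x i : (forall i j, q i = q j -> x i = x j) ->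
  cs (fun j => w j * x j) i = cs w i * x i.
Proof.
by move=> xq; rewrite /cs mulr_suml; apply: eq_bigr => j /eqP/xq ->.
Qed.

(** The number of fibres of [q]: it is the total mass of every strategy, hence the scale between
    strategies and the simplex of Brouwer's theorem. *)
Let kappa : R := \sum_i (n i)^-1.

Let strat_sum w : strategy w -> \sum_i w i = kappa.
Proof.
move=> [w_ge0 w1]; rewrite /kappa.
have ninv i : cs (fun j => (n j)^-1) i = 1.
  have := @cs_mul (fun=> 1) (fun j => (n j)^-1) i.
  rewrite (_ : (fun j => 1 * _) = (fun j => (n j)^-1)); last by apply/funext => j; rewrite mul1r.
  move=> -> => [|a b ab]; first by rewrite divff// gt_eqF.
  by rewrite /n (cs_cell _ ab).
transitivity (\sum_i \sum_(j | q j == q i) w i * (n j)^-1).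
  by apply: eq_bigr => i _; rewrite -mulr_sumr [X in _ * X]ninv mulr1.
rewrite (exchange_big_dep predT)//=; apply: eq_bigr => j _.
rewrite -mulr_suml; under eq_bigl do rewrite eq_sym.
by rewrite w1 mul1r.
Qed.

(** On each fibre, a deficit of mass is shared equally and an excess is removed by division;
    strategies are left unchanged. *)
Let strat y i := (y i + Num.max 0 (1 - cs y i) / n i) / Num.max 1 (cs y i).

Let max1_gt0 (t : R) : 0 < Num.max 1 t.
Proof. by rewrite lt_max ltr01. Qed.

Let stratP y : (forall i, 0 <= y i) -> strategy (strat y).
Proof.
move=> y_ge0; have n0 i : n i != 0 by rewrite gt_eqF.
split => i.
  apply: divr_ge0; last exact: ltW.
  by apply: addr_ge0 => //; apply: divr_ge0; [rewrite le_max lexx|exact: ltW].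
have -> : \sum_(j | q j == q i) strat y j = cs (fun j => (y j + Num.max 0 (1 - cs y j) / n j) * (Num.max 1 (cs y j))^-1) i by [].
rewrite cs_mul => [|a b ab]; last by rewrite (cs_cell _ ab).
rewrite csD.
have -> : cs (fun j => Num.max 0 (1 - cs y j) / n j) i = Num.max 0 (1 - cs y i).
  rewrite (_ : (fun j => _) = (fun j => 1 * (Num.max 0 (1 - cs y j) / n j))).
    rewrite cs_mul => [|a b ab]; first by rewrite -/(n i) mulrC divfK.
    by rewrite (cs_cell _ ab) /n (cs_cell _ ab).
  by apply/funext => j; rewrite mul1r.
have [le1|gt1] := leP 1 (cs y i).
  rewrite max_l ?subr_le0// addr0 divff// gt_eqF//; exact: lt_le_trans le1.
by rewrite max_r ?subr_ge0 ?ltW// addrC subrK divr1.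
Qed.

Let strat_id w : strategy w -> strat w = w.
Proof.
move=> [_ w1]; apply/funext => i; rewrite /strat /cs w1 subrr !maxxx mul0r addr0.
by rewrite divr1.
Qed.

Variable cost : (I -> R) -> I -> R.
Hypothesis cost_cont : forall (u : nat -> I -> R) w, (forall k, strategy (u k)) ->
  (forall i, u k i @[k --> \oo] --> w i) ->
  forall i, cost (u k) i @[k --> \oo] --> cost w i.

Let avg w i := cs (fun j => w j * cost w j) i.
Let gain w i := Num.max 0 (avg w i - cost w i).
Let nash w i := (w i + gain w i) / (1 + cs (gain w) i).

Let gain_ge0 w i : 0 <= gain w i.
Proof. by rewrite le_max lexx. Qed.

Let csgain_ge0 w i : 0 <= cs (gain w) i.
Proof. by apply: sumr_ge0. Qed.

Let nashP w : strategy w -> strategy (nash w).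
Proof.
move=> [w_ge0 w1]; split => i.
  by rewrite divr_ge0 ?addr_ge0.
have -> : \sum_(j | q j == q i) nash w j = cs (fun j => (w j + gain w j) * (1 + cs (gain w) j)^-1) i by [].
rewrite cs_mul => [|a b ab]; last by rewrite (cs_cell _ ab).
rewrite csD [cs w i]w1 divff// gt_eqF// ltr_pwDl//.
Qed.

(** At a fixed point the gains are proportional to the weights on each fibre. The weighted sum of
    [avg - cost] is zero, hence so is the sum of [gain * (avg - cost)], which is a sum of squares:
    nobody gains. All costs are then at least the average, and equal to it wherever the weight is
    positive. *)
Theorem nash_equilibrium : exists2 w, strategy w &
  forall i, 0 < w i -> forall j, q j = q i -> cost w i <= cost w j.
Proof.
have [I0|/card_gt0P[i0 _]] := posnP #|I|.
  exists (fun=> 0); first split => // i.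
    by have := fintype0 i I0.
  by move=> i; have := fintype0 i I0.
have kappa_gt0 : 0 < kappa.
  rewrite /kappa (bigD1 i0)//= ltr_pwDl ?invr_gt0//.
  by apply: sumr_ge0 => i _; rewrite invr_ge0 ltW.
have kappa0 : kappa != 0 by rewrite gt_eqF.
have [||x xs xf] := @brouwer R I i0 (fun x i => nash (strat (fun i => kappa * x i)) i / kappa).
- move=> x [x_ge0 x1].
  have W : strategy (nash (strat (fun i => kappa * x i))).
    by apply/nashP/stratP => i; rewrite mulr_ge0// ltW.
  split => [i|]; first by apply: divr_ge0; [exact: W.1|exact: ltW].
  by rewrite -mulr_suml strat_sum// divff.
- move=> u x us ux i.
  have sums (v : nat -> I -> R) y j : (forall i, v k i @[k --> \oo] --> y i) ->
      cs (v k) j @[k --> \oo] --> cs y j.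
    by move=> vy; apply: (@cvgr_sum R I _ (fun i k => v k i)).
  have kc j : kappa * u k j @[k --> \oo] --> kappa * x j.
    by apply: cvgM; [exact: cvg_cst|exact: ux].
  have max1c (v : nat -> R) (y : R) : v @ \oo --> y -> Num.max 1 (v k) @[k --> \oo] --> Num.max 1 y.
    move=> vy; have E t : Num.max 1 t = 1 + Num.max 0 (t - 1) :> R.
      by rewrite addr_maxr addr0 addrC subrK.
    under eq_fun do rewrite E; rewrite E.
    apply: cvgD; first exact: cvg_cst.
    by apply: cvgr_max0; apply: cvgB => //; exact: cvg_cst.
  have sc j : strat (fun i => kappa * u k i) j @[k --> \oo] --> strat (fun i => kappa * x i) j.
    apply: cvgM.
      apply: cvgD; first exact: kc.
      apply: cvgM; last exact: cvg_cst.
      by apply: cvgr_max0; apply: cvgB; [exact: cvg_cst|exact: (sums (fun k i => kappa * u k i))].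
    apply: cvgV; first by rewrite gt_eqF.
    by apply: max1c; exact: (sums (fun k i => kappa * u k i)).
  have W k : strategy (strat (fun i => kappa * u k i)).
    by apply: stratP => j; apply: mulr_ge0; [exact: ltW|exact: (us k).1].
  have cc := cost_cont W sc.
  have gc j : gain (strat (fun i => kappa * u k i)) j @[k --> \oo] -->
      gain (strat (fun i => kappa * x i)) j.
    apply: cvgr_max0; apply: cvgB; last exact: cc.
    apply: (sums (fun k j => strat (fun i => kappa * u k i) j * cost (strat (fun i => kappa * u k i)) j)).
    by move=> m; apply: cvgM; [exact: sc|exact: cc].
  apply: cvgM; last exact: cvg_cst.
  apply: cvgM; first by apply: cvgD; [exact: sc|exact: gc].
  apply: cvgV; first by rewrite gt_eqF// ltr_pwDl.
  apply: cvgD; first exact: cvg_cst.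
  exact: (sums (fun k => gain (strat (fun i => kappa * u k i)))).
pose y i := kappa * x i.
have yE : y = nash (strat y).
  by apply/funext => i; rewrite /y -xf mulrC divfK.
have yW : strategy y.
  by rewrite yE; apply/nashP/stratP => i; apply: mulr_ge0; [exact: ltW|exact: xs.1].
have fixy i : y i = nash y i by rewrite {1}yE strat_id.
have gy i : y i * cs (gain y) i = gain y i.
  have : y i * (1 + cs (gain y) i) = y i + gain y i.
    by rewrite {1}fixy /nash divfK// gt_eqF// ltr_pwDl.
  by rewrite mulrDr mulr1 => /addrI.
have avgD i : cs (fun j => y j * (avg y j - cost y j)) i = 0.
  under [X in cs X]eq_fun do rewrite mulrBr.
  have := csD (fun j => y j * avg y j) (fun j => -1 * (y j * cost y j)) i.
  under [in X in X = _ -> _]eq_fun do rewrite mulN1r.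
  move=> ->; rewrite cs_mul => [|a b ab]; last by rewrite /avg (cs_cell _ ab).
  have -> : cs y i = 1 := yW.2 i.
  by rewrite csZ mul1r mulN1r subrr.
have g2 j : gain y j * (avg y j - cost y j) = gain y j ^+ 2.
  by rewrite /gain expr2; case: leP => //; rewrite !mul0r.
have g0 i : gain y i = 0.
  have : cs (fun j => gain y j ^+ 2) i = 0.
    rewrite -(mulr0 (cs (gain y) i)) -(avgD i) -csZ.
    apply: eq_bigr => j /eqP ji.
    by rewrite -g2 mulrA -{1}gy (cs_cell _ ji) [_ * y j]mulrC.
  move=> /eqP; rewrite psumr_eq0 => [|j _]; last exact: sqr_ge0.
  by move/allP => /(_ i (mem_index_enum _)); rewrite eqxx sqrf_eq0 => /eqP.
have avg_le j : avg y j <= cost y j.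
  by rewrite -subr_le0; have /eqP := g0 j; rewrite /gain eq_maxl.
exists y => // i yi j ji.
have : cs (fun j => y j * (cost y j - avg y j)) i = 0.
  rewrite -oppr0 -(avgD i) /cs -sumrN; apply: eq_bigr => k _.
  by rewrite -mulrN opprB.
move=> /eqP; rewrite psumr_eq0 => [|k _]; last first.
  by rewrite mulr_ge0 ?subr_ge0//; exact: yW.1.
move/allP => /(_ i (mem_index_enum _)); rewrite eqxx mulf_eq0 gt_eqF//= subr_eq0 => /eqP->.
by have := avg_le j; rewrite /avg (cs_cell _ ji).
Qed.

End nash.

(** * Euclidean norm and topology of the phase space *)

Section euclidean_norm.
Context {R : realType} {n : nat}.
Implicit Types (u v w : 'rV[R]_n) (a : R).

Lemma dotvC v w : dotv v w = dotv w v.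
Proof. by rewrite /dotv; apply: eq_bigr => i _; rewrite mulrC. Qed.

Lemma dotvDl u v w : dotv (u + v) w = dotv u w + dotv v w.
Proof. by rewrite /dotv -big_split; apply: eq_bigr => i _; rewrite mxE mulrDl. Qed.

Lemma dotvZl a v w : dotv (a *: v) w = a * dotv v w.
Proof. by rewrite /dotv mulr_sumr; apply: eq_bigr => i _; rewrite mxE mulrA. Qed.

Lemma dotvNl v w : dotv (- v) w = - dotv v w.
Proof. by rewrite -scaleN1r dotvZl mulN1r. Qed.

Lemma dotvBl u v w : dotv (u - v) w = dotv u w - dotv v w.
Proof. by rewrite dotvDl dotvNl. Qed.

Lemma dotvDr u v w : dotv w (u + v) = dotv w u + dotv w v.
Proof. by rewrite dotvC dotvDl !(dotvC w). Qed.

Lemma dotvZr a v w : dotv w (a *: v) = a * dotv w v.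
Proof. by rewrite dotvC dotvZl (dotvC w). Qed.

Lemma dotvNr v w : dotv w (- v) = - dotv w v.
Proof. by rewrite dotvC dotvNl (dotvC w). Qed.

Lemma dotvBr u v w : dotv w (u - v) = dotv w u - dotv w v.
Proof. by rewrite dotvDr dotvNr. Qed.

Lemma dotv0l v : dotv 0 v = 0.
Proof. by rewrite -(scale0r 0) dotvZl mul0r. Qed.

Lemma dotv_ge0 v : 0 <= dotv v v.
Proof. by apply: sumr_ge0 => i _; rewrite -expr2 sqr_ge0. Qed.

Lemma enorm_ge0 v : 0 <= enorm v. Proof. exact: sqrtr_ge0. Qed.

Lemma enorm_sqr v : enorm v ^+ 2 = dotv v v.
Proof. by rewrite sqr_sqrtr// dotv_ge0. Qed.

Lemma enorm0 : enorm (0 : 'rV[R]_n) = 0.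
Proof. by rewrite /enorm dotv0l sqrtr0. Qed.

Lemma enormZ a v : enorm (a *: v) = `|a| * enorm v.
Proof.
by rewrite /enorm dotvZl dotvZr mulrA -expr2 sqrtrM ?sqr_ge0// sqrtr_sqr.
Qed.

Lemma enormN v : enorm (- v) = enorm v.
Proof. by rewrite -scaleN1r enormZ normrN normr1 mul1r. Qed.

Lemma enormB v w : enorm (v - w) = enorm (w - v).
Proof. by rewrite -enormN opprB. Qed.

Lemma coord_le_enorm v i : `|v ord0 i| <= enorm v.
Proof.
rewrite -sqrtr_sqr /enorm ler_wsqrtr// /dotv (bigD1 i)//= expr2 lerDl.
by apply: sumr_ge0 => j _; rewrite -expr2 sqr_ge0.
Qed.

Lemma enorm_eq0 v : enorm v = 0 -> v = 0.
Proof.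
move=> v0; apply/rowP => i; rewrite mxE; apply/eqP; rewrite -normr_le0 -v0.
exact: coord_le_enorm.
Qed.

Lemma enorm_gt0 v : v != 0 -> 0 < enorm v.
Proof. by move=> v0; rewrite lt_neqAle enorm_ge0 andbT eq_sym; apply: contra v0 => /eqP/enorm_eq0->. Qed.

Lemma cauchy_schwarz v w : `|dotv v w| <= enorm v * enorm w.
Proof.
have [w0|w0] := eqVneq w 0.
  by rewrite w0 dotvC dotv0l normr0 enorm0 mulr0.
have W := enorm_gt0 w0.
rewrite -(@ler_pXn2r _ 2)// ?nnegrE ?normr_ge0 ?mulr_ge0 ?enorm_ge0//.
rewrite exprMn !enorm_sqr real_normK ?num_real//.
have := dotv_ge0 (dotv w w *: v - dotv v w *: w).
rewrite dotvBl !dotvBr !dotvZl !dotvZr (dotvC w v).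
have Ww : 0 < dotv w w by rewrite -enorm_sqr exprn_gt0.
move=> H; rewrite -subr_ge0 -(pmulr_rge0 _ Ww); apply: (le_trans H).
by rewrite le_eqVlt; apply/orP; left; apply/eqP; ring.
Qed.

Lemma dotv_le v w : dotv v w <= enorm v * enorm w.
Proof. exact: le_trans (ler_norm _) (cauchy_schwarz v w). Qed.

Lemma enormD v w : enorm (v + w) <= enorm v + enorm w.
Proof.
rewrite -(@ler_pXn2r _ 2)// ?nnegrE ?addr_ge0 ?enorm_ge0//.
rewrite sqrrD !enorm_sqr dotvDl !dotvDr (dotvC w v).
by have := dotv_le v w; lra.
Qed.

Lemma enormBle v w : enorm (v - w) <= enorm v + enorm w.
Proof. by rewrite -(enormN w); exact: enormD. Qed.

Lemma enorm_dist u v w : enorm (u - w) <= enorm (u - v) + enorm (v - w).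
Proof. by apply: le_trans (enormD _ _); rewrite addrA subrK. Qed.

Lemma enorm_sub_le v w : `|enorm v - enorm w| <= enorm (v - w).
Proof.
rewrite ler_norml; apply/andP; split.
  by have := enormD (w - v) v; rewrite subrK enormB; lra.
by have := enormD (v - w) w; rewrite subrK; lra.
Qed.

Lemma enorm_le_coord v e : 0 <= e -> (forall i, `|v ord0 i| <= e) -> enorm v <= n%:R * e.
Proof.
move=> e0 H.
have : enorm v <= \sum_(i < n) `|v ord0 i|.
  rewrite -(@ler_pXn2r _ 2)// ?nnegrE ?enorm_ge0 ?sumr_ge0//.
  rewrite enorm_sqr expr2 mulr_suml; apply: ler_sum => i _.
  rewrite -expr2 -(real_normK (num_real _)) expr2 ler_wpM2l//.
  by rewrite (bigD1 i)//= lerDl sumr_ge0.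
move/le_trans; apply; apply: le_trans (ler_sum _ (fun i _ => H i)) _.
by rewrite sumr_const card_ord -[in leLHS]mulr_natl.
Qed.

Lemma enorm_sqr_sum v : enorm v ^+ 2 = \sum_(i < n) v ord0 i ^+ 2.
Proof. by rewrite enorm_sqr /dotv; apply: eq_bigr => i _; rewrite expr2. Qed.

Lemma continuous_enorm : continuous (@enorm R n).
Proof.
move=> v; apply: (@cvg_comp _ _ _ (fun v => dotv v v) (@Num.sqrt R)); last exact: sqrt_continuous.
apply: (@cvg_big _ _ _ _ _ _ _ (nbhs v) _ _ _ (nbhs_filter v)) => [|i _]; first exact: add_continuous.
by apply: (@cvgM _ _ (nbhs v) (nbhs_filter v)); exact: coord_continuous.
Qed.

Lemma rV_near (v : 'rV[R]_n) (U : set 'rV[R]_n) : nbhs v U ->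
  exists2 e, 0 < e & forall w, enorm (w - v) < e -> U w.
Proof.
move=> /nbhs_ballP[e /= e0 H]; exists e => // w wv; apply: H; split => // i j.
rewrite /ball /= (ord1 i) distrC; apply: le_lt_trans wv.
by have := coord_le_enorm (w - v) j; rewrite !mxE.
Qed.

Lemma near_rV (v : 'rV[R]_n) (U : set 'rV[R]_n) e : 0 < e ->
  (forall w, enorm (w - v) < e -> U w) -> nbhs v U.
Proof.
move=> e0 H; have N0 : 0 < n%:R + 1 :> R by rewrite ltr_pwDr.
apply/nbhs_ballP; exists (e / (n%:R + 1)); first exact: divr_gt0.
move=> w vw; apply: H.
have H i : `|(w - v) ord0 i| <= e / (n%:R + 1).
  by have [_ /(_ ord0 i)] := vw; rewrite /ball /= !mxE distrC => /ltW.
have := enorm_le_coord (ltW (divr_gt0 e0 N0)) H; move/le_lt_trans; apply.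
by rewrite mulrA ltr_pdivrMr// mulrC ltr_pM2l// ltrDl.
Qed.

Lemma cvg_rV (I : Type) (F : set_system I) (FF : Filter F) (u : I -> 'rV[R]_n)
    (l : 'rV[R]_n) :
  (forall i, u x ord0 i @[x --> F] --> l ord0 i) -> u @ F --> l.
Proof.
move=> H; apply/cvg_ballP => e e0.
have : \forall x \near F, forall i, `|l ord0 i - u x ord0 i| < e.
  by apply: filter_forall => i; move/cvgrPdist_lt: (H i) => /(_ e e0).
by apply: filterS => x Hx; split => // o i; rewrite (ord1 o); exact: Hx.
Qed.

End euclidean_norm.

Section phase_topology.
Context {R : realType} {n : nat} {Omega : domain R n}.
Implicit Types (z w : phase Omega).

Definition pcoord (c : bool * 'I_n) z : R :=
  if c.1 then pos z ord0 c.2 else vel z ord0 c.2.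

Lemma ball_phase z e w : 0 < e ->
  ball z e w <-> forall c, `|pcoord c z - pcoord c w| < e.
Proof.
move=> e0; split=> [[[_ H1] [_ H2]] [[] i]|H]; [exact: (H1 ord0 i)|exact: (H2 ord0 i)|].
by split; split => // a i; rewrite (ord1 a); [exact: (H (true, i))|exact: (H (false, i))].
Qed.

Lemma phase_near z U : nbhs z U ->
  exists2 e, 0 < e & forall w, (forall c, `|pcoord c z - pcoord c w| < e) -> U w.
Proof.
move=> /nbhs_ballP[e /= e0 H]; exists e => // w zw; apply: H; exact/(ball_phase _ _ e0).
Qed.

Lemma continuous_pcoord c : continuous (pcoord c).
Proof.
move=> z; apply/(@cvgrPdist_lt _ _ _ (nbhs z) (nbhs_filter z)) => e e0.
apply/nbhs_ballP; exists e => // w /(ball_phase _ _ e0); exact.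
Qed.

Lemma phase_cvgP (u : nat -> phase Omega) z :
  u @ \oo --> z <-> forall c, pcoord c (u k) @[k --> \oo] --> pcoord c z.
Proof.
split=> [uz c|H U /phase_near[e e0 eU]].
  exact: (cvg_comp _ _ uz (@continuous_pcoord c z)).
have : \forall k \near \oo, forall c, `|pcoord c z - pcoord c (u k)| < e.
  have /choice[N NP] : forall c, exists N, forall k, (N <= k)%N -> `|pcoord c z - pcoord c (u k)| < e.
    move=> c; have /cvgrPdist_lt/(_ e e0)[N _ NP] := H c.
    by exists N => k Nk; exact: NP.
  exists (\max_c N c)%N => // k /= Nk c; apply: NP; apply: leq_trans Nk.
  exact: leq_bigmax.
by apply: filterS => k; exact: eU.
Qed.

Definition mkphase (x v : 'rV[R]_n) (Hx : closure Omega x) : phase Omega :=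
  exist (fun z : 'rV[R]_n * 'rV[R]_n => z \in phase_set Omega) (x, v)
    (mem_set (Hx : phase_set Omega (x, v))).

Lemma pos_closure z : closure Omega (pos z).
Proof. exact: (set_mem (valP z)). Qed.

Lemma phase_eq z w : pos z = pos w -> vel z = vel w -> z = w.
Proof.
move=> p v; apply: val_inj; move: p v; rewrite /pos /vel.
by case: z w => [[? ?] ?] [[? ?] ?] /= -> ->.
Qed.

Lemma phase_extraction (u : nat -> phase Omega) M :
  (forall k c, `|pcoord c (u k)| <= M) ->
  exists2 phi : nat -> nat, (forall k, (phi k < phi k.+1)%N) &
  exists z, u (phi k) @[k --> \oo] --> z.
Proof.
move=> uM; pose a k j := if unpickle j is Some c then pcoord c (u k) else 0.
have [k j|phi phi_mono [p pP]] := @diagonal_extraction R a (fun=> `|M|).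
  rewrite /a; case: unpickle => [c|]; last by rewrite normr0.
  by apply: le_trans (uM k c) (ler_norm _).
exists phi => //.
have pc c : pcoord c (u (phi k)) @[k --> \oo] --> p (pickle c).
  by have := pP (pickle c); rewrite /a; under eq_fun do rewrite pickleK.
pose x : 'rV[R]_n := \row_i p (pickle (true, i)).
pose v : 'rV[R]_n := \row_i p (pickle (false, i)).
have xc : closure Omega x.
  apply: (@closed_cvg _ _ \oo _ (fun k => pos (u (phi k))) (closure Omega)).
  - exact: closed_closure.
  - by apply: nearW => k; exact: pos_closure.
  - apply/cvg_ballP => e e0.
    have : \forall k \near \oo, forall i, `|p (pickle (true, i)) - pcoord (true, i) (u (phi k))| < e.
      have /choice[N NP] : forall i, exists N, forall k, (N <= k)%N ->
          `|p (pickle (true, i)) - pcoord (true, i) (u (phi k))| < e.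
        move=> i; have /cvgrPdist_lt/(_ e e0)[N _ NP] := pc (true, i).
        by exists N => k Nk; exact: NP.
      exists (\max_i N i)%N => // k /= Nk i; apply: NP; apply: leq_trans Nk.
      exact: leq_bigmax.
    by apply: filterS => k H; split => // o i; rewrite (ord1 o) /ball /= mxE; exact: H.
exists (mkphase v xc); apply/phase_cvgP => -[b i].
suff -> : pcoord (b, i) (mkphase v xc) = p (pickle (b, i)) by exact: pc.
by rewrite /pcoord; case: b => /=; rewrite /pos /vel /= mxE.
Qed.

Lemma continuous_pos : continuous (@pos R n Omega).
Proof.
move=> z U /nbhs_ballP[e e0 eU]; apply/nbhs_ballP; exists e => // w [H _].
exact: eU.
Qed.

Lemma continuous_vel : continuous (@vel R n Omega).
Proof.
move=> z U /nbhs_ballP[e e0 eU]; apply/nbhs_ballP; exists e => // w [_ H].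
exact: eU.
Qed.

Lemma phase_dist_le z w e : 0 <= e -> enorm (pos z - pos w) <= e ->
  enorm (vel z - vel w) <= e -> phase_dist z w <= 2 * e.
Proof.
move=> e0 p v; rewrite /phase_dist -[2 * e]ger0_norm ?mulr_ge0// -sqrtr_sqr.
apply: ler_wsqrtr.
have p2 : enorm (pos z - pos w) ^+ 2 <= e ^+ 2.
  by rewrite ler_pXn2r// nnegrE enorm_ge0.
have v2 : enorm (vel z - vel w) ^+ 2 <= e ^+ 2.
  by rewrite ler_pXn2r// nnegrE enorm_ge0.
apply: le_trans (lerD p2 v2) _; rewrite exprMn; have := sqr_ge0 e; lra.
Qed.

End phase_topology.

(** * Absolutely continuous functions *)

Section families.
Context {R : realType}.
Implicit Types (a b x y : R) (s t : seq (R * R)) (f h : R -> R).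

Definition apart (p q : R * R) := (p.2 <= q.1) || (q.2 <= p.1).

Definition ifamily a b s :=
  all (fun p => [&& a <= p.1, p.1 <= p.2 & p.2 <= b]) s && pairwise apart s.

Definition ac a b f := forall eps, 0 < eps -> exists2 delta, 0 < delta &
  forall s, ifamily a b s -> \sum_(p <- s) (p.2 - p.1) < delta ->
  \sum_(p <- s) `|f p.2 - f p.1| < eps.

Lemma ifamily_cons a b p s : ifamily a b (p :: s) =
  [&& a <= p.1, p.1 <= p.2, p.2 <= b, all (apart p) s & ifamily a b s].
Proof. by rewrite /ifamily /= !andbA; do !case: (_ <= _) => //=; case: all; rewrite ?andbF //= ?andbA; case: all. Qed.

Lemma ifamily_mem a b s p : ifamily a b s -> p \in s ->
  [&& a <= p.1, p.1 <= p.2 & p.2 <= b].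
Proof. by move=> /andP[/allP H _] /H. Qed.

Lemma ifamily_cat a b s t : ifamily a b s -> ifamily a b t ->
  (forall p q, p \in s -> q \in t -> apart p q) -> ifamily a b (s ++ t).
Proof.
move=> /andP[s1 s2] /andP[t1 t2] H; rewrite /ifamily all_cat pairwise_cat s1 t1 s2 t2 /= !andbT.
by apply/allrelP => p q; exact: H.
Qed.

Lemma familyW a b a' b' s : a' <= a -> b <= b' -> ifamily a b s -> ifamily a' b' s.
Proof.
move=> aa bb /andP[/allP H p]; rewrite /ifamily p andbT; apply/allP => q /H /and3P[h1 h2 h3].
by rewrite (le_trans aa h1) h2 (le_trans h3 bb).
Qed.

Lemma ifamily_partition a b (l : seq R) : itv_partition a b l ->
  exists2 s, ifamily a b s & forall f, \sum_(p <- s) `|f p.2 - f p.1| = variation a b f l.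
Proof.
move=> ab; exists (map (fun x : R * R => (x.2, x.1)) (zip l (a :: l))); last first.
  by move=> f; rewrite variation_zip// big_map.
move: ab => [+ /eqP <-] {b}; elim: l a => [//|c l IH] a /= /andP[ac cl].
have cb : c <= last c l by apply: (@itv_partition_le _ _ c (last c l) l); split.
rewrite ifamily_cons /= (ltW ac) cb lexx /=; apply/andP; split; last first.
  by apply: familyW (IH c cl) => //; exact: ltW.
apply/allP => q qs; apply/orP; left => /=.
by have /and3P[] := ifamily_mem (IH c cl) qs.
Qed.

(** The intervals are disjoint but not sorted: the first one separates the others into those on its
    left and those on its right, whence an induction on the size. *)
Lemma ifamily_nondecreasing a b s h : a <= b -> {homo h : x y / x <= y} ->
  ifamily a b s -> \sum_(p <- s) (h p.2 - h p.1) <= h b - h a.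
Proof.
move=> + nh; have [n] := ubnP (size s).
elim: n s a b => // n IH [|p s] a b /= sn ab; first by rewrite big_nil subr_ge0 nh.
rewrite ifamily_cons => /and5P[ap pp pb /allP aps fs]; rewrite big_cons.
pose L := [seq q <- s | q.2 <= p.1]; pose U := [seq q <- s | ~~ (q.2 <= p.1)].
have -> : \sum_(q <- s) (h q.2 - h q.1) = \sum_(q <- L) (h q.2 - h q.1) + \sum_(q <- U) (h q.2 - h q.1).
  by rewrite (bigID (fun q : R * R => q.2 <= p.1))/= !big_filter.
have Ls : (size L < n)%N by rewrite size_filter; apply: leq_ltn_trans (count_size _ _) _; exact: sn.
have Us : (size U < n)%N by rewrite size_filter; apply: leq_ltn_trans (count_size _ _) _; exact: sn.
have pwf (P : pred (R * R)) : pairwise apart [seq q <- s | P q].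
  by apply: (subseq_pairwise (filter_subseq _ _)); case/andP: fs.
have LH : \sum_(q <- L) (h q.2 - h q.1) <= h p.1 - h a.
  apply: IH => //; rewrite /ifamily pwf andbT; apply/allP => q.
  rewrite mem_filter => /andP[qp qs]; have /and3P[-> -> _] := ifamily_mem fs qs.
  by rewrite qp.
have UH : \sum_(q <- U) (h q.2 - h q.1) <= h b - h p.2.
  apply: IH => //; rewrite /ifamily pwf andbT; apply/allP => q.
  rewrite mem_filter => /andP[qp qs]; have /and3P[_ -> ->] := ifamily_mem fs qs.
  by have := aps q qs; rewrite /apart (negbTE qp) orbF => ->.
lra.
Qed.

Lemma ifamily_length a b s : a <= b -> ifamily a b s -> \sum_(p <- s) (p.2 - p.1) <= b - a.
Proof. by move=> ab; exact: (@ifamily_nondecreasing a b s id). Qed.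

End families.

(** * Total variation of an absolutely continuous function *)

Section total_variation_ac.
Context {R : realType}.
Variables (a b : R) (f : R -> R).
Hypotheses (ab : a <= b) (fac : ac a b f).
Local Notation TV := total_variation.

(** The modulus at [eps = 1] bounds the variation by 1 on each of [N.+1] equal pieces shorter than
    [d]. *)
Lemma ac_total_variation : TV a b f \is a fin_num.
Proof.
have [d d0 H] := fac (@ltr01 R).
have small x y : a <= x -> x <= y -> y <= b -> y - x < d -> (TV x y f <= 1)%E.
  move=> ax xy yb xyd; apply: ge_ereal_sup => _ [_ [l xyl <-] <-].
  have [s fs <-] := ifamily_partition xyl.
  rewrite lee_fin ltW// H//; first exact: familyW fs.
  exact: le_lt_trans (ifamily_length xy fs) xyd.
pose N := Num.bound ((b - a) / d).
have N0 : (0 < N.+1%:R :> R) by [].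
pose e := (b - a) / N.+1%:R.
have e0 : 0 <= e by rewrite divr_ge0// subr_ge0.
have ed : e < d.
  rewrite /e ltr_pdivrMr// mulrC -ltr_pdivrMr//.
  have q0 : 0 <= (b - a) / d by rewrite divr_ge0 ?subr_ge0// ltW.
  by apply: lt_le_trans (archi_boundP q0) _; rewrite ler_nat.
have step k : (k <= N.+1)%N -> (TV a (a + k%:R * e) f <= k%:R%:E)%E.
  elim: k => [_|k IH kN]; first by rewrite mul0r addr0 total_variationxx.
  have ke : a + k%:R * e <= a + k.+1%:R * e by rewrite lerD2l ler_wpM2r// ler_nat.
  have kb : a + k.+1%:R * e <= b.
    rewrite -lerBrDl /e mulrA ler_pdivrMr// mulrC ler_wpM2l ?subr_ge0// ler_nat//.
  rewrite (@total_variationD _ _ _ (a + k%:R * e))//; last by rewrite lerDl mulr_ge0.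
  rewrite -[in leRHS]addn1 natrD EFinD; apply: leeD; first exact/IH/ltnW.
  apply: small => //; first by rewrite lerDl mulr_ge0.
  by rewrite -[k.+1]addn1 natrD mulrDl mul1r addrA [X in X - _]addrC addrK.
rewrite ge0_fin_numE ?total_variation_ge0//.
have := step N.+1 (leqnn _); rewrite /e mulrC divfK// addrC subrK.
by move/le_lt_trans; apply; rewrite ltry.
Qed.

Lemma fin_total_variation x y : a <= x -> x <= y -> y <= b -> TV x y f \is a fin_num.
Proof.
move=> ax xy yb; rewrite ge0_fin_numE ?total_variation_ge0//.
have := ac_total_variation; rewrite ge0_fin_numE ?total_variation_ge0//.
apply: le_lt_trans.
rewrite (@total_variationD _ a b x)//; last exact: le_trans yb.
rewrite (@total_variationD _ x b y)//.
rewrite addeCA leeDl// adde_ge0 ?total_variation_ge0//.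
Qed.

(* each interval of [s] is split so as to nearly attain its total variation *)
Lemma ifamily_refine eta s : 0 < eta -> ifamily a b s -> exists t,
  [/\ ifamily a b t, \sum_(p <- t) (p.2 - p.1) <= \sum_(p <- s) (p.2 - p.1),
      (forall p, p \in t -> exists2 q, q \in s & q.1 <= p.1 /\ p.2 <= q.2) &
      \sum_(p <- s) fine (TV p.1 p.2 f) <=
        \sum_(p <- t) `|f p.2 - f p.1| + (size s)%:R * eta].
Proof.
move=> eta0; elim: s => [_|p s IH].
  by exists [::]; split => //; rewrite !big_nil mul0r addr0.
rewrite ifamily_cons => /and5P[ap pp pb /allP aps fs].
have [t [ft tl tsub ts]] := IH fs.
have [u [fu ul us]] : exists u, [/\ ifamily p.1 p.2 u,
    \sum_(q <- u) (q.2 - q.1) <= p.2 - p.1 &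
    fine (TV p.1 p.2 f) <= \sum_(q <- u) `|f q.2 - f q.1| + eta].
  have fin := fin_total_variation ap pp pb.
  have : ((fine (TV p.1 p.2 f) - eta)%:E < TV p.1 p.2 f)%E.
    by rewrite -[ltRHS]fineK// lte_fin ltrBlDr ltrDl.
  move=> /ereal_sup_gt[_ [_ [l lp <-] <-]]; rewrite lte_fin => H.
  have [u fu ul] := ifamily_partition lp.
  by exists u; split => //; [exact: ifamily_length|rewrite ul; lra].
exists (u ++ t); split.
- apply: ifamily_cat => //; first exact: familyW fu.
  move=> x y xu yt; have /and3P[px xx xp] := ifamily_mem fu xu.
  have [q qs [q1 q2]] := tsub y yt.
  have /orP[pq|qp] := aps q qs; apply/orP; [left|right].
    by apply: le_trans xp _; apply: le_trans pq _.
  by apply: le_trans px; apply: le_trans qp.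
- by rewrite big_cat big_cons /=; exact: lerD.
- move=> x; rewrite mem_cat => /orP[xu|/tsub[q qs H]]; last first.
    by exists q => //; rewrite inE qs orbT.
  by exists p; rewrite ?inE ?eqxx//; have /and3P[] := ifamily_mem fu xu.
- rewrite big_cons big_cat /= -[X in X%:R]add1n natrD mulrDl mul1r; lra.
Qed.

Let V x := fine (TV a x f).

Lemma ac_tvB x y : a <= x -> x <= y -> y <= b -> V y - V x = fine (TV x y f).
Proof.
move=> ax xy yb; rewrite /V (@total_variationD _ a y x)// fineD ?fin_total_variation//.
  by rewrite addrC addKr.
exact: le_trans yb.
Qed.

(** [ifamily_refine] replaces a family by one of no greater length on which the increments of [f]
    nearly add up to the variation, so the modulus of [f] at [e / 2] serves for [V]; [eta] keeps the
    loss of the refinement at most [e / 2]. *)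
Lemma ac_tv : ac a b V.
Proof.
move=> e e0; have [d d0 H] := fac (divr_gt0 e0 (@ltr0n R 2)).
exists d => // s fs sd.
pose eta := e / 2 / (size s).+1%:R.
have eta0 : 0 < eta by rewrite !divr_gt0.
have [t [ft tl _ ts]] := ifamily_refine eta0 fs.
have -> : \sum_(p <- s) `|V p.2 - V p.1| = \sum_(p <- s) fine (TV p.1 p.2 f).
  rewrite [LHS]big_seq [RHS]big_seq; apply: eq_bigr => p ps.
  have /and3P[ap pp pb] := ifamily_mem fs ps.
  by rewrite ac_tvB// ger0_norm// fine_ge0// total_variation_ge0.
apply: le_lt_trans ts _; rewrite [ltRHS](splitr e); apply: ltr_leD.
  by apply: H => //; exact: le_lt_trans sd.
by rewrite /eta mulrCA -[leRHS]mulr1 ler_pM2l ?divr_gt0// ler_pdivrMr// mul1r ler_nat.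
Qed.

Lemma tv_ge x y : a <= x -> x <= y -> y <= b -> `|f y - f x| <= V y - V x.
Proof.
move=> ax xy yb; rewrite ac_tvB// -lee_fin fineK ?fin_total_variation//.
exact: total_variation_ge.
Qed.

Lemma acD h : ac a b h -> ac a b (fun x => f x + h x).
Proof.
move=> hac e e0; have e2 : 0 < e / 2 by rewrite divr_gt0.
have [d1 d10 H1] := fac e2; have [d2 d20 H2] := hac _ e2.
exists (Num.min d1 d2); first by rewrite lt_min d10.
move=> s fs; rewrite lt_min => /andP[s1 s2].
rewrite (splitr e); apply: le_lt_trans (ltrD (H1 s fs s1) (H2 s fs s2)).
rewrite -big_split; apply: ler_sum => p _ /=.
by apply: le_trans (ler_normD _ _); rewrite opprD addrACA.
Qed.

End total_variation_ac.

(** * Density of the Stieltjes measure of an absolutely continuous monotone function *)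

Section stieltjes.
Context {R : realType}.
Variables (a b : R).
Hypothesis ab : a < b.
Local Notation lambda := (@lebesgue_measure R).

(** Dyadic subdivision of ]a, b]. Open sets are exhausted from inside by finite unions of its cells,
    because absolute continuity speaks of finite families of intervals. *)
Let r m k := a + (b - a) * (k%:R / (2 ^ m)%:R).
Let I m k : set R := `]r m k, r m k.+1].
Let cell (U : set R) m k := if `[< I m k `<=` U >] then I m k else set0.
Let inner (U : set R) m := \big[setU/set0]_(k < 2 ^ m) cell U m k.

Let two0 m : (0 : R) < (2 ^ m)%:R. Proof. by rewrite ltr0n expn_gt0. Qed.
Let r0 m : r m 0 = a. Proof. by rewrite /r mul0r mulr0 addr0. Qed.
Let rN m : r m (2 ^ m) = b.
Proof. by rewrite /r divff ?gt_eqF// mulr1 addrC subrK. Qed.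
Let rle m k l : (k <= l)%N -> r m k <= r m l.
Proof.
move=> kl; rewrite lerD2l ler_wpM2l ?subr_ge0 ?(ltW ab)//.
by rewrite ler_wpM2r ?invr_ge0 ?ler_nat.
Qed.
Let rS m k : r m.+1 k.*2 = r m k.
Proof.
rewrite /r -muln2 expnS natrM natrM; congr (_ + _ * _).
by rewrite invfM mulrA mulfK.
Qed.

Let cellS U m k : cell U m k `<=` cell U m.+1 k.*2 `|` cell U m.+1 k.*2.+1.
Proof.
rewrite {1}/cell; case: asboolP => [IU x xI|_ x []].
have h : r m.+1 k.*2 <= r m.+1 k.*2.+1 <= r m.+1 k.*2.+2 by rewrite !rle.
have E1 : r m k.+1 = r m.+1 k.*2.+2 by rewrite -rS doubleS.
case/andP: h => h1 h2; have := xI; rewrite /I /= in_itv /= -rS E1 => /andP[x1 x2].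
have [xm|xm] := leP x (r m.+1 k.*2.+1); [left|right]; rewrite /cell.
  rewrite asboolT /I /= ?in_itv /= ?x1//.
  move=> y; rewrite /= in_itv /= => /andP[y1 y2]; apply: IU.
  by rewrite /I /= in_itv /= -rS y1 E1 (le_trans y2).
rewrite asboolT /I /= ?in_itv /= ?xm//.
move=> y; rewrite /= in_itv /= => /andP[y1 y2]; apply: IU.
by rewrite /I /= in_itv /= -rS E1 y2 andbT (le_lt_trans _ y1).
Qed.

Let innerP U m x : inner U m x <-> exists2 k, (k < 2 ^ m)%N & cell U m k x.
Proof.
rewrite /inner -bigcup_mkord; split => [[k /= km Hk]|[k km Hk]]; exists k => //.
Qed.

Let innerS U : nondecreasing_seq (inner U).
Proof.
apply/nondecreasing_seqP => m; apply/subsetPset => x /innerP[k km /cellS[]] H; apply/innerP.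
  by exists k.*2 => //; rewrite expnS mul2n ltn_double.
by exists k.*2.+1 => //; rewrite expnS mul2n ltn_Sdouble.
Qed.

Let inner_sub U m : inner U m `<=` U `&` `]a, b].
Proof.
move=> x /innerP[k km]; rewrite /cell; case: asboolP => // IU xI; split; first exact: IU.
move: xI; rewrite /I /= !in_itv /= => /andP[h1 h2]; apply/andP; split.
  by apply: le_lt_trans h1; rewrite -(r0 m) rle.
by apply: (le_trans h2); rewrite -(rN m) rle.
Qed.

Let inner_sup U : open U -> U `&` `]a, b] `<=` \bigcup_m inner U m.
Proof.
move=> oU x [Ux]; rewrite /= in_itv /= => /andP[ax xb].
have /nbhs_ballP[e /= e0 eU] : nbhs x U by exact: open_nbhs_nbhs.
have [m me] : exists m, (b - a) / (2 ^ m)%:R < e.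
  have q0 : 0 <= (b - a) / e by rewrite divr_ge0 ?subr_ge0 ?ltW.
  exists (Num.bound ((b - a) / e)); rewrite ltr_pdivrMr// mulrC -ltr_pdivrMr//.
  apply: lt_le_trans (archi_boundP q0) _; rewrite ler_nat ltnW//; exact: ltn_expl.
have ex : exists k, x <= r m k.+1.
  by exists (2 ^ m).-1; rewrite prednK ?expn_gt0// rN.
case: (ex_minnP ex) => k xk kmin.
have km : (k < 2 ^ m)%N.
  rewrite ltnNge; apply/negP => km.
  have := kmin (2 ^ m).-1; rewrite prednK ?expn_gt0// rN => /(_ xb).
  by rewrite leqNgt => /negP; apply; apply: leq_trans km; rewrite prednK ?expn_gt0.
have kx : r m k < x.
  case: k xk kmin km => [_ _ _|k _ kmin _]; first by rewrite r0.
  by rewrite ltNge; apply/negP => /kmin; rewrite ltnn.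
exists m => //; apply/innerP; exists k => //; rewrite /cell asboolT.
  by rewrite /I /= in_itv /= kx.
move=> y; rewrite /I /= in_itv /= => /andP[y1 y2]; apply: eU.
have rr : r m k.+1 - r m k < e.
  suff -> : r m k.+1 - r m k = (b - a) / (2 ^ m)%:R by [].
  by rewrite /r -addn1 natrD; ring.
rewrite /ball /= ltr_norml; lra.
Qed.

Let mI m k : measurable (I m k : set (measurableTypeR R)).
Proof. exact: measurable_itv. Qed.

Let mcell U m k : measurable (cell U m k : set (measurableTypeR R)).
Proof. by rewrite /cell; case: ifP => _; [exact: mI|exact: measurable0]. Qed.

Let cell_measure (mu : {measure set (measurableTypeR R) -> \bar R}) (h : R -> R) U m :
  (forall x y, x <= y -> mu `]x, y]%classic = (h y - h x)%:E) ->
  mu (inner U m) = (\sum_(p <- [seq (r m k, r m k.+1) | k <- iota 0 (2 ^ m) & `[< I m k `<=` U >]])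
    (h p.2 - h p.1))%:E.
Proof.
move=> muh; rewrite /inner (measure_bigsetU mu)//.
- transitivity (\sum_(k < 2 ^ m) (if `[< I m k `<=` U >] then h (r m k.+1) - h (r m k) else 0)%:E)%E.
    apply: eq_bigr => k _; rewrite /cell; case: ifP => _ /=; last by rewrite measure0.
    by rewrite /I muh// rle.
  rewrite sumEFin big_map big_filter -[X in iota 0 X]subn0 -/(index_iota _ _) big_mkord.
  by rewrite -big_mkcond.
- apply/trivIsetP => i j _ _ ij; apply/seteqP; split => // x [].
  rewrite /cell; case: ifP => // _; case: ifP => // _; rewrite /I /= !in_itv /= => /andP[i1 i2] /andP[j1 j2].
  move: ij; rewrite neq_ltn => /orP[lt|lt].
    by have := le_lt_trans (rle m lt) j1; rewrite ltNge i2.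
  by have := le_lt_trans (rle m lt) i1; rewrite ltNge j2.
Qed.

Let cell_family U m :
  ifamily a b [seq (r m k, r m k.+1) | k <- iota 0 (2 ^ m) & `[< I m k `<=` U >]].
Proof.
rewrite /ifamily; apply/andP; split.
  apply/allP => _ /mapP[k + ->] /=; rewrite mem_filter mem_iota add0n => /and3P[_ _ km].
  by rewrite -{1}(r0 m) -(rN m) !rle.
rewrite pairwise_map; apply: (@sub_pairwise _ ltn) => [i j ij|].
  by apply/orP; left => /=; exact: rle.
apply: (subseq_pairwise (filter_subseq _ _)).
rewrite -sorted_pairwise; last exact: ltn_trans.
exact: iota_ltn_sorted.
Qed.

Variable h : R -> R.
Hypotheses (hnd : {homo h : x y / x <= y}) (hc : continuous h) (hac : ac a b h).

Let H : cumulative R R :=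
  HB.pack h (isCumulative.Build R _ _ h hnd (right_continuousW hc)).
Let mu := lebesgue_stieltjes_measure H.

Let mu_itv x y : x <= y -> mu `]x, y]%classic = (h y - h x)%:E.
Proof.
move=> xy; rewrite /mu /lebesgue_stieltjes_measure /measure_extension measurable_mu_extE/=.
  by rewrite wlength_itv_bnd.
exact: is_ocitv.
Qed.

Let mab : measurable (`]a, b]%classic : set (measurableTypeR R)).
Proof. exact: measurable_itv. Qed.

Let mu_fin : (mu `]a, b]%classic < +oo)%E.
Proof. by rewrite mu_itv ?ltry// ltW. Qed.

Let nu : {finite_measure set (measurableTypeR R) -> \bar R} := mfrestr mab mu_fin.

Let lambda_itv x y : x <= y -> lambda `]x, y]%classic = (y - x)%:E.
Proof.
rewrite le_eqVlt => /predU1P[->|xy].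
  by rewrite set_itvoc0 measure0 subrr.
by rewrite lebesgue_measure_itv /= lte_fin xy.
Qed.

(** A null set is contained in an open [U] of length below [d]. Each [inner U m] is a finite union
    of disjoint cells of total length below [d], so its measure is at most [e] by absolute
    continuity, and these unions increase to the part of [U] in ]a, b]. *)
Let nu_ac : nu `<< lambda.
Proof.
move=> N nullN A mA AN.
have lA : lambda A = 0%E by exact: nullN.
apply/eqP; rewrite eq_le measure_ge0 andbT; apply/lee_addgt0Pr => e e0; rewrite add0e.
have [d d0 Hd] := hac e0.
have lAy : (lambda A < +oo)%E by rewrite lA ltry.
have [U [oU AU UA]] := @lebesgue_regularity_outer R A d mA lAy d0.
have mU : measurable (U : set (measurableTypeR R)) by exact: measurable_realfun.open_measurable.
have minner m : measurable (inner U m : set (measurableTypeR R)).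
  exact: bigsetU_measurable.
have lU : (lambda U < d%:E)%E.
  apply: le_lt_trans UA; rewrite -[leRHS]add0e -lA.
  rewrite [X in (X <= _)%E](_ : _ = lambda (A `|` U `\` A)); last by rewrite setDUK.
  by apply: measureU2 => //; exact: measurableD.
have mb : measurable (\bigcup_m inner U m : set (measurableTypeR R)).
  exact: bigcup_measurable.
have mAab : measurable (A `&` `]a, b] : set (measurableTypeR R)).
  by apply: measurableI => //; exact: measurable_itv.
apply: (@le_trans _ _ (mu (\bigcup_m inner U m))).
  rewrite /nu /= /mfrestr /mrestr; apply: le_measure; rewrite ?inE//.
  by move=> x [Ax xab]; apply: inner_sup => //; split => //; exact: AU.
have := @nondecreasing_cvg_mu _ _ _ mu _ minner mb (@innerS U).
move=> cv; suff : (lim ((mu \o inner U) x @[x --> \oo]) <= e%:E)%E.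
  by rewrite (cvg_lim _ cv).
apply: lime_le.
  apply: ereal_nondecreasing_is_cvgn => i j ij; apply: le_measure; rewrite ?inE//.
  by apply/subsetPset; exact: innerS.
apply: nearW => m; have E := cell_measure U m mu_itv.
move: E; set z := (X in _ = X) => E; suff : (z <= e%:E)%E by rewrite -E.
rewrite /z lee_fin.
have fs := cell_family U m.
apply: le_trans (ltW (Hd _ fs _)); first by apply: ler_sum => p _; exact: ler_norm.
rewrite -lte_fin; apply: le_lt_trans lU.
rewrite -(@cell_measure _ id _ _ lambda_itv); apply: le_measure; rewrite ?inE//.
by move=> x /inner_sub[].
Qed.

Lemma nondecreasing_primitive : exists g : R -> R,
  [/\ lambda.-integrable setT (EFin \o g),
      (forall x, 0 <= g x) &
      forall x y, a <= x -> x <= y -> y <= b ->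
        h y - h x = \int[lambda]_(t in `]x, y]) g t].
Proof.
have [f [f0 ff fi fE]] := radon_nikodym_sigma_finite nu_ac.
exists (fine \o f); have E : EFin \o (fine \o f) = f by apply/funext => x /=; rewrite fineK.
split; [by rewrite E|by move=> x; rewrite /= fine_ge0|].
move=> x y ax xy yb; rewrite /Rintegral.
have -> : (\int[lambda]_(t in `]x, y]) (fine (f t))%:E = \int[lambda]_(t in `]x, y]) f t)%E.
  by apply: eq_integral => t _; rewrite fineK.
have S : `]x, y] `&` `]a, b] = `]x, y]%classic.
  apply/seteqP; split => [t []//|t txy]; split => //; move: txy.
  rewrite /= !in_itv /= => /andP[xt ty].
  by rewrite (le_lt_trans ax xt) (le_trans ty yb).
rewrite -fE ?measurable_itv// /nu /= /mfrestr /mrestr S.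
by change (h y - h x = fine (mu `]x, y]%classic)); rewrite mu_itv.
Qed.

End stieltjes.

(** * Primitive and almost everywhere derivative *)

Section ac_primitive.
Context {R : realType}.
Local Notation lambda := (@lebesgue_measure R).

Definition clampr (a b t : R) := Num.max a (Num.min t b).

Lemma clampr_itv a b t : a <= b -> a <= clampr a b t <= b.
Proof. by move=> ab; rewrite /clampr le_max lexx ge_max ab /= ge_min lexx orbT. Qed.

Lemma clampr_id a b t : a <= t <= b -> clampr a b t = t.
Proof. by move=> /andP[at_ tb]; rewrite /clampr min_l// max_r. Qed.

Lemma clampr_homo a b : {homo clampr a b : x y / x <= y}.
Proof. by move=> x y xy; rewrite /clampr le_max2// le_min2. Qed.

Lemma max_lip a x y : `|Num.max a x - Num.max a y| <= `|x - y| :> R.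
Proof.
rewrite !maxr_absE; have := ler_dist_dist (a - x) (a - y).
rewrite (_ : a - x - (a - y) = y - x); last by ring.
rewrite (distrC y) ler_norml => /andP[h1 h2].
have h3 := ler_norm (x - y); have := ler_norm (y - x); rewrite distrC => h4.
rewrite ler_norml; lra.
Qed.

Lemma min_lip x y b : `|Num.min x b - Num.min y b| <= `|x - y| :> R.
Proof.
rewrite !minr_absE; have := ler_dist_dist (x - b) (y - b).
rewrite (_ : x - b - (y - b) = x - y); last by ring.
rewrite ler_norml => /andP[h1 h2].
have h3 := ler_norm (x - y); have := ler_norm (y - x); rewrite distrC => h4.
rewrite ler_norml; lra.
Qed.

Lemma clampr_lip a b x y : `|clampr a b x - clampr a b y| <= `|x - y|.
Proof. exact: le_trans (max_lip _ _ _) (min_lip _ _ _). Qed.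

Lemma ac_clamp a b f : ac a b f -> ac a b (f \o clampr a b).
Proof.
move=> fac e e0; have [d d0 H] := fac e e0; exists d => // s fs /(H s fs).
apply: le_lt_trans; rewrite big_seq [leRHS]big_seq; apply: ler_sum => p ps.
have /and3P[p1 p2 p3] := ifamily_mem fs ps.
by rewrite /= !clampr_id ?p1 ?p3 ?(le_trans p2)// (le_trans p1).
Qed.

Lemma ac_continuous a b f : a <= b -> ac a b f -> continuous (f \o clampr a b).
Proof.
move=> ab fac x; apply/cvgrPdist_lt => e e0; have [d d0 H] := fac e e0.
near=> y.
have xyd : `|clampr a b x - clampr a b y| < d.
  apply: le_lt_trans (clampr_lip _ _ _ _) _.
  by near: y; apply: cvgr_dist_lt => //; exact: cvg_id.
have /andP[x1 x2] := clampr_itv x ab; have /andP[y1 y2] := clampr_itv y ab.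
move: xyd; rewrite /=; set u := clampr a b x in x1 x2 *; set v := clampr a b y in y1 y2 *.
have [uv|vu] := leP u v => uvd.
  have := H [:: (u, v)]; rewrite !big_seq1 /= distrC; apply.
    by rewrite /ifamily /= x1 uv y2.
  by apply: le_lt_trans (ler_norm _) _; rewrite distrC.
have := H [:: (v, u)]; rewrite !big_seq1 /=; apply.
  by rewrite /ifamily /= y1 (ltW vu) x2.
exact: le_lt_trans (ler_norm _) _.
Unshelve. all: by end_near. Qed.

(** [f] is the difference of [V + f] and [V], both nondecreasing and absolutely continuous; clamping
    extends them to the whole line, where Stieltjes measures live. *)
Theorem ac_primitive a b f : a < b -> ac a b f -> exists g : R -> R,
  lambda.-integrable setT (EFin \o g) /\
  forall x y, a <= x -> x <= y -> y <= b ->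
    f y - f x = \int[lambda]_(t in `]x, y]) g t.
Proof.
move=> ab fac; have leab := ltW ab.
pose V x := fine (total_variation a x f).
have Vac : ac a b V by exact: ac_tv.
have Vfac : ac a b (fun x => V x + f x) by exact: acD.
have Vf x y : a <= x -> x <= y -> y <= b -> `|f y - f x| <= V y - V x.
  exact: tv_ge.
have h1 : {homo V \o clampr a b : x y / x <= y}.
  move=> x y /(clampr_homo a b) xy /=; rewrite -subr_ge0.
  have /andP[x1 x2] := clampr_itv x leab; have /andP[y1 y2] := clampr_itv y leab.
  by apply: le_trans (Vf _ _ x1 xy y2).
have h2 : {homo (fun x => V x + f x) \o clampr a b : x y / x <= y}.
  move=> x y /(clampr_homo a b) xy /=.
  have /andP[x1 x2] := clampr_itv x leab; have /andP[y1 y2] := clampr_itv y leab.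
  have := Vf _ _ x1 xy y2; rewrite ler_norml; lra.
have [g1 [g1i _ g1E]] := nondecreasing_primitive ab h1 (ac_continuous leab Vac) (ac_clamp Vac).
have [g2 [g2i _ g2E]] := nondecreasing_primitive ab h2 (ac_continuous leab Vfac) (ac_clamp Vfac).
exists (fun x => g2 x - g1 x); split.
  rewrite (_ : EFin \o _ = (EFin \o g2) \- (EFin \o g1))%E; first exact: integrableB.
  by apply/funext => x /=; rewrite EFinB.
move=> x y ax xy yb.
have S (g : R -> R) : lambda.-integrable setT (EFin \o g) -> lambda.-integrable `]x, y] (EFin \o g).
  by apply: integrableS => //; exact: measurable_itv.
rewrite (RintegralB _ (S _ g2i) (S _ g1i)); last exact: measurable_itv.
rewrite -g1E// -g2E//= !clampr_id ?ax ?yb ?(le_trans xy)// ?(le_trans ax)//.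
ring.
Qed.

Lemma ac_derivable a b f (g : R -> R) : a < b ->
  lambda.-integrable setT (EFin \o g) ->
  (forall x y, a <= x -> x <= y -> y <= b ->
    f y - f x = \int[lambda]_(t in `]x, y]) g t) ->
  {ae lambda, forall x, a < x < b ->
    h^-1 *: (f (clampr a b (h + x)) - f (clampr a b x)) @[h --> 0^'] --> g x}.
Proof.
move=> ab gi gE.
have gT (D : set R) : measurable D -> lambda.-integrable D (EFin \o g).
  by move=> mD; apply: integrableS gi.
have lg : locally_integrable setT g.
  by apply: open_integrable_locally gi; exact: openT.
have := @FTC1 R g (BRight a) (fun y => gT _ (measurable_itv _)) lg.
apply: filterS; first exact: (ae_filter_ringOfSetsType lambda).
move=> x Hx /andP[ax xb].
have [+ <-] := Hx ax; set F := fun y : R => _.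
rewrite derive1E /derivable /derive => /cvg_ex[l Hl].
have E : (fun h : R => h^-1 *: ((F \o shift x) (h *: 1) - F x)) = (fun h => h^-1 *: (F (h + x) - F x)).
  by apply/funext => h; rewrite /= [h *: _]mulr1.
rewrite E in Hl *.
have -> : lim (h^-1 *: (F (h + x) - F x) @[h --> 0^']) = l by apply: cvg_lim Hl.
have d0 : 0 < Num.min (x - a) (b - x) by rewrite lt_min !subr_gt0 ax.
apply: cvg_trans Hl; apply: near_eq_cvg; near=> h.
have : `|h| < Num.min (x - a) (b - x).
  by near: h; exact: dnbhs0_lt.
rewrite lt_min !ltr_norml => /andP[/andP[h1 _] /andP[_ h2]].
have ah : a < h + x by lra.
have hb : h + x < b by lra.
rewrite !clampr_id ?(ltW ax) ?(ltW xb) ?(ltW ah) ?(ltW hb)//; congr (_ *: _).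
by rewrite /F -!gE ?(ltW ax) ?(ltW xb) ?(ltW ah) ?(ltW hb)//; ring.
Unshelve. all: by end_near. Qed.

End ac_primitive.

(** * Discrete energy and Riesz' theorem *)

Import HBNNSimple.

Section integral_off_null.
Context d (T : measurableType d) (R : realType) (mu : {measure set T -> \bar R}).
Local Open Scope ereal_scope.

Let ge0_le_off_null (D N : set T) (f g : T -> \bar R) : measurable N -> mu N = 0 ->
  (forall x, 0 <= f x) -> (forall x, 0 <= g x) ->
  (forall x, D x -> ~ N x -> f x = g x) ->
  \int[mu]_(x in D) f x <= \int[mu]_(x in D) g x.
Proof.
move=> mN N0 f0 g0 fg; rewrite !ge0_integralE//.
apply: ge_ereal_sup => _ [h hf <-]; apply: ereal_sup_ubound => /=.
(* Killing a simple function on the null set keeps its integral and puts it below [g] everywhere on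
   [D]. *)
pose h' := mul_nnsfun h (indic_nnsfun R (measurableC mN)).
have h'E x : h' x = (h x * \1_(~` N) x)%R by [].
exists h'.
  move=> x; rewrite h'E indicE; have [xN|xN] := pselect (N x).
    rewrite memNset ?mulr0; last by move=> /(_ xN).
    by rewrite patchE; case: ifP.
  rewrite mem_set// mulr1; apply: le_trans (hf x) _.
  by rewrite !patchE; case: ifPn => // /set_mem xD; rewrite fg.
rewrite -!integralT_nnsfun; apply: ae_eq_integral => //.
- by apply/measurable_EFinP; exact: measurable_funP.
- by apply/measurable_EFinP; exact: measurable_funP.
- exists N; split => // x /= H; apply: contrapT => xN; apply: H => _.
  by rewrite /= /mindic indicE mem_set// mulr1.
Qed.

(* The acceleration is not known to be measurable, whence this version of
   almost everywhere equality of integrals. *)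
Lemma integral_off_null (D N : set T) (f g : T -> \bar R) : measurable N -> mu N = 0 ->
  (forall x, D x -> ~ N x -> f x = g x) ->
  \int[mu]_(x in D) f x = \int[mu]_(x in D) g x.
Proof.
move=> mN N0 fg; rewrite integralE [RHS]integralE.
by congr (_ - _); apply/eqP; rewrite eq_le; apply/andP; split;
  apply: (ge0_le_off_null mN N0) => // x Dx Nx; rewrite ?funeposE ?funenegE fg.
Qed.

Lemma integral_congr_ae (D : set T) (f g : T -> \bar R) :
  {ae mu, forall x, D x -> f x = g x} ->
  \int[mu]_(x in D) f x = \int[mu]_(x in D) g x.
Proof.
move=> [N [mN N0 H]]; apply: (integral_off_null mN N0) => x Dx Nx.
by apply: contrapT => fg; apply: Nx; apply: H => /(_ Dx).
Qed.

End integral_off_null.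

Lemma integrable_const d (T : measurableType d) (R : realType)
    (mu : {measure set T -> \bar R}) (D : set T) (c : R) :
  measurable D -> (mu D < +oo)%E -> mu.-integrable D (EFin \o cst c).
Proof.
move=> mD Dy; apply/integrableP; split; first by apply/measurable_EFinP; exact: measurable_cst.
rewrite (_ : (fun x => _) = cst `|c|%:E)//.
rewrite integral_cst//; apply: lte_mul_pinfty => //.
Qed.

Lemma Rintegral_sum d (T : measurableType d) (R : realType)
    (mu : {measure set T -> \bar R}) (D : set T) (I : Type) (s : seq I) (f : I -> T -> R) :
  measurable D -> (forall i, mu.-integrable D (EFin \o f i)) ->
  \int[mu]_(x in D) (\sum_(i <- s) f i x) = \sum_(i <- s) \int[mu]_(x in D) f i x.
Proof.
move=> mD fi; elim: s => [|i s IH].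
  under eq_Rintegral do rewrite big_nil.
  by rewrite big_nil Rintegral_cst// mul0r.
under eq_Rintegral do rewrite big_cons.
rewrite RintegralD//; first by rewrite big_cons IH.
have := integrable_sum mD s (P := predT) (fun i _ => fi i).
by congr (mu.-integrable D _); apply/funext => x /=; rewrite sumEFin.
Qed.

Section time_interval.
Context {R : realType} {T : {posnum R}}.
Implicit Types (u v : time T) (s t : R).

Lemma clampE s : set_val (clamp T s) = clampr 0 T%:num s.
Proof. by []. Qed.

Lemma time_itv u : 0 <= set_val u <= T%:num.
Proof. by have := set_mem (valP u); rewrite /= in_itv. Qed.

Lemma time_ge0 u : 0 <= set_val u. Proof. by case/andP: (time_itv u). Qed.
Lemma time_leT u : set_val u <= T%:num. Proof. by case/andP: (time_itv u). Qed.

Lemma clamp_id s : 0 <= s <= T%:num -> set_val (clamp T s) = s.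
Proof. by move=> H; rewrite clampE clampr_id. Qed.

Lemma clampK u : clamp T (set_val u) = u.
Proof. by apply: val_inj; exact: (clamp_id (time_itv u)). Qed.

Lemma clamp_clampr s : clamp T (clampr 0 T%:num s) = clamp T s.
Proof. by rewrite -clampE clampK. Qed.

Lemma val_time0 : set_val (time0 T) = 0.
Proof. by rewrite clamp_id// lexx ge0. Qed.

Lemma time_near u (U : set (time T)) : nbhs u U <->
  exists2 e, 0 < e & forall v, `|set_val v - set_val u| < e -> U v.
Proof.
split=> [/nbhs_ballP[e e0 eU]|[e e0 eU]].
  by exists e => // v vu; apply: eU; rewrite /ball /= /initial_ball /ball /= distrC.
by apply/nbhs_ballP; exists e => // v uv; apply: eU; rewrite distrC.
Qed.

Definition tfamily (s : seq (time T * time T)) :=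
  all (fun p => set_val p.1 <= set_val p.2) s &&
  pairwise (fun p q => (set_val p.2 <= set_val q.1) || (set_val q.2 <= set_val p.1)) s.

Lemma tfamilyP (s : seq (time T * time T)) : tfamily s =
  ifamily 0 T%:num [seq (set_val p.1, set_val p.2) | p <- s].
Proof.
rewrite /tfamily /ifamily all_map pairwise_map; congr (_ && _).
by apply: eq_all => p /=; rewrite time_ge0 time_leT /= andbT.
Qed.

Lemma ifamily_time (s : seq (R * R)) : ifamily (0 : R) T%:num s ->
  exists2 t, tfamily t & s = [seq (set_val p.1, set_val p.2) | p <- t].
Proof.
move=> fs; exists [seq (clamp T p.1, clamp T p.2) | p <- s]; last first.
  rewrite -map_comp -[LHS]map_id; apply/eq_in_map => -[x y] ps /=.
  have /and3P[/= p1 p2 p3] := ifamily_mem fs ps.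
  by rewrite !clamp_id ?p1 ?p3 ?(le_trans p2)// (le_trans p1).
rewrite tfamilyP -map_comp -(_ : s = map _ s)// -[LHS]map_id; apply/eq_in_map => -[x y] ps /=.
have /and3P[/= p1 p2 p3] := ifamily_mem fs ps.
by rewrite !clamp_id ?p1 ?p3 ?(le_trans p2)// (le_trans p1).
Qed.

End time_interval.

Section energy.
Context {R : realType} {T : {posnum R}}.
Implicit Types (w : time T -> time T -> R) (E : R).

(* [w s t] stands for (a bound on) an increment over the interval [s, t] *)
Definition energy_le w E := forall s : seq (time T * time T), tfamily s ->
  \sum_(p <- s) w p.1 p.2 ^+ 2 / (set_val p.2 - set_val p.1) <= E.

Lemma energy_le_ge0 w E : energy_le w E -> 0 <= E.
Proof. by move=> /(_ [::] isT); rewrite big_nil. Qed.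

Lemma energy_leW w E E' : E <= E' -> energy_le w E -> energy_le w E'.
Proof. by move=> EE H s /H/le_trans; apply. Qed.

Lemma energy_le_mono w w' E :
  (forall s t, set_val s <= set_val t -> `|w s t| <= `|w' s t|) ->
  energy_le w' E -> energy_le w E.
Proof.
move=> ww H s fs; apply: le_trans (H s fs).
rewrite big_seq [leRHS]big_seq; apply: ler_sum => p ps.
have st : set_val p.1 <= set_val p.2 by have /andP[/allP/(_ p ps)] := fs.
rewrite ler_wpM2r ?invr_ge0 ?subr_ge0//.
rewrite -(real_normK (num_real (w _ _))) -(real_normK (num_real (w' _ _))).
by rewrite ler_pXn2r ?nnegrE// ww.
Qed.

Lemma energy_leZ w E a : energy_le w E -> energy_le (fun s t => a * w s t) (a ^+ 2 * E).
Proof.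
move=> H s fs; under eq_bigr do rewrite exprMn -mulrA.
by rewrite -mulr_sumr ler_wpM2l ?sqr_ge0// H.
Qed.

(** Young's inequality on each interval. The parameter [a] brings the first coefficient as close to
    1 as desired, so that adding a term of small energy hardly raises [E]. *)
Lemma energy_leD w w' E E' a : 0 < a -> energy_le w E -> energy_le w' E' ->
  energy_le (fun s t => w s t + w' s t) ((1 + a) * E + (1 + a^-1) * E').
Proof.
move=> a0 H H' s fs.
apply: (@le_trans _ _ ((1 + a) * (\sum_(p <- s) w p.1 p.2 ^+ 2 / (set_val p.2 - set_val p.1)) +
   (1 + a^-1) * (\sum_(p <- s) w' p.1 p.2 ^+ 2 / (set_val p.2 - set_val p.1)))); last first.
  have a1 : 0 <= a^-1 by rewrite invr_ge0 ltW.
  by apply: lerD; apply: ler_wpM2l; [lra|exact: H|lra|exact: H'].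
rewrite !mulr_sumr -big_split /= big_seq [leRHS]big_seq; apply: ler_sum => p ps.
have st : set_val p.1 <= set_val p.2 by have /andP[/allP/(_ p ps)] := fs.
rewrite [(1 + a) * (_ / _)]mulrA [(1 + a^-1) * (_ / _)]mulrA -mulrDl.
rewrite ler_wpM2r ?invr_ge0 ?subr_ge0//; set x := w _ _; set y := w' _ _; rewrite -subr_ge0.
have -> : (1 + a) * x ^+ 2 + (1 + a^-1) * y ^+ 2 - (x + y) ^+ 2 = a^-1 * (a * x - y) ^+ 2.
  by field; rewrite gt_eqF.
by rewrite mulr_ge0 ?sqr_ge0// invr_ge0 ltW.
Qed.

(** After division by its length each interval contributes at most [k] times an increment of [h],
    and the increments over disjoint intervals add up to at most the total one. *)
Lemma energy_le_nondecreasing w (h : R -> R) k : 0 <= k -> {homo h : x y / x <= y} ->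
  (forall s t, set_val s <= set_val t ->
     w s t ^+ 2 <= k * (set_val t - set_val s) * (h (set_val t) - h (set_val s))) ->
  energy_le w (k * (h T%:num - h 0)).
Proof.
move=> k0 nh H s fs.
have := fs; rewrite tfamilyP => /(ifamily_nondecreasing (ge0 T) nh).
rewrite big_map /= => /(ler_wpM2l k0); apply: le_trans.
rewrite mulr_sumr big_seq [leRHS]big_seq; apply: ler_sum => p ps.
have st : set_val p.1 <= set_val p.2 by have /andP[/allP/(_ p ps)] := fs.
have [E|ne] := eqVneq (set_val p.1) (set_val p.2).
  by rewrite E !subrr invr0 !mulr0.
have lt : 0 < set_val p.2 - set_val p.1 by rewrite subr_gt0 lt_neqAle ne.
by rewrite ler_pdivrMr// mulrAC H.
Qed.

Lemma energy_le_lip w L : 0 <= L ->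
  (forall s t, set_val s <= set_val t -> `|w s t| <= L * (set_val t - set_val s)) ->
  energy_le w (L ^+ 2 * T%:num).
Proof.
move=> L0 H; rewrite -[T%:num]subr0.
apply: (@energy_le_nondecreasing _ id); rewrite ?sqr_ge0// => s t st.
rewrite -(real_normK (num_real (w _ _))) -mulrA -expr2 -exprMn.
by rewrite ler_pXn2r ?nnegrE ?mulr_ge0 ?subr_ge0// H.
Qed.

(** On an interval of length zero the quotient is zero by convention and says nothing about [w],
    whence the alternative. *)
Lemma energy_le_incr w E s t : energy_le w E -> set_val s <= set_val t ->
  w s t ^+ 2 <= E * (set_val t - set_val s) \/ set_val s = set_val t.
Proof.
move=> H st; have [E0|ne] := eqVneq (set_val s) (set_val t); [by right|left].
have lt : 0 < set_val t - set_val s by rewrite subr_gt0 lt_neqAle ne.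
by have := H [:: (s, t)]; rewrite big_seq1 /tfamily /= st ler_pdivrMr//; exact.
Qed.

End energy.

Section vector_energy.
Context {R : realType} {T : {posnum R}} {n : nat}.
Implicit Types (eta zeta : time T -> 'rV[R]_n).

Definition kinetic eta E := energy_le (fun s t => enorm (eta t - eta s)) E.

Lemma kinetic_incr eta E s t : kinetic eta E ->
  enorm (eta t - eta s) <= Num.sqrt (E * `|set_val t - set_val s|).
Proof.
move=> H; wlog st : s t / set_val s <= set_val t.
  by move=> W; have [/W//|/ltW/W] := leP (set_val s) (set_val t); rewrite enormB distrC.
have E0 := energy_le_ge0 H.
rewrite -(@ler_pXn2r _ 2)// ?nnegrE ?enorm_ge0 ?sqrtr_ge0// [leRHS]sqr_sqrtr ?mulr_ge0//.
rewrite ger0_norm ?subr_ge0//.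
have [//|/val_inj E1] := energy_le_incr H st.
by subst t; rewrite !subrr enorm0 expr0n mulr0.
Qed.

(** Cauchy-Schwarz in the form [2 x <= a x^2 / D + D / a] on each interval of length [D];
    [a = e / (E + 1)] balances the two sums when the total length is below [e^2 / (E + 1)]. *)
Lemma kinetic_abs_continuous eta E : kinetic eta E -> abs_continuous eta.
Proof.
move=> H e e0; have E0 := energy_le_ge0 H.
exists (e ^+ 2 / (E + 1)); first by rewrite divr_gt0 ?exprn_gt0// ltr_pwDr.
move=> s s1 s2 sl; have fs : tfamily s by rewrite /tfamily s1.
have Hs := H s fs.
have key (a : R) : 0 < a -> 2 * \sum_(p <- s) enorm (eta p.2 - eta p.1) <=
   a * E + a^-1 * \sum_(p <- s) (set_val p.2 - set_val p.1).
  move=> a0; apply: (@le_trans _ _ (a * (\sum_(p <- s) enorm (eta p.2 - eta p.1) ^+ 2 / (set_val p.2 - set_val p.1))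
    + a^-1 * \sum_(p <- s) (set_val p.2 - set_val p.1))); last by rewrite lerD2r ler_wpM2l// ltW.
  rewrite !mulr_sumr -big_split big_seq [leRHS]big_seq; apply: ler_sum => p ps /=.
  have st : set_val p.1 <= set_val p.2 by move/allP: s1 => /(_ p ps).
  have [/val_inj->|ne] := eqVneq (set_val p.1) (set_val p.2).
    by rewrite !subrr enorm0 invr0 !mulr0 addr0.
  have lt : 0 < set_val p.2 - set_val p.1 by rewrite subr_gt0 lt_neqAle ne.
  set D := set_val p.2 - _ in lt *; set x := enorm _; rewrite -subr_ge0.
  have -> : a * (x ^+ 2 / D) + a^-1 * D - 2 * x = (a * x - D) ^+ 2 / (a * D).
    by field; rewrite !gt_eqF.
  by rewrite divr_ge0 ?sqr_ge0// mulr_ge0// ltW.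
have E1 : 0 < E + 1 by lra.
have := key (e / (E + 1)) (divr_gt0 e0 E1); rewrite invf_div => k.
rewrite -(@ltr_pM2l _ 2)//; apply: le_lt_trans k _.
have -> : 2 * e = e / (E + 1) * (E + 1) + (E + 1) / e * (e ^+ 2 / (E + 1)).
  by field; rewrite !gt_eqF.
apply: ler_ltD; first by rewrite ler_wpM2l ?divr_ge0 ?ltW// ltrDl.
by rewrite ltr_pM2l ?divr_gt0.
Qed.

Lemma kineticD eta zeta E E' a : 0 < a -> kinetic eta E -> kinetic zeta E' ->
  kinetic (fun t => eta t + zeta t) ((1 + a) * E + (1 + a^-1) * E').
Proof.
move=> a0 H H'; apply: energy_le_mono (energy_leD a0 H H') => s t st.
rewrite !ger0_norm ?addr_ge0 ?enorm_ge0//.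
by apply: le_trans (enormD _ _); rewrite opprD addrACA.
Qed.

(** A discrete energy involves finitely many values, so pointwise convergence is enough. This is the
    lower semicontinuity of the energy. *)
Lemma kinetic_lim (u : nat -> time T -> 'rV[R]_n) eta E :
  (forall k, kinetic (u k) E) ->
  (forall t e, 0 < e -> \forall k \near \oo, enorm (u k t - eta t) <= e) ->
  kinetic eta E.
Proof.
move=> uE ue s fs.
have c t t' : enorm (u k t' - u k t) ^+ 2 @[k --> \oo] --> enorm (eta t' - eta t) ^+ 2.
  have c1 : enorm (u k t' - u k t) @[k --> \oo] --> enorm (eta t' - eta t).
    apply/cvgrPdist_le => e e0; near=> k.
    apply: le_trans (enorm_sub_le _ _) _.
    have -> : eta t' - eta t - (u k t' - u k t) = (eta t' - u k t') - (eta t - u k t).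
      by apply/rowP => i; rewrite !mxE; ring.
    apply: le_trans (enormBle _ _) _; rewrite (splitr e) !(enormB (eta _)).
    by apply: lerD; near: k; apply: ue; rewrite divr_gt0.
  by rewrite expr2; under eq_fun do rewrite expr2; exact: cvgM.
have : \sum_(p <- s) enorm (u k p.2 - u k p.1) ^+ 2 / (set_val p.2 - set_val p.1) @[k --> \oo] -->
   \sum_(p <- s) enorm (eta p.2 - eta p.1) ^+ 2 / (set_val p.2 - set_val p.1).
  apply: cvg_big => [|p _]; first exact: add_continuous.
  by apply: cvgM; [exact: c|exact: cvg_cst].
move=> H; apply: (ler_cvg_to H (cvg_cst E)); apply: nearW => k; exact: uE.
Unshelve. all: by end_near. Qed.

End vector_energy.

(* Riesz's theorem: the energy of an absolutely continuous curve is the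
   supremum of its discrete energies. *)
Section riesz.
Context {R : realType} {T : {posnum R}} {n : nat}.
Implicit Types (eta : time T -> 'rV[R]_n) (E : R).
Local Notation lambda := (@lebesgue_measure R).
Local Notation J := (`[0%R, T%:num]%classic : set R).

Definition accel eta : R -> 'rV[R]_n := (fun s : R => eta (clamp T s))^`()%classic.

Let T0 : 0 < T%:num. Proof. by []. Qed.

Definition primitive_of eta (g : R -> 'rV[R]_n) :=
  (forall i, lambda.-integrable setT (EFin \o (fun x => g x ord0 i))) /\
  forall i s t, 0 <= s -> s <= t -> t <= T%:num ->
    eta (clamp T t) ord0 i - eta (clamp T s) ord0 i = \int[lambda]_(x in `]s, t]) g x ord0 i.

Let quot eta x h := h^-1 *: (eta (clamp T (h + x)) - eta (clamp T x)).

Lemma abs_continuous_primitive eta : abs_continuous eta ->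
  exists2 g, primitive_of eta g &
    {ae lambda, forall x, 0 < x < T%:num -> quot eta x h @[h --> 0^'] --> g x}.
Proof.
move=> ace; pose f i x := eta (clamp T x) ord0 i.
have acf i : ac 0 T%:num (f i).
  move=> e e0; have [d d0 H] := ace e e0; exists d => // s /ifamily_time[t tt ->].
  rewrite !big_map /= => td.
  have /andP[t1 t2] := tt; apply: le_lt_trans (H t t1 t2 td).
  apply: ler_sum => p _; rewrite /f !clampK.
  by have := coord_le_enorm (eta p.2 - eta p.1) i; rewrite !mxE.
have /choice[g gP] := fun i => ac_primitive T0 (acf i).
exists (fun x => \row_i g i x).
  split => [i|i s t s0 st tT].
    under [X in EFin \o X]eq_fun do rewrite mxE; exact: (gP i).1.
  by under eq_Rintegral do rewrite mxE; exact: (gP i).2.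
have aei i := ac_derivable T0 (gP i).1 (gP i).2.
(* The coordinates are indexed through [nat] so that the countable intersection of sets of full
   measure applies. *)
have : {ae lambda, forall x, forall m : nat, forall i : 'I_n, i = m :> nat ->
   (0 < x < T%:num -> h^-1 *: (f i (clampr 0 T%:num (h + x)) - f i (clampr 0 T%:num x)) @[h --> 0^'] --> g i x)}.
  apply: ae_foralln => m; have [mn|nm] := ltnP m n.
    have := aei (Ordinal mn); apply: filterS; first exact: (ae_filter_ringOfSetsType lambda).
    by move=> x Hx i im; have -> : i = Ordinal mn by exact: val_inj.
  by apply/aeW => x i im; have := ltn_ord i; rewrite im ltnNge nm.
apply: filterS; first exact: (ae_filter_ringOfSetsType lambda).
move=> x Hx x0T; apply: cvg_rV => i; rewrite mxE.
have := Hx i i erefl x0T; rewrite /f.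
under eq_fun do rewrite !clamp_clampr.
by under [in X in _ -> X]eq_fun do rewrite /quot !mxE.
Qed.

Lemma quot_accel eta x l : quot eta x h @[h --> 0^'] --> l -> accel eta x = l.
Proof. by move=> H; rewrite /accel /derive1; apply: cvg_lim => //; exact: norm_hausdorff. Qed.

(** The integral of [(g - c)^2] is nonnegative, [c] being the mean of [g]. *)
Lemma dot_le_mean (g : R -> R) s t : s < t ->
  lambda.-integrable `]s, t] (EFin \o g) ->
  lambda.-integrable `]s, t] (EFin \o (fun x => g x ^+ 2)) ->
  (\int[lambda]_(x in `]s, t]) g x) ^+ 2 <= (t - s) * \int[lambda]_(x in `]s, t]) (g x ^+ 2).
Proof.
move=> st gi g2i; set G := \int[lambda]_(x in _) g x; set G2 := \int[lambda]_(x in _) (g x ^+ 2).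
have D0 : 0 < t - s by rewrite subr_gt0.
have mD : measurable (`]s, t]%classic : set (measurableTypeR R)) by exact: measurable_itv.
have lD : fine (lambda `]s, t]%classic) = t - s by rewrite lebesgue_measure_itv /= lte_fin st.
pose c := G / (t - s).
have ci : lambda.-integrable `]s, t] (EFin \o cst (c ^+ 2)).
  apply: integrable_const => //.
  have : (lambda `]s, t]%classic < +oo)%E by rewrite lebesgue_measure_itv /= lte_fin st ltry.
  exact.
have := @Rintegral_ge0 _ _ _ lambda `]s, t]%classic (fun x => (g x - c) ^+ 2) (fun x _ => sqr_ge0 _).
have -> : \int[lambda]_(x in `]s, t]) ((g x - c) ^+ 2) = G2 - 2 * c * G + c ^+ 2 * (t - s).
  under eq_Rintegral do rewrite sqrrB.
  have i1 : lambda.-integrable `]s, t] (EFin \o (fun x => (2 * c) * g x)).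
    by have := integrableZl mD (2 * c) gi.
  rewrite (@eq_Rintegral _ _ _ lambda _ (fun x => g x ^+ 2 - (2 * c) * g x + cst (c ^+ 2) x)); last first.
    by move=> x _ /=; ring.
  rewrite RintegralD//; last first.
    rewrite (_ : EFin \o _ = (fun x => (g x ^+ 2)%:E - (2 * c * g x)%:E)%E); last by [].
    exact: integrableB.
  rewrite RintegralB// RintegralZl//.
  rewrite (_ : \int[lambda]_(x in `]s, t]) cst (c ^+ 2) x = c ^+ 2 * (t - s)) ?Rintegral_cst ?lD//.
have -> : G2 - 2 * c * G + c ^+ 2 * (t - s) = ((t - s) * G2 - G ^+ 2) / (t - s).
  by rewrite /c; field; rewrite gt_eqF.
by rewrite pmulr_lge0 ?invr_gt0// subr_ge0.
Qed.

Lemma primitive_integrable eta g i (D : set R) : primitive_of eta g -> measurable D ->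
  lambda.-integrable D (EFin \o (fun x => g x ord0 i)).
Proof. by move=> [gi _] mD; apply: integrableS (gi i). Qed.

Lemma primitive_measurable eta g (D : set R) : primitive_of eta g -> measurable D ->
  measurable_fun D (fun x => enorm (g x) ^+ 2).
Proof.
move=> gp mD.
under eq_fun do rewrite enorm_sqr_sum.
apply: measurable_sum => i; apply: measurable_funX.
apply/measurable_EFinP.
exact: measurable_int (primitive_integrable i gp mD).
Qed.

Lemma primitive_incr eta g s t : primitive_of eta g ->
  0 <= s -> s <= t -> t <= T%:num ->
  lambda.-integrable J (EFin \o (fun x => enorm (g x) ^+ 2)) ->
  enorm (eta (clamp T t) - eta (clamp T s)) ^+ 2 <=
    (t - s) * \int[lambda]_(x in `]s, t]) enorm (g x) ^+ 2.
Proof.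
move=> gp s0 + tT g2; rewrite le_eqVlt => /predU1P[<-|st].
  by rewrite subrr enorm0 expr0n subrr mul0r.
have mD : measurable (`]s, t]%classic : set (measurableTypeR R)) by exact: measurable_itv.
have DJ : `]s, t]%classic `<=` J.
  move=> x; rewrite /= !in_itv /= => /andP[h1 h2].
  by rewrite (le_trans s0 (ltW h1)) (le_trans h2 tT).
have g2D : lambda.-integrable `]s, t] (EFin \o (fun x => enorm (g x) ^+ 2)).
  by apply: integrableS g2 => //; exact: measurable_itv.
have gi2 i : lambda.-integrable `]s, t] (EFin \o (fun x => g x ord0 i ^+ 2)).
  apply: (le_integrable mD _ _ g2D).
    apply/measurable_EFinP/measurable_funX.
    apply/measurable_EFinP.
    exact: measurable_int (primitive_integrable i gp mD).
  move=> x _ /=; rewrite lee_fin !ger0_norm ?sqr_ge0//.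
  by rewrite enorm_sqr_sum (bigD1 i)//= lerDl sumr_ge0// => j _; exact: sqr_ge0.
rewrite enorm_sqr_sum; under eq_Rintegral do rewrite enorm_sqr_sum.
rewrite Rintegral_sum// mulr_sumr; apply: ler_sum => i _.
rewrite !mxE (gp.2 i)// ?(ltW st)//.
exact: (@dot_le_mean (fun x => g x ord0 i) _ _ st (primitive_integrable i gp mD) (gi2 i)).
Qed.

Lemma ae_itvoo (a b : R) :
  {ae lambda, forall x, `[a, b]%classic x -> a < x < b}.
Proof.
have m1 c : measurable ([set c] : set (measurableTypeR R)) by exact: measurable_set1.
exists (([set a] : set (measurableTypeR R)) `|` [set b]); split.
- exact: measurableU.
- apply/eqP; rewrite eq_le measure_ge0 andbT.
  apply: (le_trans (measureU2 _ (m1 a) (m1 b))).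
  by rewrite [X in (X + _)%E]lebesgue_measure_set1 [X in (_ + X)%E]lebesgue_measure_set1 adde0.
- move=> x /= H; apply: contrapT => nx; apply: H.
  rewrite /= in_itv /= => /andP[x0 xT]; rewrite !lt_neqAle x0 xT !andbT.
  apply/andP; split; apply/eqP => E; apply: nx; [by left|by right].
Qed.

Lemma accel_ae eta g :
  {ae lambda, forall x, 0 < x < T%:num -> quot eta x h @[h --> 0^'] --> g x} ->
  (\int[lambda]_(s in J) (enorm (accel eta s) ^+ 2)%:E =
   \int[lambda]_(s in J) (enorm (g s) ^+ 2)%:E)%E.
Proof.
move=> gq; apply: integral_congr_ae.
apply: filterS2 gq (ae_itvoo 0 T%:num); first exact: (ae_filter_ringOfSetsType lambda).
by move=> x Hx H0 /H0/Hx/quot_accel->.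
Qed.

(** Cauchy-Schwarz on each interval bounds the squared increment of [eta] by the length times the
    increment of [h], the primitive of the squared derivative; [energy_le_nondecreasing]
    concludes. *)
Theorem kinetic_of_accel eta : abs_continuous eta ->
  (\int[lambda]_(s in J) (enorm (accel eta s) ^+ 2)%:E < +oo)%E ->
  kinetic eta (fine (\int[lambda]_(s in J) (enorm (accel eta s) ^+ 2)%:E)).
Proof.
move=> ace fin; have [g gp gq] := abs_continuous_primitive ace.
rewrite (accel_ae gq) in fin *.
have mJ : measurable (J : set (measurableTypeR R)) by exact: measurable_itv.
have g2 : lambda.-integrable J (EFin \o (fun x => enorm (g x) ^+ 2)).
  apply/integrableP; split; first by apply/measurable_EFinP; exact: primitive_measurable gp mJ.
  apply: le_lt_trans fin; apply: ge0_le_integral => //.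
  - by apply/measurableT_comp => //; by apply/measurable_EFinP; exact: primitive_measurable gp mJ.
  - by apply/measurable_EFinP; exact: primitive_measurable gp mJ.
  - by move=> x _ /=; rewrite ger0_norm// sqr_ge0.
have sub s t : 0 <= s -> t <= T%:num -> lambda.-integrable `]s, t] (EFin \o (fun x => enorm (g x) ^+ 2)).
  move=> s0 tT; apply: (integrableS mJ _ _ g2); first exact: measurable_itv.
  move=> x; rewrite /= !in_itv /= => /andP[h1 h2].
  by rewrite (le_trans s0 (ltW h1)) (le_trans h2 tT).
pose h t := \int[lambda]_(x in `]0, clampr 0 T%:num t]) enorm (g x) ^+ 2.
have hB s t : s <= t -> h t - h s = \int[lambda]_(x in `]clampr 0 T%:num s, clampr 0 T%:num t]) enorm (g x) ^+ 2.
  move=> st; have /andP[s0 sT] := clampr_itv s (ltW T0).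
  have /andP[t0 tT] := clampr_itv t (ltW T0).
  rewrite /h (Rintegral_itvB (sub _ _ _ _))//.
  by rewrite bnd_simp; exact: clampr_homo.
have hE : h T%:num - h 0 = fine (\int[lambda]_(s in J) (enorm (g s) ^+ 2)%:E)%E.
  rewrite hB// !clampr_id ?lexx ?(ltW T0)//.
  by rewrite Rintegral_itv_obnd_cbnd//; exact: sub.
rewrite -hE -[h _ - _]mul1r; apply: energy_le_nondecreasing => // [x y xy|s t st].
  by rewrite -subr_ge0 hB// Rintegral_ge0// => z _; exact: sqr_ge0.
rewrite mul1r hB// !clampr_id ?time_itv//.
have := primitive_incr gp (time_ge0 s) st (time_leT t) g2.
by rewrite !clampK.
Qed.

Let quot_near eta x (l : 'rV[R]_n) : quot eta x h @[h --> 0^'] --> l ->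
  forall e, 0 < e -> exists2 d, 0 < d & forall y, `|y - x| < d ->
    enorm (eta (clamp T y) - eta (clamp T x) - (y - x) *: l) <= e * `|y - x|.
Proof.
move=> H e e0.
have /H : nbhs l [set v | enorm (v - l) < e] by exact: near_rV e0 _.
rewrite /nbhs /= /dnbhs /within /=.
move=> /nbhs_ballP[d /= d0 Hd]; exists d => // y yx.
have [->|yx0] := eqVneq y x; first by rewrite !subrr scale0r subrr enorm0 normr0 mulr0.
have yx1 : y - x != 0 by rewrite subr_eq0.
have := Hd (y - x); rewrite /ball /= sub0r normrN => /(_ yx yx1) /ltW.
rewrite /quot subrK => le_e.
have -> : eta (clamp T y) - eta (clamp T x) - (y - x) *: l =
    (y - x) *: ((y - x)^-1 *: (eta (clamp T y) - eta (clamp T x)) - l).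
  by rewrite scalerBr scalerA divff// scale1r.
by rewrite enormZ mulrC ler_wpM2r.
Qed.

Let r N k : R := T%:num * (k%:R / N.+1%:R).

Let r_le N k l : (k <= l)%N -> r N k <= r N l.
Proof. by move=> kl; rewrite ler_wpM2l// ler_wpM2r ?invr_ge0 ?ler_nat. Qed.

Let r0 N : r N 0 = 0. Proof. by rewrite /r mul0r mulr0. Qed.
Let rN N : r N N.+1 = T%:num. Proof. by rewrite /r divff// mulr1. Qed.
Let rB N k : r N k.+1 - r N k = T%:num / N.+1%:R.
Proof. by rewrite /r -addn1 natrD; ring. Qed.

Let r_cell N x : 0 < x -> x <= T%:num -> exists2 k, (k < N.+1)%N & r N k < x <= r N k.+1.
Proof.
move=> x0 xT; have ex : exists k, x <= r N k.+1 by exists N; rewrite rN.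
case: (ex_minnP ex) => k xk kmin; exists k.
  by rewrite ltnS kmin// rN.
rewrite xk andbT; case: k xk kmin => [_ _|k _ kmin]; first by rewrite r0.
by rewrite ltNge; apply/negP => /kmin; rewrite ltnn.
Qed.

(** On the regular subdivision into [N.+1] cells, the squared difference quotients form a step
    function [q N] whose integral is a discrete energy, at most [E]. It tends almost everywhere to
    the squared derivative, and Fatou's lemma applies. *)
Theorem accel_of_kinetic eta E : kinetic eta E ->
  (\int[lambda]_(s in J) (enorm (accel eta s) ^+ 2)%:E <= E%:E)%E.
Proof.
move=> H; have [g gp gq] := abs_continuous_primitive (kinetic_abs_continuous H).
rewrite (accel_ae gq).
have mJ : measurable (J : set (measurableTypeR R)) by exact: measurable_itv.
pose I N k : set (measurableTypeR R) := `]r N k, r N k.+1]%classic.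
pose h N : R := T%:num / N.+1%:R.
have h0 N : 0 < h N by rewrite divr_gt0.
pose D N k := eta (clamp T (r N k.+1)) - eta (clamp T (r N k)).
pose c N k := enorm ((h N)^-1 *: D N k) ^+ 2.
have c0 N k : 0 <= c N k by exact: sqr_ge0.
pose q N x := (\sum_(k < N.+1) (c N k * \1_(I N k) x)%:E)%E.
have qE N x k : (k < N.+1)%N -> r N k < x <= r N k.+1 -> q N x = (c N k)%:E.
  move=> kN xk; rewrite /q (bigD1 (Ordinal kN))//= big1 ?adde0.
    by rewrite indicE mem_set ?mulr1//= /I /= in_itv.
  move=> j jk; rewrite indicE memNset ?mulr0//= /I /= in_itv /= => /andP[j1 j2].
  have [k1 k2] := andP xk; case/negP: jk; apply/eqP/val_inj => /=.
  apply/eqP; rewrite eqn_leq; apply/andP; split; rewrite leqNgt; apply/negP => lt.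
    by have := lt_le_trans j1 k2; rewrite ltNge r_le.
  by have := lt_le_trans k1 j2; rewrite ltNge r_le.
have mI N k : measurable (I N k) by exact: measurable_itv.
have mq N k : measurable_fun J (fun x => (c N k * \1_(I N k) x)%:E).
  by apply/measurable_EFinP; apply: measurable_funM; [exact: measurable_cst|exact: measurable_indic (mI N k)].
have q0 N x : (0 <= q N x)%E.
  by apply: sume_ge0 => k _; rewrite lee_fin mulr_ge0// indicE.
have qlim : {ae lambda, forall x, J x -> (enorm (g x) ^+ 2)%:E = limn_einf (q^~ x)}.
  apply: filterS2 gq (ae_itvoo 0 T%:num); first exact: (ae_filter_ringOfSetsType lambda).
  move=> x Hx H0 /H0 x0T; have /andP[x0 xT] := x0T; have qn := quot_near (Hx x0T).
  apply/esym; suff /cvg_limn_einf_sup[] : q^~ x @ \oo --> (enorm (g x) ^+ 2)%:E by [].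
  have /choice[kk kkP] : forall N, exists k, (k < N.+1)%N /\ r N k < x <= r N k.+1.
    by move=> N; have [k] := r_cell N x0 (ltW xT); exists k.
  rewrite (_ : q^~ x = EFin \o (fun N => c N (kk N))); last first.
    by apply/funext => N /=; have [k1 k2] := kkP N; exact: qE.
  apply: cvg_EFin; first exact: nearW.
  have lim1 : enorm ((h N)^-1 *: D N (kk N)) @[N --> \oo] --> enorm (g x).
    apply/cvgrPdist_le => e e0; have [d d0 Hd] := qn e e0.
    have dT : 0 < d / T%:num by rewrite divr_gt0.
    near=> N; have hd : h N < d.
      rewrite /h mulrC -ltr_pdivlMr//; near: N; exact: (near_infty_natSinv_lt (PosNum dT)).
    have [k1 /andP[k2 k3]] := kkP N.
    have rh : r N (kk N).+1 - r N (kk N) = h N by exact: rB.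
    set y1 := r N (kk N).+1 in k3 rh *; set y0 := r N (kk N) in k2 rh *.
    have := Hd y1; rewrite ger0_norm ?subr_ge0// => /(_ _)/wrap[|d1]; first by lra.
    have := Hd y0; rewrite ler0_norm ?subr_le0 ?(ltW k2)// => /(_ _)/wrap[|d2]; first by lra.
    apply: le_trans (enorm_sub_le _ _) _; rewrite enormB.
    have -> : (h N)^-1 *: D N (kk N) - g x = (h N)^-1 *: (D N (kk N) - h N *: g x).
      by apply/rowP => i; rewrite !mxE; field; rewrite gt_eqF.
    rewrite enormZ [`|_|]ger0_norm; last by rewrite invr_ge0 ltW.
    rewrite ler_pdivrMl // [leRHS]mulrC.
    (* The cell brackets [x], so its increment splits at [x] into two increments to which
       differentiability at [x] applies; their lengths add up to [h N]. *)
    have -> : D N (kk N) - h N *: g x = (eta (clamp T y1) - eta (clamp T x) - (y1 - x) *: g x)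
       - (eta (clamp T y0) - eta (clamp T x) - (y0 - x) *: g x).
      by rewrite /D -/y1 -/y0 -rh; apply/rowP => i; rewrite !mxE; ring.
    apply: le_trans (enormBle _ _) _; apply: le_trans (lerD d1 d2) _.
    by rewrite -mulrDr ler_wpM2l ?(ltW e0)//; lra.
  by rewrite expr2; under eq_fun do rewrite /c expr2; exact: cvgM.
rewrite (integral_congr_ae qlim).
have iq N : (\int[lambda]_(x in J) q N x <= E%:E)%E.
  rewrite /q ge0_integral_sum//; [|by move=> k; exact: mq|by move=> k x _; rewrite lee_fin mulr_ge0// indicE].
  have lI k : (k < N.+1)%N -> lambda (I N k `&` J) = (h N)%:E.
    move=> kN; rewrite setIidl.
      by rewrite lebesgue_measure_itv /= lte_fin -subr_gt0 rB h0 -EFinB rB.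
    move=> x; rewrite /I /= !in_itv /= => /andP[x1 x2]; apply/andP; split.
      by rewrite -(r0 N) ltW// (le_lt_trans _ x1)// r_le.
    by rewrite -(rN N) (le_trans x2)// r_le.
  have -> : (\sum_(k < N.+1) \int[lambda]_(x in J) (c N k * \1_(I N k) x)%:E =
      (\sum_(k < N.+1) enorm (D N k) ^+ 2 / h N)%:E)%E.
    rewrite -sumEFin; apply: eq_bigr => k _.
    under eq_integral do rewrite EFinM.
    rewrite ge0_integralZl//; [|by apply/measurable_EFinP; exact: measurable_indic|by rewrite lee_fin].
    rewrite (_ : (\int[_]_(x in _) _ = (h N)%:E)%E); last by rewrite integral_indic//; exact: lI.
    rewrite -EFinM /c enormZ exprMn [`|_|]ger0_norm; last by rewrite invr_ge0 ltW.
    by congr (_%:E); field; rewrite gt_eqF.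
  rewrite lee_fin.
  pose s := [seq (clamp T (r N k), clamp T (r N k.+1)) | k <- iota 0 N.+1].
  have rid k : (k <= N.+1)%N -> set_val (clamp T (r N k)) = r N k.
    by move=> kN; rewrite clamp_id// -(rN N) -{1}(r0 N) !r_le.
  have fs : tfamily s.
    rewrite tfamilyP /s -map_comp /ifamily all_map pairwise_map; apply/andP; split.
      apply/allP => k; rewrite mem_iota add0n => /andP[_ kN] /=.
      rewrite !rid//; last exact: ltnW.
      by apply/and3P; split; [rewrite -(r0 N); exact: r_le|exact: r_le|rewrite -(rN N); exact: r_le].
    apply: (@sub_in_pairwise _ [pred k | (k < N.+1)%N] ltn).
    - move=> i j /= iN jN ij; rewrite /= !rid// ?(ltnW iN)// ?(ltnW jN)//.
      by rewrite /apart /= r_le.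
    - by apply/allP => k; rewrite mem_iota add0n => /andP[_].
    - by rewrite -(sorted_pairwise ltn_trans); exact: iota_ltn_sorted.
  apply: le_trans (H s fs); rewrite /s big_map -/(index_iota 0 N.+1) big_mkord.
  by apply: ler_sum => k _; rewrite !rid// ?(ltnW (ltn_ord k))// rB.
apply: le_trans (fatou _ _ _ _) _ => //.
- by move=> N; apply: emeasurable_sum => k; exact: mq.
- rewrite limn_einf_lim; apply: lime_le; first exact: is_cvg_einfs.
  apply: nearW => N; apply: le_trans (iq N).
  by apply: ereal_inf_lbound; exists N => /=.
Unshelve. all: by end_near. Qed.

End riesz.

(** * Strict differentiability *)

Section derivatives.
Context {R : realType} {n : nat}.
Implicit Types (f : R -> R) (X : R -> 'rV[R]_n) (v : 'rV[R]_n).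

Lemma is_derive_eps f (x l : R) : is_derive x 1 f l <->
  forall e, 0 < e -> exists2 d, 0 < d & forall y, `|y - x| < d ->
    `|f y - f x - (y - x) * l| <= e * `|y - x|.
Proof.
split=> [fl e e0|H].
  have : h^-1 *: (f (h *: 1 + x) - f x) @[h --> 0^'] --> l.
    by rewrite -(@derive_val _ _ _ _ _ _ _ fl); exact: (@ex_derive _ _ _ _ _ _ _ fl).
  move=> /cvgrPdist_le /(_ e e0); rewrite near_withinE => /nbhs_ballP[d /= d0 dH].
  exists d => // y yx; have [->|yx0] := eqVneq y x; first by rewrite !subrr mul0r subrr normr0 mulr0.
  have yx1 : y - x != 0 by rewrite subr_eq0.
  have := dH (y - x); rewrite /ball /= sub0r normrN => /(_ yx yx1).
  rewrite [_ *: 1]mulr1 subrK distrC => le_e.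
  rewrite (_ : f y - f x - (y - x) * l = (y - x) * ((y - x)^-1 * (f y - f x) - l)); last by field.
  by rewrite normrM mulrC ler_wpM2r.
have : h^-1 *: (f (h *: 1 + x) - f x) @[h --> 0^'] --> l.
  apply/cvgrPdist_le => e e0; rewrite near_withinE; have [d d0 Hd] := H e e0.
  apply/nbhs_ballP; exists d => // h; rewrite /ball /= sub0r normrN => hd h0.
  have := Hd (h + x); rewrite addrK => /(_ hd).
  rewrite [h *: 1]mulr1 [X in _ -> X <= _]distrC.
  have -> : f (h + x) - f x - h * l = h * (h^-1 * (f (h + x) - f x) - l) by field.
  by rewrite normrM mulrC ler_pM2r ?normr_gt0.
by move=> cl; split; [exact: cvgP cl|exact: cvg_lim cl].
Qed.

Lemma is_derive_ext f f' (x l l' : R) : f = f' -> l = l' -> is_derive x 1 f l -> is_derive x 1 f' l'.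
Proof. by move=> -> ->. Qed.

Definition vderive X (x : R) v :=
  forall e, 0 < e -> exists2 d, 0 < d & forall y, `|y - x| < d ->
    enorm (X y - X x - (y - x) *: v) <= e * `|y - x|.

Lemma vderiveP X x v : vderive X x v <->
  forall i, is_derive x 1 (fun t => X t ord0 i) (v ord0 i).
Proof.
split=> [H i|H e e0].
  apply/is_derive_eps => e /H[d d0 Hd]; exists d => // y /Hd; apply: le_trans.
  by have := coord_le_enorm (X y - X x - (y - x) *: v) i; rewrite !mxE.
have n0 : 0 < n.+1%:R :> R by [].
have e1 : 0 < e / n.+1%:R by rewrite divr_gt0.
have Hn : \forall d \near (0 : R)^'+, forall i, forall y, `|y - x| < d ->
    `|X y ord0 i - X x ord0 i - (y - x) * v ord0 i| <= e / n.+1%:R * `|y - x|.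
  apply: filter_forall => i; have /is_derive_eps/(_ _ e1)[d d0 Hd] := H i.
  near=> d'; move=> y yx; apply: Hd; apply: lt_trans yx _; near: d'; exact: nbhs_right_lt.
have [d [Hd d0]] := filter_ex (filterI Hn (nbhs_right_gt (0 : R))).
exists d => // y yd.
have := enorm_le_coord (v := X y - X x - (y - x) *: v) (e := e / n.+1%:R * `|y - x|).
move=> /(_ _ _)/wrap[| |/le_trans]; first by rewrite mulr_ge0// ltW.
  by move=> i; rewrite !mxE; exact: Hd.
apply; rewrite mulrA ler_wpM2r// mulrCA ler_piMr ?(ltW e0)//.
by rewrite ler_pdivrMr// mul1r ler_nat.
Unshelve. all: by end_near. Qed.

Lemma vderive_cont X x v : vderive X x v -> forall e, 0 < e ->
  exists2 d, 0 < d & forall y, `|y - x| < d -> enorm (X y - X x) < e.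
Proof.
move=> H e e0; have [d d0 Hd] := H 1 ltr01.
have c0 : 0 < 1 + enorm v by rewrite ltr_pwDl ?enorm_ge0.
exists (Num.min d (e / (1 + enorm v))); first by rewrite lt_min d0 divr_gt0.
move=> y; rewrite lt_min => /andP[/Hd yd]; rewrite ltr_pdivlMr// => ye; apply: le_lt_trans ye.
rewrite -(subrK ((y - x) *: v) (X y - X x)); apply: le_trans (enormD _ _) _.
by rewrite enormZ mulrDr mulr1 lerD// -[leRHS]mul1r.
Qed.

(** Strict differentiability: both points vary near [y], instead of one of them being [y]. *)
Definition strict_grad (f : 'rV[R]_n -> R) (y p : 'rV[R]_n) :=
  forall e, 0 < e -> exists2 d, 0 < d & forall a b, enorm (a - y) < d -> enorm (b - y) < d ->
    `|f b - f a - dotv p (b - a)| <= e * enorm (b - a).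

Lemma strict_grad_chain (f : 'rV[R]_n -> R) X x v p : strict_grad f (X x) p -> vderive X x v ->
  is_derive x 1 (f \o X) (dotv p v).
Proof.
move=> fp Xv; apply/is_derive_eps => e e0.
have c0 : 0 < 1 + enorm v by rewrite ltr_pwDl ?enorm_ge0.
have p0 : 0 < 1 + enorm p by rewrite ltr_pwDl ?enorm_ge0.
have e1 : 0 < e / 2 / (1 + enorm v) by rewrite !divr_gt0.
have e2 : 0 < e / 2 / (1 + enorm p) by rewrite !divr_gt0.
have [d1 d10 H1] := fp _ e1.
have [d2 d20 H2] := vderive_cont Xv d10.
have [d3 d30 H3] := Xv _ e2.
have [d4 d40 H4] := Xv _ ltr01.
exists (Num.min d2 (Num.min d3 d4)); first by rewrite !lt_min d20 d30.
move=> y; rewrite !lt_min => /and3P[y2 y3 y4].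
have yx : enorm (X y - X x) <= (1 + enorm v) * `|y - x|.
  rewrite -(subrK ((y - x) *: v) (X y - X x)); apply: le_trans (enormD _ _) _.
  by rewrite enormZ mulrDl [_ * enorm v]mulrC lerD// H4.
have xx : enorm (X x - X x) < d1 by rewrite subrr enorm0.
have a1 := H1 _ _ xx (H2 y y2).
have a2 := H3 y y3.
have -> : (f \o X) y - (f \o X) x - (y - x) * dotv p v =
   (f (X y) - f (X x) - dotv p (X y - X x)) + dotv p (X y - X x - (y - x) *: v).
  by rewrite /= !(dotvBr, dotvZr); ring.
apply: le_trans (ler_normD _ _) _; rewrite (splitr e) mulrDl; apply: lerD.
  apply: le_trans a1 _; apply: le_trans (ler_wpM2l (ltW e1) yx) _.
  by rewrite mulrA divfK ?gt_eqF.
apply: le_trans (cauchy_schwarz _ _) _.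
apply: le_trans (ler_wpM2l (enorm_ge0 _) a2) _.
rewrite mulrA ler_wpM2r// mulrCA -ler_pdivlMl ?divr_gt0//.
by rewrite mulVf ?gt_eqF ?divr_gt0// ler_pdivrMr// mul1r lerDr.
Qed.

Lemma mean_value (g dg : R -> R) (a b : R) : a <= b ->
  (forall s : R, a <= s <= b -> is_derive s 1 g (dg s)) ->
  exists2 c, a <= c <= b & g b - g a = dg c * (b - a).
Proof.
rewrite le_eqVlt => /predU1P[<-|ab] H.
  by exists a; rewrite ?lexx// !subrr mulr0.
have [| |c] := @MVT R g dg a b ab.
- by move=> s; rewrite in_itv /= => /andP[s1 s2]; apply/H; rewrite !ltW.
- apply: derivable_within_continuous => s; rewrite in_itv /= => /H h.
  exact: (@ex_derive _ _ _ _ _ _ _ h).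
by rewrite in_itv /= => /andP[c1 c2] E; exists c; rewrite ?ltW.
Qed.

(** From [a] to [b] one coordinate at a time, through the points [w k] that take their first [k]
    coordinates from [b]; the mean value theorem applies along each basis vector, and these segments
    stay in the cube on which the partial derivatives are nearly constant. *)
Lemma C1_strict_grad (U : set 'rV[R]_n) (f : 'rV[R]_n -> R) (y : 'rV[R]_n) : open U -> C1_on U f -> U y ->
  strict_grad f y (grad f y).
Proof.
move=> oU fU Uy e e0.
have n0 : 0 < n.+1%:R :> R by [].
have e1 : 0 < e / n.+1%:R by rewrite divr_gt0.
have [d d0 Hd] : exists2 d, 0 < d & forall w : 'rV[R]_n, (forall i, `|w ord0 i - y ord0 i| < d) ->
    U w /\ forall i, `|partial i f w - partial i f y| < e / n.+1%:R.
  have : \forall w \near y, U w /\ forall i, `|partial i f w - partial i f y| < e / n.+1%:R.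
    have o1 : \forall w \near y, U w by exact: open_nbhs_nbhs.
    have o2 : \forall w \near y, forall i, `|partial i f w - partial i f y| < e / n.+1%:R.
      apply: (@filter_forall _ _ _ _ (nbhs_filter y)) => i; have [_ /cvgrPdist_lt/(_ _ e1)] := fU i y Uy.
      by apply: filterS => w; rewrite distrC.
    by near=> w; split; near: w.
  move=> /nbhs_ballP[d /= d0 dH]; exists d => // w wy; apply: dH; split=> // i j.
  by rewrite (ord1 i) /ball /= distrC.
exists d => // a b ay bY.
pose w (k : nat) : 'rV[R]_n := \row_i if (i < k)%N then b ord0 i else a ord0 i.
have wd k (i : 'I_n) : `|w k ord0 i - y ord0 i| < d.
  rewrite mxE; case: ifP => _.
    by apply: le_lt_trans bY; have := coord_le_enorm (b - y) i; rewrite !mxE.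
  by apply: le_lt_trans ay; have := coord_le_enorm (a - y) i; rewrite !mxE.
have wS (i : 'I_n) : w i.+1 = w i + (b ord0 i - a ord0 i) *: basis_vec i.
  apply/rowP => j; rewrite !mxE eqxx /= ltnS leq_eqVlt -val_eqE /=.
  case: ltngtP => ij; rewrite ?mulr1 ?mulr0 ?addr0//.
  by rewrite (val_inj ij) addrC subrK.
have step (i : 'I_n) : `|f (w i.+1) - f (w i) - (b ord0 i - a ord0 i) * grad f y ord0 i| <=
    e / n.+1%:R * enorm (b - a).
  set c := b ord0 i - a ord0 i.
  have ball_s (s : R) : 0 <= s <= 1 -> forall j, `|(w i + (s * c) *: basis_vec i) ord0 j - y ord0 j| < d.
    move=> /andP[s0 s1] j; have [->|ji] := eqVneq j i; last first.
      rewrite !mxE eqxx /= (negPf ji) mulr0 addr0.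
      by have := wd i j; rewrite mxE.
    rewrite !mxE ltnn !eqxx mulr1.
    have -> : a ord0 i + s * c - y ord0 i = (1 - s) * (a - y) ord0 i + s * (b - y) ord0 i.
      by rewrite /c !mxE; ring.
    apply: le_lt_trans (ler_normD _ _) _; rewrite !normrM (ger0_norm s0) (@ger0_norm _ (1 - s)) ?subr_ge0//.
    have k1 := le_lt_trans (coord_le_enorm (a - y) i) ay.
    have k2 := le_lt_trans (coord_le_enorm (b - y) i) bY.
    have [->|sn0] := eqVneq s 0; first by rewrite subr0 mul1r mul0r addr0.
    have -> : d = (1 - s) * d + s * d by ring.
    by apply: ler_ltD; [rewrite ler_wpM2l ?subr_ge0// ltW|rewrite ltr_pM2l// lt_neqAle eq_sym sn0].
  pose g s := f (w i + (s * c) *: basis_vec i).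
  pose dg s := partial i f (w i + (s * c) *: basis_vec i) * c.
  have gd (s : R) : 0 <= s <= 1 -> is_derive s 1 g (dg s).
    move=> /ball_s/Hd[Uw _].
    have h1 : is_derive (s * c) 1 (fun u => f (w i + u *: basis_vec i)) (partial i f (w i + (s * c) *: basis_vec i)).
      have [dw _] := fU i _ Uw.
      have E : (fun h : R => h^-1 *: (f (w i + (h *: 1 + s * c) *: basis_vec i) - f (w i + (s * c) *: basis_vec i))) =
          (fun h : R => h^-1 *: (f (h *: basis_vec i + (w i + (s * c) *: basis_vec i)) - f (w i + (s * c) *: basis_vec i))).
        by apply/funext => h; rewrite [h *: 1]mulr1 scalerDl addrCA.
      by split; rewrite /derivable /partial /derive /= E.
    have h2 : is_derive s 1 (fun u => u * c) c.
      apply: (is_derive_ext _ _ (is_deriveM (is_derive_id s 1) (is_derive_cst c s 1))).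
        by apply/funext => u.
      by rewrite scaler0 add0r [c *: 1]mulr1.
    exact: (@is_derive1_comp R (fun u => f (w i + u *: basis_vec i)) (fun u => u * c) s _ c h1 h2).
  have [th /ball_s/Hd[_ /(_ i)pp]] := mean_value ler01 gd.
  rewrite /g mul1r mul0r scale0r addr0 -wS subr0 mulr1 => ->; rewrite /dg.
  rewrite mulrC -mulrBr normrM mulrC; apply: ler_pM => //; first by rewrite mxE ltW.
  by have := coord_le_enorm (b - a) i; rewrite !mxE.
have w0 : w 0 = a by apply/rowP => i; rewrite mxE.
have wn : w n = b by apply/rowP => i; rewrite mxE ltn_ord.
have -> : f b - f a - dotv (grad f y) (b - a) =
    \sum_(i < n) (f (w i.+1) - f (w i) - (b ord0 i - a ord0 i) * grad f y ord0 i).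
  rewrite big_split /= sumrN; congr (_ - _).
    by rewrite -(big_mkord xpredT (fun k => f (w k.+1) - f (w k))) telescope_sumr// wn w0.
  by apply: eq_bigr => i _; rewrite mulrC !mxE.
apply: le_trans (ler_norm_sum _ _ _) _; apply: le_trans (ler_sum _ (fun i _ => step i)) _.
rewrite sumr_const card_ord -mulrnAl ler_wpM2r ?enorm_ge0// -mulr_natl.
by rewrite mulrCA ler_piMr ?(ltW e0)// ler_pdivrMr// mul1r ler_nat.
Unshelve. all: by end_near. Qed.

End derivatives.

(** * Derivatives on the closed time interval *)

Section time_derivative.
Context {R : realType} {n : nat} {T : {posnum R}}.
Implicit Types (xi eta : time T -> 'rV[R]_n).

Lemma is_derivative_ofP xi eta : is_derivative_of xi eta <->
  forall t e, 0 < e -> exists2 d, 0 < d & forall s, `|set_val s - set_val t| < d ->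
    enorm (xi s - xi t - (set_val s - set_val t) *: eta t) <= e * `|set_val s - set_val t|.
Proof.
have scale (t s : time T) : set_val s - set_val t != 0 ->
    enorm (xi s - xi t - (set_val s - set_val t) *: eta t) =
    `|set_val s - set_val t| * enorm ((set_val s - set_val t)^-1 *: (xi s - xi t) - eta t).
  by move=> st; rewrite -enormZ; congr enorm; apply/rowP => i; rewrite !mxE; field.
split=> [H t e e0|H t].
  have /H : nbhs (eta t) [set v | enorm (v - eta t) < e] by apply: near_rV e0 _.
  move=> /time_near[d d0 Hd]; exists d => // s st.
  have [/val_inj->|ne] := eqVneq (set_val s) (set_val t).
    by rewrite !subrr scale0r subr0 enorm0 normr0 mulr0.
  rewrite scale ?subr_eq0// mulrC ler_wpM2r//; apply/ltW/Hd => //.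
move=> U /rV_near[e e0 eU]; apply/time_near.
have e2 : 0 < e / 2 by rewrite divr_gt0.
have [d d0 Hd] := H t _ e2; exists d => // s st sn.
have ne : set_val s - set_val t != 0 by rewrite subr_eq0; apply: contra_neq sn => /val_inj.
apply: eU; have := Hd s st.
rewrite scale// mulrC ler_pM2r ?normr_gt0// => /le_lt_trans; apply.
by rewrite ltr_pdivrMr// ltr_pMr// ltrDl.
Qed.

(** Beyond the endpoints the curve follows its tangent, so that one-sided derivatives become
    two-sided. *)
Definition extend xi eta (x : R) := xi (clamp T x) + (x - set_val (clamp T x)) *: eta (clamp T x).

Lemma extend_id xi eta t : extend xi eta (set_val t) = xi t.
Proof. by rewrite /extend clampK subrr scale0r addr0. Qed.

Lemma vderive_extend xi eta x : is_derivative_of xi eta ->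
  (forall t e, 0 < e -> exists2 d, 0 < d & forall s, `|set_val s - set_val t| < d -> enorm (eta s - eta t) <= e) ->
  0 <= x <= T%:num -> vderive (extend xi eta) x (eta (clamp T x)).
Proof.
move=> /is_derivative_ofP D ce x0T e e0.
have e2 : 0 < e / 2 by rewrite divr_gt0.
have [d1 d10 H1] := D (clamp T x) _ e2; have [d2 d20 H2] := ce (clamp T x) _ e2.
exists (Num.min d1 d2); first by rewrite lt_min d10.
move=> y; rewrite lt_min => /andP[y1 y2].
set t := clamp T x in H1 H2 *; set s := clamp T y.
have tx : set_val t = x by rewrite clamp_id.
have st : `|set_val s - set_val t| <= `|y - x|.
  exact: clampr_lip.
have ys : `|y - set_val s| <= `|y - x|.
  have /andP[x0 xT] := x0T; rewrite /s clampE /clampr; clear -x0 xT.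
  have [yT|yT] := leP y T%:num; last first.
    by rewrite max_r// !ger0_norm; lra.
  have [y0|y0] := leP 0 y; first by rewrite subrr normr0 normr_ge0.
  by rewrite !ler0_norm; lra.
have k1 := H1 s (le_lt_trans st y1); have k2 := H2 s (le_lt_trans st y2).
rewrite /extend -/t -/s tx subrr scale0r addr0.
have -> : xi s + (y - set_val s) *: eta s - xi t - (y - x) *: eta t =
  (xi s - xi t - (set_val s - set_val t) *: eta t) + (y - set_val s) *: (eta s - eta t).
  by rewrite tx; apply/rowP => i; rewrite !mxE; ring.
apply: le_trans (enormD _ _) _; rewrite (splitr e) mulrDl; apply: lerD.
  by apply: le_trans k1 _; rewrite ler_wpM2l ?(ltW e2).
by rewrite enormZ mulrC; apply: ler_pM => //; exact: enorm_ge0.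
Qed.

Lemma is_derivative_of_restrict (X H : R -> 'rV[R]_n) :
  (forall t : time T, vderive X (set_val t) (H (set_val t))) ->
  is_derivative_of (fun t : time T => X (set_val t)) (fun t => H (set_val t)).
Proof.
move=> XH; apply/is_derivative_ofP => t e /(XH t)[d d0 Hd]; exists d => // s; exact: Hd.
Qed.

End time_derivative.

(** * Boundary charts *)

Section vector_analysis.
Context {R : realType} {n : nat}.
Implicit Types (x y u v w p q a b : 'rV[R]_n) (f : 'rV[R]_n -> R) (e d : R).

Lemma cvg_enorm (u : nat -> 'rV[R]_n) y : u @ \oo --> y <->
  forall e, 0 < e -> \forall k \near \oo, enorm (u k - y) < e.
Proof.
split=> [uy e e0|H U /rV_near[e e0 eU]].
  have : nbhs y [set v | enorm (v - y) < e] by apply: near_rV e0 _.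
  by move=> /uy.
by rewrite /nbhs /=; apply: filterS (H e e0) => k; exact: eU.
Qed.

Lemma rV_extraction (u : nat -> 'rV[R]_n) M : (forall k, enorm (u k) <= M) ->
  exists2 phi : nat -> nat, (forall k, (phi k < phi k.+1)%N) &
  exists y, forall e, 0 < e -> \forall k \near \oo, enorm (u (phi k) - y) < e.
Proof.
move=> uM; pose a k j := if unpickle j is Some i then u k ord0 i else 0.
have [k j|phi phi_mono [p pP]] := @diagonal_extraction R a (fun=> `|M|).
  rewrite /a; case: unpickle => [i|]; last by rewrite normr0.
  by apply: le_trans (coord_le_enorm _ _) _; apply: le_trans (uM k) (ler_norm _).
exists phi => //; exists (\row_i p (pickle i)); apply/cvg_enorm.
apply: cvg_rV => i; rewrite mxE.
by have := pP (pickle i); rewrite /a; under eq_fun do rewrite pickleK.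
Qed.

Lemma enorm_cvg_le (u : nat -> 'rV[R]_n) y a C :
  (forall e, 0 < e -> \forall k \near \oo, enorm (u k - y) < e) ->
  (\forall k \near \oo, enorm (u k - a) <= C) -> enorm (y - a) <= C.
Proof.
move=> uy ua; apply/ler_addgt0Pr => e e0.
have [k [k1 k2]] := filter_ex (filterI (uy e e0) ua).
by apply: le_trans (enorm_dist y (u k) a) _; rewrite addrC lerD// enormB ltW.
Qed.

Definition vcont_at (g : 'rV[R]_n -> 'rV[R]_n) y := forall e, 0 < e ->
  exists2 d, 0 < d & forall w, enorm (w - y) < d -> enorm (g w - g y) < e.

Lemma C1_vcont_grad U f y : C1_on U f -> U y -> vcont_at (grad f) y.
Proof.
move=> fU Uy e e0.
have c : grad f w @[w --> y] --> grad f y.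
  apply: (@cvg_rV _ _ _ _ (nbhs_filter y)) => i; rewrite mxE.
  by under eq_fun do rewrite mxE; exact: (fU i y Uy).2.
have : nbhs (grad f y) [set v | enorm (v - grad f y) < e] by apply: near_rV e0 _.
by move=> /c/rV_near[d d0 H]; exists d.
Qed.

(** Both claims come from one extraction: a sequence of counterexamples accumulates in the closed
    ball at a point where [g] is continuous. *)
Lemma closed_ball_unif (g : 'rV[R]_n -> 'rV[R]_n) x rho :
  (forall y, enorm (y - x) <= rho -> vcont_at g y) ->
  (exists M, forall y, enorm (y - x) <= rho -> enorm (g y) <= M) /\
  (forall e, 0 < e -> exists2 d, 0 < d & forall a b, enorm (a - x) <= rho ->
     enorm (b - x) <= rho -> enorm (a - b) < d -> enorm (g a - g b) <= e).
Proof.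
move=> gc.
have ext (u : nat -> 'rV[R]_n) : (forall k, enorm (u k - x) <= rho) ->
    exists2 phi : nat -> nat, (forall k, (phi k < phi k.+1)%N) &
    exists2 y, vcont_at g y & forall e, 0 < e -> \forall k \near \oo, enorm (u (phi k) - y) < e.
  move=> ux; have [|phi phi_mono [y uy]] := @rV_extraction u (rho + enorm x).
    by move=> k; rewrite -(subrK x (u k)); apply: le_trans (enormD _ _) _; rewrite lerD2r.
  by exists phi => //; exists y => //; apply/gc/(enorm_cvg_le uy); exact: nearW.
split.
  apply: contrapT => /forallNP H.
  have /choice[u uP] : forall k : nat, exists y, enorm (y - x) <= rho /\ k%:R < enorm (g y).
    by move=> k; have /existsNP[y /not_implyP[y1 /negP]] := H k%:R; rewrite -ltNge; exists y.
  have [phi phi_mono [y gy uy]] := ext u (fun k => (uP k).1).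
  have [d d0 Hd] := gy 1 ltr01.
  have [N _ NP] := uy d d0.
  pose K := (N + Num.truncn (enorm (g y) + 1)%R)%N.+1.
  have /Hd : enorm (u (phi K) - y) < d by apply: NP; rewrite /= /K -addnS leq_addr.
  have : (K%:R <= enorm (g (u (phi K)))).
    apply/ltW/(le_lt_trans _ (uP (phi K)).2); rewrite ler_nat; exact: increasing_geS.
  have : enorm (g y) + 1 < K%:R.
    apply: lt_le_trans (truncnS_gt _) _; rewrite ler_nat /K ltnS; exact: leq_addl.
  have := enormD (g (u (phi K)) - g y) (g y); rewrite subrK; lra.
move=> e e0; apply: contrapT => /forall2NP H.
have /choice[u uP] : forall k : nat, exists ab : 'rV[R]_n * 'rV[R]_n,
    [/\ enorm (ab.1 - x) <= rho, enorm (ab.2 - x) <= rho, enorm (ab.1 - ab.2) < k.+1%:R^-1 &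
        e < enorm (g ab.1 - g ab.2)].
  move=> k; have [/negP|/existsNP[a /existsNP[b]]] := H k.+1%:R^-1.
    by rewrite invr_gt0 ltr0Sn.
  move=> /not_implyP[h1 /not_implyP[h2 /not_implyP[h3 /negP]]]; rewrite -ltNge => h4.
  by exists (a, b).
have [phi phi_mono [y gy uy]] : exists2 phi : nat -> nat, (forall k, (phi k < phi k.+1)%N) &
    exists2 y, vcont_at g y & forall e, 0 < e -> \forall k \near \oo, enorm ((u (phi k)).1 - y) < e.
  by apply: (ext (fun k => (u k).1)) => k; have [] := uP k.
have e2 : 0 < e / 2 by rewrite divr_gt0.
have [d d0 Hd] := gy _ e2; have d2 : 0 < d / 2 by rewrite divr_gt0.
have [k [k1 k2]] := filter_ex (filterI (uy _ d2) (near_infty_natSinv_lt (PosNum d2))).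
have [h1 h2 h3 h4] := uP (phi k).
have h3' : enorm ((u (phi k)).1 - (u (phi k)).2) < d / 2.
  apply: lt_trans h3 (le_lt_trans _ k2).
  by rewrite lef_pV2 ?posrE// ler_nat ltnS increasing_geS.
have /Hd a1 : enorm ((u (phi k)).1 - y) < d by lra.
have /Hd a2 : enorm ((u (phi k)).2 - y) < d.
  by apply: le_lt_trans (enorm_dist _ (u (phi k)).1 _) _; rewrite enormB; lra.
have := enorm_dist (g (u (phi k)).1) (g y) (g (u (phi k)).2).
by rewrite [in X in _ <= X -> _](enormB (g y)); lra.
Qed.

(** Let [p] be the component of [g] orthogonal to [w]. The test vectors [p] plus a small multiple of
    [w] are allowed, and in the limit they give [dotv p p <= 0]. *)
Lemma half_space_polar w g : w != 0 ->
  (forall u, 0 < dotv w u -> dotv g u <= 0) -> exists2 c, 0 <= c & g = - c *: w.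
Proof.
move=> w0 H; have ww : 0 < dotv w w by rewrite -enorm_sqr exprn_gt0// enorm_gt0.
have gw : dotv g w <= 0 by exact: H.
pose c := - dotv g w / dotv w w.
have c0 : 0 <= c by rewrite /c divr_ge0 ?oppr_ge0// ltW.
exists c => //; pose p := g + c *: w.
have pw : dotv w p = 0.
  by rewrite /p dotvDr dotvZr /c (dotvC w g) divfK ?gt_eqF// subrr.
suff p0 : enorm p = 0 by apply/eqP; rewrite -subr_eq0 scaleNr opprK; apply/eqP/enorm_eq0.
have pp : dotv p p <= 0.
  apply/ler_addgt0Pr => e e0; rewrite add0r.
  have K0 : 0 < 1 - dotv g w by lra.
  have := H (p + (e / (1 - dotv g w)) *: w).
  rewrite dotvDr dotvZr pw add0r mulr_gt0 ?divr_gt0// => /(_ isT).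
  have -> : dotv g (p + (e / (1 - dotv g w)) *: w) = dotv p p + e / (1 - dotv g w) * dotv g w.
    rewrite dotvDr dotvZr; congr (_ + _).
    rewrite {2}/p dotvDl dotvZl pw mulr0 addr0//.
  have -> : e / (1 - dotv g w) * dotv g w = e / (1 - dotv g w) - e by field; rewrite gt_eqF.
  have : 0 < e / (1 - dotv g w) by rewrite divr_gt0.
  lra.
by apply/eqP; rewrite -sqrf_eq0 enorm_sqr; apply/eqP/le_anti; rewrite pp -enorm_sqr sqr_ge0.
Qed.

Lemma strict_grad_pos f y p u : strict_grad f y p -> 0 < dotv p u ->
  exists2 d, 0 < d & forall t, 0 < t < d -> f y < f (y + t *: u).
Proof.
move=> fp pu; have c0 : 0 < 1 + enorm u by rewrite ltr_pwDl ?enorm_ge0.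
have e0 : 0 < dotv p u / (1 + enorm u) by rewrite divr_gt0.
have [d d0 Hd] := fp _ e0.
exists (d / (1 + enorm u)); first by rewrite divr_gt0.
move=> t /andP[t0]; rewrite ltr_pdivlMr// => td.
have yy : enorm (y - y) < d by rewrite subrr enorm0.
have yE : y + t *: u - y = t *: u by rewrite addrC addKr.
have /(Hd _ _ yy) : enorm (y + t *: u - y) < d.
  rewrite yE enormZ (ger0_norm (ltW t0)); apply: le_lt_trans td.
  by rewrite ler_wpM2l ?(ltW t0)// lerDr.
rewrite yE enormZ (ger0_norm (ltW t0)) dotvZr => le1.
have lt1 : dotv p u / (1 + enorm u) * (t * enorm u) < t * dotv p u.
  rewrite mulrCA ltr_pM2l// mulrAC ltr_pdivrMr// ltr_pM2l//; lra.
have := le_lt_trans le1 lt1; rewrite ltr_norml => /andP[+ _].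
lra.
Qed.

Lemma strict_gradN f y p : strict_grad f y p -> strict_grad (fun w => - f w) y (- p).
Proof.
move=> fp e /fp[d d0 Hd]; exists d => // a b ay bY; apply: le_trans (Hd a b ay bY).
by rewrite dotvNl -[leRHS]normrN le_eqVlt; apply/orP; left; apply/eqP; congr (`|_|); ring.
Qed.

Lemma strict_grad_neg f y p u : strict_grad f y p -> dotv p u < 0 ->
  exists2 d, 0 < d & forall t, 0 < t < d -> f (y + t *: u) < f y.
Proof.
move=> /strict_gradN/strict_grad_pos H pu.
by have [|d d0 Hd] := H u; [rewrite dotvNl oppr_gt0|exists d => // t /Hd; rewrite ltrN2].
Qed.

Lemma ball_convex x rho a b (t : R) : enorm (a - x) < rho -> enorm (b - x) < rho ->
  0 <= t <= 1 -> enorm (a + t *: (b - a) - x) < rho.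
Proof.
move=> ax bx /andP[t0 t1].
have -> : a + t *: (b - a) - x = (1 - t) *: (a - x) + t *: (b - x).
  by apply/rowP => i; rewrite !mxE; ring.
apply: le_lt_trans (enormD _ _) _; rewrite !enormZ (ger0_norm t0) ger0_norm ?subr_ge0//.
have [->|tn0] := eqVneq t 0; first by rewrite subr0 mul1r mul0r addr0.
have -> : rho = (1 - t) * rho + t * rho by ring.
by apply: ler_ltD; [rewrite ler_wpM2l ?subr_ge0// ltW|rewrite ltr_pM2l// lt_neqAle eq_sym tn0].
Qed.

Lemma ball_mean_value f g x rho : (forall y, enorm (y - x) < rho -> strict_grad f y (g y)) ->
  forall a b, enorm (a - x) < rho -> enorm (b - x) < rho ->
  exists c, [/\ enorm (c - x) < rho, enorm (c - a) <= enorm (b - a) & f b - f a = dotv (g c) (b - a)].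
Proof.
move=> fg a b ax bx; pose X t := a + t *: (b - a).
have XD t : vderive X t (b - a).
  move=> e e0; exists 1 => // y _; rewrite (_ : _ - _ - _ = 0) ?enorm0 ?mulr_ge0 ?(ltW e0)//.
  by apply/rowP => i; rewrite !mxE; ring.
have XB (t : R) : 0 <= t <= 1 -> enorm (X t - x) < rho by exact: ball_convex.
have fX (t : R) : 0 <= t <= 1 -> is_derive t 1 (f \o X) (dotv (g (X t)) (b - a)).
  by move=> t01; apply: strict_grad_chain (XD t); exact/fg/XB.
have [t t01] := mean_value ler01 fX.
rewrite /= /X scale1r scale0r addr0 subr0 mulr1 [a + _]addrC subrK => fE; exists (X t).
split=> //; first exact: XB.
rewrite /X addrC addKr enormZ ger0_norm; last by case/andP: t01.
by case/andP: t01 => _ t1; rewrite ler_piMl ?enorm_ge0.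
Qed.

End vector_analysis.

(** Quantitative form of a [C^2] boundary on one ball. [chart_dir] makes [- e] an inward direction
    along which [phi] decreases at rate at least [1 / 2]; [chart_hess_unif] is a common modulus of
    continuity of the second derivatives, which a bound on them would not provide. *)
Record chart {R : realType} {n : nat} (A : set 'rV[R]_n) (x : 'rV[R]_n) (phi : 'rV[R]_n -> R)
    (e : 'rV[R]_n) (rho L : R) : Prop := Chart {
  chart_rho : 0 < rho ;
  chart_L : 0 <= L ;
  chart_in : forall y, enorm (y - x) < rho -> (A y <-> phi y < 0) ;
  chart_frontier : forall y, enorm (y - x) < rho -> (frontier A y <-> phi y = 0) ;
  chart_def : forall y, enorm (y - x) < rho -> exists U, defining_function A y U phi ;
  chart_dir : forall y, enorm (y - x) < rho -> 2^-1 <= dotv (grad phi y) e ;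
  chart_grad_le : forall y, enorm (y - x) < rho -> enorm (grad phi y) <= L ;
  chart_hess_le : forall i y, enorm (y - x) < rho -> enorm (grad (partial i phi) y) <= L ;
  chart_hess_unif : forall d, 0 < d -> exists2 s, 0 < s & forall i a b,
    enorm (a - x) < rho -> enorm (b - x) < rho -> enorm (a - b) < s ->
    enorm (grad (partial i phi) a - grad (partial i phi) b) <= d }.

Section charts.
Context {R : realType} {n : nat}.
Implicit Types (x y u v w p q a b : 'rV[R]_n) (f : 'rV[R]_n -> R) (d : R).
Variable A : set 'rV[R]_n.
Hypothesis oA : open A.

Lemma chart_exists x : C2_boundary A -> frontier A x ->
  exists phi e rho L, chart A x phi e rho L.
Proof.
move=> bA fx; have [U [phi [oU Ux [C1 C2] g0 UA]]] := bA x fx.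
(* Normalised so that the slope of [phi] along [e] is exactly 1 at [x]; it remains above [1 / 2]
   nearby. *)
pose e := (enorm (grad phi x) ^+ 2)^-1 *: grad phi x.
have gx : 0 < enorm (grad phi x) by apply/enorm_gt0/g0.
have [r1 r10 H1] := rV_near (open_nbhs_nbhs (conj oU Ux)).
have gx2 : 0 < enorm (grad phi x) / 2 by rewrite divr_gt0.
have [r2 r20 H2] := C1_vcont_grad C1 Ux gx2.
pose rho := Num.min r1 r2 / 2.
have rho0 : 0 < rho by rewrite divr_gt0// lt_min r10.
have rr : rho < Num.min r1 r2 by rewrite /rho ltr_pdivrMr// ltr_pMr ?ltr1n// lt_min r10.
have rU y : enorm (y - x) <= rho -> U y.
  by move=> yr; apply: H1; apply: le_lt_trans yr (lt_le_trans rr _); rewrite ge_min lexx.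
have r2U y : enorm (y - x) <= rho -> enorm (y - x) < r2.
  by move=> yr; apply: le_lt_trans yr (lt_le_trans rr _); rewrite ge_min lexx orbT.
have [[M1 B1] _] := closed_ball_unif (fun y yr => C1_vcont_grad C1 (rU y yr)).
have hess i := closed_ball_unif (fun y yr => C1_vcont_grad (C2 i) (rU y yr)).
have /choice[M2 B2] : forall i, exists M, forall y, enorm (y - x) <= rho -> enorm (grad (partial i phi) y) <= M.
  by move=> i; have [] := hess i.
pose L := Num.max 0 M1 + \sum_i Num.max 0 (M2 i).
have L0 : 0 <= \sum_i Num.max 0 (M2 i) by apply: sumr_ge0 => i _; rewrite le_max lexx.
exists phi, e, rho, L; split => //.
- by rewrite addr_ge0// le_max lexx.
- by move=> y /ltW/rU/UA[].
- by move=> y /ltW/rU/UA[].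
- by move=> y /ltW/rU Uy; exists U; split.
- move=> y /ltW/r2U/H2 yx.
  have -> : dotv (grad phi y) e = 1 + dotv (grad phi y - grad phi x) e.
    have -> : 1 = dotv (grad phi x) e by rewrite /e dotvZr -enorm_sqr mulVf// expf_neq0// gt_eqF.
    by rewrite dotvBl; ring.
  have := cauchy_schwarz (grad phi y - grad phi x) e.
  have -> : enorm e = (enorm (grad phi x))^-1.
    by rewrite /e enormZ ger0_norm ?invr_ge0 ?sqr_ge0// expr2 invfM -mulrA mulVf ?mulr1// gt_eqF.
  have : enorm (grad phi y - grad phi x) / enorm (grad phi x) < 2^-1.
    by rewrite ltr_pdivrMr// mulrC.
  move=> h1 /le_lt_trans/(_ h1); rewrite ltr_norml => /andP[+ _]; lra.
- move=> y /ltW/B1 h; apply: le_trans h _; rewrite /L -[leLHS]addr0 lerD// le_max lexx orbT//.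
- move=> i y /ltW/(B2 i) h; apply: le_trans h _; rewrite /L -[leLHS]add0r lerD// ?le_max ?lexx//.
  rewrite (bigD1 i)//= -[leLHS]addr0 lerD ?le_max ?lexx ?orbT//.
  by apply: sumr_ge0 => j _; rewrite le_max lexx.
move=> d d0; have Hn : \forall s \near (0 : R)^'+, forall i a b,
    enorm (a - x) <= rho -> enorm (b - x) <= rho -> enorm (a - b) < s ->
    enorm (grad (partial i phi) a - grad (partial i phi) b) <= d.
  apply: filter_forall => i; have [_ /(_ d d0)[s s0 Hs]] := hess i.
  near=> s'; move=> a b ax bx ab; apply: Hs => //; apply: lt_trans ab _; near: s'.
  exact: nbhs_right_lt.
have [s [Hs s0]] := filter_ex (filterI Hn (nbhs_right_gt (0 : R))).
by exists s => // i a b ax bx; apply: Hs; exact: ltW.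
Unshelve. all: by end_near. Qed.

Variables (x : 'rV[R]_n) (phi : 'rV[R]_n -> R) (e : 'rV[R]_n) (rho L : R).
Hypothesis cA : chart A x phi e rho L.
Local Notation "'B' y" := (enorm (y - x) < rho) (at level 10, y at level 9).

Lemma chart_strict y : B y -> strict_grad phi y (grad phi y).
Proof.
by move=> /(chart_def cA)[U [oU Uy [C1 _] _ _]]; exact: C1_strict_grad C1 Uy.
Qed.

Lemma chart_strict_partial i y : B y -> strict_grad (partial i phi) y (grad (partial i phi) y).
Proof.
by move=> /(chart_def cA)[U [oU Uy [_ C2] _ _]]; exact: C1_strict_grad (C2 i) Uy.
Qed.

Lemma chart_closure y : B y -> closure A y <-> phi y <= 0.
Proof.
move=> By; have h1 := chart_in cA By; have h2 := chart_frontier cA By; split.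
  move=> clA; have [/h1/ltW//|nA] := pselect (A y).
  rewrite (h2.1 _)//; split=> //; rewrite /interior; move=> /nbhs_singleton//.
rewrite le_eqVlt => /predU1P[/h2.2[]//|/h1.2 Ay]; exact: subset_closure.
Qed.

Lemma chart_lip a b : B a -> B b -> enorm (grad phi a - grad phi b) <= n%:R * L * enorm (a - b).
Proof.
move=> Ba Bb; rewrite -mulrA; apply: enorm_le_coord => [|i].
  by rewrite mulr_ge0 ?enorm_ge0 ?(chart_L cA).
rewrite !mxE.
have [c [Bc _ ->]] := ball_mean_value (fun y By => chart_strict_partial i By) Bb Ba.
apply: le_trans (cauchy_schwarz _ _) _; rewrite ler_wpM2r ?enorm_ge0//.
exact: chart_hess_le cA _ _ Bc.
Qed.

Lemma chart_taylor a b : B a -> B b ->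
  `|phi b - phi a - dotv (grad phi a) (b - a)| <= n%:R * L * enorm (b - a) ^+ 2.
Proof.
move=> Ba Bb; have [c [Bc ca ->]] := ball_mean_value (fun y By => chart_strict By) Ba Bb.
rewrite -dotvBl; apply: le_trans (cauchy_schwarz _ _) _.
rewrite expr2 mulrA ler_wpM2r ?enorm_ge0//; apply: le_trans (chart_lip Bc Ba) _.
by rewrite ler_wpM2l// mulr_ge0// (chart_L cA).
Qed.

Lemma chart_lip1 a b : B a -> B b -> `|phi b - phi a| <= L * enorm (b - a).
Proof.
move=> Ba Bb; have [c [Bc ca ->]] := ball_mean_value (fun y By => chart_strict By) Ba Bb.
apply: le_trans (cauchy_schwarz _ _) _; rewrite ler_wpM2r ?enorm_ge0//; exact: chart_grad_le cA _ Bc.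
Qed.

Lemma chart_push a (s : R) : B a -> B (a - s *: e) -> 0 <= s ->
  phi (a - s *: e) <= phi a - 2^-1 * s.
Proof.
move=> Ba Bb s0; have [c [Bc _ cE]] := ball_mean_value (fun y By => chart_strict By) Ba Bb.
have : 2^-1 * s <= - dotv (grad phi c) (a - s *: e - a).
  have -> : a - s *: e - a = - (s *: e) by rewrite addrC addKr.
  by rewrite dotvNr opprK dotvZr mulrC ler_wpM2l//; exact: chart_dir cA _ Bc.
by rewrite -cE; lra.
Qed.

Lemma chart_grad_gt0 y : B y -> 0 < enorm (grad phi y).
Proof.
by move=> /(chart_def cA)[U [oU Uy _ g0 _]]; apply/enorm_gt0/g0.
Qed.

End charts.

Section outward_normal.
Context {R : realType} {n : nat}.
Variable A : set 'rV[R]_n.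

(** Two defining functions have positively proportional gradients at [x]: in a direction where one
    decreases and the other increases to first order, nearby points would be both in [A] and outside
    it. *)
Lemma outward_normalE x U phi : frontier A x -> defining_function A x U phi ->
  outward_normal A x = (enorm (grad phi x))^-1 *: grad phi x.
Proof.
move=> fx D; rewrite /outward_normal; case: xgetP => [nu _|/(_ ((enorm (grad phi x))^-1 *: grad phi x))]; last first.
  by case; exists U, phi.
move=> [U' [psi [D' ->]]].
have [oU Ux [C1 _] g0 UA] := D; have [oU' Ux' [C1' _] g0' UA'] := D'.
have sphi := C1_strict_grad oU C1 Ux; have spsi := C1_strict_grad oU' C1' Ux'.
have phi0 : phi x = 0 by apply/(UA x Ux).2.
have psi0 : psi x = 0 by apply/(UA' x Ux').2.
have [| |c c0 gE] := @half_space_polar _ _ (- grad psi x) (grad phi x); first by rewrite oppr_eq0 g0'.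
  move=> u; rewrite dotvNl oppr_gt0 => pu; rewrite leNgt; apply/negP => qu.
  have [d1 d10 H1] := strict_grad_neg spsi pu; have [d2 d20 H2] := strict_grad_pos sphi qu.
  have [r1 r10 K1] := rV_near (open_nbhs_nbhs (conj oU Ux)).
  have [r2 r20 K2] := rV_near (open_nbhs_nbhs (conj oU' Ux')).
  have u0 : 0 < 1 + enorm u by rewrite ltr_pwDl ?enorm_ge0.
  have Hn : \forall t \near (0 : R)^'+, [/\ 0 < t, t < d1, t < d2, t < r1 / (1 + enorm u) & t < r2 / (1 + enorm u)].
    near=> t; split; near: t; [exact: nbhs_right_gt|exact: nbhs_right_lt|exact: nbhs_right_lt| |];
      apply: nbhs_right_lt; exact: divr_gt0.
  have [t [t0 t1 t2 t3 t4]] := filter_ex Hn.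
  have nr r : t < r / (1 + enorm u) -> enorm (x + t *: u - x) < r.
    rewrite ltr_pdivlMr//; apply: le_lt_trans; rewrite addrC addKr enormZ ger0_norm ?(ltW t0)//.
    by rewrite ler_wpM2l ?(ltW t0)// lerDr.
  have := H1 t; rewrite t0 t1 psi0 => /(_ isT)/(UA' _ (K2 _ (nr _ t4))).1.2.
  move=> /(UA _ (K1 _ (nr _ t3))).1.1; have := H2 t; rewrite t0 t2 phi0 => /(_ isT); lra.
have c1 : 0 < c.
  rewrite lt_neqAle c0 andbT eq_sym; apply/eqP => cz; case/eqP: (g0 x Ux).
  by rewrite gE cz oppr0 scale0r.
rewrite gE scalerN scaleNr opprK enormZ ger0_norm// invfM scalerA.
by rewrite mulrAC mulVf ?gt_eqF// mul1r.
Unshelve. all: by end_near. Qed.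

End outward_normal.

(** * Signed distance and condition (A) *)

Section nearest_point.
Context {R : realType} {n : nat}.
Implicit Types (x y u v w z h p : 'rV[R]_n) (A : set 'rV[R]_n).

Lemma dist_to_le A x z : A z -> dist_to A x <= enorm (x - z).
Proof.
move=> Az; apply: ge_inf; last by exists z.
by exists 0 => _ [y _ <-]; exact: enorm_ge0.
Qed.

Lemma le_dist_to A x c : A !=set0 -> (forall z, A z -> c <= enorm (x - z)) -> c <= dist_to A x.
Proof.
move=> [a Aa] H; apply: lb_le_inf; first by exists (enorm (x - a)), a.
by move=> _ [y /H + <-].
Qed.

Lemma nearest_point A x : closed A -> A !=set0 -> exists2 y, A y & dist_to A x = enorm (x - y).
Proof.
move=> cA A0; have [a Aa] := A0.
have hi : has_inf [set enorm (x - y) | y in A].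
  split; first by exists (enorm (x - a)), a.
  by exists 0 => _ [y _ <-]; exact: enorm_ge0.
have /choice[u uP] : forall k : nat, exists y, A y /\ enorm (x - y) < dist_to A x + k.+1%:R^-1.
  move=> k; have k0 : 0 < k.+1%:R^-1 :> R by rewrite invr_gt0.
  by have [_ [y Ay <-] yk] := inf_adherent k0 hi; exists y.
have [k|phi phi_mono [y uy]] := @rV_extraction _ _ u (dist_to A x + 1 + enorm x).
  rewrite -(subrK x (u k)); apply: le_trans (enormD _ _) _; rewrite lerD2r enormB.
  apply: le_trans (ltW (uP k).2) _; rewrite lerD2l invf_le1// ler1n//.
have Ay : A y.
  apply: (@closed_cvg _ _ \oo _ (fun k => u (phi k)) A) => //.
    by apply: nearW => k; exact: (uP (phi k)).1.
  exact/cvg_enorm.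
exists y => //; apply/le_anti; rewrite dist_to_le//=.
apply/ler_addgt0Pr => e e0; have e2 : 0 < e / 2 by rewrite divr_gt0.
have [k [k1 k2]] := filter_ex (filterI (uy _ e2) (near_infty_natSinv_lt (PosNum e2))).
have k3 : (phi k).+1%:R^-1 < e / 2.
  by apply: le_lt_trans k2; rewrite lef_pV2 ?posrE// ler_nat ltnS increasing_geS.
apply: le_trans (enorm_dist x (u (phi k)) y) _.
have h : enorm (x - u (phi k)) < dist_to A x + e / 2 by apply: lt_trans (uP (phi k)).2 _; rewrite ltrD2l.
lra.
Qed.

Lemma closed_frontier A : closed (frontier A).
Proof.
rewrite /frontier setDE; apply: closedI; first exact: closed_closure.
by apply: open_closedC; exact: open_interior.
Qed.

(** Let [y] be the point of the complement nearest to [x]. Points of the segment from [y] towards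
    [x] are nearer to [x], hence in [A], so [y] is on the frontier and at distance at least [r]. *)
Lemma ball_in_open A x r : open A -> A x -> (forall z, frontier A z -> r <= enorm (x - z)) ->
  forall w, enorm (x - w) < r -> A w.
Proof.
move=> oA Ax H w xw; apply: contrapT => nAw.
have [y nAy yE] := nearest_point x (open_closedC oA) (ex_intro (~` A) w nAw).
have xy : x != y by apply/eqP => E; apply: nAy; rewrite -E.
have D0 : 0 < enorm (x - y) by rewrite enorm_gt0// subr_eq0.
suff /H : frontier A y.
  by rewrite leNgt; case/negP; apply: le_lt_trans xw; rewrite -yE; exact: dist_to_le.
split; last by move=> /nbhs_singleton.
move=> U /rV_near[e e0 eU]; set D := enorm (x - y) in D0 yE.
pose s := Num.min (1 / 2) (e / (2 * D)).
have s0 : 0 < s by rewrite lt_min !divr_gt0// mulr_gt0.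
have s1 : s <= 1 / 2 by rewrite ge_min lexx.
have s2 : s * D <= e / 2.
  have : s <= e / (2 * D) by rewrite ge_min lexx orbT.
  by rewrite ler_pdivlMr ?mulr_gt0//; lra.
exists (y + s *: (x - y)); split.
  apply: contrapT => nA; have := dist_to_le (A := ~` A) x nA.
  rewrite yE -/D; have -> : x - (y + s *: (x - y)) = (1 - s) *: (x - y).
    by apply/rowP => i; rewrite !mxE; ring.
  rewrite enormZ ger0_norm; last by lra.
  by rewrite -/D -subr_ge0 mulrBl mul1r; have := mulr_gt0 s0 D0; lra.
apply: eU; rewrite addrC addKr enormZ -/D ger0_norm ?(ltW s0)//; lra.
Qed.

(** This is [2 D t <= D^2 + t^2] with [t] the norm of [w + h], once the square is expanded. *)
Lemma enormD_quadratic w h (D : R) : 0 < D -> enorm w = D ->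
  enorm (w + h) <= D + D^-1 * dotv w h + (2 * D)^-1 * enorm h ^+ 2.
Proof.
move=> D0 wD; have E : enorm (w + h) ^+ 2 = D ^+ 2 + 2 * dotv w h + enorm h ^+ 2.
  by rewrite -wD !enorm_sqr dotvDl !dotvDr (dotvC h w); ring.
have -> : D + D^-1 * dotv w h + (2 * D)^-1 * enorm h ^+ 2 = (D ^+ 2 + enorm (w + h) ^+ 2) / (2 * D).
  by rewrite E; field; rewrite gt_eqF.
rewrite ler_pdivlMr ?mulr_gt0//; have := sqr_ge0 (D - enorm (w + h)); nra.
Qed.

End nearest_point.

(** * Size and gradient of the signed distance inside the domain, near a boundary point *)

Section signed_distance.
Context {R : realType} {n : nat}.
Implicit Types (y u v w z h p : 'rV[R]_n) (r : R).
Variables (A : set 'rV[R]_n) (x0 : 'rV[R]_n) (phi : 'rV[R]_n -> R) (e : 'rV[R]_n) (rho L : R).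
Hypotheses (oA : open A) (cA : chart A x0 phi e rho L) (fx0 : frontier A x0).
Local Notation "'B' y" := (enorm (y - x0) < rho) (at level 10, y at level 9).

Let K := n%:R * L.
Let K0 : 0 <= K. Proof. by rewrite mulr_ge0// (chart_L cA). Qed.
Let nu y := (enorm (grad phi y))^-1 *: grad phi y.

Let nu1 y : B y -> enorm (nu y) = 1.
Proof.
move=> By; have g0 := chart_grad_gt0 cA By.
by rewrite /nu enormZ ger0_norm ?invr_ge0 ?enorm_ge0// mulVf ?gt_eqF.
Qed.

Let c0 : 0 < 2 * (1 + enorm e).
Proof. by rewrite mulr_gt0// ltr_pwDl ?enorm_ge0. Qed.

Let lam := (2 * (1 + enorm e))^-1.

Let grad_ge y : B y -> lam <= enorm (grad phi y).
Proof.
move=> By; have := le_trans (chart_dir cA By) (dotv_le _ _).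
move=> h; rewrite /lam -div1r ler_pdivrMr//; have := enorm_ge0 (grad phi y); lra.
Qed.

Let r0 := Num.min (rho / 4) (lam / (2 * (K + 1))).
Let r00 : 0 < r0.
Proof. by rewrite lt_min !divr_gt0 ?mulr_gt0 ?invr_gt0 ?(chart_rho cA)// ltr_wpDl. Qed.
Let r0rho : r0 <= rho / 4. Proof. by rewrite ge_min lexx. Qed.
Let r0lam : 2 * r0 * K <= lam.
Proof.
have : r0 <= lam / (2 * (K + 1)) by rewrite ge_min lexx orbT.
rewrite ler_pdivlMr ?mulr_gt0 ?ltr_wpDl//; have := r00; nra.
Qed.

(** In Taylor's formula at [y] the linear term has slope at least [lam] and the remainder is at most
    [K] times a square; inside a ball tangent at [y] of radius [r0], with [2 * r0 * K <= lam], the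
    linear term wins. This is the interior ball condition. *)
Let interior_ball y u : frontier A y -> enorm (y - x0) < rho / 2 ->
  enorm (u + r0 *: nu y) < r0 -> A (y + u).
Proof.
move=> fy yx ur; have rho0 := chart_rho cA.
have By : B y by lra.
have un : enorm u < rho / 2.
  rewrite -(addrK (r0 *: nu y) u); apply: le_lt_trans (enormBle _ _) _.
  rewrite enormZ nu1// mulr1 ger0_norm ?(ltW r00)//; have := r0rho; lra.
have Bu : B (y + u).
  rewrite -addrA [u - _]addrC addrA; apply: le_lt_trans (enormD _ _) _; lra.
apply/(chart_in cA Bu).
have phi0 : phi y = 0 by apply/(chart_frontier cA By).
have := chart_taylor cA By Bu; rewrite phi0 subr0 [y + u - y]addrC addKr -/K.
rewrite ler_norml => /andP[_]; set g := enorm (grad phi y).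
have g0 : 0 < g by have := chart_grad_gt0 cA By.
have gE : dotv (grad phi y) u = g * dotv (nu y) u.
  by rewrite /nu dotvZl mulrA mulfV ?gt_eqF// mul1r.
have : enorm (u + r0 *: nu y) ^+ 2 < r0 ^+ 2.
  by rewrite ltr_pXn2r ?nnegrE ?enorm_ge0 ?(ltW r00).
have -> : enorm (u + r0 *: nu y) ^+ 2 = enorm u ^+ 2 + 2 * r0 * dotv (nu y) u + r0 ^+ 2.
  move: (nu y) (nu1 By) => q q1.
  by rewrite enorm_sqr dotvDl !dotvDr !(dotvZl, dotvZr) -!enorm_sqr q1 (dotvC u); ring.
rewrite gE; have lg : lam <= g by exact: grad_ge.
set q := dotv _ _; set s := enorm u ^+ 2 => h1 h2.
have s0 : 0 <= s by exact: sqr_ge0.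
have q0 : 2 * r0 * q < - s by lra.
have r1 := r00.
have q1 : q < 0 by nra.
have h3 : g * q <= lam * q by nra.
have h4 : 2 * r0 * (K * s) <= lam * s by rewrite mulrA ler_wpM2r.
have lam0 : 0 < lam by rewrite invr_gt0.
have h5 : 2 * r0 * (lam * q) < - (lam * s) by nra.
have : 2 * r0 * phi (y + u) < 0 by nra.
by rewrite pmulr_rlt0// mulr_gt0.
Qed.

(** Points nearer to [x] than [y] are in [A], so the slope of [phi] at [y] is nonpositive in every
    direction that shortens the distance to [x]; by [half_space_polar], [x - y] is then opposite to
    the gradient. *)
Let nearest x : A x -> enorm (x - x0) < r0 -> exists y,
  [/\ frontier A y, enorm (y - x0) < rho / 2, 0 < enorm (x - y), enorm (x - y) <= enorm (x - x0) &
      dist_to (frontier A) x = enorm (x - y) /\ x - y = - enorm (x - y) *: nu y].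
Proof.
move=> Ax xx0; have [y fy yE] := nearest_point x (@closed_frontier _ _ A) (ex_intro _ x0 fx0).
have yx : enorm (x - y) <= enorm (x - x0) by rewrite -yE; exact: dist_to_le.
have yx0 : enorm (y - x0) < rho / 2.
  by apply: le_lt_trans (enorm_dist _ x _) _; rewrite enormB; have := r0rho; lra.
have By : B y by have := chart_rho cA; lra.
have xy : x - y != 0.
  rewrite subr_eq0; apply/eqP => E; case: fy => _; apply; rewrite -E.
  exact: open_nbhs_nbhs.
have D0 := enorm_gt0 xy.
exists y; split=> //; split=> //.
have phi0 : phi y = 0 by apply/(chart_frontier cA By).
have sg := chart_strict cA By.
have inA w : enorm (x - w) < enorm (x - y) -> A w.
  apply: ball_in_open => // z fz; rewrite -yE; exact: dist_to_le.
have [u wu|c cge gE] := half_space_polar xy (g := grad phi y).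
  rewrite leNgt; apply/negP => gu; have [d d0 Hd] := strict_grad_pos sg gu.
  have U0 : 0 < 1 + enorm u ^+ 2 by rewrite ltr_pwDl ?sqr_ge0.
  have [t [t0 t1 t2]] : exists t, [/\ 0 < t, t < d & t < dotv (x - y) u / (1 + enorm u ^+ 2)].
    have q0 : 0 < dotv (x - y) u / (1 + enorm u ^+ 2) by rewrite divr_gt0.
    exists (Num.min d (dotv (x - y) u / (1 + enorm u ^+ 2)) / 2).
    have m0 : 0 < Num.min d (dotv (x - y) u / (1 + enorm u ^+ 2)) by rewrite lt_min d0.
    have m1 : Num.min d (dotv (x - y) u / (1 + enorm u ^+ 2)) / 2 < Num.min d (dotv (x - y) u / (1 + enorm u ^+ 2)).
      by rewrite ltr_pdivrMr// ltr_pMr// ltr1n.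
    split; first exact: divr_gt0.
      by apply: lt_le_trans m1 _; rewrite ge_min lexx.
    by apply: lt_le_trans m1 _; rewrite ge_min lexx orbT.
  have sm : enorm (x - (y + t *: u)) < enorm (x - y).
    rewrite -(@ltr_pXn2r _ 2)// ?nnegrE ?enorm_ge0//.
    have -> : x - (y + t *: u) = (x - y) - t *: u by apply/rowP => i; rewrite !mxE; ring.
    rewrite !enorm_sqr !(dotvBl, dotvBr, dotvZl, dotvZr).
    move: t2; rewrite ltr_pdivlMr// !(dotvBl, dotvBr, dotvZl, dotvZr) -enorm_sqr.
    rewrite !enorm_sqr (dotvC u x) (dotvC u y) => t2.
    by have := dotv_ge0 u; nra.
  have Atu := inA _ sm.
  have BT : B (y + t *: u).
    have := enorm_dist (y + t *: u) x x0; rewrite (enormB _ x); have := r0rho; have := chart_rho cA; lra.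
  by have := (chart_in cA BT).1 Atu; have := Hd t; rewrite t0 t1 phi0 => /(_ isT); lra.
have gg := chart_grad_gt0 cA By.
have gn : enorm (grad phi y) = c * enorm (x - y) by rewrite gE enormZ normrN ger0_norm.
have c1 : 0 < c by rewrite -(pmulr_lgt0 _ D0) -gn.
rewrite /nu gn gE !scalerA.
have -> : - enorm (x - y) * (c * enorm (x - y))^-1 * - c = 1 by field; rewrite !gt_eqF.
by rewrite scale1r.
Qed.

Let eventually_in x v : A x -> exists2 d, 0 < d & forall h : R, `|h| < d -> A (x + h *: v).
Proof.
move=> Ax; have [d d0 Hd] := rV_near (open_nbhs_nbhs (conj oA Ax)).
have v0 : 0 < 1 + enorm v by rewrite ltr_pwDl ?enorm_ge0.
exists (d / (1 + enorm v)); first by rewrite divr_gt0.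
move=> h; rewrite ltr_pdivlMr// => hd; apply: Hd; rewrite addrC addKr enormZ.
by apply: le_lt_trans hd; rewrite ler_wpM2l// lerDr.
Qed.

Lemma signed_dist_in x : A x -> signed_dist A x = - dist_to (frontier A) x.
Proof. by move=> Ax; rewrite /signed_dist mem_set. Qed.

(** The distance to the frontier is squeezed between two functions with the same first-order
    expansion at [x]: above, the distance to [y]; below, [r0] minus the distance to the centre of
    the interior ball at [y]. *)
Let grad_signed_dist x y : A x -> frontier A y -> enorm (y - x0) < rho / 2 ->
  0 < enorm (x - y) -> enorm (x - y) < r0 ->
  dist_to (frontier A) x = enorm (x - y) -> x - y = - enorm (x - y) *: nu y ->
  grad (signed_dist A) x = nu y.
Proof.
move=> Ax fy yx0; set D := enorm (x - y) => D0 Dr dE wE.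
have By : B y by have := chart_rho cA; lra.
have rD : 0 < r0 - D by rewrite subr_gt0.
have up h : dist_to (frontier A) (x + h) <= D - dotv (nu y) h + (2 * D)^-1 * enorm h ^+ 2.
  apply: le_trans (dist_to_le _ fy) _; rewrite -addrA [h - y]addrC addrA.
  apply: le_trans (enormD_quadratic _ D0 erefl) _.
  by rewrite wE dotvZl mulrA mulrN mulVf ?gt_eqF// mulN1r.
have far z : frontier A z -> r0 <= enorm (z - (y - r0 *: nu y)).
  move=> fz; rewrite leNgt; apply/negP => zr.
  have /(interior_ball fy yx0) : enorm ((z - y) + r0 *: nu y) < r0 by move: zr; rewrite opprB addrA addrAC.
  rewrite addrC subrK => Az; case: fz => _; apply; exact: open_nbhs_nbhs.
have low h : D - dotv (nu y) h - (2 * (r0 - D))^-1 * enorm h ^+ 2 <= dist_to (frontier A) (x + h).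
  apply: le_dist_to => [|z /far zr]; first by exists x0.
  have p1 : enorm ((r0 - D) *: nu y) = r0 - D by rewrite enormZ nu1// mulr1 gtr0_norm.
  have := enormD_quadratic h rD p1.
  have := enorm_dist z (x + h) (y - r0 *: nu y); rewrite (enormB z (x + h)).
  have -> : x + h - (y - r0 *: nu y) = (r0 - D) *: nu y + h.
    have -> : x = y + - D *: nu y by rewrite -wE addrC subrK.
    by move: (nu y) => q; apply/rowP => i; rewrite !mxE; ring.
  rewrite dotvZl mulrA mulVf ?gt_eqF// mul1r; lra.
pose C := (2 * D)^-1 + (2 * (r0 - D))^-1.
have C1 : 0 < (2 * D)^-1 by rewrite invr_gt0 mulr_gt0.
have C2 : 0 < (2 * (r0 - D))^-1 by rewrite invr_gt0 mulr_gt0.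
have both h : A (x + h) -> `|signed_dist A (x + h) - signed_dist A x - dotv (nu y) h| <= C * enorm h ^+ 2.
  move=> Ah; rewrite !signed_dist_in// dE /C; have := up h; have := low h.
  have h2 := sqr_ge0 (enorm h); set q := enorm h ^+ 2 in h2 *.
  have := mulr_ge0 (ltW C1) h2; have := mulr_ge0 (ltW C2) h2.
  by rewrite ler_norml mulrDl => *; apply/andP; split; lra.
apply/rowP => i; rewrite mxE; pose v := basis_vec i : 'rV[R]_n.
have nv : dotv (nu y) v = nu y ord0 i.
  rewrite /dotv (bigD1 i)//= big1 ?addr0 => [|j ji]; rewrite !mxE ?eqxx ?mulr1//.
  by rewrite (negPf ji) andbF mulr0.
have [d d0 Hd] := eventually_in v Ax.
pose g (h : R) := signed_dist A (x + h *: v).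
have gD : is_derive (0 : R) 1 g (nu y ord0 i).
  apply/is_derive_eps => q q0.
  have V0 : 0 < C * enorm v ^+ 2 + 1 by rewrite ltr_wpDl// mulr_ge0 ?sqr_ge0// addr_ge0 ?ltW.
  exists (Num.min d (q / (C * enorm v ^+ 2 + 1))); first by rewrite lt_min d0 divr_gt0.
  move=> h; rewrite subr0 lt_min => /andP[/Hd/both hd]; rewrite ltr_pdivlMr// => hq.
  rewrite /g scale0r addr0 -nv -dotvZr; apply: le_trans hd _.
  have -> : C * enorm (h *: v) ^+ 2 = `|h| * (`|h| * (C * enorm v ^+ 2)) by rewrite enormZ exprMn; ring.
  by rewrite [q * _]mulrC ler_wpM2l//; have := normr_ge0 h; lra.
rewrite -(@derive_val _ _ _ _ _ _ _ gD) /partial /derive /=.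
have -> // : (fun h : R => h^-1 *: (signed_dist A (h *: basis_vec i + x) - signed_dist A x)) =
  (fun h : R => h^-1 *: (g (h *: 1 + 0) - g 0)).
apply/funext => h; rewrite /g addr0 [h *: 1]mulr1 scale0r addr0.
by rewrite [_ + x]addrC.
Qed.

Lemma signed_dist_chart : exists d C : R, [/\ 0 < d, 0 <= C & forall x, A x -> enorm (x - x0) < d ->
  exists y, [/\ B y, enorm (x - y) <= C * - phi x, `|signed_dist A x| = enorm (x - y) &
    grad (signed_dist A) x = (enorm (grad phi y))^-1 *: grad phi y]].
Proof.
have rho0 := chart_rho cA; have L0 := chart_L cA.
have M0 : 0 < 1 + 2 * L * enorm e by rewrite ltr_pwDl// !mulr_ge0 ?enorm_ge0.
pose d := Num.min r0 (rho / 2 / (1 + 2 * L * enorm e)).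
have d0 : 0 < d by rewrite lt_min r00 !divr_gt0.
exists d, (2 * enorm e); split => [//||x Ax]; first by rewrite mulr_ge0 ?enorm_ge0.
rewrite lt_min => /andP[xr0 xr1]; have [y [fy yx0 D0 Dx [dE wE]]] := nearest Ax xr0.
have By : B y by lra.
have Bx : B x by have := r0rho; lra.
have phix : phi x < 0 by apply/(chart_in cA Bx).
exists y; split=> //; last 2 first.
- by rewrite signed_dist_in// dE normrN ger0_norm ?enorm_ge0.
- apply: (@grad_signed_dist x y Ax fy yx0 D0 _ dE wE); exact: le_lt_trans Dx xr0.
(* Moving by [s] along [e] raises [phi] by at least [- phi x] and so leaves [A]: the distance to the
   frontier is at most [s] times the norm of [e]. *)
pose s := 2 * - phi x.
have s0 : 0 <= s by rewrite /s; lra.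
have sx : enorm (s *: e) = 2 * enorm e * - phi x by rewrite enormZ ger0_norm// /s; ring.
have phi0 : phi x0 = 0 by apply/(chart_frontier cA) => //; rewrite subrr enorm0.
have phiL : - phi x <= L * enorm (x - x0).
  have B0 : B x0 by rewrite subrr enorm0.
  by have := chart_lip1 cA B0 Bx; rewrite phi0 subr0 ler_norml => /andP[]; lra.
have Bs : B (x + s *: e).
  rewrite addrAC; apply: le_lt_trans (enormD _ _) _; rewrite sx.
  move: xr1; rewrite ltr_pdivlMr// => xr1.
  have : 2 * enorm e * - phi x <= 2 * enorm e * (L * enorm (x - x0)) by rewrite ler_wpM2l// mulr_ge0 ?enorm_ge0.
  have := enorm_ge0 (x - x0); lra.
have Bs' : B (x + s *: e - s *: e) by rewrite addrK.
have := chart_push cA Bs Bs' s0; rewrite addrK => push.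
have nA : ~ A (x + s *: e) by move=> /(chart_in cA Bs); rewrite /s in push *; lra.
rewrite leNgt; apply/negP => lt; apply: nA; apply: (ball_in_open oA Ax (r := enorm (x - y))).
  by move=> z fz; rewrite -dE; exact: dist_to_le.
by rewrite opprD addrA subrr sub0r enormN sx.
Qed.

End signed_distance.

Section condition_A_chart.
Context {R : realType} {n : nat} {Omega : domain R n}.
Implicit Types (u : nat -> phase Omega) (z : phase Omega).

Lemma cvg_pos u z : u @ \oo --> z -> forall e, 0 < e ->
  \forall k \near \oo, enorm (pos (u k) - pos z) < e.
Proof.
move=> uz; apply/cvg_enorm; exact: (cvg_comp _ _ uz (@continuous_pos R n Omega z)).
Qed.

Lemma cvg_vel u z : u @ \oo --> z -> forall e, 0 < e ->
  \forall k \near \oo, enorm (vel (u k) - vel z) < e.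
Proof.
move=> uz; apply/cvg_enorm; exact: (cvg_comp _ _ uz (@continuous_vel R n Omega z)).
Qed.

(* Near a boundary point, condition (A) controls the defining function in
   place of the signed distance. *)
Lemma condition_A_chart (Theta : set (phase Omega)) u z phi e rho L :
  Theta `<=` @admissible R n Omega -> condition_A Theta ->
  (forall k, Theta (u k)) -> Theta z -> u @ \oo --> z -> frontier Omega (pos z) ->
  chart Omega (pos z) phi e rho L ->
  forall eps, 0 < eps -> \forall k \near \oo, [/\ 0 <= - phi (pos (u k)),
    (- phi (pos (u k)) = 0 -> Num.max (dotv (grad phi (pos (u k))) (vel (u k))) 0 = 0) &
    Num.max (dotv (grad phi (pos (u k))) (vel (u k))) 0 ^+ 3 <= eps * - phi (pos (u k))].
Proof.
move=> adm cA uT zT uz fz ch eps eps0.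
have oO : open (Omega : set 'rV[R]_n) by exact: domain_open.
have L0 := chart_L ch; have rho0 := chart_rho ch.
have [d [C [d0 C0 HC]]] := signed_dist_chart oO ch fz.
have B0 : enorm (pos z - pos z) < rho by rewrite subrr enorm0.
have phi0 : phi (pos z) = 0 by apply/(chart_frontier ch B0).
pose V := enorm (vel z) + 1; pose K := n%:R * L.
have K0 : 0 <= K by rewrite mulr_ge0.
have V0 : 0 < V by rewrite ltr_wpDl ?enorm_ge0.
(* [M1] serves the term given by condition (A). [M2] serves the change of the gradient of [phi]
   between a point and its nearest boundary point: this change is at most of order [a = - phi], and
   its cube is negligible against [a], which tends to 0. *)
pose M1 := 4 * L ^+ 3 * C + 1; pose M2 := 4 * (K * V * C) ^+ 3 * L ^+ 2 + 1.
have M10 : 0 < M1 by rewrite ltr_wpDl// !mulr_ge0 ?exprn_ge0.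
have KVC0 : 0 <= K * V * C by rewrite !mulr_ge0// ltW.
have M20 : 0 < M2 by rewrite ltr_wpDl// mulr_ge0 ?sqr_ge0// mulr_ge0// exprn_ge0.
have q0 : 0 < eps / 2 / M1 by rewrite !divr_gt0.
have s0 : 0 < Num.min 1 (eps / 2 / M2) by rewrite lt_min ltr01 !divr_gt0.
have hA := cA u z uT zT uz fz _ q0.
near=> k.
have xr : enorm (pos (u k) - pos z) < rho by near: k; exact: cvg_pos.
have xd : enorm (pos (u k) - pos z) < d by near: k; exact: cvg_pos.
have xs : enorm (pos (u k) - pos z) < Num.min 1 (eps / 2 / M2) by near: k; exact: cvg_pos.
have vV : enorm (vel (u k) - vel z) < 1 by near: k; exact: cvg_vel.
have hk : `|Num.max (dotv (vel (u k)) (grad (signed_dist Omega) (pos (u k)))) 0 ^+ 3| <=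
    eps / 2 / M1 * `|signed_dist Omega (pos (u k))| by near: k.
set x := pos (u k) in xr xd xs hk *; set v := vel (u k) in vV hk *.
have {}vV : enorm v <= V.
  by have := enormD (v - vel z) (vel z); rewrite subrK /V; lra.
have a0 : phi x <= 0 by apply/(chart_closure ch xr); exact: pos_closure.
(* On the frontier both sides vanish: [phi] is zero there, and admissibility makes the slope
   nonpositive. *)
have [Ox|nOx] := pselect ((domain_set Omega) x); last first.
  have fx : frontier Omega x.
    by split; [exact: pos_closure|move=> /nbhs_singleton].
  have phix : phi x = 0 by apply/(chart_frontier ch xr).
  have [U D] := chart_def ch xr.
  have := adm _ (uT k) fx; rewrite -/v -/x (outward_normalE fx D) dotvZr pmulr_rle0; last first.
    by rewrite invr_gt0; by have := chart_grad_gt0 ch xr.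
  rewrite dotvC => b0; rewrite phix oppr0 mulr0 max_r// expr0n; split => //.
have phix : phi x < 0 by apply/(chart_in ch xr).
split; [lra|lra|].
have [y [By Dx dE gE]] := HC x Ox xd.
set D := enorm (x - y) in Dx dE; have D0 : 0 <= D by exact: enorm_ge0.
set be := Num.max (dotv v (grad (signed_dist Omega) x)) 0 in hk.
have be0 : 0 <= be by rewrite le_max lexx orbT.
rewrite dE ger0_norm ?exprn_ge0// in hk.
set a := - phi x in Dx *; have a1 : 0 < a by rewrite /a; lra.
have b_le : Num.max (dotv (grad phi x) v) 0 <= K * V * D + L * be.
  rewrite ge_max; apply/andP; split; last by rewrite addr_ge0// !mulr_ge0// ltW.
  rewrite -(subrK (grad phi y) (grad phi x)) dotvDl; apply: lerD.
    apply: le_trans (dotv_le _ _) _; rewrite mulrAC; apply: ler_pM; rewrite ?enorm_ge0//.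
    by have := chart_lip ch xr By.
  have gy := chart_grad_gt0 ch By.
  have -> : dotv (grad phi y) v = enorm (grad phi y) * dotv v (grad (signed_dist Omega) x).
    by rewrite gE dotvZr mulrA mulfV ?gt_eqF// mul1r dotvC.
  apply: le_trans (_ : enorm (grad phi y) * be <= _).
    by rewrite ler_wpM2l ?enorm_ge0// /be le_max lexx.
  by rewrite ler_wpM2r//; have := chart_grad_le ch By.
have b0 : 0 <= Num.max (dotv (grad phi x) v) 0 by rewrite le_max lexx orbT.
have cube (p q : R) : 0 <= p -> 0 <= q -> (p + q) ^+ 3 <= 4 * (p ^+ 3 + q ^+ 3).
  move=> p0 q1; rewrite -subr_ge0.
  have -> : 4 * (p ^+ 3 + q ^+ 3) - (p + q) ^+ 3 = 3 * (p + q) * (p - q) ^+ 2 by ring.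
  by rewrite mulr_ge0 ?sqr_ge0// mulr_ge0// addr_ge0.
have P0 : 0 <= K * V * D by rewrite !mulr_ge0// ltW.
have Q0 : 0 <= L * be by rewrite mulr_ge0.
have h3 : Num.max (dotv (grad phi x) v) 0 ^+ 3 <= (K * V * D + L * be) ^+ 3.
  by rewrite ler_pXn2r ?nnegrE ?addr_ge0.
apply: le_trans h3 _; apply: le_trans (cube _ _ P0 Q0) _.
have aL : a <= L * enorm (x - pos z).
  by have := chart_lip1 ch B0 xr; rewrite phi0 subr0 ler_norml => /andP[+ _]; rewrite /a; lra.
move: xs; rewrite lt_min => /andP[x1 x2].
have DC : 0 <= C * a by rewrite mulr_ge0// ltW.
have t1 : 4 * (L * be) ^+ 3 <= eps / 2 * a.
  rewrite exprMn; apply: le_trans (_ : 4 * (L ^+ 3 * (eps / 2 / M1 * (C * a))) <= _).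
    rewrite ler_wpM2l// ler_wpM2l ?exprn_ge0//; apply: le_trans hk _.
    by rewrite ler_wpM2l// ltW.
  have -> : 4 * (L ^+ 3 * (eps / 2 / M1 * (C * a))) = (4 * L ^+ 3 * C / M1) * (eps / 2 * a) by ring.
  rewrite ler_piMl ?mulr_ge0 ?divr_ge0 ?(ltW eps0) ?(ltW a1)// ler_pdivrMr// mul1r /M1; lra.
have t2 : 4 * (K * V * D) ^+ 3 <= eps / 2 * a.
  have le1 : (K * V * D) ^+ 3 <= (K * V * (C * a)) ^+ 3.
    have KV0 : 0 <= K * V by rewrite mulr_ge0// ltW.
    by rewrite ler_pXn2r ?nnegrE ?(mulr_ge0 KV0)// ler_wpM2l.
  have a2 : a ^+ 2 <= L ^+ 2 * (eps / 2 / M2).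
    apply: le_trans (_ : (L * enorm (x - pos z)) ^+ 2 <= _).
      by rewrite ler_pXn2r ?nnegrE ?mulr_ge0 ?enorm_ge0// ltW.
    rewrite exprMn ler_wpM2l ?sqr_ge0// expr2; have := enorm_ge0 (x - pos z); nra.
  apply: le_trans (ler_wpM2l _ le1) _ => //.
  have -> : 4 * (K * V * (C * a)) ^+ 3 = 4 * (K * V * C) ^+ 3 * a ^+ 2 * a by ring.
  rewrite ler_wpM2r ?(ltW a1)//; apply: le_trans (_ : 4 * (K * V * C) ^+ 3 * (L ^+ 2 * (eps / 2 / M2)) <= _).
    by rewrite ler_wpM2l// mulr_ge0// exprn_ge0.
  have -> : 4 * (K * V * C) ^+ 3 * (L ^+ 2 * (eps / 2 / M2)) = (4 * (K * V * C) ^+ 3 * L ^+ 2 / M2) * (eps / 2) by ring.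
  rewrite ler_piMl ?divr_ge0 ?(ltW eps0)// ler_pdivrMr// mul1r /M2; lra.
rewrite mulrDr; lra.
Unshelve. all: by end_near. Qed.

End condition_A_chart.

(** * Bump and brake functions *)

Section scalar_functions.
Context {R : realType}.

Lemma is_derive_sqr_pos (y : R) : is_derive y 1 (fun x => Num.max 0 x ^+ 2) (2 * Num.max 0 y).
Proof.
apply/is_derive_eps => e e0; exists e => // x xy.
have sq : `|Num.max 0 x ^+ 2 - Num.max 0 y ^+ 2 - (x - y) * (2 * Num.max 0 y)| <= `|x - y| * `|x - y|.
  rewrite -normrM -expr2 [leRHS]ger0_norm ?sqr_ge0// ler_norml.
  have h1 := sqr_ge0 x; have h2 := sqr_ge0 y; have h3 := sqr_ge0 (x - y).
  have [x0|x0] := leP x 0; have [y0|y0] := leP y 0.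
  - by apply/andP; split; lra.
  - by have := mulr_le0_ge0 x0 (ltW y0) => ?; apply/andP; split; lra.
  - by have := mulr_ge0_le0 (ltW x0) y0 => ?; apply/andP; split; lra.
  - by apply/andP; split; lra.
by apply: le_trans sq _; rewrite ler_wpM2r// ltW.
Qed.

(** The square of the positive part of [1 - x^2 / tau^2]. Squaring makes the derivative Lipschitz
    across [tau]; flatness at 0 ensures that a perturbation multiplied by [chi] keeps its initial
    position and velocity. *)
Lemma bump_function (tau : R) : 0 < tau -> exists (chi dchi : R -> R) (C : R), [/\
  forall x : R, is_derive x 1 chi (dchi x),
  chi 0 = 1 /\ dchi 0 = 0,
  forall x : R, 0 <= x -> [/\ 0 <= chi x, chi x <= 1, x <= tau / 2 -> 2^-1 <= chi x & tau <= x -> chi x = 0],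
  0 <= C &
  forall x y : R, 0 <= x -> 0 <= y -> `|dchi x - dchi y| <= C * `|x - y|].
Proof.
move=> t0; have tn := gt_eqF t0; pose m x : R := Num.max 0 (1 - x ^+ 2 / tau ^+ 2).
exists (fun x => m x ^+ 2), (fun x => - (2 * x / tau ^+ 2) * (2 * m x)), (8 / tau ^+ 2).
have t2 : 0 < tau ^+ 2 by exact: exprn_gt0.
have c (x : R) : 0 <= x -> x * m x = Num.min x tau * (1 - Num.min x tau ^+ 2 / tau ^+ 2).
  move=> x0; rewrite /m; have [xt|xt] := leP x tau.
    by rewrite max_r// subr_ge0 ler_pdivrMr// mul1r ler_pXn2r ?nnegrE// ltW.
  rewrite divff ?expf_neq0 ?tn// subrr mulr0 max_l ?mulr0// subr_le0 ler_pdivlMr// mul1r.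
  by rewrite ler_pXn2r ?nnegrE// ltW.
split.
- move=> x; have d1 : is_derive x 1 (fun x : R => 1 - x ^+ 2 / tau ^+ 2) (- (2 * x / tau ^+ 2)).
    apply/is_derive_eps => e e0; exists (e * tau ^+ 2); first by rewrite mulr_gt0.
    move=> y yx; have -> : 1 - y ^+ 2 / tau ^+ 2 - (1 - x ^+ 2 / tau ^+ 2) - (y - x) * - (2 * x / tau ^+ 2) =
      - ((y - x) * (y - x) / tau ^+ 2) by field; rewrite tn.
    rewrite normrN !normrM normfV (ger0_norm (ltW t2)) mulrAC ler_wpM2r// ler_pdivrMr//; exact: ltW.
  have := @is_derive1_comp R (fun x => Num.max 0 x ^+ 2) _ x _ _ (is_derive_sqr_pos _) d1.
  by apply: is_derive_ext; rewrite // mulrC.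
- by rewrite /m !(expr0n, mul0r, mulr0, subr0, oppr0) max_r// expr1n.
- move=> x x0; have m0 : 0 <= m x by rewrite le_max lexx.
  have m1 : m x <= 1 by rewrite ge_max ler01 gerBl divr_ge0 ?sqr_ge0.
  split; first exact: sqr_ge0.
  + by rewrite expr_le1.
  + move=> xt; have : 3 / 4 <= m x; last by nra.
    rewrite le_max; apply/orP; right.
    have : x ^+ 2 / tau ^+ 2 <= 1 / 4; last by lra.
    rewrite ler_pdivrMr//; nra.
  + move=> tx; rewrite /m max_l ?expr0n// subr_le0 ler_pdivlMr// mul1r.
    by rewrite ler_pXn2r ?nnegrE// ltW.
- by rewrite divr_ge0// ltW.
move=> x y x0 y0.
have -> : - (2 * x / tau ^+ 2) * (2 * m x) - - (2 * y / tau ^+ 2) * (2 * m y) =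
   4 / tau ^+ 2 * (y * m y - x * m x) by ring.
rewrite !c// normrM ger0_norm; last by rewrite divr_ge0// ltW.
set p := Num.min x tau; set q := Num.min y tau.
have p0 : 0 <= p by rewrite le_min x0 ltW.
have q0 : 0 <= q by rewrite le_min y0 ltW.
have pt : p <= tau by rewrite ge_min lexx orbT.
have qt : q <= tau by rewrite ge_min lexx orbT.
have pq : `|q - p| <= `|x - y| by rewrite distrC; exact: min_lip.
have -> : q * (1 - q ^+ 2 / tau ^+ 2) - p * (1 - p ^+ 2 / tau ^+ 2) =
  (q - p) * (1 - (q ^+ 2 + q * p + p ^+ 2) / tau ^+ 2) by ring.
rewrite normrM; have -> : 8 / tau ^+ 2 * `|x - y| = 4 / tau ^+ 2 * (`|x - y| * 2) by ring.
rewrite ler_wpM2l ?divr_ge0 ?(ltW t2)//; apply: ler_pM => //.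
rewrite ler_norml; have h1 : 0 <= (q ^+ 2 + q * p + p ^+ 2) / tau ^+ 2.
  by rewrite divr_ge0 ?(ltW t2)//; nra.
have h2 : (q ^+ 2 + q * p + p ^+ 2) / tau ^+ 2 <= 3 by rewrite ler_pdivrMr//; nra.
by apply/andP; split; lra.
Qed.

Lemma primitive_continuous (V : R -> R) (b : R) : 0 < b -> continuous V ->
  exists2 Q : R -> R, Q 0 = 0 & forall x : R, 0 <= x <= b -> is_derive x 1 Q (V x).
Proof.
(* Integrating from -1, on an interval that goes up to [b + 1], keeps 0 and [b] in the interior, so
   that the derivative is two-sided there. *)
move=> b0 cV; pose F x := \int[@lebesgue_measure R]_(t in `[-1, x]) V t.
exists (fun x => F x - F 0); first by rewrite subrr.
move=> x /andP[x0 xb]; have xb1 : x < b + 1 by lra.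
have iV : (@lebesgue_measure R).-integrable `[-1, (b + 1)%R] (EFin \o V).
  by apply: continuous_compact_integrable; [exact: segment_compact|exact: continuous_subspaceT].
have [|d1 d2] := @continuous_FTC1_closed R V (-1) x (b + 1) xb1 iV _ (cV x); first by lra.
have FD : is_derive x 1 F (V x) by split; [exact: d1|rewrite -derive1E; exact: d2].
move: (F) FD => F' /is_derive_eps FD; apply/is_derive_eps => e /FD[d d0 Hd].
by exists d => // y /Hd; rewrite opprB addrA subrK.
Qed.

(* [b x - a <= B x], although [B] vanishes at second order at [0] and the
   energy of [B'] is at most [2 b^3 / a]. *)
Lemma brake (a b : R) : 0 <= a -> 0 <= b -> (a = 0 -> b = 0) -> exists B dB : R -> R, [/\
  forall x : R, 0 <= x -> is_derive x 1 B (dB x),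
  B 0 = 0 /\ dB 0 = 0,
  forall x : R, 0 <= x -> [/\ b * x - a <= B x, 0 <= B x, B x <= b * x, 0 <= dB x & dB x <= b] &
  forall x y : R, 0 <= x -> x <= y -> 0 <= dB y - dB x /\ dB y - dB x <= 2 * b ^+ 2 / a * (y - x)].
Proof.
rewrite le_eqVlt => /predU1P[<-|a0] b0 ab.
  have {}ab := ab erefl; exists (fun=> 0), (fun=> 0); split => //.
  - by move=> x _; exact: is_derive_cst.
  - by move=> x x0; rewrite ab !mul0r subr0.
  - by move=> x y _ xy; rewrite subrr invr0 mulr0 mul0r.
have q0 x : 0 <= x -> 0 < b * x + a by move=> x0; rewrite ltr_wpDl// mulr_ge0.
(* The function is [(b x)^2 / (b x + a)]: its slope rises from 0 towards [b] on a time scale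
   [a / b], and it trails [b x] by less than [a]. *)
exists (fun x => b * x - a + a ^+ 2 / (b * x + a)), (fun x => b - a ^+ 2 * b / (b * x + a) ^+ 2); split.
- move=> x x0; have := q0 x x0; set q := b * x + a => qx.
  have lin c : is_derive x 1 (fun x => b * x + c) b.
    apply/is_derive_eps => e e0; exists 1 => // y _.
    by rewrite (_ : _ - _ - _ = 0) ?normr0 ?mulr_ge0 ?(ltW e0)//; ring.
  have inv : is_derive x 1 (fun x => (b * x + a)^-1) (- q ^- 2 *: b).
    by apply: is_deriveV (lin a); rewrite gt_eqF.
  have cinv : is_derive x 1 (fun x => a ^+ 2 * (b * x + a)^-1) (a ^+ 2 * (- q ^- 2 *: b)).
    exact: is_deriveZ.
  apply: (is_derive_ext _ _ (is_deriveD (lin (- a)) cinv)) => //.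
  by rewrite -[_ *: b]/(- q ^- 2 * b); field; rewrite gt_eqF.
- by rewrite !mulr0 !add0r; split; field; rewrite gt_eqF.
- move=> x x0; have := q0 x x0; set q := b * x + a => qx.
  have aq : a <= q by rewrite lerDr mulr_ge0.
  have E1 : b * x - a + a ^+ 2 / q = (b * x) ^+ 2 / q by rewrite /q; field; rewrite gt_eqF.
  have E2 : b - a ^+ 2 * b / q ^+ 2 = b * (1 - a ^+ 2 / q ^+ 2) by ring.
  have a2 : a ^+ 2 / q ^+ 2 <= 1 by rewrite ler_pdivrMr ?exprn_gt0// mul1r ler_pXn2r ?nnegrE// ltW.
  have a3 : 0 <= a ^+ 2 / q ^+ 2 by rewrite divr_ge0 ?sqr_ge0.
  split.
  + by rewrite lerDl divr_ge0 ?sqr_ge0// ltW.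
  + by rewrite E1 divr_ge0 ?sqr_ge0// ltW.
  + rewrite E1 ler_pdivrMr// expr2 ler_wpM2l ?mulr_ge0// /q lerDl ltW//.
  + by rewrite E2 mulr_ge0// subr_ge0.
  + by rewrite E2 ler_piMr// gerBl.
move=> x y x0 xy; have y0 := le_trans x0 xy.
have := q0 x x0; have := q0 y y0; set p := b * x + a; set q := b * y + a => q1 p1.
have pq : p <= q by rewrite lerD2r ler_wpM2l.
have ap : a <= p by rewrite lerDr mulr_ge0.
have E : b - a ^+ 2 * b / q ^+ 2 - (b - a ^+ 2 * b / p ^+ 2) = b * (q - p) * (a ^+ 2 * (p + q) / (p ^+ 2 * q ^+ 2)).
  by field; rewrite !gt_eqF.
rewrite E; have qp : q - p = b * (y - x) by rewrite /p /q; ring.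
have d0 : 0 <= b * (q - p) by rewrite mulr_ge0// subr_ge0.
have f0 : 0 <= a ^+ 2 * (p + q) / (p ^+ 2 * q ^+ 2).
  have pq0 : 0 <= p + q by rewrite ltW// addr_gt0.
  by apply: divr_ge0; apply: mulr_ge0 => //; exact: sqr_ge0.
split; first exact: mulr_ge0.
have -> : 2 * b ^+ 2 / a * (y - x) = b * (q - p) * (2 / a) by rewrite qp; ring.
have P0 : 0 < p ^+ 2 * q ^+ 2 by rewrite mulr_gt0 ?exprn_gt0.
rewrite ler_wpM2l// ler_pdivrMr// -(@ler_pM2l _ a)//.
have -> : a * (2 / a * (p ^+ 2 * q ^+ 2)) = 2 * (p ^+ 2 * q ^+ 2) by field; rewrite gt_eqF.
have -> : a * (a ^+ 2 * (p + q)) = a ^+ 2 * (a * (p + q)) by ring.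
have -> : 2 * (p ^+ 2 * q ^+ 2) = p ^+ 2 * (q * (2 * q)) by ring.
have aq := le_trans ap pq.
apply: ler_pM; rewrite ?sqr_ge0//; first exact: (mulr_ge0 (ltW a0) (addr_ge0 (ltW p1) (ltW q1))).
  by rewrite ler_pXn2r ?nnegrE// ltW.
by apply: ler_pM; rewrite ?(ltW a0)//; lra.
Qed.

End scalar_functions.

(** * Trajectories and their energy *)

Section curves.
Context {R : realType} {n : nat} {T : {posnum R}} {Omega : domain R n}.
Implicit Types (xi eta : time T -> 'rV[R]_n) (g h : curve T Omega) (X H : R -> 'rV[R]_n).
Local Notation lambda := (@lebesgue_measure R).
Local Notation J := (`[0%R, T%:num]%classic : set R).

Lemma strict_grad_dotv (w y : 'rV[R]_n) : strict_grad (dotv w) y w.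
Proof.
move=> e e0; exists 1 => // a b _ _.
by rewrite dotvBr opprB addrA subrK subrr normr0 mulr_ge0 ?enorm_ge0// ltW.
Qed.

(** The scalar mean value theorem for the inner product with the total increment [w]. *)
Lemma vmean_value X H (a b M : R) : a <= b ->
  (forall x : R, a <= x <= b -> vderive X x (H x)) ->
  (forall x, a <= x <= b -> enorm (H x) <= M) -> enorm (X b - X a) <= M * (b - a).
Proof.
move=> ab XH HM; pose w := X b - X a.
have d (x : R) : a <= x <= b -> is_derive x 1 (dotv w \o X) (dotv w (H x)).
  by move=> /XH; apply: strict_grad_chain; exact: strict_grad_dotv.
have [c /HM Hc] := mean_value ab d; rewrite /= -dotvBr -enorm_sqr => E.
have [w0|w0] := eqVneq (enorm w) 0.
  rewrite -/w w0 mulr_ge0 ?subr_ge0//; exact: le_trans (enorm_ge0 _) Hc.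
have w1 : 0 < enorm w by rewrite lt_neqAle eq_sym w0 enorm_ge0.
rewrite -/w -(ler_pM2l w1) -expr2 E mulrA ler_wpM2r ?subr_ge0//.
by apply: le_trans (dotv_le _ _) _; rewrite ler_wpM2l// enorm_ge0.
Qed.

Lemma curve_derivative g : is_derivative_of (xi_of g) (eta_of g).
Proof. by have /set_mem[] := valP g. Qed.

Lemma curve_abs_continuous g : abs_continuous (eta_of g).
Proof. by have /set_mem[] := valP g. Qed.

Lemma curve_closure g t : closure Omega (xi_of g t).
Proof. by have /set_mem[_ _] := valP g; exact. Qed.

Lemma curve_eta_continuous g t e : 0 < e -> exists2 d, 0 < d &
  forall s, `|set_val s - set_val t| < d -> enorm (eta_of g s - eta_of g t) <= e.
Proof.
move=> e0; have [d d0 Hd] := curve_abs_continuous g e0; exists d => // s st.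
wlog le : s t st / set_val s <= set_val t.
  move=> W; have [/W|/ltW le] := leP (set_val s) (set_val t); first exact.
  by rewrite enormB; apply: W => //; rewrite distrC.
have := Hd [:: (s, t)]; rewrite /= le !big_seq1 /= enormB => /(_ isT isT)/(_ _)/wrap[|/ltW//].
by move: st; rewrite distrC ger0_norm ?subr_ge0.
Qed.

Definition line g := extend (xi_of g) (eta_of g).

Lemma line_val g t : line g (set_val t) = xi_of g t. Proof. exact: extend_id. Qed.

Lemma vderive_line g (x : R) : 0 <= x <= T%:num -> vderive (line g) x (eta_of g (clamp T x)).
Proof.
by apply: vderive_extend; [exact: curve_derivative|move=> t e; exact: curve_eta_continuous].
Qed.

Lemma xi_lip g M s t : (forall u, enorm (eta_of g u) <= M) ->
  enorm (xi_of g s - xi_of g t) <= M * `|set_val s - set_val t|.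
Proof.
move=> gM; wlog st : s t / set_val t <= set_val s.
  by move=> W; have [/W//|/ltW/W] := leP (set_val t) (set_val s); rewrite enormB distrC.
rewrite -!line_val ger0_norm ?subr_ge0//; apply: (@vmean_value (line g) (fun x => eta_of g (clamp T x))) => // x /andP[x1 x2].
by apply: vderive_line; rewrite (le_trans (time_ge0 t) x1) (le_trans x2 (time_leT s)).
Qed.

Lemma curve_build xi eta E : is_derivative_of xi eta -> kinetic eta E ->
  (forall t, closure Omega (xi t)) ->
  exists g, xi_of g = xi /\ eta_of g = eta.
Proof.
move=> d k c; have H : curve_set Omega (xi, eta) by split => //; exact: kinetic_abs_continuous k.
by exists (exist (fun x : path_space T * path_space T => x \in curve_set Omega) (xi, eta) (mem_set H)).
Qed.

Definition energy g : R := fine (\int[lambda]_(s in J) (enorm (accel (eta_of g) s) ^+ 2)%:E)%E.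

Lemma energy_ge0 g : 0 <= energy g.
Proof. by apply/fine_ge0/integral_ge0 => x _; rewrite lee_fin sqr_ge0. Qed.

Lemma acceleration_L2normE g : acceleration_L2norm g =
  sqrte (\int[lambda]_(s in J) (enorm (accel (eta_of g) s) ^+ 2)%:E)%E.
Proof.
rewrite /acceleration_L2norm poweR12_sqrt//; apply: integral_ge0 => x _.
by rewrite lee_fin sqr_ge0.
Qed.

Lemma kinetic_integral g E : kinetic (eta_of g) E ->
  (\int[lambda]_(s in J) (enorm (accel (eta_of g) s) ^+ 2)%:E)%E = (energy g)%:E /\ energy g <= E.
Proof.
move=> /accel_of_kinetic; set I := (\int[_]_(_ in _) _)%E => IE.
have I0 : (0 <= I)%E by apply: integral_ge0 => x _; rewrite lee_fin sqr_ge0.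
have If : I \is a fin_num by rewrite ge0_fin_numE//; exact: le_lt_trans IE (ltry _).
have IE' : I = (energy g)%:E by rewrite -(fineK If).
by split=> //; rewrite -lee_fin -IE'.
Qed.

Lemma L2norm_kinetic g : (acceleration_L2norm g < +oo)%E -> kinetic (eta_of g) (energy g).
Proof.
move=> H; apply: kinetic_of_accel; first exact: curve_abs_continuous.
by apply: (lty_poweRy _ H); rewrite invr_eq0.
Qed.

Lemma kinetic_L2norm g E : kinetic (eta_of g) E -> (acceleration_L2norm g < +oo)%E.
Proof.
move=> /kinetic_integral[gE _]; rewrite /acceleration_L2norm; apply: poweR_lty.
by rewrite gE ltry.
Qed.

Lemma L2norm_le g C : 0 <= C -> (acceleration_L2norm g <= C%:E)%E <-> kinetic (eta_of g) (C ^+ 2).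
Proof.
move=> C0; have key E : kinetic (eta_of g) E -> acceleration_L2norm g = (Num.sqrt (energy g))%:E.
  by move=> /kinetic_integral[gE _]; rewrite acceleration_L2normE gE.
split=> [H|k].
  have k : kinetic (eta_of g) (energy g) by apply/L2norm_kinetic/(le_lt_trans H)/ltry.
  apply: (energy_leW _ k); rewrite -(sqr_sqrtr (energy_ge0 g)).
  by rewrite ler_pXn2r ?nnegrE ?sqrtr_ge0// -lee_fin -(key _ k).
rewrite (key _ k) lee_fin -[leRHS](ger0_norm C0) -sqrtr_sqr; apply: ler_wsqrtr.
exact: (kinetic_integral k).2.
Qed.

Lemma eta_bound g E t : kinetic (eta_of g) E ->
  enorm (eta_of g t) <= enorm (eta_of g (time0 T)) + Num.sqrt (E * T%:num).
Proof.
move=> k; rewrite -(subrK (eta_of g (time0 T)) (eta_of g t)).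
apply: le_trans (enormD _ _) _; rewrite addrC lerD2l; apply: le_trans (kinetic_incr _ _ k) _.
apply: ler_wsqrtr; rewrite ler_wpM2l ?(energy_le_ge0 k)// val_time0 subr0 ger0_norm ?time_ge0//.
exact: time_leT.
Qed.

Definition close_curve e g h := forall t,
  enorm (xi_of h t - xi_of g t) <= e /\ enorm (eta_of h t - eta_of g t) <= e.

Lemma ball_curve g e h : 0 < e ->
  ball g e h <-> forall t c, `|pcoord c (ev t g) - pcoord c (ev t h)| < e.
Proof.
move=> e0; split=> [[H1 H2] t [[] i]|H].
- by have [_ /(_ ord0 i)] := H1 t.
- by have [_ /(_ ord0 i)] := H2 t.
by split=> t; split => // a i; rewrite (ord1 a); [exact: (H t (true, i))|exact: (H t (false, i))].
Qed.

Lemma curve_near g (U : set (curve T Omega)) : nbhs g U ->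
  exists2 e, 0 < e & forall h, close_curve e g h -> U h.
Proof.
move=> /nbhs_ballP[e /= e0 eU]; exists (e / 2); first by rewrite divr_gt0.
move=> h gh; apply/eU/(ball_curve _ _ e0) => t [b i]; rewrite distrC.
have e2 : e / 2 < e by rewrite ltr_pdivrMr// ltr_pMr// ltr1n.
apply: le_lt_trans e2; have [h1 h2] := gh t.
case: b; [apply: le_trans h1|apply: le_trans h2].
  by have := coord_le_enorm (xi_of h t - xi_of g t) i; rewrite !mxE.
by have := coord_le_enorm (eta_of h t - eta_of g t) i; rewrite !mxE.
Qed.

Lemma close_curve_nbhs g e : 0 < e -> nbhs g [set h | close_curve e g h].
Proof.
move=> e0; have N0 : 0 < n.+1%:R :> R by [].
have e1 : 0 < e / n.+1%:R by rewrite divr_gt0.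
apply/nbhs_ballP; exists (e / n.+1%:R) => // h /(ball_curve _ _ e1) H t.
have le1 : n%:R * (e / n.+1%:R) <= e.
  by rewrite mulrCA ler_piMr ?(ltW e0)// ler_pdivrMr// mul1r ler_nat.
split; apply: (le_trans _ le1); apply: enorm_le_coord; rewrite ?(ltW e1)// => i; rewrite !mxE distrC.
  exact/ltW/(H t (true, i)).
exact/ltW/(H t (false, i)).
Qed.

Lemma cvg_curve (u : nat -> curve T Omega) g : u @ \oo --> g <->
  forall e, 0 < e -> \forall k \near \oo, close_curve e g (u k).
Proof.
split=> [ug e e0|H U /curve_near[e e0 eU]]; first exact: (ug _ (close_curve_nbhs g e0)).
by rewrite /nbhs /=; apply: filterS (H e e0) => k; exact: eU.
Qed.

Lemma cvg_curve_kinetic (u : nat -> curve T Omega) g E : u @ \oo --> g ->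
  (forall k, kinetic (eta_of (u k)) E) -> kinetic (eta_of g) E.
Proof.
move=> /cvg_curve ug uE; apply: kinetic_lim uE _ => t e e0.
by apply: filterS (ug e e0) => k /(_ t)[].
Qed.

Lemma closed_of_seq (A : set (curve T Omega)) :
  (forall u g, (forall k, A (u k)) -> u @ \oo --> g -> A g) -> closed A.
Proof.
move=> H g Ag.
have /choice[u uP] : forall k : nat, exists h, A h /\ close_curve k.+1%:R^-1 g h.
  move=> k; have k0 : 0 < k.+1%:R^-1 :> R by rewrite invr_gt0.
  by have [h [Ah gh]] := Ag _ (close_curve_nbhs g k0); exists h.
apply: (H u) => [k|]; first exact: (uP k).1.
apply/cvg_curve => e e0; near=> k; have [_ gh] := uP k => t; have [h1 h2] := gh t.
have ke : k.+1%:R^-1 <= e by apply: ltW; near: k; exact: (near_infty_natSinv_lt (PosNum e0)).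
by split; apply: le_trans ke.
Unshelve. all: by end_near. Qed.

Lemma closed_curves_bounded C : closed (curves_bounded C : set (curve T Omega)).
Proof.
have [C0|C0] := leP 0 C; last first.
  apply: closed_of_seq => u g uC _; have [H _] := uC 0%N.
  by have := le_trans (enorm_ge0 _) (H (time0 T)); rewrite leNgt C0.
apply: closed_of_seq => u g uC ug; split=> [t|]; last first.
  by apply/L2norm_le => //; apply: cvg_curve_kinetic ug _ => k; apply/L2norm_le => //; exact: (uC k).2.
rewrite /K /=; apply/ler_addgt0Pr => e e0; move/cvg_curve: ug => /(_ e e0) ug.
have [k /(_ t)[_ h]] := filter_ex ug; have := (uC k).1 t; rewrite /K /= => h2.
rewrite -(subrK (vel (ev t (u k))) (vel (ev t g))) addrC.
by apply: le_trans (enormD _ _) _; rewrite lerD// enormB.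
Qed.

End curves.

(** * Approximation of trajectories *)

Section vderive_algebra.
Context {R : realType} {n : nat}.
Implicit Types (X Y : R -> 'rV[R]_n) (x : R).

Lemma vderiveD X Y x v w : vderive X x v -> vderive Y x w -> vderive (fun t => X t + Y t) x (v + w).
Proof.
move=> /vderiveP Xv /vderiveP Yw; apply/vderiveP => i.
apply: (is_derive_ext _ _ (is_deriveD (Xv i) (Yw i))); last by rewrite mxE.
by apply/funext => t; rewrite mxE.
Qed.

Lemma vderiveZ (f : R -> R) (df : R) Y x w : is_derive x 1 f df -> vderive Y x w ->
  vderive (fun t => f t *: Y t) x (df *: Y x + f x *: w).
Proof.
move=> fd /vderiveP Yw; apply/vderiveP => i.
apply: (is_derive_ext _ _ (is_deriveM fd (Yw i))).
  by apply/funext => t; rewrite mxE.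
by rewrite !mxE addrC; congr (_ + _); rewrite [LHS]mulrC.
Qed.

Lemma vderive_cst (a : 'rV[R]_n) x : vderive (fun=> a) x 0.
Proof.
move=> e e0; exists 1 => // y _.
by rewrite subrr sub0r scaler0 oppr0 enorm0 mulr_ge0// ltW.
Qed.

Lemma vderive_ext X Y x v w : (forall t, X t = Y t) -> v = w -> vderive X x v -> vderive Y x w.
Proof. by move=> /funext -> ->. Qed.

End vderive_algebra.

(** * Perturbed trajectories: distance and energy *)

Section perturbation.
Context {R : realType} {n : nat} {T : {posnum R}} {Omega : domain R n}.
Implicit Types (al be : 'rV[R]_n) (x : R).
Variables (g : curve T Omega) (E : R) (kE : kinetic (eta_of g) E) (e : 'rV[R]_n).
Let E0 : 0 <= E. Proof. exact: energy_le_ge0 kE. Qed.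

(** Gauge of the errors in the slope of [phi] along a shifted trajectory: they are small multiples
    of the elapsed time and of the change of velocity. Its energy is controlled by that of [eta], so
    subtracting a small multiple of its primitive costs little; the velocity of [g] could not be
    treated as Lipschitz instead. *)
Definition speed (x : R) : R := x + enorm (eta_of g (clamp T x) - eta_of g (time0 T)).

Lemma eta_clamp_continuous x (d : R) : 0 < d -> \forall y \near x,
  enorm (eta_of g (clamp T y) - eta_of g (clamp T x)) <= d.
Proof.
move=> /(curve_eta_continuous g (clamp T x))[r r0 Hr]; apply/nbhs_ballP; exists r => //= y yx.
apply: Hr; apply: le_lt_trans (clampr_lip _ _ _ _) _; by rewrite distrC.
Qed.

Lemma speed_incr s t : set_val s <= set_val t -> `|speed (set_val t) - speed (set_val s)| <=
  (set_val t - set_val s) + enorm (eta_of g t - eta_of g s).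
Proof.
move=> st; rewrite /speed !clampK opprD addrACA; apply: le_trans (ler_normD _ _) _.
rewrite (ger0_norm (_ : 0 <= set_val t - set_val s)) ?subr_ge0// lerD2l.
apply: le_trans (enorm_sub_le _ _) _.
by rewrite opprB addrA subrK.
Qed.

Lemma continuous_speed : continuous speed.
Proof.
move=> x; apply: cvgD; first exact: cvg_id.
apply/cvgrPdist_le => d d0; apply: filterS (eta_clamp_continuous x d0) => y yx.
apply: le_trans (enorm_sub_le _ _) _; rewrite opprB addrA subrK enormB; exact: yx.
Qed.

Let Vm := T%:num + Num.sqrt (E * T%:num).

Lemma speed_le x : 0 <= x <= T%:num -> 0 <= speed x <= Vm.
Proof.
move=> x0T; have /andP[x0 xT] := x0T; rewrite /speed addr_ge0 ?enorm_ge0//= lerD//.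
apply: le_trans (kinetic_incr _ _ kE) _; apply: ler_wsqrtr; rewrite ler_wpM2l//.
by rewrite val_time0 subr0 clamp_id// ger0_norm.
Qed.

Variables (chi dchi : R -> R) (C : R).
Hypothesis C0 : 0 <= C.
Hypothesis chiD : forall x : R, is_derive x 1 chi (dchi x).
Hypothesis chi0 : chi 0 = 1 /\ dchi 0 = 0.
Hypothesis chi01 : forall x, 0 <= x -> 0 <= chi x <= 1.
Hypothesis dchi_lip : forall x y, 0 <= x -> 0 <= y -> `|dchi x - dchi y| <= C * `|x - y|.
Variable Q : R -> R.
Hypothesis Q0 : Q 0 = 0.
Hypothesis QD : forall x : R, 0 <= x <= T%:num -> is_derive x 1 Q (speed x).

Let T0 : 0 < T%:num. Proof. by []. Qed.

Lemma bump_dchi x : 0 <= x -> `|dchi x| <= C * x.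
Proof.
by move=> x0; have := dchi_lip x0 (lexx 0); rewrite chi0.2 !subr0 (ger0_norm x0).
Qed.

Lemma bump_dchiT x : 0 <= x <= T%:num -> `|dchi x| <= C * T%:num.
Proof. by move=> /andP[x0 xT]; apply: le_trans (bump_dchi x0) _; rewrite ler_wpM2l. Qed.

Lemma bump_lip x y : 0 <= x -> x <= y -> y <= T%:num -> `|chi y - chi x| <= C * T%:num * (y - x).
Proof.
move=> x0 xy yT; have [c /andP[xc cy] ->] := mean_value xy (fun s _ => chiD s).
rewrite normrM (ger0_norm (_ : 0 <= y - x)) ?subr_ge0// ler_wpM2r ?subr_ge0//.
by apply: bump_dchiT; rewrite (le_trans x0 xc) (le_trans cy yT).
Qed.

Lemma Q_le x : 0 <= x <= T%:num -> `|Q x| <= Vm * T%:num.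
Proof.
move=> /andP[x0 xT].
have [|c /andP[c0 cx]] := mean_value x0 (dg := speed) (g := Q).
  by move=> s /andP[s0 sx]; apply: QD; rewrite s0 (le_trans sx).
rewrite Q0 !subr0 => ->; have /speed_le/andP[s0 sV] : 0 <= c <= T%:num by rewrite c0 (le_trans cx).
by rewrite ger0_norm ?mulr_ge0//; apply: ler_pM.
Qed.

(* [al] and [be] shift the initial position and velocity. The inward
   displacement along [- e] compensates the shift through [d * Q], where [Q] is
   a primitive of [speed], and the outgoing initial velocity through the brake
   [B]. *)
Definition push al be (d : R) (B : R -> R) x := al + x *: be - (4 * (d * Q x + B x)) *: e.
Definition dpush be (d : R) (dB : R -> R) x := be - (4 * (d * speed x + dB x)) *: e.

Lemma vderive_push al be d B dB x : 0 <= x <= T%:num -> is_derive x 1 B (dB x) ->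
  vderive (push al be d B) x (dpush be d dB x).
Proof.
move=> xT Bd.
have idd : is_derive x 1 (fun x : R => x) 1 by exact: is_derive_id.
have h1 : is_derive x 1 (fun x => - (4 * (d * Q x + B x))) (- (4 * (d * speed x + dB x))).
  have /is_derive_eps HQ := QD xT; have /is_derive_eps HB := Bd.
  have h2 : is_derive x 1 (d \*: Q + B) (d *: speed x + dB x) by exact: (is_deriveD (is_deriveZ d (QD xT)) Bd).
  by apply: (is_derive_ext _ _ (is_deriveZ (- 4) h2)); [apply/funext => y|]; rewrite -mulNr.
have := vderiveD (vderiveD (vderive_cst al x) (vderiveZ idd (vderive_cst be x))) (vderiveZ h1 (vderive_cst e x)).
move=> _.
have h3 := vderiveZ idd (vderive_cst be x).
have h4 := vderiveZ h1 (vderive_cst e x).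
apply: vderive_ext (vderiveD (vderiveD (vderive_cst al x) h3) h4).
  by move=> t; rewrite /push scaleNr.
by rewrite /dpush scale1r !scaler0 !addr0 add0r scaleNr.
Qed.

Let Kc := 1 + T%:num + 4 * (Vm * T%:num + T%:num + Vm + 1) * enorm e.
Let C' := C * T%:num + C.

Let Vm0 : 0 <= Vm. Proof. by rewrite addr_ge0// sqrtr_ge0. Qed.

Let Kc1 : 1 <= Kc.
Proof.
by rewrite /Kc -addrA lerDl addr_ge0// ?mulr_ge0 ?enorm_ge0// !addr_ge0// mulr_ge0.
Qed.

Section bounds.
Variables (al be : 'rV[R]_n) (d b sig : R) (B dB : R -> R).
Hypotheses (als : enorm al <= sig) (bes : enorm be <= sig) (d0 : 0 <= d) (ds : d <= sig)
  (b0 : 0 <= b) (bs : b <= sig).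
Hypothesis BD : forall x : R, 0 <= x -> is_derive x 1 B (dB x).
Hypothesis Bmono : forall x y, 0 <= x -> x <= y -> 0 <= dB y - dB x.
Hypothesis Bb : forall x, 0 <= x -> [/\ 0 <= B x, B x <= b * x, 0 <= dB x & dB x <= b].
Let sig0 : 0 <= sig. Proof. exact: le_trans d0 ds. Qed.

Lemma push_le x : 0 <= x <= T%:num -> enorm (push al be d B x) <= sig * Kc.
Proof.
move=> xT; have /andP[x0 xT'] := xT; have := Q_le xT; have [B0 Bx _ _] := Bb x0.
move=> Qx; apply: le_trans (enormBle _ _) _.
have h1 : enorm (al + x *: be) <= sig * (1 + T%:num).
  apply: le_trans (enormD _ _) _; rewrite enormZ ger0_norm// mulrDr mulr1 lerD//.
  by rewrite mulrC ler_pM ?enorm_ge0.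
have h2 : `|d * Q x + B x| <= sig * (Vm * T%:num + T%:num).
  apply: le_trans (ler_normD _ _) _; rewrite normrM (ger0_norm d0) (ger0_norm B0) mulrDr lerD//.
    exact: ler_pM.
  by apply: le_trans Bx _; apply: ler_pM.
have h3 : enorm ((4 * (d * Q x + B x)) *: e) <= sig * (4 * (Vm * T%:num + T%:num) * enorm e).
  rewrite enormZ normrM (ger0_norm (_ : 0 <= 4))// mulrA ler_wpM2r ?enorm_ge0//.
  by rewrite mulrCA ler_wpM2l.
apply: le_trans (lerD h1 h3) _; rewrite -mulrDr ler_wpM2l// /Kc lerD2l ler_wpM2r ?enorm_ge0//.
by rewrite ler_wpM2l//; have := Vm0; lra.
Qed.

Lemma dpush_le x : 0 <= x <= T%:num -> enorm (dpush be d dB x) <= sig * Kc.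
Proof.
move=> xT; have /andP[x0 xT'] := xT; have /andP[s0 sV] := speed_le xT; have [_ _ B0 Bx] := Bb x0.
apply: le_trans (enormBle _ _) _.
have h2 : `|d * speed x + dB x| <= sig * (Vm + 1).
  rewrite ger0_norm; last by rewrite addr_ge0 ?mulr_ge0.
  by rewrite [leRHS]mulrDr mulr1; apply: lerD; [exact: ler_pM|exact: le_trans Bx bs].
have h3 : enorm ((4 * (d * speed x + dB x)) *: e) <= sig * (4 * (Vm + 1) * enorm e).
  rewrite enormZ normrM (ger0_norm (_ : 0 <= 4))// mulrA ler_wpM2r ?enorm_ge0//.
  by rewrite mulrCA ler_wpM2l.
apply: le_trans (lerD bes h3) _; rewrite -{1}[sig]mulr1 -mulrDr ler_wpM2l// /Kc.
apply: lerD; first by rewrite lerDl.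
by rewrite ler_wpM2r ?enorm_ge0// ler_wpM2l//; have := mulr_ge0 Vm0 (ltW T0); have := ltW T0; lra.
Qed.

Lemma push_lip x y : 0 <= x -> x <= y -> y <= T%:num ->
  enorm (push al be d B y - push al be d B x) <= sig * Kc * (y - x).
Proof.
move=> x0 xy yT; apply: (@vmean_value _ _ (push al be d B) (dpush be d dB)) => // z /andP[z1 z2].
  apply: vderive_push; first by rewrite (le_trans x0 z1) (le_trans z2).
  by apply: BD; exact: le_trans z1.
by apply: dpush_le; rewrite (le_trans x0 z1) (le_trans z2).
Qed.

Definition dperturb x := dchi x *: push al be d B x + chi x *: dpush be d dB x.

Lemma dperturb_incr s t : set_val s <= set_val t ->
  enorm (dperturb (set_val t) - dperturb (set_val s)) <=
   (sig * (3 * C' * Kc + 4 * enorm e)) * (set_val t - set_val s) +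
   (sig * (4 * enorm e)) * enorm (eta_of g t - eta_of g s) +
   (4 * enorm e) * `|dB (set_val t) - dB (set_val s)|.
Proof.
have s0 := time_ge0 s; have tT := time_leT t.
set x := set_val s in s0 *; set y := set_val t in tT * => xy; set D := y - x.
have y0 : 0 <= y := le_trans s0 xy; have xT : x <= T%:num := le_trans xy tT.
have D0 : 0 <= D by rewrite subr_ge0.
have yI : 0 <= y <= T%:num by rewrite y0.
have xI : 0 <= x <= T%:num by rewrite s0.
have -> : dperturb y - dperturb x = dchi y *: (push al be d B y - push al be d B x) +
   (dchi y - dchi x) *: push al be d B x + (chi y - chi x) *: dpush be d dB x +
   chi y *: (dpush be d dB y - dpush be d dB x).
  by rewrite /dperturb; apply/rowP => i; rewrite !mxE; ring.
have SK : 0 <= sig * Kc by rewrite mulr_ge0//; have := Kc1; lra.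
have CT : 0 <= C * T%:num by rewrite mulr_ge0.
have CC : C * T%:num <= C' by rewrite lerDl.
have CC2 : C <= C' by rewrite lerDr.
have h1 : enorm (dchi y *: (push al be d B y - push al be d B x)) <= C' * (sig * Kc) * D.
  rewrite enormZ -mulrA; apply: ler_pM; rewrite ?enorm_ge0//; last exact: push_lip.
  exact: le_trans (bump_dchiT yI) CC.
have h2 : enorm ((dchi y - dchi x) *: push al be d B x) <= C' * (sig * Kc) * D.
  rewrite enormZ mulrAC; apply: ler_pM; rewrite ?enorm_ge0//; last exact: push_le.
  by apply: le_trans (dchi_lip y0 s0) _; rewrite ger0_norm// ler_wpM2r.
have h3 : enorm ((chi y - chi x) *: dpush be d dB x) <= C' * (sig * Kc) * D.
  rewrite enormZ mulrAC; apply: ler_pM; rewrite ?enorm_ge0//; last exact: dpush_le.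
  by apply: le_trans (bump_lip s0 xy tT) _; rewrite ler_wpM2r.
have h4 : enorm (chi y *: (dpush be d dB y - dpush be d dB x)) <=
    4 * enorm e * (sig * (D + enorm (eta_of g t - eta_of g s)) + `|dB y - dB x|).
  have -> : dpush be d dB y - dpush be d dB x = - ((4 * (d * (speed y - speed x) + (dB y - dB x))) *: e).
    by apply/rowP => i; rewrite !mxE; ring.
  rewrite enormZ enormN enormZ; have /andP[c0 c1] := chi01 y0.
  rewrite (ger0_norm c0); apply: (le_trans (ler_piMl _ c1)); first by rewrite mulr_ge0 ?enorm_ge0.
  rewrite normrM (ger0_norm (_ : 0 <= 4))// mulrAC ler_wpM2l ?mulr_ge0 ?enorm_ge0//.
  apply: le_trans (ler_normD _ _) _; rewrite lerD2r normrM (ger0_norm d0).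
  by apply: ler_pM => //; exact: speed_incr.
apply: le_trans (enormD _ _) _.
apply: le_trans (lerD (le_trans (enormD _ _) (lerD (le_trans (enormD _ _) (lerD h1 h2)) h3)) h4) _.
by rewrite le_eqVlt; apply/orP; left; apply/eqP; ring.
Qed.

Lemma kinetic_dperturb Eb : energy_le (fun s t : time T => dB (set_val t) - dB (set_val s)) Eb ->
  kinetic (fun t : time T => dperturb (set_val t))
    (2 * ((sig * (3 * C' * Kc + 4 * enorm e)) ^+ 2 * T%:num) +
     2 * (2 * ((sig * (4 * enorm e)) ^+ 2 * E) + 2 * ((4 * enorm e) ^+ 2 * Eb))).
Proof.
move=> kB; set M1 := sig * (3 * C' * Kc + 4 * enorm e).
have C'0 : 0 <= C' by rewrite addr_ge0// mulr_ge0.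
have M10 : 0 <= M1 by rewrite mulr_ge0// addr_ge0 ?mulr_ge0 ?enorm_ge0//; have := Kc1; lra.
have w1 : energy_le (fun s t : time T => M1 * (set_val t - set_val s)) (M1 ^+ 2 * T%:num).
  by apply: energy_le_lip => // s t st; rewrite ger0_norm// mulr_ge0// subr_ge0.
have w2 := energy_leZ (sig * (4 * enorm e)) kE.
have w3 := energy_leZ (4 * enorm e) kB.
have two : 1 + 1 = 2 :> R by [].
have := energy_leD ltr01 w1 (energy_leD ltr01 w2 w3); rewrite invr1 two.
apply: energy_le_mono => s t st; rewrite (ger0_norm (enorm_ge0 _)).
apply: le_trans (dperturb_incr st) _.
rewrite addrA (ger0_norm (Bmono (time_ge0 s) st)); exact: ler_norm.
Qed.

End bounds.

(** The new position is that of [g] plus [chi * push]. Only distance and energy are settled here;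
    the constraint is left as a hypothesis, to be met in different ways inside the domain and at its
    boundary. *)
Lemma perturbation (eps : R) : 0 < eps -> exists2 sig, 0 < sig &
  forall al be (d b : R) (B dB : R -> R),
  enorm al <= sig -> enorm be <= sig -> 0 <= d -> d <= sig -> 0 <= b -> b <= sig ->
  (forall x : R, 0 <= x -> is_derive x 1 B (dB x)) -> B 0 = 0 /\ dB 0 = 0 ->
  (forall x, 0 <= x -> [/\ 0 <= B x, B x <= b * x, 0 <= dB x & dB x <= b]) ->
  (forall x y, 0 <= x -> x <= y -> 0 <= dB y - dB x) ->
  energy_le (fun s t : time T => dB (set_val t) - dB (set_val s)) sig ->
  (forall t : time T, closure Omega (xi_of g t + chi (set_val t) *: push al be d B (set_val t))) ->
  exists h : curve T Omega, [/\ xi_of h (time0 T) = xi_of g (time0 T) + al,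
    eta_of h (time0 T) = eta_of g (time0 T) + be,
    close_curve eps g h & kinetic (eta_of h) (E + eps)].
Proof.
move=> eps0; pose A := 2 * ((3 * C' * Kc + 4 * enorm e) ^+ 2 * T%:num) +
  2 * (2 * ((4 * enorm e) ^+ 2 * E) + 2 * (4 * enorm e) ^+ 2).
have A0 : 0 <= A.
  have u1 := sqr_ge0 (3 * C' * Kc + 4 * enorm e); have u2 := sqr_ge0 (4 * enorm e).
  by have := mulr_ge0 u1 (ltW T0); have := mulr_ge0 u2 E0; rewrite /A; lra.
pose a := eps / (2 * (E + 1)).
have E1 : 0 < E + 1 by rewrite ltr_wpDl.
have a0 : 0 < a by rewrite divr_gt0// mulr_gt0.
have a1 : 0 < a^-1 by rewrite invr_gt0.
have C'0 : 0 <= C' by rewrite addr_ge0// mulr_ge0.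
have K0 : 0 < Kc by exact: lt_le_trans Kc1.
have q1 : 0 < eps / (Kc * (C' + 1)) by rewrite divr_gt0// mulr_gt0// ltr_wpDl.
have A1 : 0 < A + 1 by rewrite ltr_wpDl.
have a2 : 0 < 1 + a^-1 by rewrite addr_gt0.
have Aa : 0 < (A + 1) * (1 + a^-1) by rewrite mulr_gt0.
have q2 : 0 < eps / 2 / ((A + 1) * (1 + a^-1)) by rewrite !divr_gt0.
(* The bound 1 gives [sig^2 <= sig], the second term the [C^1] distance, and the third makes the
   energy of the perturbation at most [eps / 2] after multiplication by [1 + a^-1]; the other half
   of the budget is [a * E]. *)
pose sig := Num.min 1 (Num.min (eps / (Kc * (C' + 1))) (eps / 2 / ((A + 1) * (1 + a^-1)))).
have sig0 : 0 < sig by rewrite !lt_min ltr01 q1.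
exists sig => // al be d b B dB als bes d0 ds b0 bs BD [B0 dB0] Bb Bmono kB cl.
have /and3P[s1 s2 s3] : [&& sig <= 1, sig <= eps / (Kc * (C' + 1)) & sig <= eps / 2 / ((A + 1) * (1 + a^-1))].
  by rewrite -!le_min lexx.
pose xi t := xi_of g t + chi (set_val t) *: push al be d B (set_val t).
pose om (t : time T) := dperturb al be d B dB (set_val t).
pose eta (t : time T) := eta_of g t + om t.
have d1 : is_derivative_of xi eta.
  have := @is_derivative_of_restrict R n T (fun x => line g x + chi x *: push al be d B x)
    (fun x => eta_of g (clamp T x) + dperturb al be d B dB x).
  have -> : (fun t : time T => line g (set_val t) + chi (set_val t) *: push al be d B (set_val t)) = xi.
    by apply/funext => t; rewrite line_val.
  have -> : (fun t : time T => eta_of g (clamp T (set_val t)) + dperturb al be d B dB (set_val t)) = eta.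
    by apply/funext => t; rewrite clampK.
  apply=> t; have tT := time_itv t; apply: vderiveD; first exact: vderive_line.
  apply: vderiveZ => //; apply: vderive_push => //; exact/BD/time_ge0.
have kom := kinetic_dperturb als bes d0 ds b0 bs BD Bmono Bb kB.
have omA : kinetic om (sig * A).
  apply: energy_leW kom; rewrite ![(sig * _) ^+ 2]exprMn.
  have ss : sig ^+ 2 <= sig by rewrite expr2 ler_piMr ?(ltW sig0).
  rewrite /A; set u1 := (3 * C' * Kc + 4 * enorm e) ^+ 2; set u2 := (4 * enorm e) ^+ 2.
  have u10 : 0 <= u1 * T%:num by rewrite mulr_ge0 ?sqr_ge0.
  have u20 : 0 <= u2 * E by rewrite mulr_ge0// sqr_ge0.
  have := ler_wpM2r u10 ss; have := ler_wpM2r u20 ss; lra.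
have kEeps : kinetic eta (E + eps).
  apply: energy_leW (kineticD a0 kE omA).
  have h1 : a * E <= eps / 2.
    rewrite /a invfM mulrA mulrAC ler_pdivrMr// mulrC -[leRHS]mulrC.
    by rewrite ler_wpM2r ?divr_ge0 ?(ltW eps0)// lerDl.
  have h2 : (1 + a^-1) * (sig * A) <= eps / 2.
    move: s3; rewrite ler_pdivlMr// => /(le_trans _); apply.
    by rewrite mulrCA ler_wpM2l ?(ltW sig0)// mulrC ler_wpM2r ?lerDl// ltW.
  lra.
have [h [hx he]] := curve_build d1 kEeps cl.
exists h; rewrite hx he; split => //.
- rewrite /xi val_time0 chi0.1 scale1r /push Q0 B0 scale0r addr0 mulr0 addr0 mulr0 scale0r subr0//.
- rewrite /eta /om /dperturb val_time0 chi0.1 chi0.2 scale0r add0r scale1r /dpush /speed dB0.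
  by rewrite add0r subrr enorm0 mulr0 addr0 mulr0 scale0r subr0.
have KS : sig * Kc * (C' + 1) <= eps.
  by rewrite -mulrA -ler_pdivlMr// mulr_gt0// ltr_wpDl.
have SK0 : 0 <= sig * Kc by rewrite mulr_ge0// ltW.
move=> t; rewrite hx he; have tT := time_itv t; have /andP[c0 c1] := chi01 (time_ge0 t).
have p1 := push_le als bes d0 ds b0 bs Bb tT; have p2 := dpush_le bes d0 ds bs Bb tT.
rewrite /xi /eta [xi_of g t + _]addrC addrK [eta_of g t + _]addrC addrK; split.
  rewrite enormZ (ger0_norm c0); apply: le_trans KS; apply: le_trans (ler_piMl (enorm_ge0 _) c1) _.
  by apply: le_trans p1 _; rewrite ler_peMr// lerDr.
apply: le_trans KS; rewrite mulrDr mulr1; apply: le_trans (enormD _ _) _; apply: lerD.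
  rewrite enormZ mulrC; apply: ler_pM; rewrite ?enorm_ge0//.
  by apply: le_trans (bump_dchiT tT) _; rewrite lerDl.
by rewrite enormZ (ger0_norm c0); apply: le_trans (ler_piMl (enorm_ge0 _) c1) _.
Qed.

End perturbation.

(** The change of slope due to the shift, with its value at time 0 set apart. Each of the four
    remaining products will be a small constant times the elapsed time or times the change of
    velocity [h - v]. *)
Lemma dotv_slope_split (R : realType) (n : nat) (p q p0 q0 h r v b : 'rV[R]_n) :
  dotv p (h + r) - dotv q h = dotv p0 (v + b) - dotv q0 v +
   (dotv (p - q) (h - v) + dotv ((p - q) - (p0 - q0)) v + dotv p (r - b) + dotv (p - p0) b).
Proof. by rewrite !(dotvDr, dotvDl, dotvNl, dotvNr); ring. Qed.

Lemma dotv_slope_split2 (R : realType) (n : nat) (p q h r : 'rV[R]_n) :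
  dotv p (h + r) - dotv q h = dotv (p - q) h + dotv p r.
Proof. by rewrite dotvDr dotvBl addrAC. Qed.

(** * Respecting the constraint near a boundary point *)

Section boundary.
Context {R : realType} {n : nat} {T : {posnum R}} {Omega : domain R n}.
Implicit Types (al be : 'rV[R]_n) (t x : R).
Variables (g : curve T Omega) (E : R) (kE : kinetic (eta_of g) E).
Let x0 := xi_of g (time0 T).
Let v := eta_of g (time0 T).
Variables (phi : 'rV[R]_n -> R) (e : 'rV[R]_n) (rho L : R) (ch : chart Omega x0 phi e rho L).
Hypothesis fx0 : frontier Omega x0.
Variables (tau : R) (tau0 : 0 < tau) (tauT : tau <= T%:num).
Hypothesis tau_near : forall t : R, 0 <= t <= tau -> enorm (line g t - x0) < rho / 2.
Variables (chi dchi : R -> R) (C : R).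
Hypothesis C0 : 0 <= C.
Hypothesis chiD : forall x : R, is_derive x 1 chi (dchi x).
Hypothesis chi0 : chi 0 = 1 /\ dchi 0 = 0.
Hypothesis chi_prop : forall x, 0 <= x ->
  [/\ 0 <= chi x, chi x <= 1, x <= tau / 2 -> 2^-1 <= chi x & tau <= x -> chi x = 0].
Hypothesis dchi_lip : forall x y, 0 <= x -> 0 <= y -> `|dchi x - dchi y| <= C * `|x - y|.
Variable Q : R -> R.
Hypothesis Q0 : Q 0 = 0.
Hypothesis QD : forall x : R, 0 <= x <= T%:num -> is_derive x 1 Q (speed g x).
Local Notation X := (line g).
Local Notation "'B' y" := (enorm (y - x0) < rho) (at level 10, y at level 9).
Let H t := eta_of g (clamp T t).
Let Vb := enorm v + Num.sqrt (E * T%:num).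
Let L0 : 0 <= L. Proof. exact: chart_L ch. Qed.
Let rho0 : 0 < rho. Proof. exact: chart_rho ch. Qed.
Let Vb0 : 0 <= Vb. Proof. by rewrite addr_ge0 ?enorm_ge0 ?sqrtr_ge0. Qed.
Let HV t : enorm (H t) <= Vb. Proof. exact: eta_bound kE. Qed.
Let H0 : H 0 = v. Proof. by rewrite /H -{1}(val_time0 (T := T)) clampK. Qed.
Let X0 : X 0 = x0. Proof. by rewrite -(val_time0 (T := T)) line_val. Qed.
Let T0 : 0 <= T%:num. Proof. by []. Qed.
Let phi0 : phi x0 = 0.
Proof. by apply/(chart_frontier ch) => //; rewrite subrr enorm0. Qed.
Let chi01 x : 0 <= x -> 0 <= chi x <= 1. Proof. by move=> /chi_prop[-> ->]. Qed.

Let tI t : 0 <= t <= tau -> 0 <= t <= T%:num.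
Proof. by move=> /andP[-> /le_trans]; exact. Qed.

Lemma Q_ge t : 0 <= t <= T%:num -> t ^+ 2 / 2 <= Q t.
Proof.
move=> /andP[t0 tT].
have d (s : R) : 0 <= s <= t -> is_derive s 1 (fun s => Q s + - (s ^+ 2 / 2)) (speed g s + - s).
  move=> /andP[s0 st]; have sT : 0 <= s <= T%:num by rewrite s0 (le_trans st).
  have h1 : is_derive s 1 (fun s : R => - (s ^+ 2 / 2)) (- s).
    apply/is_derive_eps => d d0; exists d => // y ys.
    have -> : - (y ^+ 2 / 2) - - (s ^+ 2 / 2) - (y - s) * - s = - ((y - s) * (y - s) / 2) by field.
    rewrite normrN !normrM normfV (ger0_norm (_ : 0 <= 2))// -mulrA mulrCA mulrC ler_wpM2r//.
    by rewrite ler_pdivrMr//; have := normr_ge0 (y - s); lra.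
  exact: (is_deriveD (QD sT) h1).
have [c /andP[c0 ct]] := mean_value t0 d.
rewrite Q0 expr0n mul0r oppr0 addr0 !subr0 => E1; rewrite -subr_ge0 E1 mulr_ge0 ?addr0//.
by rewrite /speed addrAC subrr add0r enorm_ge0.
Qed.

Section perturbed.
Variables (al be : 'rV[R]_n) (sig : R).
Hypotheses (als : enorm al <= sig) (bes : enorm be <= sig).
Let sig0 : 0 <= sig. Proof. exact: le_trans (enorm_ge0 _) als. Qed.

Definition shifted t := X t + chi t *: (al + t *: be).
Let rr t := dchi t *: (al + t *: be) + chi t *: be.

Let ab t : 0 <= t <= T%:num -> enorm (al + t *: be) <= sig * (1 + T%:num).
Proof.
move=> /andP[t0 tT]; apply: le_trans (enormD _ _) _; rewrite enormZ ger0_norm// mulrDr mulr1 lerD//.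
by rewrite mulrC ler_pM ?enorm_ge0.
Qed.

Let cab t : 0 <= t <= T%:num -> enorm (chi t *: (al + t *: be)) <= chi t * (sig * (1 + T%:num)).
Proof.
move=> tT; have /andP[t0 _] := tT; have /andP[c0 c1] := chi01 t0.
by rewrite enormZ ger0_norm// ler_wpM2l// ab.
Qed.

Let cab1 t : 0 <= t <= T%:num -> enorm (chi t *: (al + t *: be)) <= sig * (1 + T%:num).
Proof.
move=> tT; have /andP[t0 _] := tT; have /andP[c0 c1] := chi01 t0.
by apply: le_trans (cab tT) _; rewrite ler_piMl// mulr_ge0// addr_ge0.
Qed.

Let Cr := C * T%:num * (1 + T%:num) + 1.
Let Cr0 : 0 <= Cr. Proof. by rewrite /Cr !addr_ge0// !mulr_ge0// addr_ge0. Qed.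

Let rr_le t : 0 <= t <= T%:num -> enorm (rr t) <= sig * Cr.
Proof.
move=> tT; have /andP[t0 _] := tT; have /andP[c0 c1] := chi01 t0.
apply: le_trans (enormD _ _) _; rewrite /Cr mulrDr mulr1; apply: lerD.
  rewrite enormZ mulrCA; apply: ler_pM; rewrite ?enorm_ge0//; last exact: ab.
  exact: (bump_dchiT C0 chi0 dchi_lip).
by rewrite enormZ ger0_norm//; apply: le_trans (ler_piMl (enorm_ge0 _) c1) _.
Qed.

Let rrB_le t : 0 <= t <= T%:num -> enorm (rr t - be) <= sig * (C * (1 + 2 * T%:num)) * t.
Proof.
move=> tT; have /andP[t0 t1] := tT.
have -> : rr t - be = dchi t *: (al + t *: be) + (chi t - chi 0) *: be.
  by rewrite chi0.1 /rr; apply/rowP => i; rewrite !mxE; ring.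
apply: le_trans (enormD _ _) _; rewrite !enormZ.
have h1 : `|dchi t| * enorm (al + t *: be) <= C * t * (sig * (1 + T%:num)).
  by apply: ler_pM; rewrite ?enorm_ge0 ?ab//; exact: (bump_dchi chi0 dchi_lip).
have h2 : `|chi t - chi 0| * enorm be <= C * T%:num * t * sig.
  apply: ler_pM; rewrite ?enorm_ge0//.
  have := bump_lip C0 chiD chi0 dchi_lip (lexx 0) t0 t1; by rewrite subr0.
apply: le_trans (lerD h1 h2) _.
by rewrite le_eqVlt; apply/orP; left; apply/eqP; ring.
Qed.

Lemma vderive_shifted t : 0 <= t <= T%:num -> vderive shifted t (H t + rr t).
Proof.
move=> tT; apply: vderiveD; first exact: vderive_line.
apply: (vderiveZ (chiD t)).
have idd : is_derive t 1 (fun x : R => x) 1 by exact: is_derive_id.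
apply: vderive_ext (vderiveD (vderive_cst al t) (vderiveZ idd (vderive_cst be t))) => //.
by rewrite scale1r scaler0 addr0 add0r.
Qed.

Hypothesis sigrho : sig * (1 + T%:num) <= rho / 4.

Lemma shifted_near t : 0 <= t <= tau -> enorm (shifted t - x0) < 3 * rho / 4.
Proof.
move=> tt; have k2 := tau_near tt; have k1 := le_trans (cab1 (tI tt)) sigrho.
rewrite /shifted addrAC; apply: le_lt_trans (enormD _ _) _.
have -> : 3 * rho / 4 = rho / 2 + rho / 4 by field.
exact: ltr_leD.
Qed.

Let BX t : 0 <= t <= tau -> B (X t). Proof. by move=> /tau_near; have := rho0; lra. Qed.
Let BS t : 0 <= t <= tau -> B (shifted t). Proof. by move=> /shifted_near; have := rho0; lra. Qed.

Let SX t : shifted t - X t = chi t *: (al + t *: be).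
Proof. by rewrite /shifted addrC addKr. Qed.

Let D t := grad phi (shifted t) - grad phi (X t).

Let D_le t : 0 <= t <= tau -> enorm (D t) <= n%:R * L * (sig * (1 + T%:num)).
Proof.
move=> tt; apply: le_trans (chart_lip ch (BS tt) (BX tt)) _; rewrite ler_wpM2l ?mulr_ge0//.
by rewrite SX; exact: cab1 (tI tt).
Qed.

Variables (d s : R).
Hypothesis d0 : 0 <= d.
Hypothesis hess : forall i a b, B a -> B b -> enorm (a - b) < s ->
  enorm (grad (partial i phi) a - grad (partial i phi) b) <= d.
Hypothesis sigs : sig * (1 + T%:num) < s.

(** This is where the modulus of continuity of the second derivatives is used: with a bound on them
    alone, the coefficient of [t] would not become small with the shift. *)
Let DD_le t : 0 <= t <= tau -> enorm (D t - D 0) <= n%:R * ((d * Vb + L * (sig * Cr)) * t).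
Proof.
move=> /andP[t0 tt]; apply: enorm_le_coord => [|i].
  by rewrite mulr_ge0// addr_ge0// !mulr_ge0.
pose f x := partial i phi (shifted x) + - partial i phi (X x).
have st x : 0 <= x <= t -> 0 <= x <= tau by move=> /andP[-> /le_trans]; exact.
have fd (x : R) : 0 <= x <= t -> is_derive x 1 f
    (dotv (grad (partial i phi) (shifted x)) (H x + rr x) - dotv (grad (partial i phi) (X x)) (H x)).
  move=> /st xt.
  have h1 := strict_grad_chain (chart_strict_partial ch i (BS xt)) (vderive_shifted (tI xt)).
  have h2 := strict_grad_chain (chart_strict_partial ch i (BX xt)) (vderive_line g (tI xt)).
  exact: (is_deriveB h1 h2).
have [c /st ct] := mean_value t0 fd; rewrite /f subr0 => fE.
have -> : (D t - D 0) ord0 i = f t - f 0 by rewrite /D !mxE.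
rewrite fE normrM (ger0_norm t0) ler_wpM2r//.
set p := grad _ _; set q := grad _ _.
have -> : dotv p (H c + rr c) - dotv q (H c) = dotv (p - q) (H c) + dotv p (rr c).
  exact: dotv_slope_split2.
apply: le_trans (ler_normD _ _) _; apply: lerD; apply: le_trans (cauchy_schwarz _ _) _.
  apply: ler_pM; rewrite ?enorm_ge0//; apply: hess; [exact: BS|exact: BX|].
  by rewrite SX; exact: le_lt_trans (cab1 (tI ct)) sigs.
apply: ler_pM; rewrite ?enorm_ge0//; last exact: rr_le (tI ct).
by apply: (chart_hess_le ch); exact: BS.
Qed.

Definition slope_const := n%:R * L * (1 + T%:num) + n%:R * L * Cr * enorm v + L * C * (1 + 2 * T%:num) +
  n%:R * L * (Vb + Cr).

Let slope t : 0 <= t <= tau -> sig <= 1 ->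
  dotv (grad phi (shifted t)) (H t + rr t) - dotv (grad phi (X t)) (H t) <=
  dotv (grad phi (x0 + al)) (v + be) - dotv (grad phi x0) v +
  (sig * slope_const + n%:R * d * Vb * enorm v) * speed g t.
Proof.
move=> tt sig1; have tT := tI tt; have /andP[t0 _] := tt.
have z0 : 0 <= (0 : R) <= tau by rewrite lexx ltW.
have S0 : shifted 0 = x0 + al by rewrite /shifted X0 chi0.1 scale1r scale0r addr0.
have E1 : dotv (grad phi (shifted t)) (H t + rr t) - dotv (grad phi (X t)) (H t) =
   dotv (grad phi (x0 + al)) (v + be) - dotv (grad phi x0) v +
   (dotv (D t) (H t - v) + dotv (D t - D 0) v + dotv (grad phi (shifted t)) (rr t - be) +
    dotv (grad phi (shifted t) - grad phi (shifted 0)) be).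
  by rewrite /D S0 X0; exact: dotv_slope_split.
rewrite E1 lerD2l.
have h1 : dotv (D t) (H t - v) <= sig * (n%:R * L * (1 + T%:num)) * enorm (H t - v).
  apply: le_trans (dotv_le _ _) _; rewrite ler_wpM2r ?enorm_ge0//.
  by apply: le_trans (D_le tt) _; rewrite mulrCA.
have h2 : dotv (D t - D 0) v <= (n%:R * d * Vb * enorm v + sig * (n%:R * L * Cr * enorm v)) * t.
  apply: le_trans (dotv_le _ _) _.
  have -> : (n%:R * d * Vb * enorm v + sig * (n%:R * L * Cr * enorm v)) * t =
    n%:R * ((d * Vb + L * (sig * Cr)) * t) * enorm v by ring.
  by rewrite ler_wpM2r ?enorm_ge0// DD_le.
have h3 : dotv (grad phi (shifted t)) (rr t - be) <= sig * (L * C * (1 + 2 * T%:num)) * t.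
  apply: le_trans (dotv_le _ _) _.
  have -> : sig * (L * C * (1 + 2 * T%:num)) * t = L * (sig * (C * (1 + 2 * T%:num)) * t) by ring.
  apply: ler_pM; rewrite ?enorm_ge0//; last exact: rrB_le.
  by apply: (chart_grad_le ch); exact: BS.
have h4 : dotv (grad phi (shifted t) - grad phi (shifted 0)) be <= sig * (n%:R * L * (Vb + Cr)) * t.
  apply: le_trans (dotv_le _ _) _.
  have -> : sig * (n%:R * L * (Vb + Cr)) * t = n%:R * L * ((Vb + Cr) * t) * sig by ring.
  apply: ler_pM; rewrite ?enorm_ge0//; apply: le_trans (chart_lip ch (BS tt) (BS z0)) _.
  rewrite ler_wpM2l ?mulr_ge0// -[t in leRHS]subr0.
  apply: (@vmean_value _ _ shifted (fun t => H t + rr t)) => // y /andP[y0 yt].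
    by apply: vderive_shifted; rewrite y0 (le_trans yt)//; case/andP: tT.
  apply: le_trans (enormD _ _) _; rewrite lerD//.
  have yT : 0 <= y <= T%:num by rewrite y0 (le_trans yt)//; case/andP: tT.
  by apply: le_trans (rr_le yT) _; rewrite ler_piMl.
apply: le_trans (lerD (lerD (lerD h1 h2) h3) h4) _.
have -> : speed g t = t + enorm (H t - v) by [].
set q := enorm (H t - v); have q0 : 0 <= q by exact: enorm_ge0.
have k1 : 0 <= n%:R * L * (1 + T%:num) by rewrite !mulr_ge0// addr_ge0.
have k2 : 0 <= n%:R * L * Cr * enorm v by rewrite !mulr_ge0 ?enorm_ge0.
have k3 : 0 <= L * C * (1 + 2 * T%:num) by rewrite !mulr_ge0// addr_ge0// mulr_ge0.
have k4 : 0 <= n%:R * L * (Vb + Cr) by rewrite !mulr_ge0// addr_ge0.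
have k5 : 0 <= n%:R * d * Vb * enorm v by rewrite !mulr_ge0 ?enorm_ge0.
rewrite /slope_const; move: k1 k2 k3 k4 k5.
set a1 := n%:R * L * (1 + T%:num); set a2 := n%:R * L * Cr * _; set a3 := L * C * _.
set a4 := n%:R * L * (Vb + Cr); set a5 := n%:R * d * Vb * _ => k1 k2 k3 k4 k5.
rewrite -subr_ge0.
have -> : (sig * (a1 + a2 + a3 + a4) + a5) * (t + q) - (sig * a1 * q + (a5 + sig * a2) * t + sig * a3 * t + sig * a4 * t) =
  sig * a1 * t + (sig * (a2 + a3 + a4) + a5) * q by ring.
by rewrite addr_ge0// !mulr_ge0// ?addr_ge0// ?mulr_ge0// ?addr_ge0// addr_ge0.
Qed.

(** [slope] integrated from 0: its constant part gives the linear term, and its multiple of [speed]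
    becomes [del * Q]. *)
Lemma shifted_estimate t (del : R) : 0 <= t <= tau -> sig <= 1 ->
  sig * slope_const + n%:R * d * Vb * enorm v <= del ->
  phi (shifted t) <= phi (x0 + al) + phi (X t) +
    t * (dotv (grad phi (x0 + al)) (v + be) - dotv (grad phi x0) v) + del * Q t.
Proof.
move=> tt sig1 Kdel; have /andP[t0 t1] := tt; set w := _ - dotv (grad phi x0) v.
have st y : 0 <= y <= t -> 0 <= y <= tau by move=> /andP[-> /le_trans]; exact.
pose G y := phi (shifted y) - phi (X y) + - (y * w + del * Q y).
have GD (y : R) : 0 <= y <= t -> is_derive y 1 G
   (dotv (grad phi (shifted y)) (H y + rr y) - dotv (grad phi (X y)) (H y) + - (w + del * speed g y)).
  move=> /st yt.
  have h1 := strict_grad_chain (chart_strict ch (BS yt)) (vderive_shifted (tI yt)).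
  have h2 := strict_grad_chain (chart_strict ch (BX yt)) (vderive_line g (tI yt)).
  have h3 : is_derive y 1 (fun y : R => y * w) w.
    by apply/is_derive_eps => q q0; exists 1 => // z _; rewrite -mulrBl subrr normr0 mulr_ge0// ltW.
  have h4 : is_derive y 1 (del \*: Q) (del *: speed g y) by exact: is_deriveZ (QD (tI yt)).
  exact: (is_deriveD (is_deriveB h1 h2) (is_deriveN (is_deriveD h3 h4))).
have [c ct] := mean_value t0 GD; rewrite subr0.
have S0 : shifted 0 = x0 + al by rewrite /shifted X0 chi0.1 scale1r scale0r addr0.
have G0 : G 0 = phi (x0 + al) by rewrite /G S0 X0 phi0 Q0 mul0r mulr0 !(addr0, oppr0).
have := slope (st c ct) sig1; rewrite -/w => le1.
have /andP[c0 c1] := ct.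
have sp0 : 0 <= speed g c by have /andP[] := speed_le kE (tI (st c ct)).
have := ler_wpM2r sp0 Kdel => le2 GE.
have : G t - G 0 <= 0 by rewrite GE mulr_le0_ge0//; lra.
rewrite G0 /G; lra.
Qed.

End perturbed.

(** Order of the choices: [del] fixes the oscillation allowed to the second derivatives, which fixes
    the distance [s], and [sig] comes last. *)
Lemma gap_estimate (del : R) : 0 < del -> exists2 sig, 0 < sig & sig * (1 + T%:num) <= rho / 4 /\
  forall al be, enorm al <= sig -> enorm be <= sig -> forall t, 0 <= t <= tau ->
  phi (shifted al be t) <= phi (x0 + al) + phi (X t) +
    t * (dotv (grad phi (x0 + al)) (v + be) - dotv (grad phi x0) v) + del * Q t.
Proof.
move=> del0; have del2 : 0 < del / 2 by rewrite divr_gt0.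
have N0 : 0 <= n%:R * Vb * enorm v by rewrite !mulr_ge0 ?enorm_ge0.
have N1 : 0 < 1 + n%:R * Vb * enorm v by rewrite ltr_pwDl.
have [s s0 Hs] := chart_hess_unif ch (divr_gt0 del2 N1).
have T1 : 0 < 1 + T%:num by rewrite addr_gt0.
have K0 : 0 < 1 + `|slope_const| by rewrite ltr_pwDl.
pose sig := Num.min (Num.min 1 (rho / 4 / (1 + T%:num)))
  (Num.min (s / 2 / (1 + T%:num)) (del / 2 / (1 + `|slope_const|))).
have : 0 < sig by rewrite !lt_min ltr01 !divr_gt0.
have /and4P[] : [&& sig <= 1, sig <= rho / 4 / (1 + T%:num), sig <= s / 2 / (1 + T%:num) &
    sig <= del / 2 / (1 + `|slope_const|)] by rewrite andbA -!le_min lexx.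
move: sig => sig s1; rewrite (ler_pdivlMr _ _ T1) => s2; rewrite (ler_pdivlMr _ _ T1) => s3.
rewrite (ler_pdivlMr _ _ K0) => s4 sig0.
exists sig => //; split=> // al be als bes t tt.
apply: (shifted_estimate als bes s2 (d := del / 2 / (1 + n%:R * Vb * enorm v)) _ Hs) => //.
- by rewrite !divr_ge0// ltW.
- by apply: le_lt_trans s3 _; rewrite ltr_pdivrMr// ltr_pMr// ltr1n.
have h1 : sig * slope_const <= del / 2.
  apply: le_trans s4; rewrite ler_wpM2l ?(ltW sig0)//.
  by apply: le_trans (ler_norm _) _; rewrite lerDr.
have h2 : n%:R * (del / 2 / (1 + n%:R * Vb * enorm v)) * Vb * enorm v <= del / 2.
  have -> : n%:R * (del / 2 / (1 + n%:R * Vb * enorm v)) * Vb * enorm v =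
    del / 2 * ((n%:R * Vb * enorm v) / (1 + n%:R * Vb * enorm v)) by ring.
  by rewrite ler_piMr ?(ltW del2)// ler_pdivrMr// mul1r lerDr.
by apply: le_trans (lerD h1 h2) _; rewrite -splitr.
Qed.

(** Up to [tau / 2], the factor 4 of [push] makes up for the slope [1 / 2] of [phi] along [e] and
    for [chi >= 1 / 2], so [phi] drops by at least [del * Q + Br], which covers the estimate for the
    shifted curve. Between [tau / 2] and [tau], shift and push carry the same factor [chi], and
    [Q >= tau^2 / 8] dominates the size of the shift. After [tau] nothing has changed. *)
Lemma pushed_closure al be (sig del b : R) (Br : R -> R) :
  enorm al <= sig -> enorm be <= sig -> sig * (1 + T%:num) <= rho / 4 ->
  (forall t, 0 <= t <= tau ->
    phi (shifted al be t) <= phi (x0 + al) + phi (X t) +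
    t * (dotv (grad phi (x0 + al)) (v + be) - dotv (grad phi x0) v) + del * Q t) ->
  (forall t, 0 <= t <= tau ->
    phi (X t) + t * (dotv (grad phi (x0 + al)) (v + be) - dotv (grad phi x0) v) <= b * t) ->
  (forall t, 0 <= t -> [/\ b * t - - phi (x0 + al) <= Br t, 0 <= Br t & Br t <= b * t]) ->
  0 <= b -> b <= del -> 4 * del * ((T%:num + Num.sqrt (E * T%:num)) * T%:num + T%:num) * enorm e <= rho / 4 ->
  L * (sig * (1 + T%:num)) <= del * tau ^+ 2 / 4 ->
  forall t : time T, closure Omega (xi_of g t + chi (set_val t) *: push e Q al be del Br (set_val t)).
Proof.
move=> als bes sr est ref Bb b0 bd er Ls tt; have t0 := time_ge0 tt; have tT := time_itv tt.
rewrite -line_val; set t := set_val tt in t0 tT *.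
have [c0 c1 ch2 ctau] := chi_prop t0.
have [taut|ttau] := leP tau t.
  by rewrite ctau// scale0r addr0 line_val; exact: curve_closure.
have tI' : 0 <= t <= tau by rewrite t0 ltW.
have del0 : 0 <= del by exact: le_trans bd.
have [Ba B0 Bt] := Bb t t0.
have Qt := Q_ge tT; have Qt0 : 0 <= Q t by apply: le_trans Qt; rewrite divr_ge0 ?sqr_ge0.
have QM : Q t <= (T%:num + Num.sqrt (E * T%:num)) * T%:num.
  by apply: le_trans (ler_norm _) (Q_le kE Q0 QD tT).
pose m := 4 * (del * Q t + Br t).
have m0 : 0 <= m by rewrite mulr_ge0// addr_ge0// mulr_ge0.
have -> : X t + chi t *: push e Q al be del Br t = shifted al be t - (chi t * m) *: e.
  by rewrite /shifted /push -/m; apply/rowP => i; rewrite !mxE; ring.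
have near1 := shifted_near als bes sr tI'.
have cm0 : 0 <= chi t * m by exact: mulr_ge0.
have m_le : enorm ((chi t * m) *: e) <= rho / 4.
  rewrite enormZ (ger0_norm cm0); apply: le_trans er; rewrite ler_wpM2r ?enorm_ge0//.
  apply: le_trans (ler_piMl m0 c1) _; rewrite /m -mulrA ler_wpM2l// mulrDr; apply: lerD.
    by rewrite ler_wpM2l.
  by apply: le_trans Bt _; apply: ler_pM => //; case/andP: tT.
have BS : B (shifted al be t) by have := rho0; lra.
have BP : B (shifted al be t - (chi t * m) *: e).
  rewrite addrAC; apply: le_lt_trans (enormBle _ _) _.
  by have := ltr_leD near1 m_le; have := rho0; lra.
apply/(chart_closure ch BP); apply: le_trans (chart_push ch BS BP cm0) _.
have E1 : 2^-1 * (chi t * m) = 2 * chi t * (del * Q t + Br t) by rewrite /m; field.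
rewrite E1 subr_le0; have W0 : 0 <= del * Q t + Br t by rewrite addr_ge0// mulr_ge0.
have [t2|t2] := leP t (tau / 2).
  have h1 := est t tI'; have h2 := ref t tI'; have h3 := ch2 t2.
  have h4 : del * Q t + Br t <= 2 * chi t * (del * Q t + Br t) by rewrite ler_peMl//; lra.
  lra.
have BX : B (X t) by have := tau_near tI'; have := rho0; lra.
have := chart_lip1 ch BX BS; rewrite ler_norml => /andP[_ h1].
have h2 : phi (X t) <= 0 by apply/(chart_closure ch BX); rewrite line_val; exact: curve_closure.
have h3 : enorm (shifted al be t - X t) <= chi t * (sig * (1 + T%:num)).
  rewrite /shifted [X t + _]addrC addrK enormZ (ger0_norm c0) ler_wpM2l//.
  apply: le_trans (enormD _ _) _; rewrite enormZ (ger0_norm t0) mulrDr mulr1 lerD// mulrC.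
  by apply: ler_pM; rewrite ?enorm_ge0//; case/andP: tT.
have h4 : L * (sig * (1 + T%:num)) <= 2 * (del * Q t).
  apply: le_trans Ls _; have -> : 2 * (del * Q t) = del * (2 * Q t) by ring.
  have -> : del * tau ^+ 2 / 4 = del * (tau / 2) ^+ 2 by field.
  rewrite ler_wpM2l//.
  have : (tau / 2) ^+ 2 <= t ^+ 2 by rewrite ler_pXn2r ?nnegrE// ?divr_ge0// ltW.
  lra.
have h5 : L * enorm (shifted al be t - X t) <= chi t * (2 * (del * Q t)).
  apply: le_trans (ler_wpM2l L0 h3) _; rewrite mulrCA ler_wpM2l//.
have h6 : 0 <= 2 * chi t * Br t by rewrite !mulr_ge0.
rewrite mulrDr; lra.
Qed.

End boundary.

(** * Following a trajectory from a neighbouring starting point *)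

Section approximation.
Context {R : realType} {n : nat} {T : {posnum R}} {Omega : domain R n}.
Implicit Types (g h : curve T Omega) (z : phase Omega).
Let T0 : 0 < T%:num. Proof. by []. Qed.

Lemma exists_primitive_speed g : exists2 Q : R -> R, Q 0 = 0 &
  forall x : R, 0 <= x <= T%:num -> is_derive x 1 Q (speed g x).
Proof. by apply: primitive_continuous => //; exact: continuous_speed. Qed.

Lemma line_near g (r : R) : 0 < r -> exists2 d, 0 < d & forall t : R, 0 <= t <= d ->
  enorm (line g t - xi_of g (time0 T)) < r.
Proof.
move=> r0; have z0 : 0 <= (0 : R) <= T%:num by rewrite lexx /=.
have [d d0 Hd] := vderive_cont (vderive_line g z0) r0.
have l0 : line g 0 = xi_of g (time0 T) by rewrite -(val_time0 (T := T)) line_val.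
exists (d / 2); first by rewrite divr_gt0.
move=> t /andP[t0 td]; rewrite -l0; apply: Hd; rewrite subr0 ger0_norm//; lra.
Qed.

Lemma admissible_slope z phi e rho L : @admissible R n Omega z -> frontier Omega (pos z) ->
  chart Omega (pos z) phi e rho L -> dotv (grad phi (pos z)) (vel z) <= 0.
Proof.
move=> az fz ch; have B0 : enorm (pos z - pos z) < rho by rewrite subrr enorm0 (chart_rho ch).
have [U D] := chart_def ch B0; have := az fz.
rewrite (outward_normalE fz D) dotvZr dotvC pmulr_rle0// invr_gt0.
by have := chart_grad_gt0 ch B0.
Qed.

(** [dB] is nondecreasing, with slopes at most [2 b^2 / a] and total increase at most [b]; its
    energy is at most the product of the two. *)
Lemma brake_energy (dB : R -> R) (a b sig : R) : 0 <= b -> 0 <= a -> (a = 0 -> b = 0) -> dB 0 = 0 ->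
  (forall x, 0 <= x -> 0 <= dB x <= b) ->
  (forall x y, 0 <= x -> x <= y -> 0 <= dB y - dB x /\ dB y - dB x <= 2 * b ^+ 2 / a * (y - x)) ->
  2 * b ^+ 3 <= sig * a -> 0 <= sig ->
  energy_le (fun s t : time T => dB (set_val t) - dB (set_val s)) sig.
Proof.
move=> b0 a0 ab dB0 dBb H ba sig0; pose k := 2 * b ^+ 2 / a.
have k0 : 0 <= k by rewrite divr_ge0// mulr_ge0// sqr_ge0.
have hh : {homo (fun x => dB (Num.max 0 x)) : x y / x <= y}.
  move=> x y xy; rewrite -subr_ge0; apply: (H _ _ _ _).1; first by rewrite le_max lexx.
  by rewrite ge_max !le_max lexx /= xy orbT.
have := @energy_le_nondecreasing R T (fun s t => dB (set_val t) - dB (set_val s)) _ k k0 hh.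
move=> /(_ _)/wrap[s t st|].
  rewrite !max_r ?time_ge0//; have [h1 h2] := H _ _ (time_ge0 s) st.
  by rewrite expr2; apply: ler_wpM2r.
apply: energy_leW; rewrite max_r// max_l// dB0 subr0.
have /andP[d1 d2] := dBb _ (ltW T0).
apply: le_trans (ler_wpM2l k0 d2) _; rewrite /k.
have [a00|an] := eqVneq a 0; first by rewrite ab// expr0n mulr0.
rewrite mulrAC ler_pdivrMr; last by rewrite lt_neqAle eq_sym an.
by rewrite -mulrA -exprSr.
Qed.

Variable (Theta : set (phase Omega)).
Hypotheses (adm : Theta `<=` @admissible R n Omega) (cA : condition_A Theta).
Hypothesis bdO : C2_boundary Omega.

(** From an interior point, a shift that the bump stops while [g] is still in a ball of the domain
    is enough, with no push. From a boundary point, the push works in a chart, with [a = - phi] and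
    [b] the outgoing slope, both taken at the new starting phase. *)
Lemma approx_curve (u : nat -> phase Omega) g E : (forall k, Theta (u k)) -> Theta (ev (time0 T) g) ->
  u @ \oo --> ev (time0 T) g -> kinetic (eta_of g) E -> forall eps, 0 < eps ->
  \forall k \near \oo, exists h, [/\ ev (time0 T) h = u k, close_curve eps g h & kinetic (eta_of h) (E + eps)].
Proof.
move=> uT zT uz kE eps eps0; set z := ev (time0 T) g in zT uz.
have [Q Q0 QD] := exists_primitive_speed g.
pose x0 := xi_of g (time0 T); pose v := eta_of g (time0 T).
have pz : pos z = x0 by []. have vz : vel z = v by [].
have near_u (s : R) : 0 < s -> \forall k \near \oo, enorm (pos (u k) - x0) <= s /\ enorm (vel (u k) - v) <= s.
  move=> s0; apply: filterS2 (cvg_pos uz s0) (cvg_vel uz s0) => k h1 h2.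
  by split; apply: ltW.
have finish k h : xi_of h (time0 T) = x0 + (pos (u k) - x0) ->
    eta_of h (time0 T) = v + (vel (u k) - v) -> ev (time0 T) h = u k.
  by move=> h1 h2; apply: phase_eq; rewrite /pos /vel /= ?h1 ?h2 addrC subrK.
have [fz|nfz] := pselect (frontier Omega (pos z)); last first.
  have Ox : domain_set Omega x0.
    apply: contrapT => nO; apply: nfz; split; first exact: pos_closure.
    by rewrite pz => /nbhs_singleton.
  have [rho rho0 Hrho] := rV_near (open_nbhs_nbhs (conj (@domain_open _ _ Omega) Ox)).
  have r2 : 0 < rho / 2 by rewrite divr_gt0.
  have [tau tau0 Htau] := line_near g r2.
  have [chi [dchi [C [chiD chi0 chiP C0 chiL]]]] := bump_function tau0.
  have chi01 x : 0 <= x -> 0 <= chi x <= 1 by move=> /chiP[-> ->].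
  have [sig sig0 Hsig] := perturbation kE 0 C0 chiD chi0 chi01 chiL Q0 QD eps0.
  have T1 : 0 < 1 + T%:num by rewrite addr_gt0.
  have s0 : 0 < Num.min sig (rho / 2 / (1 + T%:num)) by rewrite lt_min sig0 divr_gt0.
  apply: filterS (near_u _ s0) => k; rewrite !le_min => -[/andP[al1 al2] /andP[be1 be2]].
  have [] := Hsig (pos (u k) - x0) (vel (u k) - v) 0 0 (fun=> 0) (fun=> 0) al1 be1 (lexx _) (ltW sig0) (lexx _) (ltW sig0).
  - by [].
  - by move=> x _; rewrite mul0r.
  - by move=> x y _ _; rewrite subrr.
  - by apply: energy_leW (energy_le_lip (lexx 0) _) => [|s t _]; rewrite ?expr0n ?mul0r ?subrr ?normr0 ?(ltW sig0).
  - move=> t; have t0 := time_ge0 t; have [c0 c1 _ ctau] := chiP _ t0.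
    have [tt|tt] := leP tau (set_val t); first by rewrite ctau// scale0r addr0; exact: curve_closure.
    apply/subset_closure/Hrho; rewrite -line_val.
    have lt : enorm (line g (set_val t) - x0) < rho / 2 by apply: Htau; rewrite t0 ltW.
    rewrite addrAC; apply: le_lt_trans (enormD _ _) _; rewrite [ltRHS]splitr.
    apply: ltr_leD => //; rewrite enormZ (ger0_norm c0).
    apply: le_trans (ler_piMl (enorm_ge0 _) c1) _.
    rewrite /push scaler0 subr0; apply: le_trans (enormD _ _) _; rewrite enormZ (ger0_norm t0).
    have -> : rho / 2 = rho / 2 / (1 + T%:num) + T%:num * (rho / 2 / (1 + T%:num)) by field; rewrite gt_eqF.
    by apply: lerD => //; apply: ler_pM; rewrite ?enorm_ge0// time_leT.
  by move=> h [h1 h2 h3 h4]; exists h; split=> //; exact: finish.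
have [phi [e [rho [L ch]]]] := chart_exists bdO fz.
have rho0 := chart_rho ch; have L0 := chart_L ch.
have B0 : enorm (pos z - pos z) < rho by rewrite subrr enorm0.
have phi0 : phi x0 = 0 by apply/(chart_frontier ch B0).
have w0 := admissible_slope (adm zT) fz ch; rewrite pz vz in w0.
set w := dotv (grad phi x0) v in w0.
have r2 : 0 < rho / 2 by rewrite divr_gt0.
have [tau1 tau10 Htau1] := line_near g r2.
have l0 : line g 0 = x0 by rewrite -(val_time0 (T := T)) line_val.
have fD : is_derive (0 : R) 1 (phi \o line g) w.
  have z0 : 0 <= (0 : R) <= T%:num by rewrite lexx /=.
  have := vderive_line g z0; have -> : eta_of g (clamp T 0) = v by [].
  move=> D; have B0' : enorm (line g 0 - pos z) < rho by rewrite l0 pz subrr enorm0.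
  have := strict_grad_chain (chart_strict ch B0') D; by rewrite l0.
(* When the initial velocity is strictly inward, [phi] is at most [t * (w / 2)] along [g] for small
   times, which absorbs a change of the initial slope by [ew]. When [w = 0], [phi <= 0] along [g]
   suffices, and 1 is an arbitrary positive value. *)
pose ew := if w < 0 then - w / 2 else 1.
have ew0 : 0 < ew by rewrite /ew; case: ifP => // wn; rewrite divr_gt0// oppr_gt0.
have [tau2 tau20 Htau2] := (is_derive_eps _ _ _).1 fD _ ew0.
pose tau := Num.min T%:num (Num.min tau1 (tau2 / 2)).
have tau0 : 0 < tau by rewrite !lt_min T0 tau10 divr_gt0.
have /and3P[tauT ta1 ta2] : [&& tau <= T%:num, tau <= tau1 & tau <= tau2 / 2] by rewrite -!le_min lexx.
have near_tau (t : R) : 0 <= t <= tau -> enorm (line g t - x0) < rho / 2.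
  by move=> /andP[t0 tt]; apply: Htau1; rewrite t0 (le_trans tt).
have fneg (t : R) : 0 <= t <= tau -> w < 0 -> phi (line g t) <= t * (w / 2).
  move=> /andP[t0 tt] wn; have := Htau2 t; rewrite subr0 ger0_norm// /= l0 phi0 subr0 /ew wn.
  move=> /(_ _)/wrap[|]; first by lra.
  by rewrite ler_norml => /andP[_]; lra.
have fnp (t : R) : 0 <= t <= tau -> phi (line g t) <= 0.
  move=> /andP[t0 tt]; have tT : 0 <= t <= T%:num by rewrite t0 (le_trans tt).
  have Bt : enorm (line g t - pos z) < rho by have := near_tau t; rewrite t0 tt pz => /(_ isT); lra.
  apply/(chart_closure ch Bt); have -> : line g t = xi_of g (clamp T t) by rewrite -line_val clamp_id.
  exact: curve_closure.
have [chi [dchi [C [chiD chi0 chiP C0 chiL]]]] := bump_function tau0.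
have chi01 x : 0 <= x -> 0 <= chi x <= 1 by move=> /chiP[-> ->].
have [sig1 sig10 Hsig] := perturbation kE e C0 chiD chi0 chi01 chiL Q0 QD eps0.
have e1 : 0 < 1 + enorm e by rewrite ltr_pwDl ?enorm_ge0.
pose W := (T%:num + Num.sqrt (E * T%:num)) * T%:num + T%:num.
have W0 : 0 < W by rewrite addr_gt0// mulr_gt0// ltr_pwDl// sqrtr_ge0.
pose del := Num.min sig1 (rho / 4 / (4 * W * (1 + enorm e))).
have del0 : 0 < del by rewrite lt_min sig10 !divr_gt0// !mulr_gt0.
have /andP[del1 del2] : (del <= sig1) && (del <= rho / 4 / (4 * W * (1 + enorm e))) by rewrite -le_min lexx.
have [sig2 sig20 [sig2r est]] := gap_estimate kE ch fz tau0 tauT near_tau C0 chiD chi0 chiP chiL Q0 QD del0.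
have T1 : 0 < 1 + T%:num by rewrite addr_gt0.
have L1 : 0 < L + 1 by rewrite ltr_wpDl.
have M0 : 0 < n%:R * L * (enorm v + 1) + L + 1.
  by rewrite ltr_wpDl// addr_ge0// mulr_ge0 ?mulr_ge0// addr_ge0 ?enorm_ge0.
(* In order: [perturbation], [gap_estimate], the second half of the bump in [pushed_closure], the
   bound [b <= del] obtained from [b^3 <= a <= L * s], and a change of the initial slope by at most
   [ew], where 1 bounds the shift of velocity. *)
pose s := Num.min (Num.min sig1 sig2) (Num.min (del * tau ^+ 2 / 4 / ((L + 1) * (1 + T%:num)))
   (Num.min (del ^+ 3 / (L + 1)) (Num.min 1 (ew / (n%:R * L * (enorm v + 1) + L + 1))))).
have s0 : 0 < s by rewrite !lt_min sig10 sig20 ltr01 !divr_gt0// ?mulr_gt0 ?exprn_gt0// mulr_gt0.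
have /and3P[s1 s2 /and4P[s3 s4 s5 s6]] : [&& s <= sig1, s <= sig2 & [&& s <= del * tau ^+ 2 / 4 / ((L + 1) * (1 + T%:num)),
   s <= del ^+ 3 / (L + 1), s <= 1 & s <= ew / (n%:R * L * (enorm v + 1) + L + 1)]].
  by rewrite andbA -!le_min lexx.
clearbody s.
(* In condition (A), the factor 1 gives [b^3 <= a], and the factor [sig1 / 2] bounds the energy
   [2 b^3 / a] of the brake by [sig1]. *)
have q0 : 0 < Num.min 1 (sig1 / 2) by rewrite lt_min ltr01 divr_gt0.
have condA := condition_A_chart adm cA uT zT uz fz ch q0.
near=> k.
have [als bes] : enorm (pos (u k) - x0) <= s /\ enorm (vel (u k) - v) <= s by near: k; exact: near_u.
have [a0 ab0 b3] : [/\ 0 <= - phi (pos (u k)),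
    (- phi (pos (u k)) = 0 -> Num.max (dotv (grad phi (pos (u k))) (vel (u k))) 0 = 0) &
    Num.max (dotv (grad phi (pos (u k))) (vel (u k))) 0 ^+ 3 <= Num.min 1 (sig1 / 2) * - phi (pos (u k))].
  by near: k.
set al := pos (u k) - x0 in als; set be := vel (u k) - v in bes.
have alE : pos (u k) = x0 + al by rewrite /al addrC subrK.
have beE : vel (u k) = v + be by rewrite /be addrC subrK.
rewrite alE beE in a0 ab0 b3.
set a := - phi (x0 + al) in a0 ab0 b3; set wk := dotv (grad phi (x0 + al)) (v + be) in ab0 b3.
set b := Num.max wk 0 in ab0 b3.
have b0 : 0 <= b by rewrite le_max lexx orbT.
have Bk : enorm (x0 + al - pos z) < rho.
  rewrite pz addrC addKr; apply: le_lt_trans als _; apply: le_lt_trans s2 _.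
  have : sig2 <= rho / 4; last by lra.
  by apply: le_trans sig2r; rewrite ler_peMr ?(ltW sig20)// lerDl.
have aL : a <= L * s.
  have := chart_lip1 ch B0 Bk; rewrite pz phi0 subr0 [x0 + al - x0]addrC addKr ler_norml => /andP[h _].
  have : L * enorm al <= L * s by rewrite ler_wpM2l.
  rewrite /a; lra.
have /andP[m1 m2] : (Num.min 1 (sig1 / 2) <= 1) && (Num.min 1 (sig1 / 2) <= sig1 / 2) by rewrite -le_min lexx.
have b_del : b <= del.
  rewrite -(@ler_pXn2r _ 3)// ?nnegrE ?(ltW del0)//; apply: le_trans b3 _.
  apply: le_trans (ler_wpM2r a0 m1) _; rewrite mul1r; apply: le_trans aL _.
  move: s4; rewrite ler_pdivlMr// => s4; lra.
have [Br [dBr [BD [Br0 dBr0] BP BL]]] := brake a0 b0 ab0.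
have [] := Hsig al be del b Br dBr (le_trans als s1) (le_trans bes s1) (ltW del0) del1 b0 (le_trans b_del del1) BD (conj Br0 dBr0).
- by move=> x x0'; have [_ ? ? ? ?] := BP x x0'.
- by move=> x y h1 h2; have [] := BL x y h1 h2.
- apply: (brake_energy b0 a0 ab0 dBr0 _ BL); last exact: ltW.
    by move=> x /BP[_ _ _ -> ->].
  have := ler_wpM2r a0 m2; lra.
- apply: (pushed_closure kE ch tau0 tauT near_tau chiP Q0 QD als bes (b := b)) => //.
  + by apply: le_trans sig2r; rewrite ler_wpM2r// addr_ge0// ltW.
  + by move=> t; apply: est; [exact: le_trans als s2|exact: le_trans bes s2].
  + move=> t tt; have /andP[t0 _] := tt; have ft := fnp t tt.
    rewrite -/w -/wk [b * t]mulrC; have wkb : wk <= b by rewrite le_max lexx.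
    have [wn|wp] := ltP w 0; last first.
      have -> : w = 0 by apply/le_anti; rewrite w0.
      by rewrite subr0; have := ler_wpM2l t0 wkb; lra.
    have fw := fneg t tt wn.
    have dw : `|wk - w| <= ew.
      have -> : wk - w = dotv (grad phi (x0 + al) - grad phi x0) (v + be) + dotv (grad phi x0) be.
        by rewrite /wk /w dotvBl !dotvDr; ring.
      have B00 : enorm (x0 - pos z) < rho by [].
      have := chart_lip ch Bk B00; rewrite [x0 + al - x0]addrC addKr => h1.
      have h2 := chart_grad_le ch B00.
      have h3 : enorm (v + be) <= enorm v + 1.
        by apply: le_trans (enormD _ _) _; rewrite lerD2l (le_trans bes).
      have NL : 0 <= n%:R * L by rewrite mulr_ge0.
      have h4 : enorm (grad phi (x0 + al) - grad phi x0) <= n%:R * L * s.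
        by apply: le_trans h1 _; rewrite ler_wpM2l.
      have k1 : `|dotv (grad phi (x0 + al) - grad phi x0) (v + be)| <= n%:R * L * s * (enorm v + 1).
        by apply: le_trans (cauchy_schwarz _ _) _; apply: ler_pM; rewrite ?enorm_ge0.
      have k2 : `|dotv (grad phi x0) be| <= L * s.
        by apply: le_trans (cauchy_schwarz _ _) _; apply: ler_pM; rewrite ?enorm_ge0.
      apply: le_trans (ler_normD _ _) _; apply: le_trans (lerD k1 k2) _.
      move: s6; rewrite ler_pdivlMr//; lra.
    move: dw; rewrite /ew wn ler_norml => /andP[_ dw].
    have : t * (wk - w / 2) <= t * b.
      by apply: ler_wpM2l => //; rewrite /b le_max; apply/orP; right; lra.
    lra.
  + by move=> t /BP[h1 h2 h3 _ _].
  + move: del2; rewrite ler_pdivlMr ?mulr_gt0// => del2; apply: le_trans del2.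
    have -> : 4 * del * W * enorm e = del * (4 * W * enorm e) by ring.
    rewrite ler_wpM2l ?(ltW del0)// ler_wpM2l ?mulr_ge0 ?(ltW W0)// lerDr//.
  + move: s3; rewrite ler_pdivlMr ?mulr_gt0// => s3; apply: le_trans s3.
    have := ltW T1 => T1'; have -> : s * ((L + 1) * (1 + T%:num)) = (L + 1) * (s * (1 + T%:num)) by ring.
    by rewrite ler_wpM2r ?lerDl// mulr_ge0// ltW.
by move=> h [h1 h2 h3 h4]; exists h; split=> //; exact: finish.
Unshelve. all: by end_near. Qed.

End approximation.

(** * Existence of trajectories of bounded energy *)

Section existence.
Context {R : realType} {n : nat} {T : {posnum R}} {Omega : domain R n}.
Implicit Types (g h : curve T Omega) (z : phase Omega).

(* The curve [x + r(t) v - q r(t)^2 e], where [r] is increasing, bounded by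
   [m], and [r'(0) = 1]. *)
Lemma parabola_curve z (e : 'rV[R]_n) (m q : R) : 0 < m -> 0 <= q ->
  (forall r, 0 <= r <= m -> closure Omega (pos z + r *: vel z - (q * r ^+ 2) *: e)) ->
  exists g E, ev (time0 T) g = z /\ kinetic (eta_of g) E.
Proof.
move=> m0 q0 cl.
have m1 : m = 0 -> 1 = 0 :> R by move=> E; move: m0; rewrite E ltxx.
have [B [dB [BD [B0 dB0] BP BL]]] := brake (ltW m0) ler01 m1.
pose r (t : R) := t - B t; pose dr (t : R) := 1 - dB t.
have rm t : 0 <= t -> 0 <= r t <= m.
  by move=> /BP; rewrite !mul1r => -[h1 h2 h3 _ _]; apply/andP; rewrite /r; split; lra.
have dr1 t : 0 <= t -> 0 <= dr t <= 1.
  by move=> /BP[_ _ _ h4 h5]; apply/andP; rewrite /dr; split; lra.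
have rD (t : R) : 0 <= t -> is_derive t 1 r (dr t).
  by move=> /BD h; exact: (is_deriveB (is_derive_id t 1) h).
have r2D (t : R) : 0 <= t -> is_derive t 1 (fun t => - (q * r t ^+ 2)) (- (2 * q * r t * dr t)).
  move=> t0; have h := is_deriveN (is_deriveZ q (is_deriveM (rD t t0) (rD t t0))).
  apply: (is_derive_ext _ _ h).
    by apply/funext => s; rewrite expr2.
  by rewrite -[_ *: dr t]/(r t * dr t) -[q *: _]/(q * _); ring.
pose X t := pos z + r t *: vel z + (- (q * r t ^+ 2)) *: e.
pose H t := dr t *: vel z + (- (2 * q * r t * dr t)) *: e.
have XD (t : R) : 0 <= t -> vderive X t (H t).
  move=> t0; have h1 := vderiveZ (rD t t0) (vderive_cst (vel z) t).
  have h2 := vderiveZ (r2D t t0) (vderive_cst e t).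
  apply: vderive_ext (vderiveD (vderiveD (vderive_cst (pos z) t) h1) h2) => //.
  by rewrite !scaler0 !addr0 add0r.
have rlip s t : 0 <= s -> s <= t -> `|r t - r s| <= t - s.
  move=> s0 st; have d (x : R) : s <= x <= t -> is_derive x 1 r (dr x).
    by move=> /andP[sx _]; apply: rD; exact: le_trans sx.
  have [c /andP[sc _] ->] := mean_value st d.
  have /andP[d0 d1] := dr1 c (le_trans s0 sc).
  by rewrite normrM (ger0_norm d0) ger0_norm ?subr_ge0// ler_piMl// subr_ge0.
pose Lc := 2 / m * (enorm (vel z) + 2 * q * m * enorm e) + 2 * q * enorm e.
have Lc0 : 0 <= Lc.
  apply: addr_ge0; last by rewrite !mulr_ge0 ?enorm_ge0.
  by apply: mulr_ge0; [rewrite divr_ge0// ltW|rewrite addr_ge0 ?enorm_ge0// !mulr_ge0 ?enorm_ge0// ltW].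
have Hlip s t : 0 <= s -> s <= t -> enorm (H t - H s) <= Lc * (t - s).
  move=> s0 st; have t0 := le_trans s0 st.
  have -> : H t - H s = (dr t - dr s) *: (vel z - (2 * q * r t) *: e) - (2 * q * (r t - r s) * dr s) *: e.
    by apply/rowP => i; rewrite !mxE; ring.
  have [h1 h2] := BL s t s0 st.
  have h3 : `|dr t - dr s| <= 2 / m * (t - s).
    by move: h2; rewrite expr1n mulr1 /dr ler_norml => h2; apply/andP; split; lra.
  have /andP[r0 r1] := rm t t0; have /andP[d0 d1] := dr1 s s0.
  have h4 : enorm (vel z - (2 * q * r t) *: e) <= enorm (vel z) + 2 * q * m * enorm e.
    apply: le_trans (enormBle _ _) _; rewrite lerD2l enormZ ger0_norm ?mulr_ge0//.
    by rewrite ler_wpM2r ?enorm_ge0// ler_wpM2l// mulr_ge0.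
  apply: le_trans (enormBle _ _) _; rewrite !enormZ.
  have -> : Lc * (t - s) = 2 / m * (enorm (vel z) + 2 * q * m * enorm e) * (t - s) + 2 * q * enorm e * (t - s).
    by rewrite /Lc; ring.
  apply: lerD.
    by rewrite [leRHS]mulrAC; apply: ler_pM; rewrite ?enorm_ge0.
  rewrite [leRHS]mulrAC ler_wpM2r ?enorm_ge0// !normrM (ger0_norm (_ : 0 <= 2))// (ger0_norm q0) (ger0_norm d0).
  apply: le_trans (ler_piMr _ d1) _; first by rewrite !mulr_ge0.
  by rewrite ler_wpM2l ?mulr_ge0// rlip.
have d1 : is_derivative_of (fun t : time T => X (set_val t)) (fun t => H (set_val t)).
  by apply: is_derivative_of_restrict => t; exact/XD/time_ge0.
have k1 : kinetic (fun t : time T => H (set_val t)) (Lc ^+ 2 * T%:num).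
  apply: energy_le_lip => // s t st; rewrite ger0_norm ?enorm_ge0//; exact: Hlip (time_ge0 s) st.
have cX (t : time T) : closure Omega (X (set_val t)).
  by rewrite /X scaleNr; apply/cl/rm/time_ge0.
have [g [gx ge]] := curve_build d1 k1 cX.
exists g, (Lc ^+ 2 * T%:num); rewrite ge; split=> //; apply: phase_eq; rewrite /pos /vel /= ?gx ?ge.
  by rewrite val_time0 /X /r B0 subrr scale0r addr0 expr0n mulr0 oppr0 scale0r addr0.
by rewrite val_time0 /H /dr /r dB0 B0 !subr0 scale1r mulr0 mul0r oppr0 scale0r addr0.
Qed.

(** Along the tangent line [phi] has a nonpositive linear part, by admissibility, and a remainder at
    most [n L |v|^2 r^2]. The push [q r^2] along [- e] removes it; the factor 2 in [q] is the
    inverse of the rate [1 / 2] at which [phi] decreases. *)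
Lemma exists_curve z : C2_boundary Omega -> @admissible R n Omega z ->
  exists g E, ev (time0 T) g = z /\ kinetic (eta_of g) E.
Proof.
move=> bdO az; set x := pos z; set v := vel z.
have v1 : 0 < 1 + enorm v by rewrite ltr_pwDl ?enorm_ge0.
have [fz|nfz] := pselect (frontier Omega x); last first.
  have Ox : domain_set Omega x.
    by apply: contrapT => nO; apply: nfz; split; [exact: pos_closure|move=> /nbhs_singleton].
  have [rho rho0 Hrho] := rV_near (open_nbhs_nbhs (conj (@domain_open _ _ Omega) Ox)).
  apply: (@parabola_curve z 0 (rho / 2 / (1 + enorm v)) 0) => //; first by rewrite !divr_gt0.
  move=> r /andP[r0]; rewrite ler_pdivlMr// => rr; rewrite scaler0 subr0.
  apply/subset_closure/Hrho; rewrite addrC addKr enormZ ger0_norm//.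
  have : r * enorm v <= r * (1 + enorm v) by rewrite ler_wpM2l// lerDr.
  lra.
have [phi [e [rho [L ch]]]] := chart_exists bdO fz.
have rho0 := chart_rho ch; have L0 := chart_L ch.
have B0 : enorm (x - x) < rho by rewrite subrr enorm0.
have phi0 : phi x = 0 by apply/(chart_frontier ch B0).
have w0 := admissible_slope az fz ch.
pose q := 2 * (n%:R * L * enorm v ^+ 2).
have q0 : 0 <= q by rewrite mulr_ge0// mulr_ge0 ?sqr_ge0// mulr_ge0.
have M0 : 0 < 1 + enorm v + q * enorm e by rewrite ltr_wpDr// mulr_ge0 ?enorm_ge0.
apply: (@parabola_curve z e (Num.min 1 (rho / 2 / (1 + enorm v + q * enorm e))) q) => //.
  by rewrite lt_min ltr01 !divr_gt0.
move=> r /andP[r0]; rewrite le_min => /andP[r1]; rewrite ler_pdivlMr// => rr.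
have r2 : r ^+ 2 <= r by rewrite expr2 ler_piMr.
have qr0 : 0 <= q * r ^+ 2 by rewrite mulr_ge0 ?sqr_ge0.
have Bp : enorm (x + r *: v - x) < rho.
  rewrite addrC addKr enormZ ger0_norm//; have : r * (q * enorm e) >= 0 by rewrite !mulr_ge0 ?enorm_ge0.
  have := enorm_ge0 v; lra.
have Bq : enorm (x + r *: v - (q * r ^+ 2) *: e - x) < rho.
  rewrite addrAC [x + _ - x]addrC addKr; apply: le_lt_trans (enormBle _ _) _.
  rewrite !enormZ (ger0_norm r0) (ger0_norm qr0).
  have : q * r ^+ 2 * enorm e <= q * r * enorm e by rewrite ler_wpM2r ?enorm_ge0// ler_wpM2l.
  lra.
apply/(chart_closure ch Bq); apply: le_trans (chart_push ch Bp Bq qr0) _.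
have := chart_taylor ch B0 Bp; rewrite -/x phi0 subr0 [x + r *: v - x]addrC addKr ler_norml => /andP[_].
rewrite dotvZr enormZ (ger0_norm r0) exprMn => h.
have : r * dotv (grad phi x) v <= 0 by rewrite mulr_ge0_le0.
rewrite /q; lra.
Qed.

Variables (Theta : set (phase Omega)) (r : R).
Hypotheses (adm : Theta `<=` @admissible R n Omega) (cA : condition_A Theta).
Hypotheses (bdO : C2_boundary Omega) (bO : bounded_set (Omega : set 'rV[R]_n)) (clT : closed Theta).

Lemma phase_bounded : exists M, forall z, enorm (vel z) <= r -> forall c, `|pcoord c z| <= M.
Proof.
have [M [_ HM]] := bO; pose M' := `|M| + 1.
have OM y : domain_set Omega y -> forall i, `|y ord0 i| <= M'.
  move=> Oy i; have := HM M' _ y Oy; have MM : M < M' by rewrite /M'; have := ler_norm M; lra.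
  move=> /(_ MM); apply: le_trans.
  rewrite [leRHS]mx_normrE; exact: (le_bigmax 0 (fun ij : 'I_1 * 'I_n => `|y ij.1 ij.2|) (ord0, i)).
exists (Num.max M' r) => z zr [b i]; rewrite le_max; apply/orP.
case: b; [left|right]; last by apply: le_trans zr; exact: coord_le_enorm.
apply/ler_addgt0Pr => d d0.
have N : nbhs (pos z) [set y | enorm (y - pos z) < d] by apply: near_rV d0 _.
have [y [Oy yz]] := pos_closure N.
have := OM y Oy i; have := le_lt_trans (coord_le_enorm (y - pos z) i) yz; rewrite !mxE.
have := ler_normB (y ord0 i) (y ord0 i - pos z ord0 i); rewrite subKr /pcoord /=.
lra.
Qed.

(** Phases that would require energies above every bound accumulate at a phase of [Theta]; a
    trajectory that starts there is carried over to them by [approx_curve] with energy at most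
    [E + 1]. *)
Lemma uniform_energy : exists E0, forall z, Theta z -> K r z ->
  exists2 g, ev (time0 T) g = z & kinetic (eta_of g) E0.
Proof.
apply: contrapT => /forallNP H.
have /choice[u uP] : forall k : nat, exists z, [/\ Theta z, K r z &
    forall g, ev (time0 T) g = z -> ~ kinetic (eta_of g) k%:R].
  move=> k; have /existsNP[z /not_implyP[z1 /not_implyP[z2 z3]]] := H k%:R.
  by exists z; split=> // g gz kg; apply: z3; exists g.
have [M HM] := phase_bounded.
have [k c|f f_mono [z uz]] := @phase_extraction R n Omega u M.
  by have [_ h _] := uP k; exact: HM.
have zT : Theta z.
  by apply: (@closed_cvg _ _ \oo _ (fun k => u (f k)) Theta) => //; apply: nearW => k; have [] := uP (f k).
have [g [E [gz kE]]] := exists_curve bdO (adm zT).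
have uT k : Theta (u (f k)) by have [] := uP (f k).
rewrite -gz in zT uz.
have := approx_curve adm cA bdO uT zT uz kE ltr01.
move=> [N _ HN]; pose k := (N + Num.truncn (E + 1)%R).+1.
have [h [h1 _ h3]] := HN k (leq_trans (leq_addr _ _) (leqnSn _)).
have [_ _ /(_ h h1)] := uP (f k); apply; apply: energy_leW h3.
have /ltW : E + 1 < (Num.truncn (E + 1)).+1%:R by exact: truncnS_gt.
move=> /le_trans; apply; rewrite ler_nat; apply: leq_trans (increasing_geS f_mono k).
by rewrite ltnS leq_addl.
Qed.

End existence.

(** * Words of bits *)

Lemma sqrtr_le_sqr (R : realType) (x e : R) : 0 <= e -> x <= e ^+ 2 -> Num.sqrt x <= e.
Proof. by move=> e0 /ler_wsqrtr; rewrite sqrtr_sqr ger0_norm. Qed.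

Section bits.
Context {R : realType} {X : Type} {I : countType}.
Variable a : I -> X -> R.

Definition bit (j : nat) (x : X) : bool :=
  if unpickle j is Some (i, q) then a i x < ratr (q : rat) else false.

Lemma bit_pickle i (q : rat) x : bit (pickle (i, q)) x = (a i x < ratr q).
Proof. by rewrite /bit pickleK. Qed.

(* the newest bit comes first *)
Fixpoint word (j : nat) (x : X) : seq bool :=
  if j is j'.+1 then bit j' x :: word j' x else [::].

Lemma size_word j x : size (word j x) = j.
Proof. by elim: j => //= j ->. Qed.

Lemma word_bit M x y : word M x = word M y <-> forall j, (j < M)%N -> bit j x = bit j y.
Proof.
elim: M => [|M IH] /=; first by split.
split=> [[b w] j|H].
  by rewrite ltnS leq_eqVlt => /predU1P[->//|]; exact: IH.1.
by congr (_ :: _); [exact: H|apply/IH => j jM; apply: H; exact: ltnW].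
Qed.

Lemma wordW M N x y : (M <= N)%N -> word N x = word N y -> word M x = word M y.
Proof. by move=> MN /word_bit H; apply/word_bit => j jM; apply: H; exact: leq_trans MN. Qed.

Lemma word_drop M N x : word M x = drop N (word (N + M) x).
Proof. by elim: N => [|N IH]; rewrite ?drop0//= IH. Qed.

(** Along pairs with ever longer common words and values of [a i] more than [e] apart, the values
    would have distinct limits; a rational between these limits is the threshold of a bit on which
    the words differ. *)
Lemma bits_close (A : set X) i (B : R) : (forall x, A x -> `|a i x| <= B) ->
  forall e, 0 < e -> exists M, forall x y, A x -> A y -> word M x = word M y -> `|a i x - a i y| <= e.
Proof.
move=> AB e e0; apply: contrapT => /forallNP H.
have /choice[u uP] : forall M, exists xy : X * X, [/\ A xy.1, A xy.2, word M xy.1 = word M xy.2 &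
    e < `|a i xy.1 - a i xy.2|].
  move=> M; have /existsNP[x /existsNP[y]] := H M.
  move=> /not_implyP[h1 /not_implyP[h2 /not_implyP[h3 /negP]]]; rewrite -ltNge => h4.
  by exists (x, y).
pose s k j := if j is 0%N then a i (u k).1 else a i (u k).2.
have [k j|f f_mono [p pP]] := @diagonal_extraction R s (fun=> B).
  by have [h1 h2 _ _] := uP k; case: j => [|j]; exact: AB.
have p0 := pP 0%N; have p1 := pP 1%N.
have pe : e <= `|p 0%N - p 1%N|.
  apply: (ler_cvg_to (cvg_cst e) (cvg_norm (cvgB p0 p1))).
  by apply: nearW => k; have [_ _ _ /ltW] := uP (f k).
have key (v w : nat -> R) (pv pw : R) : v @ \oo --> pv -> w @ \oo --> pw -> pv < pw ->
    exists q : rat, \forall k \near \oo, v k < ratr q /\ ratr q < w k.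
  move=> vp wp /rat_in_itvoo[q]; rewrite in_itv /= => /andP[q1 q2]; exists q.
  by near=> k; split; near: k; [exact: (cvgr_lt pv vp)|exact: (cvgr_gt pw wp)].
have same k j : (j < f k)%N -> bit j (u (f k)).1 = bit j (u (f k)).2.
  by have [_ _ /word_bit + _] := uP (f k); exact.
have [lt|gt|E] := ltgtP (p 0%N) (p 1%N); last by move: pe; rewrite E subrr normr0 leNgt e0.
  have [q Hq] := key _ _ _ _ p0 p1 lt.
  have [k [[q1 q2] kq]] := filter_ex (filterI Hq (nbhs_infty_gt (pickle (i, q)))).
  have := same k _ (leq_trans kq (increasing_geS f_mono k)); rewrite !bit_pickle.
  by rewrite [X in X = _](_ : _ = true)// => /esym; rewrite ltNge (ltW q2).
have [q Hq] := key _ _ _ _ p1 p0 gt.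
have [k [[q1 q2] kq]] := filter_ex (filterI Hq (nbhs_infty_gt (pickle (i, q)))).
have := same k _ (leq_trans kq (increasing_geS f_mono k)); rewrite !bit_pickle.
by rewrite [X in _ = X](_ : _ = true)// ltNge (ltW q2).
Unshelve. all: by end_near. Qed.

End bits.

Section phase_words.
Context {R : realType} {n : nat} {Omega : domain R n}.
Implicit Types (z w : phase Omega).

Definition pword := word (@pcoord R n Omega).

Lemma phase_words_close r : (exists M, forall z, enorm (vel z) <= r -> forall c, `|pcoord c z| <= M) ->
  forall e, 0 < e -> exists M, forall z w, enorm (vel z) <= r -> enorm (vel w) <= r ->
    pword M z = pword M w -> forall c, `|pcoord c z - pcoord c w| <= e.
Proof.
move=> [B HB] e e0.
have /choice[M MP] := fun c => @bits_close R (phase Omega) _ (@pcoord R n Omega)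
  [set z | enorm (vel z) <= r] c B (fun z zr => HB z zr c) e e0.
exists (\max_c M c)%N => z w zr wr zw c; apply: MP => //.
by apply: wordW zw; exact: leq_bigmax.
Qed.

(** Two bits per coordinate, with rational thresholds on either side of its value, confine that
    coordinate. The cells of words thus play the part of a countable base. *)
Lemma phase_cell_in_open z (U : set (phase Omega)) : nbhs z U ->
  exists M, forall w, pword M w = pword M z -> U w.
Proof.
move=> /phase_near[e e0 eU].
have /choice[M MP] : forall c, exists M, forall w, pword M w = pword M z -> `|pcoord c z - pcoord c w| < e.
  move=> c; have e2 : 0 < e / 2 by rewrite divr_gt0.
  have lt1 : pcoord c z - e / 2 < pcoord c z by lra.
  have lt2 : pcoord c z < pcoord c z + e / 2 by lra.
  have [q1] := rat_in_itvoo lt1; have [q2] := rat_in_itvoo lt2.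
  rewrite !in_itv /= => /andP[q21 q22] /andP[q11 q12].
  exists (maxn (pickle (c, q1)) (pickle (c, q2))).+1 => w /word_bit H.
  have := H (pickle (c, q1)); rewrite ltnS leq_maxl !bit_pickle => /(_ isT) b1.
  have := H (pickle (c, q2)); rewrite ltnS leq_maxr !bit_pickle q21 => /(_ isT) b2.
  have z1 : (pcoord c z < ratr q1) = false by apply/negbTE; rewrite -leNgt ltW.
  rewrite z1 in b1; move/negbT: b1; rewrite -leNgt => b1.
  by rewrite ltr_norml; apply/andP; split; lra.
exists (\max_c M c)%N => w zw; apply: eU => c; apply: MP; apply: wordW zw; exact: leq_bigmax.
Qed.

End phase_words.

Section curve_words.
Context {R : realType} {n : nat} {T : {posnum R}} {Omega : domain R n}.
Implicit Types (g h : curve T Omega) (E r : R).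

Definition ccoord (i : (bool * 'I_n) * rat) (g : curve T Omega) : R :=
  pcoord i.1 (ev (clamp T (ratr i.2)) g).

Definition cword := word ccoord.

Definition tame E r : set (curve T Omega) :=
  [set g | kinetic (eta_of g) E /\ enorm (eta_of g (time0 T)) <= r].

Let V E r := r + Num.sqrt (E * T%:num).

Lemma tame_eta E r g t : tame E r g -> enorm (eta_of g t) <= V E r.
Proof. by move=> [k gr]; apply: le_trans (eta_bound t k) _; rewrite lerD2r. Qed.

Lemma tame_equicontinuous E r e : 0 < e -> exists2 d, 0 < d & forall g s t, tame E r g ->
  `|set_val s - set_val t| < d ->
  enorm (xi_of g s - xi_of g t) <= e /\ enorm (eta_of g s - eta_of g t) <= e.
Proof.
move=> e0; have E1 : 0 < `|E| + 1 by rewrite ltr_wpDl.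
have V1 : 0 < `|V E r| + 1 by rewrite ltr_wpDl.
exists (Num.min (e / (`|V E r| + 1)) (e ^+ 2 / (`|E| + 1))); first by rewrite lt_min !divr_gt0 ?exprn_gt0.
move=> g s t gE; rewrite lt_min => /andP[]; rewrite !ltr_pdivlMr// => d1 d2; split.
  apply: le_trans (xi_lip s t (fun u => tame_eta u gE)) _.
  have := ler_wpM2r (normr_ge0 (set_val s - set_val t)) (ler_norm (V E r)).
  have := normr_ge0 (set_val s - set_val t); lra.
apply: le_trans (kinetic_incr _ _ gE.1) _.
apply: sqrtr_le_sqr; first exact: ltW.
have := ler_wpM2r (normr_ge0 (set_val s - set_val t)) (ler_norm E).
have := normr_ge0 (set_val s - set_val t); lra.
Qed.

Hypothesis bounded_phases : forall r : R, exists M, forall z : phase Omega, enorm (vel z) <= r ->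
  forall c, `|pcoord c z| <= M.

Lemma close_curve_coord e g h : 0 <= e ->
  (forall t c, `|pcoord c (ev t h) - pcoord c (ev t g)| <= e) -> close_curve (n%:R * e) g h.
Proof.
move=> e0 H t; split; apply: enorm_le_coord => // i; rewrite !mxE; first exact: (H t (true, i)).
exact: (H t (false, i)).
Qed.

(** The bits see rational times only. The times of discrepancy accumulate somewhere; equicontinuity
    carries the discrepancy to a fixed rational time nearby, where [bits_close] excludes it. *)
Lemma curve_words_close E r e : 0 < e -> exists M, forall g h, tame E r g -> tame E r h ->
  cword M g = cword M h -> close_curve e g h.
Proof.
move=> e0; apply: contrapT => /forallNP H.
have n0 : 0 < n.+1%:R :> R by [].
pose e' := e / n.+1%:R; have e'0 : 0 < e' by rewrite divr_gt0.
have /choice[u uP] : forall M, exists ght : curve T Omega * curve T Omega * (time T * (bool * 'I_n)),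
    [/\ tame E r ght.1.1, tame E r ght.1.2, cword M ght.1.1 = cword M ght.1.2 &
    e' < `|pcoord ght.2.2 (ev ght.2.1 ght.1.2) - pcoord ght.2.2 (ev ght.2.1 ght.1.1)|].
  move=> M; have /existsNP[g /existsNP[h]] := H M.
  move=> /not_implyP[h1 /not_implyP[h2 /not_implyP[h3 h4]]]; apply: contrapT => N; apply: h4.
  have := @close_curve_coord e' g h (ltW e'0) => /(_ _)/wrap[t c|K t].
    by rewrite leNgt; apply/negP => lt; apply: N; exists ((g, h), (t, c)).
  have le1 : n%:R * e' <= e.
    by rewrite mulrCA ler_piMr ?(ltW e0)// ler_pdivrMr// mul1r ler_nat.
  by have [k1 k2] := K t; split; apply: le_trans le1.
have [k j|f f_mono [p /(_ 0%N) pP]] := @diagonal_extraction R (fun k _ => set_val (u k).2.1) (fun=> T%:num).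
  by rewrite ger0_norm ?time_ge0// time_leT.
have e4 : 0 < e' / (n.+1%:R * 4) by rewrite divr_gt0// mulr_gt0.
have [d d0 Hd] := tame_equicontinuous E r e4.
have lt1 : p 0%N - d / 2 < p 0%N + d / 2 by lra.
have [q] := rat_in_itvoo lt1; rewrite in_itv /= => /andP[q1 q2].
have [B HB] := bounded_phases (V E r).
have e2 : 0 < e' / 4 by rewrite divr_gt0.
have /choice[M MP] := fun c => @bits_close R (curve T Omega) _ ccoord (tame E r) (c, q) B
  (fun g gE => HB (ev (clamp T (ratr q)) g) (tame_eta (clamp T (ratr q)) gE) c) _ e2.
have d2 : 0 < d / 2 by rewrite divr_gt0.
move/cvgrPdist_lt/(_ _ d2): pP => pP.
have [k [k1 k2]] := filter_ex (filterI pP (nbhs_infty_gt (\max_c M c)%N)).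
have := uP (f k); move: k1; case: (u (f k)) => -[g h] [t c] /= k1 [gE hE w].
have Mk : (M c <= f k)%N.
  apply: leq_trans (increasing_geS f_mono k); apply: leq_trans (ltnW k2); exact: leq_bigmax.
have := MP c g h gE hE (wordW Mk w); rewrite /ccoord /= => cq.
have st : `|set_val (clamp T (ratr q)) - set_val t| < d.
  have := clampr_lip 0 T%:num (ratr q) (set_val t); rewrite -!clampE clampK => /le_lt_trans; apply.
  move: k1; rewrite !ltr_norml => /andP[k11 k12]; apply/andP; split; lra.
have near_t g' : tame E r g' -> `|pcoord c (ev (clamp T (ratr q)) g') - pcoord c (ev t g')| <= e' / 4.
  move=> g'E; have [h1 h2] := Hd g' _ _ g'E st.
  have le4 : e' / (n.+1%:R * 4) <= e' / 4.
    rewrite ler_wpM2l ?(ltW e'0)// lef_pV2 ?posrE ?mulr_gt0// ler_peMl// ler1n//.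
  case: c {MP cq Mk} => -[] i; [apply: le_trans (le_trans h1 le4)|apply: le_trans (le_trans h2 le4)].
    by have := coord_le_enorm (xi_of g' (clamp T (ratr q)) - xi_of g' t) i; rewrite !mxE.
  by have := coord_le_enorm (eta_of g' (clamp T (ratr q)) - eta_of g' t) i; rewrite !mxE.
have n1 := near_t _ gE; have n2 := near_t _ hE; apply/negP; rewrite -leNgt.
move: n1 n2 cq; rewrite !ler_norml => /andP[a1 a2] /andP[b1 b2] /andP[c1 c2].
by apply/andP; split; lra.
Qed.

(** The remainder depends on the trajectory through its energy only, so that differentiability
    passes to uniform limits of bounded energy. *)
Lemma curve_taylor E g s t : kinetic (eta_of g) E ->
  enorm (xi_of g s - xi_of g t - (set_val s - set_val t) *: eta_of g t) <=
    Num.sqrt (E * `|set_val s - set_val t|) * `|set_val s - set_val t|.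
Proof.
move=> kE; pose X y := line g y - y *: eta_of g t.
have -> : xi_of g s - xi_of g t - (set_val s - set_val t) *: eta_of g t = X (set_val s) - X (set_val t).
  by rewrite /X !line_val; apply/rowP => i; rewrite !mxE; ring.
have dX x : 0 <= x <= T%:num -> vderive X x (eta_of g (clamp T x) - eta_of g t).
  move=> xT e e0; have [d d0 H] := vderive_line g xT e0; exists d => // y /H.
  by congr (enorm _ <= _); rewrite /X; apply/rowP => i; rewrite !mxE; ring.
have bound y : `|y - set_val t| <= `|set_val s - set_val t| ->
    enorm (eta_of g (clamp T y) - eta_of g t) <= Num.sqrt (E * `|set_val s - set_val t|).
  move=> yt; apply: le_trans (kinetic_incr _ _ kE) _; apply: ler_wsqrtr.
  apply: ler_wpM2l; first by have := kE [::] isT; rewrite big_nil; exact.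
  apply: le_trans yt; have := clampr_lip 0 T%:num y (set_val t); by rewrite -!clampE clampK.
have s0 := time_ge0 s; have sT := time_leT s; have t0 := time_ge0 t; have tT := time_leT t.
have [st|ts] := leP (set_val s) (set_val t).
  rewrite -enormN opprB [X in _ * X]distrC [X in _ * X]ger0_norm ?subr_ge0//.
  apply: vmean_value st _ _ => y /andP[y1 y2]; first by apply: dX; lra.
  apply: bound; rewrite !ler0_norm; lra.
rewrite [X in _ * X]ger0_norm ?subr_ge0 ?(ltW ts)//.
apply: vmean_value (ltW ts) _ _ => y /andP[y1 y2]; first by apply: dX; lra.
apply: bound; rewrite !ger0_norm; lra.
Qed.

(** Completeness under a common energy bound: this bound makes the limit velocity absolutely
    continuous and, through [curve_taylor], the derivative of the limit position. *)
Lemma cauchy_curve E (u : nat -> curve T Omega) : (forall k, kinetic (eta_of (u k)) E) ->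
  (forall e, 0 < e -> exists N, forall i j, (N <= i)%N -> (N <= j)%N -> close_curve e (u i) (u j)) ->
  exists g, u @ \oo --> g.
Proof.
move=> uE uC.
have lim_exists (v : nat -> time T -> 'rV[R]_n) :
    (forall e, 0 < e -> exists N, forall i j, (N <= i)%N -> (N <= j)%N ->
      forall t, enorm (v j t - v i t) <= e) ->
    exists l, forall e, 0 < e -> exists N, forall i, (N <= i)%N -> forall t, enorm (v i t - l t) <= e.
  move=> vC; have /choice[l lP] : forall t, exists l, forall e, 0 < e -> \forall k \near \oo, enorm (v k t - l) < e.
    move=> t; have /choice[l lP] : forall i, exists l : R, v k t ord0 i @[k --> \oo] --> l.
      move=> i; apply/(@cvg_ex R^o)/(@cauchy_cvgP R^o)/cauchy_exP => e e0.
      have e2 : 0 < e / 2 by rewrite divr_gt0.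
      have [N NP] := vC _ e2; exists (v N t ord0 i); exists N => // k /= Nk.
      rewrite /ball /= distrC; apply: (@le_lt_trans _ _ (e / 2)); last lra.
      apply: le_trans (NP _ _ (leqnn N) Nk t).
      by have := coord_le_enorm (v k t - v N t) i; rewrite !mxE.
    exists (\row_i l i); apply/(cvg_enorm (v ^~ t)).
    by apply: cvg_rV => i; rewrite mxE; exact: lP.
  exists l => e e0; have e2 : 0 < e / 2 by rewrite divr_gt0.
  have [N NP] := vC _ e2; exists N => i Ni t.
  have [k [k1 k2]] := filter_ex (filterI (lP t _ e2) (nbhs_infty_ge N)).
  apply: le_trans (enorm_dist _ (v k t) _) _; rewrite [leRHS]splitr lerD ?(ltW k1)//.
  exact: NP.
have [x xP] := lim_exists (fun k => xi_of (u k)) (fun e e0 => let: ex_intro N H := uC e e0 in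
  ex_intro _ N (fun i j Ni Nj t => (H i j Ni Nj t).1)).
have [v vP] := lim_exists (fun k => eta_of (u k)) (fun e e0 => let: ex_intro N H := uC e e0 in
  ex_intro _ N (fun i j Ni Nj t => (H i j Ni Nj t).2)).
have kv : kinetic v E.
  apply: kinetic_lim uE _ => t e /(vP)[N NP]; exists N => // k /= Nk; exact: NP.
have dx : is_derivative_of x v.
  apply/is_derivative_ofP => t e e0.
  have E1 : 0 < `|E| + 1 by rewrite ltr_wpDl.
  exists (e ^+ 2 / (`|E| + 1)); first by rewrite divr_gt0 ?exprn_gt0.
  move=> s; rewrite ltr_pdivlMr// => st.
  apply: le_trans (_ : Num.sqrt (E * `|set_val s - set_val t|) * `|set_val s - set_val t| <= _); last first.
    rewrite ler_wpM2r//; apply: sqrtr_le_sqr; first exact: ltW.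
    have := ler_wpM2r (normr_ge0 (set_val s - set_val t)) (ler_norm E).
    have := normr_ge0 (set_val s - set_val t); lra.
  rewrite -[x s - x t - _]subr0.
  apply: (@enorm_cvg_le _ _ (fun k => xi_of (u k) s - xi_of (u k) t - (set_val s - set_val t) *: eta_of (u k) t)); last first.
    by apply: nearW => k; rewrite subr0; exact: curve_taylor (uE k).
  move=> d d0; have d4 : 0 < d / (3 + `|set_val s - set_val t|) by rewrite divr_gt0// ltr_pwDl.
  have [N1 N1P] := xP _ d4; have [N2 N2P] := vP _ d4.
  exists (maxn N1 N2) => // k /=; rewrite geq_max => /andP[k1 k2].
  rewrite [X in enorm X](_ : _ = (xi_of (u k) s - x s) - (xi_of (u k) t - x t)
      - (set_val s - set_val t) *: (eta_of (u k) t - v t)); last by apply/rowP => i; rewrite !mxE; ring.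
  apply: le_lt_trans (enormBle _ _) _; apply: le_lt_trans (lerD (enormBle _ _) (lexx _)) _.
  rewrite enormZ; have a1 := N1P k k1 s; have a2 := N1P k k1 t; have a3 := N2P k k2 t.
  have a4 := ler_wpM2l (normr_ge0 (set_val s - set_val t)) a3.
  apply: (@lt_le_trans _ _ (d / (3 + `|set_val s - set_val t|) * (3 + `|set_val s - set_val t|))); last first.
    by rewrite divfK// gt_eqF// ltr_pwDl.
  by lra.
have cx t : closure Omega (x t).
  apply: (@closed_cvg _ _ \oo _ (fun k => xi_of (u k) t) (closure Omega)).
  - exact: closed_closure.
  - by apply: nearW => k; exact: curve_closure.
  - apply/cvg_enorm => e e0; have e2 : 0 < e / 2 by rewrite divr_gt0.
    have [N NP] := xP _ e2; exists N => // k /= Nk; apply: le_lt_trans (NP k Nk t) _; lra.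
have [g [gx ge]] := curve_build dx kv cx.
exists g; apply/cvg_curve => e e0; have [N1 N1P] := xP e e0; have [N2 N2P] := vP e e0.
exists (maxn N1 N2) => // k /=; rewrite geq_max => /andP[k1 k2] t; rewrite gx ge.
by split; [exact: N1P|exact: N2P].
Qed.

End curve_words.

(** * Measures on words *)

Lemma bounded_integrable d (X : measurableType d) (R : realType) (P : probability X R) (h : X -> R) :
  measurable_fun setT h -> bounded_real h -> P.-integrable setT (EFin \o h).
Proof.
move=> mh [B hB]; apply: measurable_bounded_integrable => //.
  by have := ltry (1 : R); rewrite -(probability_setT P).
exists B; split; first by rewrite num_real.
by move=> x Bx u _; exact: le_trans (hB u) (ltW Bx).
Qed.

Section unit_law.
Context {R : realType}.

Definition unit_law : set (measurableTypeR R) -> \bar R :=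
  mrestr lebesgue_measure (measurable_itv `[(0 : R), 1[).

HB.instance Definition _ := Measure.on unit_law.

Let unit_law_setT : unit_law setT = 1%:E.
Proof. by rewrite /unit_law /mrestr setTI lebesgue_measure_itv /= lte01 oppr0 adde0. Qed.

HB.instance Definition _ := Measure_isProbability.Build _ _ _ unit_law unit_law_setT.

Definition unit_prob : probability (measurableTypeR R) R := unit_law.

Lemma unit_law_itv (a b : R) : 0 <= a -> a <= b -> b <= 1 -> unit_prob `[a, b[%classic = (b - a)%:E.
Proof.
move=> a0 ab b1; rewrite -[unit_prob _]/(unit_law _) /unit_law /mrestr setIidl; last first.
  move=> x /=; rewrite !in_itv /= => /andP[ax xb].
  by rewrite (le_trans a0 ax) (lt_le_trans xb b1).
rewrite lebesgue_measure_itv /= lte_fin; case: ltP => [//|ba].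
by have -> : a = b by [apply/eqP; rewrite eq_le ab]; rewrite subrr.
Qed.

End unit_law.

(** * Slicing the unit interval according to the masses of words *)

Section cells.
Context {R : realType}.
Variable m : seq bool -> R.
Hypothesis m_nil : m [::] = 1.
Hypothesis m_split : forall b, m b = m (false :: b) + m (true :: b).
Hypothesis m_ge0 : forall b, 0 <= m b.
Implicit Types (u : R) (b : seq bool).

(** The words of a given length label disjoint slices of [0, 1[ with the prescribed masses: the
    slice of [b] is cut into that of [false :: b], on the left, and that of [true :: b], on the
    right. *)
Fixpoint left_end b : R :=
  if b is c :: b' then left_end b' + (if c then m (false :: b') else 0) else 0.

(** The inverse labelling: each bit tells on which side of the cut [u] falls. *)
Fixpoint bit_code u (j : nat) : seq bool :=
  if j is j'.+1 then (left_end (bit_code u j') + m (false :: bit_code u j') <= u) :: bit_code u j' else [::].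

Definition cell b : set (measurableTypeR R) := `[left_end b, left_end b + m b[%classic.

Lemma cell_nil : cell [::] = `[0, 1[%classic.
Proof. by rewrite /cell /= m_nil add0r. Qed.

Lemma cellE b u : cell b u <-> left_end b <= u < left_end b + m b.
Proof. by rewrite /cell /= in_itv. Qed.

Lemma cell_cons c b u : cell (c :: b) u <-> cell b u /\ (left_end b + m (false :: b) <= u) = c.
Proof.
rewrite !cellE /=; have := m_ge0 (false :: b); have := m_ge0 (true :: b).
have := m_split b; case: c => /= E h1 h2; split.
- by move=> /andP[u1 u2]; split; [lra|lra].
- by move=> [/andP[u1 u2] u3]; apply/andP; split; lra.
- by move=> /andP[u1 u2]; split; [lra|apply/negbTE; rewrite -ltNge; lra].
- by move=> [/andP[u1 u2] /negbT]; rewrite -ltNge => u3; apply/andP; split; lra.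
Qed.

Lemma cell_split b : cell b = cell (false :: b) `|` cell (true :: b).
Proof.
apply/seteqP; split => u.
  by move=> bu; case E : (left_end b + m (false :: b) <= u); [right|left]; apply/cell_cons.
by move=> [/cell_cons[]|/cell_cons[]].
Qed.

Lemma cell_disjoint b : [disjoint cell (false :: b) & cell (true :: b)].
Proof.
apply/disj_setPS => u [/cell_cons[_ h] /cell_cons[_]]; by rewrite h.
Qed.

Lemma size_bit_code u j : size (bit_code u j) = j.
Proof. by elim: j => //= j ->. Qed.

Lemma bit_code_cell u j : 0 <= u < 1 -> cell (bit_code u j) u.
Proof.
move=> u1; elim: j => [|j IH] /=; first by rewrite cell_nil /= in_itv.
by apply/cell_cons.
Qed.

Lemma cell_bit_code u b : cell b u -> bit_code u (size b) = b.
Proof. by elim: b => // c b IH /cell_cons[/IH bu <-] /=; rewrite bu. Qed.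

Lemma cell_bounds b : 0 <= left_end b /\ left_end b + m b <= 1.
Proof.
elim: b => [|c b [IH1 IH2]] /=; first by rewrite m_nil add0r.
have := m_split b; have := m_ge0 (false :: b); have := m_ge0 (true :: b).
by case: c => /=; split; lra.
Qed.

Lemma measurable_cell b : measurable (cell b). Proof. exact: measurable_itv. Qed.

Lemma unit_law_cell b : unit_prob (cell b) = (m b)%:E.
Proof.
have [h1 h2] := cell_bounds b; rewrite unit_law_itv//; last by rewrite lerDl.
by rewrite addrC addKr.
Qed.

Lemma cell_fin b : (unit_prob (cell b) < +oo)%E.
Proof. by have := ltry (m b); rewrite -unit_law_cell. Qed.

Lemma Rintegral_cell_cst b c : \int[unit_prob]_(u in cell b) c = m b * c.
Proof.
rewrite (Rintegral_cst _ (measurable_cell b)) mulrC; congr (_ * _).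
by have /(congr1 fine) := unit_law_cell b.
Qed.

Lemma outside_root : unit_prob (~` cell [::]) = 0%E.
Proof. by rewrite probability_setC ?unit_law_cell ?m_nil ?subee//; exact: measurable_cell. Qed.

Lemma bit_code_mass u j : 0 <= u < 1 -> 0 < m (bit_code u j).
Proof. by move=> /(bit_code_cell j)/cellE/andP[a /(le_lt_trans a)]; rewrite ltrDl. Qed.

Lemma measurable_bit_code (P : seq bool -> Prop) j :
  measurable ([set u | P (bit_code u j)] : set (measurableTypeR R)).
Proof.
rewrite (_ : [set u | _] = \bigcup_(b in [set b | P b]) [set u | bit_code u j = b]); last first.
  by apply/seteqP; split => [u /= Pu|u [b /= Pb ub]]; [exists (bit_code u j)|rewrite ub].
rewrite bigcup_mkcond; apply: countable_bigcupT_measurable; first exact: countableP.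
move=> b; case: ifP => // _.
elim: j b => [|j IH] b /=.
  case: b => [|c b]; first by rewrite (_ : [set _ | _] = setT)//; apply/seteqP.
  by rewrite (_ : [set _ | _] = set0)//; apply/seteqP; split.
case: b => [|c b]; first by rewrite (_ : [set _ | _] = set0)//; apply/seteqP; split.
rewrite (_ : [set _ | _] = [set u | bit_code u j = b] `&`
    (if c then `[left_end b + m (false :: b), +oo[%classic else `]-oo, left_end b + m (false :: b)[%classic)).
  by apply: measurableI; [exact: IH|case: c; exact: measurable_itv].
apply/seteqP; split => u /=.
  by move=> [<- <-]; split => //; case: leP => h; rewrite /= in_itv /= ?andbT.
move=> [->]; case: c => /=; rewrite in_itv /= ?andbT => h; congr (_ :: _) => //.
by apply/negbTE; rewrite -ltNge.
Qed.

(* Comparison cell by cell at depth [N], summed up to the root. *)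
Lemma cells_integral (h : measurableTypeR R -> R) (S mk : nat -> seq bool -> R) (N : nat) (e : R) :
  measurable_fun setT h -> bounded_real h ->
  (forall k b, S k b = S k (false :: b) + S k (true :: b)) ->
  (forall b, mk ^~ b @ \oo --> m b) ->
  (exists B, forall k b, `|S k b| <= B * mk k b) ->
  (forall b, size b = N -> 0 < m b -> exists c, (forall u, cell b u -> `|h u - c| <= e) /\
     forall k, `|S k b - mk k b * c| <= e * mk k b) ->
  forall d, 0 < d -> \forall k \near \oo, `|S k [::] - \int[unit_prob]_u h u| <= 2 * e + d.
Proof.
move=> mh [Bh hB] S_split mkm [B SB] H.
have ih b : unit_prob.-integrable (cell b) (EFin \o h).
  apply: measurable_bounded_integrable; first exact: measurable_cell.
  - exact: cell_fin.
  - exact: measurable_funTS.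
  - exists Bh; split; first by rewrite num_real.
    by move=> x Bx u _; exact: le_trans (hB u) (ltW Bx).
pose J b := \int[unit_prob]_(u in cell b) h u.
have J_split b : J b = J (false :: b) + J (true :: b).
  rewrite /J [in LHS]cell_split Rintegral_setU//; [exact: measurable_cell|exact: measurable_cell| |exact: cell_disjoint].
  by rewrite -cell_split.
have J_le b c c' : (forall u, cell b u -> `|h u - c| <= c') -> `|J b - m b * c| <= c' * m b.
  move=> hc; rewrite [X in _ - X](_ : _ = \int[unit_prob]_(u in cell b) c); last first.
    by rewrite Rintegral_cell_cst.
  have ic (a : R) : unit_prob.-integrable (cell b) (EFin \o cst a).
    by apply: integrable_const; [exact: measurable_cell|exact: cell_fin].
  have i1 : unit_prob.-integrable (cell b) (EFin \o (fun u => h u - c)).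
    exact: (@integrableB _ _ _ _ _ (measurable_cell b) (EFin \o h) (EFin \o cst c) (ih b) (ic c)).
  rewrite -RintegralB//; [|exact: measurable_cell|exact: ic].
  apply: le_trans (le_normr_Rintegral _ _) _; [exact: measurable_cell|exact: i1|].
  rewrite [leRHS](_ : _ = \int[unit_prob]_(u in cell b) c'); last first.
    by rewrite Rintegral_cell_cst mulrC.
  apply: le_Rintegral => //; [exact: measurable_cell| |exact: ic].
  exact: (integrable_norm i1).
have iT : unit_prob.-integrable setT (EFin \o h) by apply: bounded_integrable => //; exists Bh.
have JT : \int[unit_prob]_u h u = J [::].
  rewrite /J -[in LHS](setUv (cell [::])) Rintegral_setU; [|exact: measurable_cell|exact: measurableC (measurable_cell _)| |].
  - rewrite [X in _ + X](_ : _ = 0) ?addr0// /Rintegral null_set_integral//.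
    + exact: measurableC (measurable_cell _).
    + by apply: measurable_funTS; exact/measurable_EFinP.
    + exact: outside_root.
  - by rewrite setUv.
  - by apply/disj_setPS => u [].
have key b : (size b <= N)%N -> forall d, 0 < d -> \forall k \near \oo, `|S k b - J b| <= 2 * e * m b + d.
  move=> /subnKC; move: (N - size b)%N => M; elim: M b => [|M IH] b.
    rewrite addn0 => bN d d0; case: (ltP 0 (m b)) => [mb|mb].
      have [c [hc kc]] := H _ bN mb; have Jc := J_le _ _ _ hc.
      have e1 : 0 < `|c| + `|e| + 1 by rewrite ltr_wpDl ?addr_ge0.
      have /cvgrPdist_le/(_ _ (divr_gt0 d0 e1)) := mkm b.
      apply: filterS => k; rewrite ler_pdivlMr// distrC => mkb.
      have -> : S k b - J b = (S k b - mk k b * c) + (mk k b - m b) * c - (J b - m b * c) by ring.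
      apply: le_trans (ler_normB _ _) _; apply: le_trans (lerD (ler_normD _ _) (lexx _)) _.
      rewrite normrM; have h1 := kc k; have h2 : e * mk k b <= e * m b + `|e| * `|mk k b - m b|.
        have -> : mk k b = m b + (mk k b - m b) by ring.
        by rewrite mulrDr lerD2l -normrM [m b + _]addrC addrK ler_norm.
      have := normr_ge0 (mk k b - m b); lra.
    (* A cell without mass has no reference value [c]; there the sums tend to 0 with [mk k b],
       thanks to the bound [B]. *)
    have m0 : m b = 0 by apply/eqP; rewrite eq_le mb m_ge0.
    have J0 : J b = 0.
      have := @J_le b 0 Bh; rewrite m0 !mulr0 subr0 => J0; apply/eqP; rewrite -normr_le0; apply: J0.
      by move=> u _; rewrite subr0.
    have B1 : 0 < `|B| + 1 by rewrite ltr_wpDl.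
    have /cvgrPdist_le/(_ _ (divr_gt0 d0 B1)) := mkm b.
    apply: filterS => k; rewrite distrC ler_pdivlMr// m0 J0 !subr0 mulr0 add0r => mkb.
    apply: le_trans (SB k b) _; apply: le_trans (ler_norm _) _; rewrite normrM.
    have := normr_ge0 (mk k b); lra.
  rewrite addnS => bN d d0; have d2 : 0 < d / 2 by rewrite divr_gt0.
  apply: filterS (filterI (IH (false :: b) bN _ d2) (IH (true :: b) bN _ d2)) => k [h1 h2].
  rewrite S_split J_split (m_split b).
  have -> : S k (false :: b) + S k (true :: b) - (J (false :: b) + J (true :: b)) =
    (S k (false :: b) - J (false :: b)) + (S k (true :: b) - J (true :: b)) by ring.
  apply: le_trans (ler_normD _ _) _; lra.
by move=> d d0; have := key [::] (leq0n _) d d0; rewrite m_nil mulr1 -JT.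
Qed.

End cells.

(** * Compactness of laws of trajectories *)

Lemma continuous_measurable_real (R : realType) (X : ptopologicalType) (f : X -> R) :
  continuous f -> measurable_fun setT (f : borel X -> R).
Proof.
move=> /continuousP cf.
apply: (measurability (@RGenOInfty.G R)); first exact: RGenOInfty.measurableE.
move=> _ [_ [a ->] <-]; rewrite setTI; apply: sub_sigma_algebra; apply: cf.
exact: interval_open.
Qed.

Section curve_measures.
Context {R : realType} {n : nat} {T : {posnum R}} {Omega : domain R n}.
Implicit Types (g h : curve T Omega) (E r : R).

Lemma close_curve_sym e g h : close_curve e g h -> close_curve e h g.
Proof. by move=> H t; rewrite enormB [X in _ /\ X <= _]enormB. Qed.

Lemma close_curve_trans e1 e2 g h h' :
  close_curve e1 g h -> close_curve e2 h h' -> close_curve (e1 + e2) g h'.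
Proof.
move=> H1 H2 t; have [a1 b1] := H1 t; have [a2 b2] := H2 t; split.
  by apply: le_trans (enorm_dist _ (xi_of h t) _) _; rewrite addrC; exact: lerD.
by apply: le_trans (enorm_dist _ (eta_of h t) _) _; rewrite addrC; exact: lerD.
Qed.

Lemma close_curve_le e1 e2 g h : e1 <= e2 -> close_curve e1 g h -> close_curve e2 g h.
Proof. by move=> e12 H t; have [a b] := H t; split; apply: le_trans e12. Qed.

Lemma close_curve_lim e h (u : nat -> curve T Omega) g : u @ \oo --> g ->
  (\forall k \near \oo, close_curve e h (u k)) -> close_curve e h g.
Proof.
move=> /cvg_curve ug hu t; split; apply/ler_addgt0Pr => d d0;
  have [k [k1 k2]] := filter_ex (filterI (ug d d0) hu).
  by have [] := close_curve_trans k2 (close_curve_sym k1) t.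
by have [] := close_curve_trans k2 (close_curve_sym k1) t.
Qed.

Lemma tame_lim E r (u : nat -> curve T Omega) g : u @ \oo --> g -> (forall k, tame E r (u k)) -> tame E r g.
Proof.
move=> ug uE; split.
  apply: (@kinetic_lim _ _ _ (fun k => eta_of (u k))) => [k|t e e0]; first by have [] := uE k.
  by move/cvg_curve/(_ e e0): ug; apply: filterS => k /(_ t)[].
apply/ler_addgt0Pr => d d0; move/cvg_curve/(_ d d0): ug => ug.
have [k k1] := filter_ex ug; have [_ k2] := uE k; have [_ k3] := k1 (time0 T).
have := enormD (eta_of g (time0 T) - eta_of (u k) (time0 T)) (eta_of (u k) (time0 T)).
rewrite subrK enormB; lra.
Qed.

Lemma integral_marginal (mu : prob R (curve T Omega)) t (psi : phase Omega -> R) :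
  continuous psi -> bounded_real psi ->
  (\int[marginal mu t]_z (psi z)%:E = \int[mu]_g (psi (ev t g))%:E)%E.
Proof.
move=> cpsi [B bpsi]; rewrite (@integral_distribution _ _ _ _ _ mu (ev_mfun Omega t) (EFin \o psi))//.
  by apply/measurable_EFinP; exact: continuous_measurable_real.
apply: (@bounded_integrable _ _ _ mu (psi \o ev t)); last by exists B => g; exact: bpsi.
apply: continuous_measurable_real => g; apply: (continuous_comp (@continuous_ev _ _ _ _ t g)); exact: cpsi.
Qed.

Hypothesis bounded_phases : forall r : R, exists M, forall z : phase Omega, enorm (vel z) <= r ->
  forall c, `|pcoord c z| <= M.

Lemma phase_uniform r (psi : phase Omega -> R) : continuous psi ->
  forall e, 0 < e -> exists2 d, 0 < d & forall z w, enorm (vel z) <= r ->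
    (forall c, `|pcoord c z - pcoord c w| <= d) -> `|psi z - psi w| <= e.
Proof.
move=> cpsi e e0; apply: contrapT => H.
have /choice[u uP] : forall k : nat, exists zw : phase Omega * phase Omega,
    [/\ enorm (vel zw.1) <= r, (forall c, `|pcoord c zw.1 - pcoord c zw.2| <= k.+1%:R^-1) &
    e < `|psi zw.1 - psi zw.2|].
  move=> k; apply: contrapT => N; apply: H; exists k.+1%:R^-1; first by rewrite invr_gt0.
  by move=> z w zr zw; rewrite leNgt; apply/negP => lt; apply: N; exists (z, w).
have [B HB] := bounded_phases r.
have [k c|f f_mono [z uz]] := @phase_extraction _ _ _ (fun k => (u k).1) B.
  by apply: HB; have [] := uP k.
have uz2 : (u (f k)).2 @[k --> \oo] --> z.
  apply/phase_cvgP => c; apply/cvgrPdist_le => d d0; have d2 : 0 < d / 2 by rewrite divr_gt0.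
  move/phase_cvgP/(_ c)/cvgrPdist_le/(_ _ d2): uz => uz.
  apply: filterS (filterI uz (near_infty_natSinv_lt (PosNum d2))) => k [k1 k2].
  have [_ /(_ c) k3 _] := uP (f k).
  apply: le_trans (ler_distD (pcoord c (u (f k)).1) _ _) _; rewrite [leRHS]splitr lerD//.
  apply: le_trans k3 (le_trans _ (ltW k2)); rewrite lef_pV2 ?posrE// ler_nat ltnS.
  exact: increasing_geS f_mono k.
have lim0 : `|psi (u (f k)).1 - psi (u (f k)).2| @[k --> \oo] --> `|psi z - psi z|.
  by apply: cvg_norm; apply: cvgB; [exact: (cvg_comp _ _ uz (cpsi z))|exact: (cvg_comp _ _ uz2 (cpsi z))].
suff : e <= 0 by rewrite leNgt e0.
rewrite subrr normr0 in lim0; apply: (ler_cvg_to (cvg_cst e) lim0).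
by apply: nearW => k; have [_ _ /ltW] := uP (f k).
Qed.

Lemma ev_words_close E r (t : time T) (psi : phase Omega -> R) : continuous psi ->
  forall e, 0 < e -> exists M, forall g h, tame E r g -> tame E r h -> cword M g = cword M h ->
    `|psi (ev t g) - psi (ev t h)| <= e.
Proof.
move=> cpsi e e0; have [d d0 H] := phase_uniform (r + Num.sqrt (E * T%:num)) cpsi e0.
have [M MP] := @curve_words_close _ _ T _ bounded_phases E r _ d0; exists M => g h gE hE gh.
apply: H; first exact: tame_eta.
have [cx cv] := MP _ _ hE gE (esym gh) t.
case=> -[] i; [apply: le_trans cx|apply: le_trans cv].
  by have := coord_le_enorm (xi_of g t - xi_of h t) i; rewrite !mxE.
by have := coord_le_enorm (eta_of g t - eta_of h t) i; rewrite !mxE.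
Qed.

Section word_limit.
Variables (E r : R) (m : seq bool -> R).
Hypothesis m_nil : m [::] = 1.
Hypothesis m_split : forall b, m b = m (false :: b) + m (true :: b).
Hypothesis m_ge0 : forall b, 0 <= m b.
Hypothesis m_curve : forall b, 0 < m b -> exists2 g : curve T Omega, tame E r g & cword (size b) g = b.

Definition repr b : curve T Omega := xget point [set g | tame E r g /\ cword (size b) g = b].

Lemma reprP b : 0 < m b -> tame E r (repr b) /\ cword (size b) (repr b) = b.
Proof.
move=> /m_curve[g g1 g2]; rewrite /repr; case: xgetP => [h _ [h1 h2]//|/(_ g)]; by case.
Qed.

Lemma bit_code_drop u M N : bit_code m u M = drop N (bit_code m u (N + M)).
Proof. by elim: N => [|N IH]; rewrite ?drop0//= IH. Qed.

Lemma repr_bit_code u M j : 0 <= u < 1 -> (M <= j)%N ->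
  tame E r (repr (bit_code m u j)) /\ cword M (repr (bit_code m u j)) = bit_code m u M.
Proof.
move=> u1 /subnK <-.
have [h1] := reprP (bit_code_mass m_nil m_split m_ge0 (j - M + M) u1).
by rewrite size_bit_code => h2; split => //; rewrite [LHS](word_drop _ M (j - M)) -[word _ _ _]/(cword _ _) h2 -bit_code_drop.
Qed.

(* [sample] carries the uniform law on [0, 1[ to the limit measure: the
   trajectories [repr (bit_code m u j)] agree with one another on longer and
   longer words as [j] grows. *)
Definition sample (u : measurableTypeR R) : curve T Omega :=
  if 0 <= u < 1 then xget point [set g | (fun j => repr (bit_code m u j)) @ \oo --> g] else point.

Lemma sample_cvg u : 0 <= u < 1 -> (fun j => repr (bit_code m u j)) @ \oo --> sample u.
Proof.
move=> u1; rewrite /sample u1; case: xgetP => [g _ //|H].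
have [||g /H//] := @cauchy_curve _ _ _ _ E (fun j => repr (bit_code m u j)).
  by move=> k; have [[]] := repr_bit_code u1 (leqnn k).
move=> e e0; have [M MP] := @curve_words_close _ _ T _ bounded_phases E r _ e0.
exists M => i j Mi Mj; have [h1 h2] := repr_bit_code u1 Mi; have [h3 h4] := repr_bit_code u1 Mj.
by apply: MP => //; rewrite h2 h4.
Qed.

Lemma sample_close e M u : 0 <= u < 1 ->
  (forall g h : curve T Omega, tame E r g -> tame E r h -> cword M g = cword M h -> close_curve e g h) ->
  close_curve e (repr (bit_code m u M)) (sample u).
Proof.
move=> u1 MP; apply: close_curve_lim (sample_cvg u1) _.
exists M => // j /= Mj; have [h1 h2] := repr_bit_code u1 Mj; have [h3 h4] := repr_bit_code u1 (leqnn M).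
by apply: MP => //; rewrite h2 h4.
Qed.

Lemma measurable_sample : measurable_fun setT (sample : measurableTypeR R -> borel (curve T Omega)).
Proof.
have mod (p : nat) : exists M, forall g h : curve T Omega, tame E r g -> tame E r h -> cword M g = cword M h ->
    close_curve (p.+1%:R^-1) g h.
  have p0 : 0 < p.+1%:R^-1 :> R by rewrite invr_gt0.
  exact: @curve_words_close _ _ T _ bounded_phases E r _ p0.
have /choice[M MP] := mod.
apply: (@measurability _ _ (measurableTypeR R) (borel (curve T Omega)) setT sample (@open (curve T Omega))) => // _ [U oU <-]; rewrite setTI.
(* For fixed [p] the condition depends on finitely many bits of [u]: the whole ball of radius
   [p.+1%:R^-1] around the representative of the word must lie in [U], and [sample u] belongs to
   that ball. *)
pose A p := [set b | forall g, close_curve (p.+1%:R^-1) (repr b) g -> U g].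
rewrite (_ : _ @^-1` _ = (`[0, 1[%classic `&` \bigcup_p [set u | A p (bit_code m u (M p))]) `|`
    (~` `[0, 1[%classic `&` [set u | U point])); last first.
  apply/seteqP; split => u /=.
    rewrite in_itv /=; case: (boolP (0 <= u < 1)) => u1 Uu; last first.
      by right; split; [exact/negP|move: Uu; rewrite /sample (negbTE u1)].
    left; split => //; have [e e0 eU] := curve_near (open_nbhs_nbhs (conj oU Uu)).
    have e2 : 0 < e / 2 by rewrite divr_gt0.
    have [p pe] := filter_ex (near_infty_natSinv_lt (PosNum e2)); exists p => // g pg; apply: eU.
    apply: close_curve_le (_ : p.+1%:R^-1 + p.+1%:R^-1 <= e) _; first by rewrite [leRHS]splitr; apply: lerD; exact: ltW pe.
    by apply: close_curve_trans pg; apply: close_curve_sym; exact: sample_close (MP p).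
  rewrite in_itv /=; case=> [[u1 [p _ Ap]]|[/negP/negbTE u1 Up]].
    by apply: Ap; apply: sample_close (MP p).
  by rewrite /sample u1.
apply: measurableU; apply: measurableI.
- exact: measurable_itv.
- by apply: bigcupT_measurable => p; exact: measurable_bit_code.
- exact: measurableC (measurable_itv _).
- by case: (pselect (U point)) => Up; [rewrite (_ : [set _ | _] = setT)|rewrite (_ : [set _ | _] = set0)]; rewrite -?subset0 -?subTset.
Qed.

Definition sample_mfun : {mfun measurableTypeR R >-> borel (curve T Omega)} :=
  HB.pack (sample : measurableTypeR R -> borel (curve T Omega))
    (isMeasurableFun.Build _ _ _ _ _ measurable_sample).

Definition sample_law : prob R (curve T Omega) := distribution unit_prob sample_mfun.

(** A neighbourhood of [sample u] contains the samples of an entire slice around [u], and a slice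
    that contains a point has positive length. *)
Lemma sample_supp u : 0 <= u < 1 -> supp sample_law (sample u).
Proof.
move=> u1 U oU Uu; have [e e0 eU] := curve_near (open_nbhs_nbhs (conj oU Uu)).
have e2 : 0 < e / 2 by rewrite divr_gt0.
have [M MP] := @curve_words_close _ _ T _ bounded_phases E r _ e2.
have c0 := bit_code_mass m_nil m_split m_ge0 M u1.
apply: (@lt_le_trans _ _ (unit_prob (cell m (bit_code m u M)))).
  by rewrite unit_law_cell// lte_fin.
apply: le_measure; rewrite ?inE; [exact: measurable_cell| |].
  rewrite -[X in measurable X]setTI; apply: measurable_sample => //; exact: sub_sigma_algebra.
move=> v vu; apply: eU; have v1 : 0 <= v < 1.
  have [b1 b2] := cell_bounds m_nil m_split m_ge0 (bit_code m u M).
  by move/cellE: vu => /andP[v1 v2]; apply/andP; split; lra.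
apply: close_curve_le (_ : e / 2 + e / 2 <= e) _; first lra.
apply: close_curve_trans (sample_close v1 MP).
have := cell_bit_code m_split m_ge0 vu; rewrite size_bit_code => ->.
exact: close_curve_sym (sample_close u1 MP).
Qed.

Lemma supp_sample g U : supp sample_law g -> nbhs g U -> exists2 u, 0 <= u < 1 & U (sample u).
Proof.
move=> /(_ U^°) + gU; move/(_ (open_interior _) gU) => pos; apply: contrapT => N.
have : (unit_prob (sample @^-1` U^°) <= unit_prob (~` cell m [::]))%E.
  apply: le_measure; rewrite ?inE.
  - rewrite -[X in measurable X]setTI; apply: measurable_sample => //; exact: sub_sigma_algebra (open_interior _).
  - exact: measurableC (measurable_cell _ _).
  move=> u Uu; rewrite cell_nil//= in_itv /= => u1; apply: N; exists u => //.
  exact: interior_subset Uu.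
by rewrite outside_root// leNgt => /negP; apply; exact: pos.
Qed.

(** A measure need not be carried by its support in general; here every sample from [0, 1[ belongs
    to the support. *)
Lemma sample_law_full (A : set (borel (curve T Omega))) : measurable A ->
  supp sample_law `<=` A -> sample_law A = 1%E.
Proof.
move=> mA sA; apply/eqP; rewrite eq_le probability_le1//=.
have <- : unit_prob (cell m [::]) = 1%E by rewrite unit_law_cell// m_nil.
apply: le_measure; rewrite ?inE; [exact: measurable_cell| |].
  by rewrite -[X in measurable X]setTI; exact: measurable_sample.
by move=> u; rewrite cell_nil//= in_itv /= => u1; apply: sA; exact: sample_supp.
Qed.

Lemma integral_sample_law (phi : curve T Omega -> R) : continuous phi -> bounded_real phi ->
  (\int[sample_law]_g (phi g)%:E)%E = (\int[unit_prob]_u phi (sample u))%:E.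
Proof.
move=> cphi [B bphi].
have mphi : measurable_fun setT (phi : borel _ -> R) by exact: continuous_measurable_real.
have ms := measurableT_comp mphi measurable_sample.
have ib : unit_prob.-integrable setT (EFin \o (phi \o sample)).
  by apply: bounded_integrable => //; exists B => u; exact: bphi.
rewrite (@integral_distribution _ _ _ _ _ unit_prob sample_mfun (EFin \o phi))//.
  by rewrite /Rintegral fineK//; exact: integrable_fin_num ib.
exact/measurable_EFinP.
Qed.

End word_limit.

(** * Limits of laws with finitely many atoms *)

Section stages.
Variables (E r : R) (I : nat -> finType) (W : forall k, I k -> R) (gam : forall k, I k -> curve T Omega).
Hypothesis W_ge0 : forall k i, 0 <= @W k i.
Hypothesis W_sum : forall k, \sum_i @W k i = 1.
Hypothesis gam_tame : forall k i, tame E r (@gam k i).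

Definition weighted (phi : curve T Omega -> R) k b : R :=
  \sum_(i | cword (size b) (@gam k i) == b) @W k i * phi (@gam k i).

Lemma weighted_nil phi k : weighted phi k [::] = \sum_i @W k i * phi (@gam k i).
Proof. by apply: eq_bigl => i. Qed.

Lemma weighted_split phi k b : weighted phi k b = weighted phi k (false :: b) + weighted phi k (true :: b).
Proof.
rewrite /weighted (bigID (fun i => bit ccoord (size b) (@gam k i))) /= addrC.
congr (_ + _); apply: eq_bigl => i; rewrite eqseq_cons andbC; congr (_ && _); by case: bit.
Qed.

Definition mass k b := weighted (cst 1) k b.

Lemma mass_ge0 k b : 0 <= mass k b.
Proof. by apply: sumr_ge0 => i _; rewrite mulr1. Qed.

Lemma mass_le1 k b : mass k b <= 1.
Proof.
rewrite -(W_sum k) /mass /weighted [leRHS](bigID (fun i => cword (size b) (@gam k i) == b)) /=.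
by rewrite -[leLHS]addr0 lerD ?sumr_ge0//; apply: ler_sum => i _; rewrite mulr1.
Qed.

Lemma weighted_dist phi k b c e : (forall i, cword (size b) (@gam k i) = b -> `|phi (@gam k i) - c| <= e) ->
  `|weighted phi k b - mass k b * c| <= e * mass k b.
Proof.
move=> H; rewrite /mass /weighted mulr_suml -sumrB mulr_sumr; apply: le_trans (ler_norm_sum _ _ _) _.
apply: ler_sum => i /eqP/H ie; rewrite /cst mulr1 -mulrBr normrM ger0_norm// mulrC.
exact: ler_wpM2r.
Qed.

Lemma mass_atom k b : 0 < mass k b -> exists2 i, 0 < @W k i & cword (size b) (@gam k i) = b.
Proof.
move=> m0; apply: contrapT => N; move: m0; rewrite /mass /weighted big1 ?ltxx// => i /eqP ib.
rewrite /cst mulr1; apply/eqP; rewrite eq_le W_ge0 andbT leNgt; apply/negP => Wi.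
by apply: N; exists i.
Qed.

(** Stands in for Prokhorov's theorem. There are countably many words, so one extraction makes all
    their masses converge; the limits are additive and define [sample_law]. A word charged in the
    limit is charged at all late stages, hence every point of the support is approached by
    trajectories of positive weight. *)
Theorem tame_compactness : exists2 f : nat -> nat, forall k, (f k < f k.+1)%N &
  exists mu : prob R (curve T Omega),
  [/\ forall t psi, continuous psi -> bounded_real psi ->
        \sum_i @W (f k) i * psi (ev t (@gam (f k) i)) @[k --> \oo] --> \int[marginal mu t]_z psi z,
      forall g, supp mu g -> tame E r g,
      forall g e, supp mu g -> 0 < e ->
        \forall k \near \oo, exists2 i, 0 < @W (f k) i & close_curve e g (@gam (f k) i) &
      forall A : set (borel (curve T Omega)), measurable A -> supp mu `<=` A -> mu A = 1%E].
Proof.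
pose s k j := if unpickle j is Some b then mass k b else 0.
have [k j|f f_mono [p pP]] := @diagonal_extraction R s (fun=> 1).
  by rewrite /s; case: unpickle => [b|]; rewrite ?normr0// ger0_norm ?mass_ge0// mass_le1.
exists f => //; pose m (b : seq bool) := p (pickle b).
have mP b : mass (f k) b @[k --> \oo] --> m b.
  by have := pP (pickle b); rewrite /s pickleK.
have m_nil : m [::] = 1.
  apply/(cvg_unique _ (mP [::])) => //; rewrite (_ : (fun k => _) = cst 1); first exact: cvg_cst.
  by apply/funext => k; rewrite /mass weighted_nil -[RHS](W_sum (f k)); apply: eq_bigr => i _; rewrite mulr1.
have m_split b : m b = m (false :: b) + m (true :: b).
  apply/(cvg_unique _ (mP b)) => //; rewrite (_ : (fun k => mass (f k) b) =
    fun k => mass (f k) (false :: b) + mass (f k) (true :: b)); last by apply/funext => k; exact: weighted_split.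
  exact: cvgD (mP (false :: b)) (mP (true :: b)).
have m_ge0 b : 0 <= m b.
  by apply: ler_cvg_to (cvg_cst 0) (mP b) _; apply: nearW => k; exact: mass_ge0.
have m_near b : 0 < m b -> \forall k \near \oo, exists2 i, 0 < @W (f k) i & cword (size b) (@gam (f k) i) = b.
  by move=> b0; apply: filterS (cvgr_gt _ (mP b) _ b0) => k; exact: mass_atom.
have m_curve b : 0 < m b -> exists2 g : curve T Omega, tame E r g & cword (size b) g = b.
  by move=> /m_near/filter_ex[k [i _ ib]]; exists (@gam (f k) i).
pose mu := sample_law m_nil m_split m_ge0 m_curve.
have supp_tame g : supp mu g -> tame E r g.
  move=> gmu; have /choice[u uP] : forall k : nat, exists h, tame E r h /\ close_curve k.+1%:R^-1 g h.
    move=> k; have k0 : 0 < k.+1%:R^-1 :> R by rewrite invr_gt0.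
    have [u u1 cl] := supp_sample gmu (close_curve_nbhs g k0); exists (sample E r m u); split => //.
    apply: tame_lim (sample_cvg m_nil m_split m_ge0 m_curve u1) _ => j.
    by have [] := repr_bit_code m_nil m_split m_ge0 m_curve u1 (leqnn j).
  apply: (@tame_lim E r u) => [|k]; last by have [] := uP k.
  apply/cvg_curve => e e0; apply: filterS (near_infty_natSinv_lt (PosNum e0)) => k ke.
  by have [_] := uP k; apply: close_curve_le; exact: ltW ke.
exists mu; split => //.
- move=> t psi cpsi [B bpsi]; apply/cvgrPdist_le => e e0.
  have e3 : 0 < e / 3 by rewrite divr_gt0.
  have [M MP] := ev_words_close E r t cpsi e3.
  pose phi g := psi (ev t g).
  have cphi : continuous phi by move=> g; apply: (continuous_comp (@continuous_ev _ _ _ _ t g)); exact: cpsi.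
  have bphi : bounded_real phi by exists B => g; exact: bpsi.
  have msam := @measurable_sample E r m m_nil m_split m_ge0 m_curve.
  have mphi : measurable_fun setT (phi \o sample E r m).
    by apply: measurableT_comp msam; exact: continuous_measurable_real.
  have -> : \int[marginal mu t]_z psi z = \int[unit_prob]_u phi (sample E r m u).
    rewrite /Rintegral integral_marginal//; last by exists B.
    by rewrite (@integral_sample_law E r m m_nil m_split m_ge0 m_curve phi cphi bphi).
  have [|k b||b bM mb|] := @cells_integral _ m m_nil m_split m_ge0 (phi \o sample E r m)
      (fun k => weighted phi (f k)) (fun k => mass (f k)) M (e / 3) mphi _ _ mP _ _ _ e3.
  - by exists B => u; exact: bpsi.
  - exact: weighted_split.
  - exists B => k b; have := @weighted_dist phi (f k) b 0 B; rewrite mulr0 subr0; apply=> i _.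
    by rewrite subr0; exact: bpsi.
  - have [h1 h2] := reprP m_curve mb; rewrite bM in h2; exists (phi (repr E r b)); split; last first.
      move=> k; apply: weighted_dist => i; rewrite bM => ib; apply: MP => //.
      by rewrite ib.
    move=> u ub; have u1 : 0 <= u < 1.
      have [b1 b2] := cell_bounds m_nil m_split m_ge0 b.
      by move/cellE: ub => /andP[v1 v2]; apply/andP; split; lra.
    have cs := sample_cvg m_nil m_split m_ge0 m_curve u1.
    apply: (ler_cvg_to (cvg_norm (cvgB (cvg_comp _ _ cs (cphi _)) (cvg_cst (phi (repr E r b))))) (cvg_cst (e / 3))).
    exists M => // j /= Mj; have [h3 h4] := repr_bit_code m_nil m_split m_ge0 m_curve u1 Mj.
    by apply: MP => //; rewrite h4 h2 -bM; exact: cell_bit_code ub.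
  move=> N _ NP; exists N => // k /NP /=; rewrite weighted_nil distrC => /le_trans; apply; lra.
- move=> g e gmu e0; have e3 : 0 < e / 3 by rewrite divr_gt0.
  have [u u1 cl] := supp_sample gmu (close_curve_nbhs g e3).
  have [M MP] := @curve_words_close _ _ T _ bounded_phases E r _ e3.
  have b0 := bit_code_mass m_nil m_split m_ge0 M u1.
  apply: filterS (m_near _ b0) => k [i Wi]; rewrite size_bit_code => ib; exists i => //.
  apply: close_curve_le (_ : e / 3 + e / 3 + e / 3 <= e) _; first lra.
  have [h1 h2] := repr_bit_code m_nil m_split m_ge0 m_curve u1 (leqnn M).
  apply: close_curve_trans (close_curve_trans cl (close_curve_sym (sample_close m_nil m_split m_ge0 m_curve u1 MP))) _.
  by apply: MP => //; rewrite h2 ib.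
- by move=> A; exact: sample_law_full.
Qed.

End stages.

End curve_measures.

(** * Probability measures on the phase space *)

Section phase_measures.
Context {R : realType} {n : nat} {Omega : domain R n}.
Implicit Types (P Q : prob R (phase Omega)).

(** It suffices to agree on open sets. The indicator of [U] is the limit of Urysohn functions that
    separate the complement of [U] from the points [V k] whose ball of radius [k.+1%:R^-1] lies in
    [U]; this gap provides the uniform separation. *)
Lemma prob_eq_integrals P Q :
  (forall psi : phase Omega -> R, continuous psi -> bounded_real psi ->
     (\int[P]_z (psi z)%:E = \int[Q]_z (psi z)%:E)%E) ->
  forall B : set (borel (phase Omega)), measurable B -> P B = Q B.
Proof.
move=> PQ; apply: (@measure_unique _ R (borel (phase Omega)) (@open (phase Omega)) (fun=> setT)) => //.
- by move=> A B; exact: openI.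
- by move=> _; exact: openT.
- by rewrite bigcup_const.
- move=> U oU.
  pose V k := [set z : phase Omega | ball z (k.+1%:R^-1 : R) `<=` U].
  pose f k : phase Omega -> R := Urysohn (R := R) (~` U) (V k).
  have cf k : continuous (f k) by exact: Urysohn_continuous.
  have sep k : uniform_separator (~` U) (V k).
    apply: uniform_separatorW; exists [set zw : phase Omega * phase Omega | ball zw.1 (k.+1%:R^-1 : R) zw.2].
      by rewrite -entourage_ballE; exists (k.+1%:R^-1 : R) => //=; rewrite invr_gt0.
    by rewrite -subset0 => -[z w] [[/= Uz Vw] /ball_sym zw]; apply: Uz; exact: Vw.
  have f_itv k z : 0 <= f k z <= 1.
    by have /(_ (f k z)) := @Urysohn_range _ R (~` U) (V k); rewrite /= in_itv /=; apply; exists z.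
  have f_cvg z : (f k z)%:E @[k --> \oo] --> (\1_U z)%:E.
    apply: cvg_EFin; first exact: nearW.
    rewrite indicE; case: (boolP (z \in U)) => [|] Uz.
      rewrite inE in Uz; have /nbhs_ballP[e /= e0 eU] := open_nbhs_nbhs (conj oU Uz).
      apply: cvg_near_cst; apply: filterS (near_infty_natSinv_lt (PosNum e0)) => k ke.
      apply: (Urysohn_sub1 (sep k)); exists z => // w /(le_ball (ltW ke)); exact: eU.
    apply: cvg_near_cst; apply: nearW => k; apply: (Urysohn_sub0 (sep k)); exists z => //=.
    by move=> /mem_set; apply/negP.
  have mU : measurable (U : set (borel (phase Omega))) by exact: sub_sigma_algebra.
  have int_cvg P' : (\int[P']_z (f k z)%:E)%E @[k --> \oo] --> (P' U).
    rewrite -[U in P' U]setIT -integral_indic//.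
    apply: (@dominated_cvg _ _ _ _ _ measurableT _ _ (cst 1%:E)) => //.
    - by move=> k; apply/measurable_EFinP; exact: (continuous_measurable_real (cf k)).
    - by apply: (@bounded_integrable _ _ _ P' (cst 1)); [exact: measurable_cst|exists 1 => z; rewrite normr1].
    - by move=> k z _; have /andP[f0 f1] := f_itv k z; rewrite /= lee_fin ger0_norm.
  apply: (cvg_unique _ (int_cvg P)) => //; rewrite (_ : (fun k => _) = fun k => (\int[Q]_z (f k z)%:E)%E).
    exact: int_cvg.
  apply/funext => k; apply: PQ; first exact: cf.
  by exists 1 => z; have /andP[f0 f1] := f_itv k z; rewrite ger0_norm.
- by move=> k; have := ltry (1 : R); rewrite -(probability_setT P).
Qed.

Definition pcell b : set (phase Omega) := [set w | pword (size b) w = b].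

Lemma pcell_nil : pcell [::] = setT. Proof. by apply/seteqP. Qed.

Lemma pcell_cons c b : pcell (c :: b) = pcell b `&` [set w | bit (@pcoord R n Omega) (size b) w = c].
Proof. by apply/seteqP; split => w; rewrite /pcell /pword /= => -[-> ->]. Qed.

Lemma measurable_pcell b : measurable (pcell b : set (borel (phase Omega))).
Proof.
elim: b => [|c b IH]; first by rewrite pcell_nil.
rewrite pcell_cons; apply: measurableI => //; rewrite /bit.
case: unpickle => [[i q]|]; last first.
  by case: c; [rewrite (_ : [set _ | _] = set0)|rewrite (_ : [set _ | _] = setT)] => //; apply/seteqP; split.
have oc : measurable ([set w | pcoord i w < ratr q] : set (borel (phase Omega))).
  apply: sub_sigma_algebra; have /continuousP/(_ [set x | x < ratr q]) := @continuous_pcoord _ _ Omega i.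
  by apply; exact: open_lt.
case: c; first exact: oc.
rewrite (_ : [set _ | _] = ~` [set w | pcoord i w < ratr q]); first exact: measurableC.
by apply/seteqP; split => w /=; [move=> ->|move/negP/negbTE].
Qed.

Lemma pcell_split b : pcell b = pcell (false :: b) `|` pcell (true :: b).
Proof.
rewrite !pcell_cons; apply/seteqP; split => w; last by move=> [[]|[]].
by move=> bw; case E : (bit (@pcoord R n Omega) (size b) w); [right|left].
Qed.

Lemma pcell_disjoint b : [disjoint pcell (false :: b) & pcell (true :: b)].
Proof. by apply/disj_setPS => w; rewrite !pcell_cons => -[[_ /= ->] [_ /=]]. Qed.

Lemma pcell_mass P b : (P (pcell b) = P (pcell (false :: b)) + P (pcell (true :: b)))%E.
Proof.
rewrite pcell_split measureU//; try exact: measurable_pcell.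
exact/disj_set2P/pcell_disjoint.
Qed.

(** Every point outside the support lies in a null open set, hence in a null cell of words, and
    there are countably many words. *)
Lemma supp_null P (A : set (phase Omega)) : supp P `<=` A -> closed A -> P (~` A) = 0%E.
Proof.
move=> sA cA; pose N := [set b | P (pcell b) = 0%E].
have mA : measurable (A : set (borel (phase Omega))).
  by rewrite -[A]setCK; apply: measurableC; apply: sub_sigma_algebra; exact: closed_openC.
have : P.-negligible (\bigcup_(b in N) pcell b).
  pose F k := if unpickle k is Some b then (if `[< N b >] then pcell b else set0) else set0.
  suff nF : P.-negligible (\bigcup_k F k).
    by apply: negligibleS nF => z [b Nb bz]; exists (pickle b) => //; rewrite /F pickleK asboolT.
  apply: negligible_bigcup => k; rewrite /F; case: unpickle => [b|]; last exact: negligible_set0.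
  case: asboolP => Nb; last exact: negligible_set0.
  by apply/negligibleP => //; exact: measurable_pcell.
move=> neg; apply: (negligibleP _ _).1; first exact: measurableC.
apply: negligibleS neg => z Az.
have [U [oU Uz PU]] : exists U : set (phase Omega), [/\ open U, U z & P U = 0%E].
  apply: contrapT => H; apply: Az; apply: sA => U oU Uz; rewrite lt0e measure_ge0 andbT.
  by apply/eqP => PU; apply: H; exists U.
have [M MP] := phase_cell_in_open (open_nbhs_nbhs (conj oU Uz)).
exists (pword M z); last by rewrite /pcell /= size_word.
apply/eqP; rewrite eq_le measure_ge0 andbT -PU; apply: le_measure; rewrite ?inE.
- exact: measurable_pcell.
- exact: sub_sigma_algebra.
- by move=> w; rewrite /pcell /= size_word; exact: MP.
Qed.

Lemma additive_words (S J m : seq bool -> R) (e : R) (N : nat) :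
  (forall b, S b = S (false :: b) + S (true :: b)) ->
  (forall b, J b = J (false :: b) + J (true :: b)) ->
  (forall b, m b = m (false :: b) + m (true :: b)) ->
  (forall b, size b = N -> `|S b - J b| <= e * m b) -> `|S [::] - J [::]| <= e * m [::].
Proof.
move=> aS aJ am H; suff key b : (size b <= N)%N -> `|S b - J b| <= e * m b by exact: key.
move=> /subnKC; move: (N - size b)%N => M; elim: M b => [|M IH] b.
  by rewrite addn0 => /H.
rewrite addnS => bN; have h1 := IH (false :: b) bN; have h2 := IH (true :: b) bN.
rewrite aS aJ am; have -> : S (false :: b) + S (true :: b) - (J (false :: b) + J (true :: b)) =
    (S (false :: b) - J (false :: b)) + (S (true :: b) - J (true :: b)) by ring.
by apply: le_trans (ler_normD _ _) _; lra.
Qed.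

End phase_measures.

(** * The cost functional *)

Lemma continuous_of_seq (R : realType) (f : R -> R) :
  (forall (u : nat -> R) x, u @ \oo --> x -> f (u k) @[k --> \oo] --> f x) -> continuous f.
Proof.
move=> H x; apply/cvgrPdist_lt => e e0; apply: contrapT => N.
have /choice[u uP] : forall k : nat, exists y, `|x - y| < k.+1%:R^-1 /\ e <= `|f x - f y|.
  move=> k; apply: contrapT => Nk; apply: N; apply/nbhs_ballP.
  exists k.+1%:R^-1 => /=; first by rewrite invr_gt0.
  by move=> y xy; rewrite ltNge; apply/negP => fy; apply: Nk; exists y.
have ux : u @ \oo --> x.
  apply/cvgrPdist_lt => d d0; apply: filterS (near_infty_natSinv_lt (PosNum d0)) => k kd.
  by have [h _] := uP k; exact: lt_trans kd.
have /cvgrPdist_lt/(_ _ e0) fu := H u x ux.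
by have [k] := filter_ex fu; have [_] := uP k; rewrite leNgt => /negP.
Qed.

Section cost_functional.
Context {R : realType} {n : nat} {T : {posnum R}} {Omega : domain R n}.
Notation lambda := (@lebesgue_measure R).
Notation J := `[0%R, T%:num]%classic.
Implicit Types (g h : curve T Omega) (mu : prob R (curve T Omega)).

Lemma coupling_cvg (Phi : prob R (phase Omega) -> phase Omega -> R) (m : nat -> prob R (phase Omega)) m'
    (z : nat -> phase Omega) (z' : phase Omega) : bounded_continuous_coupling Phi ->
  narrow_cvg m m' -> z @ \oo --> z' -> Phi (m k) (z k) @[k --> \oo] --> Phi m' z'.
Proof.
move=> [cPhi _ PhiP] mm zz; apply/cvgrPdist_le => e e0; have e2 : 0 < e / 2 by rewrite divr_gt0.
have cz : {for z', continuous (Phi m')} by exact: cPhi.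
have /cvgrPdist_le/(_ _ e2) h1 := cvg_comp _ _ zz cz.
apply: filterS (filterI h1 (PhiP m m' mm _ e2)) => k [/= k1 k2].
apply: le_trans (ler_distD (Phi m' (z k)) _ _) _; rewrite [leRHS]splitr lerD// distrC; exact: k2.
Qed.

Lemma time_cvg (t : nat -> time T) (t' : time T) : set_val (t k) @[k --> \oo] --> set_val t' -> t @ \oo --> t'.
Proof.
move=> /cvgrPdist_lt tt U /time_near[e e0 eU]; apply: filterS (tt e e0) => k /= k1.
by apply: eU; rewrite distrC.
Qed.

Lemma clamp_cvg (u : nat -> R) x : u @ \oo --> x -> clamp T (u k) @[k --> \oo] --> clamp T x.
Proof.
move=> /cvgrPdist_lt ux; apply: time_cvg; apply/cvgrPdist_lt => e e0; apply: filterS (ux e e0) => k.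
by apply: le_lt_trans; rewrite !clampE; exact: clampr_lip.
Qed.

Lemma ev_time_cvg g (t : nat -> time T) (t' : time T) : t @ \oo --> t' -> ev (t k) g @[k --> \oo] --> ev t' g.
Proof.
move=> tt; have near_time d : 0 < d -> \forall k \near \oo, `|set_val (t k) - set_val t'| < d.
  by move=> d0; apply: (tt [set s | `|set_val s - set_val t'| < d]); apply/time_near; exists d.
have xi_cvg : xi_of g (t k) @[k --> \oo] --> xi_of g t'.
  apply/(cvg_enorm (fun k => xi_of g (t k))) => e e0.
  have [d d0 H] := (is_derivative_ofP (xi_of g) (eta_of g)).1 (@curve_derivative _ _ _ _ g) t' 1 ltr01.
  have M0 : 0 < 1 + enorm (eta_of g t') by rewrite ltr_pwDl ?enorm_ge0.
  apply: filterS (filterI (near_time _ d0) (near_time _ (divr_gt0 e0 M0))) => k [/H k1].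
  rewrite ltr_pdivlMr// => k2.
  rewrite -(subrK ((set_val (t k) - set_val t') *: eta_of g t') (xi_of g (t k) - xi_of g t')).
  apply: le_lt_trans (enormD _ _) _; rewrite enormZ; lra.
have eta_cvg : eta_of g (t k) @[k --> \oo] --> eta_of g t'.
  apply/(cvg_enorm (fun k => eta_of g (t k))) => e e0; have e2 : 0 < e / 2 by rewrite divr_gt0.
  have [d d0 H] := curve_eta_continuous g t' e2.
  by apply: filterS (near_time _ d0) => k /H; lra.
apply/phase_cvgP => -[[] i]; apply/cvgrPdist_lt => e e0.
  move/cvg_enorm/(_ e e0): xi_cvg; apply: filterS => k; apply: le_lt_trans.
  by have := coord_le_enorm (xi_of g (t k) - xi_of g t') i; rewrite !mxE distrC.
move/cvg_enorm/(_ e e0): eta_cvg; apply: filterS => k; apply: le_lt_trans.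
by have := coord_le_enorm (eta_of g (t k) - eta_of g t') i; rewrite !mxE distrC.
Qed.

Lemma marginal_time_cvg mu (t : nat -> time T) (t' : time T) : t @ \oo --> t' ->
  narrow_cvg (fun k => marginal mu (t k)) (marginal mu t').
Proof.
move=> tt psi cpsi [B bpsi]; rewrite integral_marginal//; last by exists B.
rewrite (_ : (fun k => _) = fun k => (\int[mu]_g (psi (ev (t k) g))%:E)%E); last first.
  by apply/funext => k; rewrite integral_marginal//; exists B.
have cphi s : continuous (fun g => psi (ev s g)).
  by move=> g; apply: (continuous_comp (@continuous_ev _ _ _ _ s g)); exact: cpsi.
apply: (@dominated_cvg _ _ _ mu _ measurableT _ _ (cst B%:E)) => //.
- by move=> k; apply/measurable_EFinP; exact: (continuous_measurable_real (cphi (t k))).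
- move=> g _; apply: cvg_EFin; first exact: nearW.
  have h : psi (ev (t k) g) @[k --> \oo] --> psi (ev t' g).
    have cz : {for ev t' g, continuous psi} by exact: cpsi.
    exact: (cvg_comp _ _ (@ev_time_cvg g _ _ tt) cz).
  exact: h.
- by apply: (@bounded_integrable _ _ _ mu (cst B)); [exact: measurable_cst|exists `|B|].
- by move=> k g _; rewrite /= lee_fin; exact: bpsi.
Qed.

Lemma accel_measurable g : exists q : R -> R, [/\ measurable_fun setT q, (forall x, 0 <= q x) &
  {ae lambda, forall x, J x -> enorm (accel (eta_of g) x) ^+ 2 = q x}].
Proof.
have [d dp dq] := abs_continuous_primitive (@curve_abs_continuous _ _ _ _ g).
exists (fun x => enorm (d x) ^+ 2); split; [exact: primitive_measurable dp _|by move=> x; rewrite sqr_ge0|].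
apply: filterS2 dq (ae_itvoo 0 T%:num); first exact: (ae_filter_ringOfSetsType lambda).
by move=> x Hx H0 /H0/Hx/quot_accel->.
Qed.

Variables (F G : prob R (phase Omega) -> phase Omega -> R) (l : phase Omega * time T -> R).
Hypothesis cF : bounded_continuous_coupling F.
Hypothesis cG : bounded_continuous_coupling G.
Hypothesis cl : continuous l.

Let l_cvg (z : nat -> phase Omega) z' (t : nat -> time T) t' : z @ \oo --> z' -> t @ \oo --> t' ->
  l (z k, t k) @[k --> \oo] --> l (z', t').
Proof.
move=> zz tt; have cl' : {for (z', t'), continuous l} by exact: cl.
exact: (cvg_comp (fun k => (z k, t k)) l (cvg_pair zz tt) cl').
Qed.

Definition rate mu g (s : R) : R :=
  F (marginal mu (clamp T s)) (ev (clamp T s) g) + l (ev (clamp T s) g, clamp T s).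

Definition running mu g : R :=
  \int[lambda]_(s in J) rate mu g s + G (marginal mu (timeT T)) (ev (timeT T) g).

Lemma rate_continuous mu g : continuous (rate mu g).
Proof.
apply: continuous_of_seq => u x ux; apply: cvgD.
  exact: (@coupling_cvg F (fun k => marginal mu (clamp T (u k))) _ (fun k => ev (clamp T (u k)) g) _ cF
    (@marginal_time_cvg mu _ _ (clamp_cvg ux)) (@ev_time_cvg g _ _ (clamp_cvg ux))).
exact: l_cvg (@ev_time_cvg g _ _ (clamp_cvg ux)) (clamp_cvg ux).
Qed.

Hypothesis bounded_phases : forall r : R, exists M, forall z : phase Omega, enorm (vel z) <= r ->
  forall c, `|pcoord c z| <= M.

Lemma running_cost_bounded V : exists2 B, 0 <= B & forall z t, enorm (vel z) <= V -> `|l (z, t)| <= B.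
Proof.
apply: contrapT => H.
have /choice[u uP] : forall k : nat, exists zt : phase Omega * time T, enorm (vel zt.1) <= V /\ k%:R < `|l zt|.
  move=> k; apply: contrapT => N; apply: H; exists k%:R => // z t zV; rewrite leNgt; apply/negP => lt.
  by apply: N; exists (z, t).
have [M HM] := bounded_phases V.
have [k c|f f_mono [z uz]] := @phase_extraction _ _ _ (fun k => (u k).1) M.
  by apply: HM; have [] := uP k.
have [k j|f' f'_mono [p /(_ 0%N) pP]] := @diagonal_extraction R (fun k _ => set_val (u (f k)).2) (fun=> T%:num).
  by rewrite ger0_norm ?time_ge0// time_leT.
have tp : (u (f (f' k))).2 @[k --> \oo] --> clamp T (p 0%N).
  by have := clamp_cvg pP; under eq_fun do rewrite clampK.
have uz' : (u (f (f' k))).1 @[k --> \oo] --> z.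
  apply: (cvg_comp f' (fun k => (u (f k)).1) _ uz) => U [N _ NU].
  by exists N => // k /= Nk; apply: NU; exact: leq_trans (increasing_geS f'_mono k).
have lz : `|l (u (f (f' k)))| @[k --> \oo] --> `|l (z, clamp T (p 0%N))|.
  by apply: cvg_norm; have := l_cvg uz' tp; under eq_fun do rewrite -surjective_pairing.
set L := `|l (z, _)| in lz.
have lt1 : L < L + 1 by lra.
have [k [k1 k2]] := filter_ex (filterI (cvgr_lt _ lz _ lt1) (nbhs_infty_ge (Num.bound (L + 1)))).
have [_] := uP (f (f' k)); apply/negP; rewrite -leNgt; apply: le_trans (ltW k1) _.
have L0 : 0 <= L + 1 by apply: addr_ge0 => //; exact: normr_ge0.
apply: le_trans (ltW (archi_boundP L0)) _; rewrite ler_nat; apply: leq_trans k2 _.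
exact: leq_trans (increasing_geS f'_mono k) (increasing_geS f_mono _).
Qed.

Lemma rate_bounded E r : exists B, forall mu g s, tame E r g -> `|rate mu g s| <= B.
Proof.
have [_ [BF HF] _] := cF; have [B _ HB] := running_cost_bounded (r + Num.sqrt (E * T%:num)).
exists (BF + B) => mu g s gE; apply: le_trans (ler_normD _ _) _; apply: lerD; first exact: HF.
by apply: HB; exact: tame_eta.
Qed.

Let mJ : measurable (J : set (measurableTypeR R)). Proof. exact: measurable_itv. Qed.

Let J_fin : (lambda J < +oo)%E.
Proof. by rewrite lebesgue_measure_itv /= lte_fin gt0 ltry. Qed.

Lemma rate_integrable mu g E r : tame E r g -> lambda.-integrable J (EFin \o rate mu g).
Proof.
move=> gE; have [B HB] := rate_bounded E r.
apply: measurable_bounded_integrable => //.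
  by apply: measurable_funTS; exact: continuous_measurable_fun (@rate_continuous mu g).
exists B; split; first by rewrite num_real.
by move=> x Bx s _; exact: le_trans (HB mu g s gE) (ltW Bx).
Qed.

(** The squared acceleration is replaced by a measurable function [q] equal to it almost everywhere,
    after which the integral can be split into its running and kinetic parts. *)
Lemma cost_kinetic mu g E : kinetic (eta_of g) E ->
  cost F G l mu g = (running mu g + 2^-1 * energy g)%:E.
Proof.
move=> kE; rewrite /cost asboolT; last exact: kinetic_L2norm kE.
have gE : tame E (enorm (eta_of g (time0 T))) g by [].
have iR := rate_integrable mu gE; have [q [mq q0 qE]] := accel_measurable g.
have Iq : (\int[lambda]_(s in J) (q s)%:E = (energy g)%:E)%E.
  have [<- _] := kinetic_integral kE.
  have ae : {ae lambda, forall x, J x -> (q x)%:E = (enorm (accel (eta_of g) x) ^+ 2)%:E}.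
    by apply: (@filterS _ _ (ae_filter_ringOfSetsType lambda)) qE => x H /H ->.
  exact: (integral_congr_ae ae).
have Iq2 : (\int[lambda]_(s in J) (2^-1 * q s)%:E = (2^-1 * energy g)%:E)%E.
  rewrite EFinM -Iq -ge0_integralZl_EFin//; first by move=> x _; rewrite lee_fin.
  by apply/measurable_EFinP; exact: measurable_funTS.
have iq : lambda.-integrable J (EFin \o (fun s => 2^-1 * q s)).
  apply/integrableP; split; first by apply/measurable_EFinP; apply: measurable_funM => //; exact: measurable_funTS.
  rewrite (_ : (fun x => _) = (fun s => (2^-1 * q s)%:E)); first by rewrite Iq2 ltry.
  by apply/funext => x /=; rewrite ger0_norm// mulr_ge0.
have ae : {ae lambda, forall x, J x -> (rate mu g x + 2^-1 * enorm (acceleration g x) ^+ 2)%:E =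
    (rate mu g x + 2^-1 * q x)%:E}.
  by apply: (@filterS _ _ (ae_filter_ringOfSetsType lambda)) qE => x H /H <-.
have I : (\int[lambda]_(s in J) (rate mu g s + 2^-1 * enorm (acceleration g s) ^+ 2)%:E =
    (\int[lambda]_(s in J) rate mu g s + 2^-1 * energy g)%:E)%E.
  rewrite (integral_congr_ae ae).
  have -> : (\int[lambda]_(s in J) (rate mu g s + 2^-1 * q s)%:E =
      \int[lambda]_(s in J) (rate mu g s)%:E + \int[lambda]_(s in J) (2^-1 * q s)%:E)%E.
    exact: (integralD mJ iR iq).
  by rewrite Iq2 EFinD /Rintegral fineK//; exact: integrable_fin_num iR.
by rewrite [X in (X + _)%E]I -EFinD /running addrAC.
Qed.

Lemma running_bounded E r : exists B, forall mu g, tame E r g -> `|running mu g| <= B.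
Proof.
have [B HB] := rate_bounded E r; have [_ [BG HG] _] := cG.
exists (B * T%:num + BG) => mu g gE; apply: le_trans (ler_normD _ _) _; apply: lerD; last exact: HG.
have iR := rate_integrable mu gE.
apply: le_trans (le_normr_Rintegral mJ iR) _.
have -> : B * T%:num = \int[lambda]_(s in J) B.
  by rewrite Rintegral_cst//= lebesgue_measure_itv /= lte_fin gt0 /= subr0.
apply: le_Rintegral => //; [exact: integrable_norm iR|exact: integrable_const|].
by move=> s _; exact: HB.
Qed.

Lemma running_lower b : (forall z, b <= l z) -> exists B, forall mu g E r, tame E r g -> B <= running mu g.
Proof.
move=> bl; have [_ [BF HF] _] := cF; have [_ [BG HG] _] := cG.
exists ((- BF + b) * T%:num - BG) => mu g E r gE; apply: lerD; last first.
  by have := HG (marginal mu (timeT T)) (ev (timeT T) g); rewrite ler_norml => /andP[].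
have -> : (- BF + b) * T%:num = \int[lambda]_(s in J) (- BF + b).
  by rewrite Rintegral_cst//= lebesgue_measure_itv /= lte_fin gt0 /= subr0.
apply: le_Rintegral => //; [exact: integrable_const|exact: rate_integrable gE|].
move=> s _; apply: lerD => //.
by have := HF (marginal mu (clamp T s)) (ev (clamp T s) g); rewrite ler_norml => /andP[].
Qed.

(** Dominated convergence in time: [tame] keeps all phases in a bounded set, on which [l] is bounded
    uniformly in the laws and the trajectories. *)
Lemma running_cvg E r (mu : nat -> prob R (curve T Omega)) mu' (g : nat -> curve T Omega) g' :
  (forall t, narrow_cvg (fun k => marginal (mu k) t) (marginal mu' t)) ->
  g @ \oo --> g' -> (forall k, tame E r (g k)) ->
  running (mu k) (g k) @[k --> \oo] --> running mu' g'.
Proof.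
move=> mm gg gE; have ev_cvg t : ev t (g k) @[k --> \oo] --> ev t g'.
  exact: (cvg_comp _ _ gg (@continuous_ev _ _ _ _ t g')).
apply: cvgD; last first.
  exact: (@coupling_cvg G (fun k => marginal (mu k) _) _ (fun k => ev _ (g k)) _ cG).
have [B HB] := rate_bounded E r; have g'E : tame E r g' by exact: tame_lim gg gE.
have fi mu0 g0 : tame E r g0 -> (\int[lambda]_(s in J) (rate mu0 g0 s)%:E)%E \is a fin_num.
  by move=> g0E; exact: integrable_fin_num (rate_integrable mu0 g0E).
apply: fine_cvg; rewrite fineK; last exact: fi.
apply: (@dominated_cvg _ _ _ lambda _ mJ _ _ (cst B%:E)) => //.
- by move=> k; apply/measurable_EFinP/measurable_funTS; exact: continuous_measurable_fun (@rate_continuous _ _).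
- move=> s _; apply: cvg_EFin; first exact: nearW.
  have h : rate (mu k) (g k) s @[k --> \oo] --> rate mu' g' s.
    apply: cvgD; last exact: l_cvg (ev_cvg _) (cvg_cst (clamp T s)).
    exact: (@coupling_cvg F (fun k => marginal (mu k) (clamp T s)) _ (fun k => ev (clamp T s) (g k)) _ cF).
  exact: h.
- exact: (integrable_const _ mJ J_fin).
- by move=> k s _; rewrite /= lee_fin; exact: HB.
Qed.

End cost_functional.

(** * Finite games *)

Lemma slice_close (R : realType) (N : nat) (x y : R) : 0 <= x <= N%:R -> 0 <= y <= N%:R ->
  inord (Num.truncn (x * N.+1%:R)) = inord (Num.truncn (y * N.+1%:R)) :> 'I_(N * N.+1).+1 ->
  y <= x + N.+1%:R^-1.
Proof.
have bound (z : R) : 0 <= z <= N%:R -> (Num.truncn (z * N.+1%:R) < (N * N.+1).+1)%N.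
  move=> /andP[z0 zN]; rewrite ltnS -(ler_nat R).
  have /truncn_itv/andP[+ _] : 0 <= z * N.+1%:R by rewrite mulr_ge0.
  by move=> /le_trans; apply; rewrite natrM ler_wpM2r.
move=> xN yN /(congr1 val) /=; rewrite !inordK ?bound// => E.
have /andP[x0 _] := xN; have /andP[y0 _] := yN.
have /truncn_itv/andP[h1 _] : 0 <= x * N.+1%:R by rewrite mulr_ge0.
have /truncn_itv/andP[_ h2] : 0 <= y * N.+1%:R by rewrite mulr_ge0.
rewrite -E -[X in _ < X]natr1 in h2.
by rewrite -(ler_pM2r (ltr0Sn R N)) mulrDl mulVf//; lra.
Qed.

Lemma finite_net (X : Type) (C : finType) (good : X -> Prop) (code : X -> C) :
  exists (I : finType) (gam : I -> X), (forall i, good (gam i)) /\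
    forall g, good g -> exists i, code (gam i) = code g.
Proof.
pose I : finType := {c | `[< exists2 g, good g & code g = c >]}.
have gam_ex (i : I) : exists2 g, good g & code g = val i by exact/asboolP/(valP i).
exists I, (fun i => projT1 (cid2 (gam_ex i))); split=> [i|g gg]; first by case: cid2.
have Ig : `[< exists2 h, good h & code h = code g >] by apply/asboolP; exists g.
by exists (exist _ (code g) Ig : I); case: cid2.
Qed.

Definition bits (R : realType) (X : Type) (J : countType) (a : J -> X -> R) (N : nat) (x : X) : {ffun 'I_N -> bool} :=
  [ffun j : 'I_N => bit a j x].

Lemma bits_word (R : realType) (X : Type) (J : countType) (a : J -> X -> R) N x y :
  bits a N x = bits a N y -> word a N x = word a N y.
Proof.
by move=> /ffunP xy; apply/word_bit => j jN; have := xy (Ordinal jN); rewrite !ffunE.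
Qed.

Lemma word_sum_split (R : realType) (X : Type) (J : countType) (a : J -> X -> R) (I : finType)
    (x : I -> X) (w : I -> R) b :
  \sum_(i | word a (size b) (x i) == b) w i =
  \sum_(i | word a (size b).+1 (x i) == false :: b) w i + \sum_(i | word a (size b).+1 (x i) == true :: b) w i.
Proof.
rewrite (bigID (fun i => bit a (size b) (x i))) /= addrC.
congr (_ + _); apply: eq_bigl => i; rewrite eqseq_cons andbC; congr (_ && _); by case: bit.
Qed.

Section finite_laws.
Context {R : realType} {n : nat} {T : {posnum R}} {Omega : domain R n}.
Hypothesis bounded_phases : forall r : R, exists M, forall z : phase Omega, enorm (vel z) <= r ->
  forall c, `|pcoord c z| <= M.

Lemma marginal_integral_fine (mu : prob R (curve T Omega)) t (psi : phase Omega -> R) :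
  continuous psi -> bounded_real psi ->
  (\int[marginal mu t]_z (psi z)%:E = (\int[marginal mu t]_z psi z)%:E)%E.
Proof.
move=> cpsi bpsi; rewrite /Rintegral fineK//; apply: integrable_fin_num => //.
by apply: (@bounded_integrable _ _ _ (marginal mu t) psi) => //; exact: continuous_measurable_real.
Qed.

(** The law with atoms [gam i] of weights [w i], obtained from [tame_compactness] for a constant
    sequence of stages; only the integrals of its marginals are recorded. *)
Lemma finite_law (E r : R) (I : finType) (w : I -> R) (gam : I -> curve T Omega) :
  (forall i, 0 <= w i) -> \sum_i w i = 1 -> (forall i, tame E r (gam i)) ->
  exists mu : prob R (curve T Omega), forall t psi, continuous psi -> bounded_real psi ->
    (\int[marginal mu t]_z (psi z)%:E = (\sum_i w i * psi (ev t (gam i)))%:E)%E.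
Proof.
move=> w0 w1 gE; have [f _ [mu [H _ _ _]]] := @tame_compactness _ _ _ _ bounded_phases E r
  (fun=> I) (fun _ => w) (fun _ => gam) (fun=> w0) (fun=> w1) (fun=> gE).
exists mu => t psi cpsi bpsi; rewrite marginal_integral_fine//; congr (_%:E).
by have C := H t psi cpsi bpsi; apply/esym; exact: (cvg_unique _ (cvg_cst _) C).
Qed.

Section stage.
Variables (F G : prob R (phase Omega) -> phase Omega -> R) (l : phase Omega * time T -> R).
Hypothesis cF : bounded_continuous_coupling F.
Hypothesis cG : bounded_continuous_coupling G.
Hypothesis cl : continuous l.
Variables (A : set (phase Omega)) (r E0 : R) (m0 : prob R (phase Omega)).
Hypothesis A_vel : forall z, A z -> enorm (vel z) <= r.
Hypothesis A_curve : forall z, A z -> exists2 g : curve T Omega, ev (time0 T) g = z & kinetic (eta_of g) E0.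
Hypothesis m0A : m0 (~` A) = 0%E.
Hypothesis mA : measurable (A : set (borel (phase Omega))).

Let start (g : curve T Omega) := ev (time0 T) g.
Let value mu (g : curve T Omega) := running F G l mu g + 2^-1 * energy g.
Let mass b : R := fine (m0 (pcell b)).

Lemma mass_split b : mass b = mass (false :: b) + mass (true :: b).
Proof. by rewrite /mass pcell_mass fineD//; apply: fin_num_measure; exact: measurable_pcell. Qed.

Lemma start_mass_ge0 b : 0 <= mass b. Proof. exact: fine_ge0. Qed.

Lemma mass_nil : mass [::] = 1.
Proof. by rewrite /mass pcell_nil probability_setT. Qed.

Lemma mass_gt0 b : 0 < mass b -> exists2 z, A z & pcell b z.
Proof.
move=> m0b; apply: contrapT => N; move: m0b; rewrite /mass (_ : m0 (pcell b) = 0%E) ?ltxx//.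
apply/eqP; rewrite eq_le measure_ge0 andbT -m0A; apply: le_measure; rewrite ?inE.
- exact: measurable_pcell.
- exact: measurableC.
- by move=> z zb Az; apply: N; exists z.
Qed.

(** The net must reproduce starting cell, shape and energy at once: closeness in [C^1] says nothing
    about energies, whereas a player near a competitor must not cost noticeably more than this
    competitor. *)
Theorem stage_equilibrium N : E0 <= N%:R -> exists (I : finType) (gam : I -> curve T Omega) (W : I -> R)
    (mu : prob R (curve T Omega)),
  ([/\ (forall i, 0 <= W i), \sum_i W i = 1, (forall i, A (start (gam i))),
      forall i, kinetic (eta_of (gam i)) N%:R &
      forall t psi, continuous psi -> bounded_real psi ->
        (\int[marginal mu t]_z (psi z)%:E = (\sum_i W i * psi (ev t (gam i)))%:E)%E] /\
  [/\ forall b, size b = N -> \sum_(i | pword N (start (gam i)) == b) W i = fine (m0 (pcell b)),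
      forall g E, A (start g) -> kinetic (eta_of g) E -> E <= N%:R -> exists i,
        [/\ pword N (start (gam i)) = pword N (start g), close_curve N.+1%:R^-1 g (gam i) &
         kinetic (eta_of (gam i)) (E + N.+1%:R^-1)] &
      forall i, 0 < W i -> forall j, pword N (start (gam j)) = pword N (start (gam i)) ->
        value mu (gam i) <= value mu (gam j)]).
Proof.
move=> E0N; have N0 : 0 < N.+1%:R^-1 :> R by rewrite invr_gt0.
have [M MP] := @curve_words_close _ _ T _ bounded_phases N%:R r _ N0.
pose good g := A (start g) /\ kinetic (eta_of g) N%:R.
have good_tame g : good g -> tame N%:R r g by move=> [/A_vel Ag kg].
pose slice (g : curve T Omega) : 'I_(N * N.+1).+1 := inord (Num.truncn (energy g * N.+1%:R)).
have good_energy g : good g -> 0 <= energy g <= N%:R.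
  by move=> [_ /kinetic_integral[_ kN]]; rewrite energy_ge0.
(* The energy, at most [N], is recorded up to [N.+1%:R^-1] by the index of its slice; the other two
   components are finitely many bits of the starting phase and of the trajectory. *)
pose code g := (bits (@pcoord R n Omega) N (start g), bits ccoord M g, slice g).
have [I [gam [gam_good gam_code]]] := finite_net good code.
pose q i := pword N (start (gam i)).
have net g E : A (start g) -> kinetic (eta_of g) E -> E <= N%:R -> exists i,
    [/\ q i = pword N (start g), close_curve N.+1%:R^-1 g (gam i) & kinetic (eta_of (gam i)) (E + N.+1%:R^-1)].
  move=> Ag kg EN; have gg : good g by split => //; exact: energy_leW kg.
  have [i ci] := gam_code g gg; exists i.
  have [c1 c2 c3] : [/\ bits (@pcoord R n Omega) N (start (gam i)) = bits (@pcoord R n Omega) N (start g),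
      bits ccoord M (gam i) = bits ccoord M g & slice (gam i) = slice g].
    by split; [exact: (congr1 (fun c => c.1.1) ci)|exact: (congr1 (fun c => c.1.2) ci)|exact: (congr1 snd ci)].
  split; first exact: bits_word c1.
  - by apply: MP; [exact: good_tame|exact: good_tame|exact/esym/bits_word/c2].
  - have [_ ki] := gam_good i; have [_ ke] := kinetic_integral kg.
    apply: energy_leW (L2norm_kinetic (kinetic_L2norm ki)).
    by apply: le_trans (slice_close (good_energy g gg) (good_energy _ (gam_good i)) (esym c3)) _; rewrite lerD2r.
pose W (w : I -> R) i := mass (q i) * w i.
have W_cell w b : strategy q w -> size b = N -> \sum_(i | q i == b) W w i = mass b.
  move=> [w0 w1] bN; have [/mass_gt0[z Az zb]|mb] := ltP 0 (mass b); last first.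
    have mb0 : mass b = 0 by apply/eqP; rewrite eq_le mb start_mass_ge0.
    by rewrite mb0; apply: big1 => i /eqP ib; rewrite /W ib mb0 mul0r.
  (* A cell charged by [m0] meets [A], and [E0 <= N] guarantees that the net has a player in it;
     with no player the mass of the cell would be lost. *)
  have [g gz kg] := A_curve Az.
  have Ag : A (start g) by rewrite /start gz.
  have [i [qi _ _]] := net g E0 Ag kg E0N.
  have qb : q i = b by rewrite qi /start gz -bN; exact: zb.
  rewrite -qb -[RHS]mulr1 -(w1 i) mulr_sumr; by apply: eq_bigr => j /eqP; rewrite /W => ->.
have W_sum w : strategy q w -> \sum_i W w i = 1.
  move=> sw; pose S b := \sum_(i | pword (size b) (start (gam i)) == b) W w i.
  have := @additive_words _ S mass mass 0 N _ mass_split mass_split _.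
  rewrite mass_nil mulr1 => H; apply/eqP; rewrite -subr_eq0 -normr_le0.
  apply: H => b; first exact: (@word_sum_split _ _ _ (@pcoord R n Omega) I (fun i => start (gam i))).
  by move=> bN; rewrite /S bN W_cell// subrr normr0 mul0r.
have W_ge0 w i : strategy q w -> 0 <= W w i by move=> [w0 _]; rewrite mulr_ge0 ?start_mass_ge0.
have /choice[law lawP] : forall w, exists mu : prob R (curve T Omega), strategy q w ->
    forall t psi, continuous psi -> bounded_real psi ->
    (\int[marginal mu t]_z (psi z)%:E = (\sum_i W w i * psi (ev t (gam i)))%:E)%E.
  move=> w; case: (pselect (strategy q w)) => [sw|nw]; last by exists point.
  have [mu muP] := finite_law (fun i => W_ge0 w i sw) (W_sum w sw) (fun i => good_tame _ (gam_good i)).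
  by exists mu.
have [|w sw nash] := @nash_equilibrium R I _ q (fun w i => value (law w) (gam i)).
- move=> u w su uw i; have sw : strategy q w.
    split=> [j|j]; first by apply: ler_cvg_to (cvg_cst 0) (uw j) _; apply: nearW => k; have [] := su k.
    apply/(cvg_unique _ (@cvgr_sum R I (fun j' => q j' == q j) (fun i k => u k i) w uw)) => //.
    rewrite (_ : (fun k => _) = cst 1); first exact: cvg_cst.
    by apply/funext => k; have [_ ->] := su k.
  apply: cvgD; last exact: cvg_cst.
  apply: (@running_cvg _ _ _ _ F G l cF cG cl bounded_phases N%:R r (fun k => law (u k)) (law w) (fun=> gam i)).
  + move=> t psi cpsi bpsi; rewrite lawP//; under eq_fun do rewrite lawP//.
    apply: cvg_EFin; first exact: nearW.
    apply: (@cvgr_sum R I xpredT (fun j k => W (u k) j * psi (ev t (gam j)))) => j.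
    apply: cvgM; last exact: cvg_cst.
    by apply: cvgM; [exact: cvg_cst|exact: uw].
  + exact: cvg_cst.
  + by move=> _; exact: good_tame.
exists I, gam, (W w), (law w); split; split.
- by move=> i; apply: W_ge0 sw.
- exact: W_sum sw.
- by move=> i; have [] := gam_good i.
- by move=> i; have [] := gam_good i.
- exact: lawP sw.
- by move=> b; apply: W_cell sw.
- exact: net.
- move=> i Wi j ji; apply: nash => //; rewrite lt0r; have [w0 _] := sw; rewrite w0 andbT.
  by apply/eqP => wi; move: Wi; rewrite /W wi mulr0 ltxx.
Qed.

End stage.
End finite_laws.

Lemma integral_near_const d (X : measurableType d) (R : realType) (P : probability X R) (D : set X)
    (h : X -> R) (c e : R) : measurable D -> measurable_fun setT h -> bounded_real h ->
  (forall x, D x -> `|h x - c| <= e) -> `|\int[P]_(x in D) h x - fine (P D) * c| <= e * fine (P D).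
Proof.
move=> mD mh bh hc.
have ih : P.-integrable D (EFin \o h) by apply: integrableS (bounded_integrable P mh bh).
have PD : (P D < +oo)%E by apply: le_lt_trans (probability_le1 P mD) (ltry _).
have ic (a : R) : P.-integrable D (EFin \o cst a) by exact: integrable_const.
have cE (a : R) : \int[P]_(x in D) a = fine (P D) * a by rewrite (Rintegral_cst _ mD) mulrC.
have i1 : P.-integrable D (EFin \o (fun x => h x - c)).
  exact: (@integrableB _ _ _ _ _ mD (EFin \o h) (EFin \o cst c) ih (ic c)).
rewrite -(cE c) -RintegralB//; last exact: ic.
apply: le_trans (le_normr_Rintegral mD i1) _; rewrite mulrC -cE.
by apply: le_Rintegral => //; [exact: (integrable_norm i1)|exact: ic].
Qed.

Section start_law.
Context {R : realType} {n : nat} {Omega : domain R n}.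
Hypothesis bounded_phases : forall r : R, exists M, forall z : phase Omega, enorm (vel z) <= r ->
  forall c, `|pcoord c z| <= M.
Variables (A : set (phase Omega)) (r : R) (m0 : prob R (phase Omega)).
Hypothesis A_vel : forall z, A z -> enorm (vel z) <= r.
Hypothesis m0A : m0 (~` A) = 0%E.
Hypothesis mA : measurable (A : set (borel (phase Omega))).

(** The starting points need not follow [m0]; only the masses of the cells of depth [N] agree. On
    [A], where velocities are bounded, [psi] varies by at most [e / 2] over such a cell, and the
    comparison is summed over the words. *)
Lemma start_integral (psi : phase Omega -> R) (e : R) : continuous psi -> bounded_real psi -> 0 < e ->
  exists M, forall (N : nat) (I : finType) (x : I -> phase Omega) (W : I -> R), (M <= N)%N ->
    (forall i, 0 <= W i) -> (forall i, A (x i)) ->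
    (forall b, size b = N -> \sum_(i | pword N (x i) == b) W i = fine (m0 (pcell b))) ->
    `|\sum_i W i * psi (x i) - \int[m0]_z psi z| <= e.
Proof.
move=> cpsi bpsi e0; have e2 : 0 < e / 2 by rewrite divr_gt0.
have mpsi : measurable_fun setT (psi : borel (phase Omega) -> R) by exact: continuous_measurable_real.
have [d d0 dP] := phase_uniform bounded_phases r cpsi e2.
have [M MP] := phase_words_close (bounded_phases r) d0.
have close N z w : (M <= N)%N -> A z -> A w -> pword N z = pword N w -> `|psi z - psi w| <= e / 2.
  move=> MN Az Aw zw; apply: dP => [|c]; first exact: A_vel.
  by apply: MP; [exact: A_vel|exact: A_vel|exact: wordW MN zw].
exists M => N I x W MN W0 xA Wb.
pose D b : set (borel (phase Omega)) := pcell b `&` A.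
have mD b : measurable (D b) by apply: measurableI => //; exact: measurable_pcell.
have massD b : m0 (D b) = m0 (pcell b).
  rewrite [RHS](measureDI _ (measurable_pcell b) mA) [X in (X + _)%E](_ : _ = 0%E) ?add0e//.
  apply/eqP; rewrite eq_le measure_ge0 andbT -m0A; apply: le_measure; rewrite ?inE.
  - by apply: measurableD => //; exact: measurable_pcell.
  - exact: measurableC.
  - by move=> z [].
pose S b := \sum_(i | pword (size b) (x i) == b) W i * psi (x i).
pose J b := \int[m0]_(z in D b) psi z.
pose mass b := fine (m0 (pcell b)).
have J_split b : J b = J (false :: b) + J (true :: b).
  rewrite /J {1}/D pcell_split setIUl Rintegral_setU//; [exact: mD|exact: mD| |].
    by apply: integrableS (bounded_integrable m0 mpsi bpsi) => //; apply: measurableU; exact: mD.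
  apply/disj_setPS => z [[z1 _] [z2 _]]; have /disj_setPS/(_ z) := @pcell_disjoint _ _ Omega b; exact.
have mass_split' b : mass b = mass (false :: b) + mass (true :: b).
  by rewrite /mass pcell_mass fineD//; apply: fin_num_measure; exact: measurable_pcell.
have J_nil : J [::] = \int[m0]_z psi z.
  have D_nil : D [::] = setT `\` ~` A by rewrite /D pcell_nil setTI setTD setCK.
  rewrite /J /Rintegral D_nil -negligible_integral//; first exact: measurableC.
  exact: bounded_integrable.
have mass1 : mass [::] = 1 by rewrite /mass pcell_nil probability_setT.
have := @additive_words _ S J mass e N _ J_split mass_split' _; rewrite J_nil mass1 mulr1.
rewrite (_ : S [::] = \sum_i W i * psi (x i)); last by apply: eq_bigl => i.
apply=> b; first exact: (@word_sum_split _ _ _ (@pcoord R n Omega) I x).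
move=> bN; case: (pselect (exists z, D b z)) => [[z [bz Az]]|nD]; last first.
  have -> : S b = 0.
    rewrite /S big1// => i /eqP ib; case: nD; exists (x i); split => //; exact: ib.
  rewrite /J (_ : D b = set0); last by rewrite -subset0 => z Dz; apply: nD; exists z.
  rewrite Rintegral_set0 subrr normr0; apply: mulr_ge0; [exact: ltW|exact: fine_ge0].
have bz' : pword N z = b by rewrite -bN.
have h1 : `|S b - mass b * psi z| <= e / 2 * mass b.
  rewrite /mass -(Wb b bN) /S bN mulr_suml -sumrB mulr_sumr; apply: le_trans (ler_norm_sum _ _ _) _.
  apply: ler_sum => i /eqP ib; rewrite -mulrBr normrM ger0_norm// mulrC; apply: ler_wpM2r => //.
  by apply: (close N) => //; rewrite ib bz'.
have h2 : `|J b - mass b * psi z| <= e / 2 * mass b.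
  rewrite /mass -massD; apply: integral_near_const => // w [bw Aw].
  by apply: (close N) => //; rewrite bz' -bN.
have -> : S b - J b = (S b - mass b * psi z) - (J b - mass b * psi z) by ring.
by apply: le_trans (ler_normB _ _) _; lra.
Qed.

End start_law.

(** * Regularity of the marginals *)

Section marginal_regularity.
Context {R : realType} {n : nat} {T : {posnum R}} {Omega : domain R n}.

Lemma closed_K (C : R) : closed (K C : set (phase Omega)).
Proof.
have cv : continuous (fun z : phase Omega => enorm (vel z)).
  by move=> z; exact: (cvg_comp _ _ (@continuous_vel R n Omega z) (@continuous_enorm R n (vel z))).
exact: (@closed_comp _ _ (fun z : phase Omega => enorm (vel z)) [set x | x <= C] (fun z _ => cv z) (@closed_le _ C)).
Qed.

Lemma measurable_closed (X : ptopologicalType) (A : set X) : closed A -> measurable (A : set (borel X)).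
Proof. by move=> cA; rewrite -[A]setCK; apply: measurableC; apply: sub_sigma_algebra; exact: closed_openC. Qed.

Lemma phase_dist_coord (z w : phase Omega) e : 0 <= e -> (forall c, `|pcoord c z - pcoord c w| <= e) ->
  phase_dist z w <= 2 * (n%:R * e).
Proof.
move=> e0 H; apply: phase_dist_le; [exact: mulr_ge0| |]; apply: enorm_le_coord => // i; rewrite !mxE.
  exact: (H (true, i)).
exact: (H (false, i)).
Qed.

(** Test functions of [KR_dist] are controlled on [A] only. Their superlevel sets are traces on [A]
    of open sets, which gives measurability there. *)
Lemma lipschitz_measurable (A : set (phase Omega)) (phi : phase Omega -> R) :
  (forall z w, A z -> A w -> `|phi z - phi w| <= phase_dist z w) ->
  measurable (A : set (borel (phase Omega))) ->
  measurable_fun (A : set (borel (phase Omega))) (phi : borel (phase Omega) -> R).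
Proof.
move=> lip mA; apply: (@measurability _ _ (borel (phase Omega)) R A phi (@RGenOInfty.G R)); first exact: RGenOInfty.measurableE.
move=> _ [_ [a ->] <-].
pose U := \bigcup_(V in [set V : set (phase Omega) | open V /\ forall w, A w -> V w -> a < phi w]) V.
rewrite (_ : A `&` _ = A `&` U); last first.
  apply/seteqP; split => z [Az] /=; rewrite in_itv /= andbT; last first.
    by move=> [V [oV HV] Vz]; split => //; exact: HV.
  move=> az; split => //; pose d := (phi z - a) / (2 * (n%:R + 1)).
  have n1 : 0 < n%:R + 1 :> R by rewrite ltr_wpDl.
  have d0 : 0 < d by rewrite divr_gt0 ?subr_gt0// mulr_gt0.
  have nz : nbhs z [set w | forall c, `|pcoord c z - pcoord c w| < d].
    by apply/nbhs_ballP; exists d => // w /(ball_phase _ _ d0).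
  exists ([set w | forall c, `|pcoord c z - pcoord c w| < d]^°); last exact: nz.
  split; first exact: open_interior.
  move=> w Aw /interior_subset /= zw; have := lip z w Az Aw.
  have := @phase_dist_coord z w d (ltW d0) (fun c => ltW (zw c)).
  have E : phi z - a = 2 * (n%:R * d) + 2 * d by rewrite /d; field; rewrite gt_eqF.
  by move=> h1; rewrite ler_norml => /andP[h2 h3]; lra.
apply: measurableI => //; apply: sub_sigma_algebra; apply: bigcup_open => V [oV _]; exact: oV.
Qed.

(** The joint law of the phases at times [s] and [t] under [mu] is a coupling of the two marginals.
    Positions are Lipschitz in time with constant [C], which accounts for the factor
    [Num.sqrt T%:num]; velocities are half-Hölder with constant [C] by Cauchy-Schwarz. *)
Lemma half_holder_marginal (mu : prob R (curve T Omega)) (C : R) :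
  (forall r : R, exists M, forall z : phase Omega, enorm (vel z) <= r -> forall c, `|pcoord c z| <= M) ->
  0 <= C -> mu (curves_bounded C) = 1%E -> half_holder (K C) (marginal mu).
Proof.
move=> bounded_phases C0 muC; pose CB : set (borel (curve T Omega)) := curves_bounded C.
have mCB : measurable CB by apply: measurable_closed; exact: closed_curves_bounded.
have mK : measurable (K C : set (borel (phase Omega))) by apply: measurable_closed; exact: closed_K.
split.
  move=> t; apply/eqP; rewrite eq_le probability_le1//= -muC; apply: le_measure; rewrite ?inE//.
    rewrite -[X in measurable X]setTI; apply: (continuous_borel_measurable (@continuous_ev _ _ _ Omega t)) => //.
  by move=> g [gC _]; exact: gC.
exists (2 * (C * (1 + Num.sqrt T%:num))) => s t.
set L := 2 * _; set q := Num.sqrt _.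
have q0 : 0 <= q by exact: sqrtr_ge0.
have dist g : CB g -> phase_dist (ev s g) (ev t g) <= L * q.
  move=> [gC /(L2norm_le _ C0) kg]; rewrite /L -mulrA; apply: phase_dist_le.
  - by rewrite !mulr_ge0 ?addr_ge0 ?sqrtr_ge0.
  - apply: le_trans (xi_lip s t (fun u => gC u)) _; rewrite -mulrA; apply: ler_wpM2l => //.
    rewrite mulrDl mul1r; apply: (@le_trans _ _ (Num.sqrt T%:num * q)); last by rewrite lerDr.
    rewrite /q -sqrtrM// -[leLHS]ger0_norm// -sqrtr_sqr; apply: ler_wsqrtr.
    rewrite expr2; apply: ler_wpM2r => //; rewrite ler_norml.
    by have := time_ge0 s; have := time_leT s; have := time_ge0 t; have := time_leT t; lra.
  - apply: le_trans (kinetic_incr _ _ kg) _; rewrite sqrtrM ?sqr_ge0// sqrtr_sqr ger0_norm//.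
    rewrite -mulrA; apply: ler_wpM2l => //; rewrite mulrDl mul1r lerDl mulr_ge0// sqrtr_ge0.
apply: ge_ereal_sup => _ [phi lip <-].
have mphi := lipschitz_measurable lip mK.
have [g0 g0C] : exists g, CB g.
  apply: contrapT => N; have : mu CB = 0%E by rewrite (_ : CB = set0) ?measure0// -subset0 => g Cg; apply: N; exists g.
  by rewrite muC => /eqP; rewrite onee_eq0.
pose h : phase Omega -> R := phi \_ (K C).
have mh : measurable_fun setT (h : borel (phase Omega) -> R) by exact: (measurable_restrictT (phi : borel (phase Omega) -> R) mK).1.
have bh : bounded_real h.
  have [M HM] := bounded_phases C; pose z0 := ev s g0; have z0C : K C z0 by exact: g0C.1.
  exists (`|phi z0| + 2 * (n%:R * (`|M| + `|M|))) => z; rewrite /h patchE; case: ifPn => [|_]; last first.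
    by rewrite normr0 !(addr_ge0, mulr_ge0).
  rewrite inE => zC; rewrite -[phi z](subrK (phi z0)) addrC; apply: le_trans (ler_normD _ _) _.
  rewrite lerD2l; apply: le_trans (lip _ _ zC z0C) _; apply: phase_dist_coord; first by rewrite addr_ge0.
  move=> c; apply: le_trans (ler_normB _ _) _.
  by apply: lerD; apply: le_trans (ler_norm M); apply: HM.
have evm u : measurable_fun setT (ev u : borel (curve T Omega) -> borel (phase Omega)).
  exact: continuous_borel_measurable (@continuous_ev _ _ _ _ u).
have mhe u : measurable_fun setT (h \o ev u : borel (curve T Omega) -> R) by exact: measurableT_comp (evm u).
have bhe (u : time T) : bounded_real (fun g : curve T Omega => h (ev u g)) by have [B HB] := bh; exists B => g; exact: HB.
have ihe u := bounded_integrable mu (mhe u) (bhe u).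
have intE u : (\int[marginal mu u]_(z in K C) (phi z)%:E = (\int[mu]_g h (ev u g))%:E)%E.
  rewrite integral_mkcond (_ : _ \_ _ = EFin \o h); last first.
    by apply/funext => z; rewrite /h /= !patchE; case: ifP.
  rewrite (@integral_distribution _ _ _ _ _ mu (ev_mfun Omega u) (EFin \o h)).
  - by rewrite /Rintegral fineK//; exact: integrable_fin_num (ihe u).
  - exact/measurable_EFinP.
  - exact: ihe.
rewrite !intE -EFinB lee_fin -RintegralB//; [|exact: ihe|exact: ihe].
have mD : measurable_fun setT (fun g : borel (curve T Omega) => h (ev s g) - h (ev t g)).
  exact: (measurable_funB (mhe s) (mhe t)).
have bD : bounded_real (fun g : curve T Omega => h (ev s g) - h (ev t g)).
  have [B HB] := bh; exists (B + B) => g; apply: le_trans (ler_normB _ _) _; exact: lerD.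
have iD := bounded_integrable mu mD bD.
have CB0 : mu (~` CB) = 0%E by rewrite probability_setC// muC subee.
have -> : \int[mu]_g (h (ev s g) - h (ev t g)) = \int[mu]_(g in CB) (h (ev s g) - h (ev t g)).
  rewrite /Rintegral (negligible_integral _ _ iD CB0)//; last exact: measurableC.
  by rewrite setTD setCK.
have := @integral_near_const _ _ _ mu CB _ 0 (L * q) mCB mD bD.
rewrite muC /= mulr1 mulr0 subr0 => H; apply: le_trans (ler_norm _) _; apply: H => g gC.
rewrite subr0 /h !patchE !mem_set; [|exact: gC.1|exact: gC.1].
by apply: le_trans (lip _ _ _ _) (dist g gC); exact: gC.1.
Qed.

End marginal_regularity.

(** * Passage to the limit *)

Fact value_perturbation (R : realType) (x y x' y' ex ey E d e : R) :
  `|x - x'| <= e / 8 -> `|y - y'| <= e / 8 -> d <= e / 4 -> ey <= E + d ->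
  x' + 2^-1 * ex <= y' + 2^-1 * ey -> ex <= 2 * (y + 2^-1 * E - x) + e.
Proof. rewrite !ler_norml => /andP[a1 a2] /andP[b1 b2]; lra. Qed.

Fact energy_from_value (R : realType) (x y ex ey lo hi E : R) :
  y <= hi -> lo <= x -> ey <= E -> x + 2^-1 * ex <= y + 2^-1 * ey -> ex <= 2 * (hi + 2^-1 * E - lo).
Proof. lra. Qed.

Section equilibrium.
Context {R : realType} {n : nat} {T : {posnum R}} {Omega : domain R n}.
Variables (F G : prob R (phase Omega) -> phase Omega -> R) (l : phase Omega * time T -> R).
Hypothesis cF : bounded_continuous_coupling F.
Hypothesis cG : bounded_continuous_coupling G.
Hypothesis cl : continuous l.
Hypothesis bounded_phases : forall r : R, exists M, forall z : phase Omega, enorm (vel z) <= r ->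
  forall c, `|pcoord c z| <= M.
Implicit Types (g h : curve T Omega).

Let start g := ev (time0 T) g.
Let value mu g := running F G l mu g + 2^-1 * energy g.

Let inv_near e : 0 < e -> \forall m \near \oo, 2 / m.+1%:R <= e :> R.
Proof.
move=> e0; have e2 : 0 < e / 2 by rewrite divr_gt0.
apply: filterS (near_infty_natSinv_lt (PosNum e2)) => m me.
have me' : m.+1%:R^-1 < e / 2 by exact: me.
by rewrite mulrC -ler_pdivlMr// ltW.
Qed.

Lemma close_curve_cvg g (u : nat -> curve T Omega) : (forall m, close_curve (2 / m.+1%:R) g (u m)) -> u @ \oo --> g.
Proof.
move=> H; apply/cvg_curve => e e0; apply: filterS (inv_near e0) => m me.
exact: close_curve_le me (H m).
Qed.

(** The energies of [u m] are not known to converge, but the comparison with [v m] bounds them from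
    above by [2 * c + e] for late [m], and the bound passes to [g] by lower semicontinuity. *)
Lemma value_limit (E1 E r : R) (mus : nat -> prob R (curve T Omega)) mu (u v : nat -> curve T Omega) g h :
  (forall t, narrow_cvg (fun m => marginal (mus m) t) (marginal mu t)) ->
  u @ \oo --> g -> v @ \oo --> h ->
  (forall m, tame E1 r (u m)) -> (forall m, tame (E + 2 / m.+1%:R) r (v m)) ->
  (forall m, value (mus m) (u m) <= value (mus m) (v m)) ->
  running F G l mu g + 2^-1 * energy g <= running F G l mu h + 2^-1 * E.
Proof.
move=> mm ug vh uE vE uv.
have vE2 m : tame (E + 2) r (v m).
  have [vk vr] := vE m; split => //; apply: energy_leW vk; rewrite lerD2l ler_pdivrMr// ler_peMr// ler1n//.
have ru := @running_cvg _ _ _ _ F G l cF cG cl bounded_phases E1 r mus mu u g mm ug uE.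
have rv := @running_cvg _ _ _ _ F G l cF cG cl bounded_phases (E + 2) r mus mu v h mm vh vE2.
set c := running F G l mu h + 2^-1 * E - running F G l mu g.
suff : energy g <= 2 * c by rewrite /c; lra.
apply/ler_addgt0Pr => e e0; have e8 : 0 < e / 8 by rewrite divr_gt0.
have e4 : 0 < e / 4 by rewrite divr_gt0.
move/cvgrPdist_le/(_ _ e8): ru => ru; move/cvgrPdist_le/(_ _ e8): rv => rv.
have [M _ MP] : \forall m \near \oo, energy (u m) <= 2 * c + e.
  apply: filterS (filterI (filterI ru rv) (inv_near e4)) => m [[/= h1 h2] h3].
  have [vk _] := vE m; have [_ h4] := kinetic_integral vk.
  exact: (value_perturbation h1 h2 h3 h4 (uv m)).
have ug' : (fun m => u (m + M)%N) @ \oo --> g.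
  by move=> U /ug[k _ kU]; exists k => // m /= km; apply: kU; exact: leq_trans km (leq_addr _ _).
have kg : kinetic (eta_of g) (2 * c + e).
  apply: cvg_curve_kinetic ug' _ => m; have [uk _] := uE (m + M)%N.
  apply: energy_leW (L2norm_kinetic (kinetic_L2norm uk)); apply: MP; exact: leq_addl.
by have [_] := kinetic_integral kg.
Qed.

Record game := Game {
  player : finType; path_of : player -> curve T Omega; weight : player -> R; law_of : prob R (curve T Omega) }.

Variables (Theta : set (phase Omega)) (r b : R) (m0 : prob R (phase Omega)).
Hypothesis bO : bounded_set (Omega : set 'rV[R]_n).
Hypothesis bd : C2_boundary Omega.
Hypothesis bl : forall z, b <= l z.
Hypothesis clT : closed Theta.
Hypothesis adm : Theta `<=` @admissible R n Omega.
Hypothesis cA : condition_A Theta.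
Hypothesis m0supp : supp m0 `<=` Theta `&` K r.

Theorem limit_equilibrium : exists mu : prob R (curve T Omega), [/\ prob_from m0 mu,
  forall g, supp mu g -> supp m0 (start g) /\ optimal_curves F G l mu (start g) g &
  forall B : set (borel (curve T Omega)), measurable B -> supp mu `<=` B -> mu B = 1%E].
Proof.
pose A := Theta `&` K r.
have closedA : closed A by apply: closedI; [exact: clT|exact: closed_K].
have mA : measurable (A : set (borel (phase Omega))) by exact: measurable_closed.
have m0A := supp_null m0supp closedA.
have A_vel z : A z -> enorm (vel z) <= r by case.
have [E0 E0P] := @uniform_energy _ _ T _ _ r adm cA bd bO clT.
have A_curve z : A z -> exists2 g : curve T Omega, ev (time0 T) g = z & kinetic (eta_of g) E0.
  by move=> [Tz Kz]; exact: E0P.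
pose N k := (k + Num.bound `|E0|)%N.
have E0N k : E0 <= (N k)%:R.
  apply: le_trans (ler_norm _) _; apply: le_trans (ltW (archi_boundP (normr_ge0 E0))) _.
  by rewrite ler_nat leq_addl.
have /choice[st stP] : forall k, exists s : game,
    ([/\ (forall i, 0 <= @weight s i), \sum_i @weight s i = 1, (forall i, A (start (@path_of s i))),
      forall i, kinetic (eta_of (@path_of s i)) (N k)%:R &
      forall t psi, continuous psi -> bounded_real psi ->
        (\int[marginal (law_of s) t]_z (psi z)%:E = (\sum_i @weight s i * psi (ev t (@path_of s i)))%:E)%E] /\
    [/\ forall b, size b = N k -> \sum_(i | pword (N k) (start (@path_of s i)) == b) @weight s i = fine (m0 (pcell b)),
      forall g E, A (start g) -> kinetic (eta_of g) E -> E <= (N k)%:R -> exists i,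
        [/\ pword (N k) (start (@path_of s i)) = pword (N k) (start g), close_curve (N k).+1%:R^-1 g (@path_of s i) &
         kinetic (eta_of (@path_of s i)) (E + (N k).+1%:R^-1)] &
      forall i, 0 < @weight s i -> forall j,
        pword (N k) (start (@path_of s j)) = pword (N k) (start (@path_of s i)) ->
        value (law_of s) (@path_of s i) <= value (law_of s) (@path_of s j)]).
  move=> k; have [I [gam [W [mu H]]]] := stage_equilibrium bounded_phases cF cG cl A_vel A_curve m0A mA (E0N k).
  by exists (Game gam W mu).
have [B1 B1P] := running_bounded cF cG cl bounded_phases (E0 + 1) r.
have [B0 B0P] := running_lower cF cG cl bounded_phases bl.
(* A charged trajectory competes, in its own cell, with a trajectory of energy at most [E0 + 1],
   whose running cost is at most [B1]; its own running cost is at least [B0], which leaves this much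
   energy. *)
pose E1 := 2 * (B1 + 2^-1 * (E0 + 1) - B0).
have atom_tame k i : 0 < @weight (st k) i -> tame E1 r (@path_of (st k) i).
  have [[W0 W1 gA gN _] [_ net nash]] := stP k => Wi; split; last exact: A_vel (gA i).
  have [g0 gz kg] := A_curve _ (gA i).
  have Ag : A (start g0) by rewrite /start gz.
  have [j [jw _ kj]] := net g0 E0 Ag kg (E0N k).
  have kj1 : kinetic (eta_of (@path_of (st k) j)) (E0 + 1).
    by apply: energy_leW kj; rewrite lerD2l invf_le1// ler1n.
  have tj : tame (E0 + 1) r (@path_of (st k) j) by split => //; exact: A_vel (gA j).
  have ti : tame (N k)%:R r (@path_of (st k) i) by split; [exact: gN|exact: A_vel (gA i)].
  have := nash i Wi j; rewrite jw /start gz => /(_ erefl); rewrite /value.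
  have := B1P (law_of (st k)) _ tj; rewrite ler_norml => /andP[_ h1].
  have h2 := B0P (law_of (st k)) _ _ _ ti; have [_ h3] := kinetic_integral kj1 => h4.
  apply: energy_leW (L2norm_kinetic (kinetic_L2norm (gN i))).
  exact: (energy_from_value h1 h2 h3 h4).
have [i0 Wi0] : exists i, 0 < @weight (st 0%N) i.
  have [[W0 W1 _ _ _] _] := stP 0%N; apply: contrapT => H.
  have : \sum_i @weight (st 0%N) i = 0.
    by apply: big1 => i _; apply/eqP; rewrite eq_le W0 andbT leNgt; apply/negP => Wi; apply: H; exists i.
  by rewrite W1 => /eqP; rewrite oner_eq0.
(* Players of weight zero may have energies growing with [k]; a fixed charged trajectory takes their
   place, which leaves all weighted sums unchanged and makes the family uniformly tame. *)
pose gam k i := if 0 < @weight (st k) i then @path_of (st k) i else @path_of (st 0%N) i0.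
have gam_tame k i : tame E1 r (gam k i) by rewrite /gam; case: ifP => [/atom_tame//|_]; exact: atom_tame.
have gam_sum k (psi : curve T Omega -> R) :
    \sum_i @weight (st k) i * psi (gam k i) = \sum_i @weight (st k) i * psi (@path_of (st k) i).
  have [[W0 _ _ _ _] _] := stP k; apply: eq_bigr => i _; rewrite /gam; case: ltP => // Wi.
  by have -> : @weight (st k) i = 0 by [apply/eqP; rewrite eq_le Wi W0]; rewrite !mul0r.
have W_ge0 k i : 0 <= @weight (st k) i by have [[]] := stP k.
have W_sum k : \sum_i @weight (st k) i = 1 by have [[]] := stP k.
have [f f_mono [mu [mu_cvg mu_tame mu_atom mu_full]]] := @tame_compactness _ _ _ _ bounded_phases E1 r
  (fun k => player (st k)) (fun k => @weight (st k)) gam W_ge0 W_sum gam_tame.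
have marg_cvg t : narrow_cvg (fun k => marginal (law_of (st (f k))) t) (marginal mu t).
  move=> psi cpsi bpsi; rewrite marginal_integral_fine//.
  rewrite (_ : (fun k => _) = fun k => (\sum_i @weight (st (f k)) i * psi (ev t (gam (f k) i)))%:E).
    by apply: cvg_EFin; [exact: nearW|exact: mu_cvg].
  apply/funext => k; have [[_ _ _ _ ->//] _] := stP (f k).
  by rewrite (gam_sum (f k) (fun g => psi (ev t g))).
have from_m0 : prob_from m0 mu.
  apply: prob_eq_integrals => psi cpsi bpsi; rewrite marginal_integral_fine//.
  rewrite -[RHS]fineK; last first.
    apply: integrable_fin_num => //; apply: (@bounded_integrable _ _ _ m0 psi) => //.
    exact: continuous_measurable_real.
  congr (_%:E); apply: (cvg_unique _ (mu_cvg (time0 T) psi cpsi bpsi)) => //.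
  apply/cvgrPdist_le => e e0.
  have [M MP] := start_integral bounded_phases A_vel m0A mA cpsi bpsi e0.
  exists M => // k /= Mk; rewrite (gam_sum (f k) (fun g => psi (start g))) distrC.
  have [[_ _ gA _ _] [cm _ _]] := stP (f k); apply: (MP (N (f k)) _ (fun i => start (@path_of (st (f k)) i))) => //.
  exact: leq_trans (leq_trans Mk (increasing_geS f_mono k)) (leq_addr _ _).
have start_supp g : supp mu g -> supp m0 (start g).
  move=> gmu U oU Ug; rewrite -from_m0; last exact: sub_sigma_algebra.
  apply: gmu; last exact: Ug.
  by have /continuousP/(_ _ oU) := @continuous_ev _ _ T Omega (time0 T).
exists mu; split => // g gmu; split; first exact: start_supp.
split => // h hg; have [Lh|Lh] := pselect (acceleration_L2norm h < +oo)%E; last first.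
  by rewrite [leRHS]/cost asboolF// leey.
have kh := L2norm_kinetic Lh; have [kg _] := mu_tame _ gmu.
rewrite (@cost_kinetic _ _ _ _ F G l cF cl bounded_phases mu g E1 kg)
  (@cost_kinetic _ _ _ _ F G l cF cl bounded_phases mu h _ kh) lee_fin.
set E := energy h in kh *.
(* Charged trajectories tending to [g], each with the stage at which it is played. *)
have /choice[p pP] : forall j : nat, exists p : nat * curve T Omega,
    [/\ (j <= p.1)%N, close_curve j.+1%:R^-1 g p.2 &
     exists2 i, 0 < @weight (st (f p.1)) i & @path_of (st (f p.1)) i = p.2].
  move=> j; have j0 : 0 < j.+1%:R^-1 :> R by rewrite invr_gt0.
  have [k [[i Wi cli] jk]] := filter_ex (filterI (mu_atom g _ gmu j0) (nbhs_infty_ge j)).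
  by exists (k, @path_of (st (f k)) i); split => //=; [move: cli; rewrite /gam Wi|exists i].
have pg : (fun j => (p j).2) @ \oo --> g.
  apply: close_curve_cvg => j; have [_ cj _] := pP j; apply: close_curve_le cj.
  by rewrite ler_peMl// ler1n.
have pA j : A (start (p j).2) by have [_ _ [i _ <-]] := pP j; have [[_ _ + _ _] _] := stP (f (p j).1); exact.
have pz : start (p j).2 @[j --> \oo] --> start h.
  by rewrite /start hg; exact: (cvg_comp _ _ pg (@continuous_ev _ _ _ _ (time0 T) g)).
(* At stage [d.1], the charged trajectory near [g] is compared with a player of the same cell near
   [h]. That player is reached in two moves: [approx_curve] transfers [h] to the starting point of
   the charged trajectory, then the net approximates the result. Each move loses at most
   [m.+1%:R^-1] in distance and in energy, whence the factor 2. *)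
have /choice[d dP] : forall m : nat, exists d : nat * (curve T Omega * curve T Omega),
    [/\ (m <= d.1)%N, close_curve (2 / m.+1%:R) g d.2.1 /\ tame E1 r d.2.1,
      close_curve (2 / m.+1%:R) h d.2.2, tame (E + 2 / m.+1%:R) r d.2.2 &
      value (law_of (st (f d.1))) d.2.1 <= value (law_of (st (f d.1))) d.2.2].
  move=> m; have m1 : 0 < m.+1%:R^-1 :> R by rewrite invr_gt0.
  have Th : Theta (start h) by rewrite /start hg; have [] := m0supp (start_supp _ gmu).
  have ap := approx_curve adm cA bd (fun j => (pA j).1) Th pz kh m1.
  have [j [[h' [h's h'c h'k]] mj]] := filter_ex (filterI ap (nbhs_infty_ge (maxn m (Num.bound (`|E| + 1))))).
  have [jk cg [i Wi ip]] := pP j; move: mj; rewrite geq_max => /andP[mj Ej].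
  set k := (p j).1 in jk i Wi ip; have [[_ _ gA gN _] [_ net nash]] := stP (f k).
  have kN : (k <= N (f k))%N by exact: leq_trans (increasing_geS f_mono k) (leq_addr _ _).
  have invN : (N (f k)).+1%:R^-1 <= m.+1%:R^-1 :> R.
    by rewrite lef_pV2 ?posrE// ler_nat ltnS; exact: leq_trans mj (leq_trans jk kN).
  have m11 : m.+1%:R^-1 <= 1 :> R by rewrite invf_le1// ler1n.
  have EN : E + m.+1%:R^-1 <= (N (f k))%:R.
    apply: (@le_trans _ _ (`|E| + 1)); first by rewrite lerD// ler_norm.
    have E10 : 0 <= `|E| + 1 by rewrite addr_ge0.
    apply: le_trans (ltW (archi_boundP E10)) _; rewrite ler_nat; exact: leq_trans Ej (leq_trans jk kN).
  have h'A : A (start h') by rewrite /start h's; exact: pA.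
  have [i' [i'w i'c i'k]] := net h' _ h'A h'k EN.
  have two : 2 / m.+1%:R = m.+1%:R^-1 + m.+1%:R^-1 :> R by rewrite mulr2n mulrDl mul1r.
  exists (k, (@path_of (st (f k)) i, @path_of (st (f k)) i')); split => /=.
  - exact: leq_trans mj jk.
  - split; last exact: atom_tame.
    rewrite ip; apply: close_curve_le cg; rewrite two; apply: (@le_trans _ _ m.+1%:R^-1).
      by rewrite lef_pV2 ?posrE// ler_nat ltnS.
    by rewrite lerDl ltW.
  - apply: (@close_curve_le _ _ _ _ (m.+1%:R^-1 + (N (f k)).+1%:R^-1)).
      by rewrite two lerD2l.
    exact: close_curve_trans h'c i'c.
  - split; last exact: A_vel (gA i').
    by apply: energy_leW i'k; rewrite two addrA lerD2l.
  - by apply: nash => //; rewrite i'w /start h's ip.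
apply: (@value_limit E1 E r (fun m => law_of (st (f (d m).1))) mu (fun m => (d m).2.1) (fun m => (d m).2.2)).
- move=> t psi cpsi bpsi; have C := marg_cvg t psi cpsi bpsi.
  apply: (cvg_comp (fun m => (d m).1) _ _ C) => U [M _ MU].
  by exists M => // m /= Mm; apply: MU => /=; have [+ _ _ _ _] := dP m; exact: leq_trans.
- by apply: close_curve_cvg => m; have [_ [] ] := dP m.
- by apply: close_curve_cvg => m; have [_ _] := dP m.
- by move=> m; have [_ []] := dP m.
- by move=> m; have [] := dP m.
- by move=> m; have [] := dP m.
Qed.

End equilibrium.

Theorem theorem3p2 (R : realType) (n : nat) (T : {posnum R}) (Omega : domain R n)
    (F G : prob R (phase Omega) -> phase Omega -> R)
    (l : phase Omega * time T -> R)
    (Theta : set (phase Omega)) (r C : R) (m0 : prob R (phase Omega)) :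
  bounded_set (Omega : set 'rV[R]_n) -> C2_boundary Omega ->
  bounded_continuous_coupling F -> bounded_continuous_coupling G ->
  continuous l -> (exists b : R, forall z, b <= l z) ->
  closed Theta -> Theta `<=` @admissible R n Omega -> condition_A Theta ->
  0 < r -> supp m0 `<=` Theta `&` K r ->
  0 < C ->
  (forall (mu : prob R (curve T Omega)) z, (Theta `&` K r) z ->
     optimal_curves F G l mu z `<=` curves_bounded C) ->
  exists mu : prob R (curve T Omega),
    [/\ prob_from_bounded m0 C mu,
        is_equilibrium F G l m0 mu &
        half_holder (K C) (marginal mu)].
Proof.
move=> bO bd cF cG cl [b bl] clT adm cA r0 m0supp C0 bounded_optimal.
have bounded_phases r' := @phase_bounded R n Omega r' bO.
have [mu [mu_m0 mu_opt mu_full]] :=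
  limit_equilibrium cF cG cl bounded_phases bO bd bl clT adm cA m0supp.
(* A trajectory of the support is optimal from a starting phase that lies in the support of [m0],
   hence in [Theta] with velocity at most [r], where the property defining [C] applies. *)
have mu_bounded : supp mu `<=` curves_bounded C.
  by move=> g /mu_opt[/m0supp zA opt]; exact: bounded_optimal opt.
have muC : mu (curves_bounded C) = 1%E.
  by apply: mu_full => //; apply: measurable_closed; exact: closed_curves_bounded.
exists mu; split => //.
- by split => // g gmu; have [z0 opt] := mu_opt g gmu; exists (ev (time0 T) g).
- exact: half_holder_marginal bounded_phases (ltW C0) muC.
Qed.
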